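(* Let $\rho,\sigma$ be full-rank density operators on a finite-dimensional Hilbert space and $\alpha\in\overline{\mathbb R}$. Define $\widehat D^{\mathrm L}_\alpha(\rho\|\sigma)=\lim_{n\to\infty}\frac1nD_\alpha(\mathcal P_{\sigma^{\otimes n}}(\rho^{\otimes n})\|\sigma^{\otimes n})$. Then: (i) this limit exists; (ii) $\widehat D^{\mathrm L}_\alpha(\rho\|\sigma)\ge0$ for $\alpha\ge0$ and $\le0$ for $\alpha\le0$; (iii) $\widehat D^{\mathrm L}_\alpha(\rho\|\sigma)\le\widetilde D_\alpha(\rho\|\sigma)$ for $\alpha\ge0$ and $\widehat D^{\mathrm L}_\alpha(\rho\|\sigma)\ge\widetilde D_\alpha(\rho\|\sigma)$ for $\alpha\le0$; (iv) $\alpha\mapsto\widehat D^{\mathrm L}_\alpha(\rho\|\sigma)$ is differentiable. All of these properties also hold for $\widehat D^{\mathrm R}_\alpha(\rho\|\sigma)=\lim_{n\to\infty}\frac1nD_\alpha(\rho^{\otimes n}\|\mathcal P_{\rho^{\otimes n}}(\sigma^{\otimes n}))$.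
   Context: $\overline{\mathbb R}=\mathbb R\cup\{\pm\infty\}$. Pinching: for $\tau=\sum_\lambda\lambda\Pi_\lambda$, $\mathcal P_\tau(X)=\sum_\lambda\Pi_\lambda X\Pi_\lambda$. For commuting states $D_\alpha(\rho\|\sigma)=\frac1{\alpha-1}\log\mathrm{Tr}(\rho^\alpha\sigma^{1-\alpha})$, with $\alpha\in\{1,\pm\infty\}$ by limits. Minimal Rényi divergence: $\widetilde D_\alpha(\rho\|\sigma)=\frac1{\alpha-1}\log\mathrm{Tr}((\sqrt\rho\sigma^{\frac{1-\alpha}\alpha}\sqrt\rho)^\alpha)$ for $\alpha\ge\frac12$, $\frac1{\alpha-1}\log\mathrm{Tr}((\sqrt\sigma\rho^{\frac\alpha{1-\alpha}}\sqrt\sigma)^{1-\alpha})$ for $\alpha\le\frac12$, limits at $1,\pm\infty$. *)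

(* Defs.v *)
From HB Require Import structures.
From mathcomp Require Import all_boot all_order all_algebra.
From mathcomp Require Import sesquilinear spectral.
From mathcomp Require Import all_classical all_reals all_analysis.
From mathcomp.real_closed Require Import complex mxtens.

Set Implicit Arguments.
Unset Strict Implicit.
Unset Printing Implicit Defensive.

Import Order.TTheory GRing.Theory Num.Theory Num.Def.
Import numFieldNormedType.Exports.
Local Open Scope ring_scope.
Local Open Scope complex_scope.
Local Open Scope classical_set_scope.

Section QDefs.
Variable R : realType.
Local Notation C := R[i].

Definition full_rank_density d (rho : 'M[C]_d) : Prop :=
  [/\ rho \is hermsymmx,
      (forall v : 'rV[C]_d, v != 0 -> 0 < (v *m rho *m (map_mx conjC v)^T) 0 0)
    & \tr rho = 1].

Definition mxfun d (f : R -> R) (A : 'M[C]_d) : 'M[C]_d :=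
  invmx (spectralmx A)
    *m diag_mx (map_mx (fun z : C => (f (complex.Re z))%:C) (spectral_diag A))
    *m spectralmx A.

Definition mxpowR d (A : 'M[C]_d) (a : R) : 'M[C]_d := mxfun (fun x => x `^ a) A.

Definition eigvals d (A : 'M[C]_d) : seq R :=
  undup [seq complex.Re (spectral_diag A 0 i) | i <- enum 'I_d].

Definition eigproj d (A : 'M[C]_d) (l : R) : 'M[C]_d :=
  mxfun (fun x => (x == l)%:R) A.

Definition pinch d (tau X : 'M[C]_d) : 'M[C]_d :=
  \sum_(l <- eigvals tau) eigproj tau l *m X *m eigproj tau l.

Fixpoint tdim (d k : nat) : nat := if k is k'.+1 then (d * tdim d k')%N else 1%N.

Fixpoint tpow d (A : 'M[C]_d) (k : nat) : 'M[C]_(tdim d k) :=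
  match k with
  | 0 => 1%:M
  | k'.+1 => A *t tpow A k'
  end.

Definition ext_by_limits (g : R -> R) (a : \bar R) : R :=
  match a with
  | a'%:E => if a' == 1 then lim (g @ (1 : R)^') else g a'
  | +oo%E => lim (g @ +oo)
  | -oo%E => lim (g @ -oo)
  end.

Definition Dcomm d (a : \bar R) (rho sigma : 'M[C]_d) : R :=
  ext_by_limits (fun a =>
    (a - 1)^-1 * ln (complex.Re (\tr (mxpowR rho a *m mxpowR sigma (1 - a))))) a.

Definition Dmin d (a : \bar R) (rho sigma : 'M[C]_d) : R :=
  ext_by_limits (fun a =>
    if 2^-1 <= a then
      (a - 1)^-1 * ln (complex.Re (\tr (mxpowR
          (mxpowR rho 2^-1 *m mxpowR sigma ((1 - a) / a) *m mxpowR rho 2^-1) a)))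
    else
      (a - 1)^-1 * ln (complex.Re (\tr (mxpowR
          (mxpowR sigma 2^-1 *m mxpowR rho (a / (1 - a)) *m mxpowR sigma 2^-1)
          (1 - a))))) a.

Definition seqL d (a : \bar R) (rho sigma : 'M[C]_d) (n : nat) : R :=
  n%:R^-1 * Dcomm a (pinch (tpow sigma n) (tpow rho n)) (tpow sigma n).

Definition seqR d (a : \bar R) (rho sigma : 'M[C]_d) (n : nat) : R :=
  n%:R^-1 * Dcomm a (tpow rho n) (pinch (tpow rho n) (tpow sigma n)).

Definition DhatL d (a : \bar R) (rho sigma : 'M[C]_d) : R :=
  lim (seqL a rho sigma @ \oo).

Definition DhatR d (a : \bar R) (rho sigma : 'M[C]_d) : R :=
  lim (seqR a rho sigma @ \oo).

End QDefs.

(* Main.v *)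
Require Import Defs.
From HB Require Import structures.
From mathcomp Require Import all_boot all_order all_algebra.
From mathcomp Require Import fingroup perm sesquilinear spectral.
From mathcomp Require Import all_classical all_reals all_analysis.
From mathcomp.real_closed Require Import complex mxtens.
From mathcomp Require Import ring lra zify.
Import Order.TTheory GRing.Theory Num.Theory.
Import numFieldNormedType.Exports.
Local Open Scope ring_scope.
Local Open Scope classical_set_scope.

Set Implicit Arguments.
Unset Strict Implicit.
Unset Printing Implicit Defensive.
Local Open Scope complex_scope.
Local Open Scope sesquilinear_scope.

(** Work in an eigenbasis of sigma, with spectrum [s]. Let X be the pinched n-fold power of rho and
    S the n-fold power of sigma, and put [psi n a] = log Tr(X^a S^(1-a)). The n-th term of the left
    sequence is [psi n a] / (n (a-1)), so all claims concern the limit [Psi a] of [psi n a] / n.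
    Each [psi n] is a log-sum-exp, hence convex, with zeros at 0 and 1; this passes to [Psi] and
    gives the signs. The right sequence is the one of the swapped pair read at 1-a ([seqR_link]), so
    a single function [Psi] is studied. Differentiability of the quotient Psi(a)/(a-1) at a = 1
    requires a second-order expansion of [Psi] at 1 for the left version and at 0 for the right one.
    Orders 1 and plus or minus infinity come from supporting lines at 1 and from asymptotic slopes
    ([family_properties]).

    Orders a > 0. Pinching commutes with multiplication by powers of S, so Tr(X^a S^(1-a)) is the
    a-th power trace of the pinched n-fold power of Y = sigma^((1-a)/2a) rho sigma^((1-a)/2a)
    ([qn_trp]). Since S has only polynomially many eigenvalues, pinching changes power traces by
    polynomial factors, and [Psi a] = log Tr Y^a ([psi_cvg_pos]). For a at least 1/2 this is (a-1)
    times the minimal divergence; for a < 1/2 two Jensen inequalities compare [Psi] with it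
    ([qn_ge_Wlow], [qn_le_Wlow]). At a = 1 the expansion of Tr Y^a has a cubic error
    ([trp_Ya_expand]).

    Orders a < 0. No closed formula is used. Arrange n*m copies in a grid. At size n*m the operator
    X^a S^(1-a) is permutation invariant, hence at most its trace times a product of n universal
    symmetric operators of polynomial trace, each acting on m copies. Taking logarithms (operator
    monotone) and testing against the m-th power of a state p diagonal in the joint eigenbasis at
    size n yields [star]: m times the p-mean of a log X + (1-a) log S is at most [psi (n * m) a],
    plus m times the sum of the negative entropies of the one-copy marginals of p, plus n O(log m).
    For Gibbs weights p and by subadditivity of entropy this is superadditivity up to a logarithmic
    error ([psi_mul]), and Fekete's argument gives the limit ([neg_limit]). For general p and large
    m it is a variational lower bound on n [Psi a] ([star_limit]), nearly attained by Gibbs weights.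
    Near-maximisers at a+e and a-e average to a competitor at a; strong convexity of the negative
    entropy makes their marginals close, hence also their slopes, so the second difference of [Psi]
    is o(e) ([neg_second_difference]). A convex function with this property is differentiable
    ([convex_is_derive]).

    Order 0. Write rho as G times its adjoint, with G triangular for the order of the eigenvalues of
    sigma, and let [del] be the spectrum of B times its adjoint, B being the block-diagonal part of
    G. Kadison-Schwarz gives X at least the n-fold power of [del]; conversely the off-block part of
    G is damped by factors exp(-h/b). Hence [Psi b] = log sum_i del_i^b s_i^(1-b) up to O(|b|^3)
    ([near_zero]). *)

(** * Spectral calculus: [sp E a] has the rows of the unitary [E] as eigenvectors and [a] as
    eigenvalues *)

Section Spectral.
Variable R : realType.
Local Notation C := R[i].

Definition nsq (z : C) : R := complex.Re z ^+ 2 + complex.Im z ^+ 2.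

Lemma nsqE (z : C) : (nsq z)%:C = z * z^*%R.
Proof. by rewrite /nsq add_Re2_Im2 normCK. Qed.

Lemma nsq_ge0 z : 0 <= nsq z.
Proof. by rewrite addr_ge0 ?sqr_ge0. Qed.

Lemma ReM_real (r : R) (z : C) : complex.Re (r%:C * z) = r * complex.Re z.
Proof. by case: z => a b /=; rewrite mul0r subr0. Qed.

Lemma nsqZ (r : R) (z : C) : nsq (r%:C * z) = r ^+ 2 * nsq z.
Proof. by case: z => a b; rewrite /nsq /=; ring. Qed.

Lemma nsqM (x z : C) : nsq (x * z) = nsq x * nsq z.
Proof. by case: z x => a b [c d]; rewrite /nsq /=; ring. Qed.

Lemma nsq0 : nsq 0 = 0.
Proof. by rewrite /nsq /= expr0n addr0. Qed.

Lemma nsq1 : nsq 1 = 1.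
Proof. by rewrite /nsq /= expr0n expr1n addr0. Qed.

Lemma nsqJ z : nsq (z^*)%R = nsq z.
Proof. by apply: complexI; rewrite !nsqE conjCK mulrC. Qed.

Lemma nsq_prod (I : finType) (P : pred I) (F : I -> C) :
  nsq (\prod_(i | P i) F i) = \prod_(i | P i) nsq (F i).
Proof. by elim/big_rec2: _ => [|i x y _ <-]; rewrite ?nsq1 ?nsqM. Qed.

Lemma nsq_eq0 z : (nsq z == 0) = (z == 0).
Proof.
rewrite /nsq paddr_eq0 ?sqr_ge0 // !sqrf_eq0.
by case: z => a b; rewrite eq_complex.
Qed.

Lemma Re_sum (I : Type) (r : seq I) (P : pred I) (F : I -> C) :
  complex.Re (\sum_(i <- r | P i) F i) = \sum_(i <- r | P i) complex.Re (F i).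
Proof. exact: (raddf_sum (@complex.Re R : Rcomplex R -> R)). Qed.

Lemma real_complex_sum (I : Type) (r : seq I) (P : pred I) (F : I -> R) :
  (\sum_(i <- r | P i) F i)%:C = \sum_(i <- r | P i) (F i)%:C.
Proof. exact: rmorph_sum. Qed.

Lemma real_complex_prod (I : Type) (r : seq I) (P : pred I) (F : I -> R) :
  (\prod_(i <- r | P i) F i)%:C = \prod_(i <- r | P i) (F i)%:C.
Proof. exact: rmorph_prod. Qed.

Lemma conjC_real_complex (r : R) : ((r%:C)^*)%R = r%:C.
Proof. exact: conjc_real. Qed.

(* [rdiag], [sp] and [qf] are locked: unification must not unfold them into products. *)
Fact rdiag_key : unit. Proof. by []. Qed.

Definition rdiag d (a : 'I_d -> R) : 'M[C]_d :=
  locked_with rdiag_key (diag_mx (\row_i (a i)%:C)).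

Lemma rdiagmxE d (a : 'I_d -> R) : rdiag a = diag_mx (\row_i (a i)%:C).
Proof. by rewrite /rdiag unlock. Qed.

Fact sp_key : unit. Proof. by []. Qed.

Definition sp d (E : 'M[C]_d) (a : 'I_d -> R) : 'M[C]_d :=
  locked_with sp_key (E^t* *m rdiag a *m E).

Lemma spmxE d (E : 'M[C]_d) (a : 'I_d -> R) : sp E a = E^t* *m rdiag a *m E.
Proof. by rewrite /sp unlock. Qed.

Fact qf_key : unit. Proof. by []. Qed.

Definition qf d (A : 'M[C]_d) (v : 'rV[C]_d) : R :=
  locked_with qf_key (complex.Re ((v *m A *m v^t*) 0 0)).

Lemma qfmxE d (A : 'M[C]_d) v : qf A v = complex.Re ((v *m A *m v^t*) 0 0).
Proof. by rewrite /qf unlock. Qed.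

Definition nv d (v : 'rV[C]_d) : R := \sum_i nsq (v 0 i).

(** Squared overlap of [v] with the [i]-th row of [E]. When [v] runs over the rows of another
    unitary these weights are doubly stochastic, which reduces trace inequalities in two bases to
    scalar ones. *)
Definition wt d (E : 'M[C]_d) (v : 'rV[C]_d) (i : 'I_d) : R :=
  nsq ((v *m E^t*) 0 i).

Section Dim.
Variable d : nat.
Implicit Types (A E F : 'M[C]_d) (v : 'rV[C]_d) (a b : 'I_d -> R).

Lemma wt_ge0 E v i : 0 <= wt E v i.
Proof. exact: nsq_ge0. Qed.

Lemma adjM m n p (A : 'M[C]_(m, n)) (B : 'M[C]_(n, p)) :
  (A *m B)^t* = B^t* *m A^t*.
Proof. by rewrite trmx_mul map_mxM. Qed.

Lemma adjK m n (A : 'M[C]_(m, n)) : A^t*^t* = A.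
Proof. exact: trmxCK. Qed.

Lemma adj1 : (1%:M : 'M[C]_d)^t* = 1%:M.
Proof. by rewrite trmx1 map_mx1. Qed.

Lemma unitary_adjr E : E \is unitarymx -> E *m E^t* = 1%:M.
Proof. exact: unitarymxP. Qed.

Lemma unitary_adjl E : E \is unitarymx -> E^t* *m E = 1%:M.
Proof. by move=> /unitarymxP /mulmx1C. Qed.

Lemma rdiag_adj a : (rdiag a)^t* = rdiag a.
Proof.
apply/matrixP=> i j; rewrite rdiagmxE !mxE eq_sym; case: eqP => [->|_].
  by rewrite !mulr1n conjC_real_complex.
by rewrite !mulr0n conjC0.
Qed.

Lemma rdiagM a b : rdiag a *m rdiag b = rdiag (fun i => a i * b i).
Proof.
rewrite !rdiagmxE mulmx_diag; congr diag_mx.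
by apply/rowP=> i; rewrite !mxE rmorphM.
Qed.

Lemma rdiag_eq a b : a =1 b -> rdiag a = rdiag b.
Proof. by move=> ab; rewrite !rdiagmxE; congr diag_mx; apply/rowP => i; rewrite !mxE ab. Qed.

Lemma sp_eq E a b : a =1 b -> sp E a = sp E b.
Proof. by move=> ab; rewrite !spmxE (rdiag_eq ab). Qed.

Lemma mul_rdiagE n a (M : 'M[C]_(d, n)) i j :
  (rdiag a *m M) i j = (a i)%:C * M i j.
Proof. by rewrite rdiagmxE mul_diag_mx !mxE. Qed.

Lemma mul_mx_rdiagE n a (M : 'M[C]_(n, d)) i j :
  (M *m rdiag a) i j = M i j * (a j)%:C.
Proof. by rewrite rdiagmxE mul_mx_diag !mxE. Qed.

Lemma rdiagE a i j : rdiag a i j = (a i)%:C *+ (i == j).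
Proof. by rewrite rdiagmxE !mxE. Qed.

Lemma rdiag1 : rdiag (fun=> 1) = 1%:M :> 'M[C]_d.
Proof. by apply/matrixP=> i j; rewrite rdiagmxE !mxE. Qed.

Lemma sp1 E : E \is unitarymx -> sp E (fun=> 1) = 1%:M.
Proof. by move=> uE; rewrite !spmxE rdiag1 mulmx1 unitary_adjl. Qed.

Lemma sp_adj E a : (sp E a)^t* = sp E a.
Proof. by rewrite !spmxE !adjM adjK rdiag_adj mulmxA. Qed.

Lemma spM E a b : E \is unitarymx -> sp E a *m sp E b = sp E (fun i => a i * b i).
Proof.
move=> uE; have -> : sp E a *m sp E b =
    E^t* *m (rdiag a *m (E *m E^t*) *m rdiag b) *m E by rewrite !spmxE !mulmxA.
by rewrite (unitary_adjr uE) mulmx1 rdiagM spmxE.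
Qed.

Lemma spE E a i j : sp E a i j = \sum_k (a k)%:C * (E k i)^*%R * E k j.
Proof.
rewrite !spmxE mxE; apply: eq_bigr => k _; rewrite mul_mx_rdiagE !mxE.
by congr (_ * _); rewrite mulrC.
Qed.

Lemma tr_sp E a : E \is unitarymx -> \tr (sp E a) = (\sum_i a i)%:C.
Proof.
move=> uE; rewrite !spmxE -mulmxA mxtrace_mulC -mulmxA unitary_adjr // mulmx1.
rewrite /mxtrace real_complex_sum; apply: eq_bigr => i _.
by rewrite rdiagE eqxx mulr1n.
Qed.

Lemma qf_sp E a v : qf (sp E a) v = \sum_i a i * wt E v i.
Proof.
rewrite !qfmxE spmxE !mulmxA -(mulmxA _ E) -[E in E *m v^t*]adjK -adjM.
rewrite mxE Re_sum; apply: eq_bigr => i _.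
rewrite mul_mx_rdiagE [X in _ * X](_ : _ = ((v *m E^t*) 0 i)^*%R).
  by rewrite mulrAC -nsqE mulrC ReM_real.
by rewrite [LHS]mxE mxE.
Qed.

Lemma nv_qf1 v : nv v = qf 1%:M v.
Proof.
rewrite !qfmxE mulmx1 mxE Re_sum; apply: eq_bigr => i _.
by rewrite !mxE -nsqE.
Qed.

Lemma parseval E v : E \is unitarymx -> \sum_i wt E v i = nv v.
Proof.
move=> uE; rewrite nv_qf1 -(sp1 uE) qf_sp.
by apply: eq_bigr => i _; rewrite mul1r.
Qed.

Lemma nv_row E i : E \is unitarymx -> nv (row i E) = 1.
Proof.
move=> /unitary_adjr /matrixP /(_ i i); rewrite !mxE eqxx => h.
apply: complexI; rewrite /nv real_complex_sum -[RHS]h.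
by apply: eq_bigr => j _; rewrite nsqE !mxE.
Qed.

Lemma wt_row E F i j : wt E (row i F) j = nsq ((F *m E^t*) i j).
Proof. by rewrite /wt -row_mul mxE. Qed.

Lemma wt_rowC E F i j : wt E (row i F) j = wt F (row j E) i.
Proof.
rewrite !wt_row -[E in RHS]adjK -adjM [in RHS]mxE [in RHS]mxE.
by rewrite nsqJ.
Qed.

Lemma sum_wt_row E F i : E \is unitarymx -> F \is unitarymx ->
  \sum_j wt E (row i F) j = 1.
Proof. by move=> uE uF; rewrite parseval // nv_row. Qed.

Lemma sum_wt_rowC E F j : E \is unitarymx -> F \is unitarymx ->
  \sum_i wt E (row i F) j = 1.
Proof.
move=> uE uF; under eq_bigr do rewrite wt_rowC.
by rewrite sum_wt_row.
Qed.

Lemma sum_qf A E : E \is unitarymx -> \sum_i qf A (row i E) = complex.Re (\tr A).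
Proof.
move=> uE; rewrite -[in RHS](mulmx1 A) -(unitary_adjl uE) mulmxA mxtrace_mulC.
rewrite mulmxA /mxtrace Re_sum; apply: eq_bigr => i _.
by rewrite !qfmxE -row_mul mxE [in RHS]mxE; congr complex.Re;
   apply: eq_bigr => j _; rewrite !mxE.
Qed.

Lemma qf_row_sp E a i : E \is unitarymx -> qf (sp E a) (row i E) = a i.
Proof.
move=> uE; rewrite qf_sp (bigD1 i) //= wt_row unitary_adjr //.
rewrite mxE eqxx nsq1 mulr1 big1 ?addr0 // => j ji.
by rewrite wt_row unitary_adjr // mxE eq_sym (negbTE ji) nsq0 mulr0.
Qed.

(** A matrix intertwining two diagonals has nonzero entries only between equal diagonal values, so
    [f] may be applied to both sides. *)
Lemma mxfun_intertwine (f : R -> R) (l : 'rV[C]_d) a (W : 'M[C]_d) :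
  diag_mx l *m W = W *m rdiag a ->
  diag_mx (map_mx (fun z : C => (f (complex.Re z))%:C) l) *m W =
  W *m rdiag (fun i => f (a i)).
Proof.
move=> /matrixP eW; apply/matrixP => i j; have := eW i j.
rewrite !mul_diag_mx !mul_mx_rdiagE !mxE ![_ * W i j]mulrC.
have [->|W0] := eqVneq (W i j) 0; first by rewrite !mul0r.
by move=> /(mulfI W0) ->.
Qed.

(** [mxfun] is defined through the chosen diagonalisation [spectralmx]; this makes it independent of
    the eigenbasis, since the change of basis intertwines the two diagonals. *)
Lemma mxfun_sp (f : R -> R) E a : E \is unitarymx ->
  mxfun f (sp E a) = sp E (fun i => f (a i)).
Proof.
move=> uE; set A := sp E a.
have nA : A \is normalmx by apply/normalmxP; rewrite sp_adj.
have uV := spectral_unitarymx A.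
have eA := orthomx_spectralP nA.
rewrite /mxfun; move: (spectralmx A) (spectral_diag A) uV eA => V l uV.
rewrite (invmx_unitary uV) => eA.
pose W := V *m E^t*.
have uE' := unitary_adjr uE; have uV' := unitary_adjr uV.
have eW : diag_mx l *m W = W *m rdiag a.
  rewrite /W; have := congr1 (fun X => V *m X *m E^t*) eA.
  rewrite /A spmxE !mulmxA uV' mul1mx -!mulmxA uE' mulmx1.
  by rewrite !mulmxA => ->.
have eWf := mxfun_intertwine f eW.
have eV : V = W *m E by rewrite /W -mulmxA (unitary_adjl uE) mulmx1.
have uW : W^t* *m W = 1%:M.
  by rewrite /W adjM adjK mulmxA -(mulmxA E (V^t*) V) (unitary_adjl uV) mulmx1 uE'.
clearbody W; rewrite eV spmxE adjM; set D := diag_mx _ in eWf *.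
rewrite -!mulmxA; congr (_ *m _); rewrite (mulmxA D) eWf -mulmxA.
by rewrite (mulmxA (W^t*)) uW mul1mx.
Qed.

Lemma mxpow_sp E a p : E \is unitarymx ->
  mxpowR (sp E a) p = sp E (fun i => a i `^ p).
Proof. exact: mxfun_sp. Qed.

Lemma hermP A : reflect (A^t* = A) (A \is hermsymmx).
Proof.
apply: (iffP idP) => [/is_hermitianmxP|h].
  by rewrite expr0 scale1r => {2}->.
by apply/is_hermitianmxP; rewrite expr0 scale1r h.
Qed.

(** Commuting matrices are triangular in a common orthonormal basis, and a Hermitian triangular
    matrix is diagonal with real entries. *)
Lemma joint_spectral A B : A^t* = A -> B^t* = B -> A *m B = B *m A ->
  exists E a b, [/\ E \is unitarymx, A = sp E a & B = sp E b].
Proof.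
move=> hA hB /cotrigonalization2 [P uP /andP[tA tB]].
suff H M : M^t* = M -> similar_trig P M -> exists a, M = sp P a.
  by have [a ea] := H _ hA tA; have [b eb] := H _ hB tB; exists P, a, b.
move=> hM /is_trig_mxP; rewrite conjymx // => tM.
pose N := P *m M *m P^t*.
have hN : N^t* = N by rewrite /N !adjM adjK hM mulmxA.
have dN i j : i != j -> N i j = 0.
  rewrite neq_ltn => /orP[] ij; first by rewrite tM.
  by rewrite -hN mxE mxE (tM _ _ ij) conjC0.
have rN i : N i i = (complex.Re (N i i))%:C.
  rewrite RRe_real //; apply/CrealP.
  by have /matrixP /(_ i i) := hN; rewrite mxE mxE.
exists (fun i => complex.Re (N i i)).
have -> : M = P^t* *m N *m P.
  rewrite /N !mulmxA unitary_adjl // mul1mx -mulmxA unitary_adjl //.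
  by rewrite mulmx1.
rewrite spmxE; congr (_ *m _ *m _); apply/matrixP => i j.
rewrite rdiagE; case: (eqVneq i j) => [->|/dN -> //].
by rewrite mulr1n -rN.
Qed.

Lemma spectral_sp A : A^t* = A -> exists E a, E \is unitarymx /\ A = sp E a.
Proof. by move=> hA; have [E [a [_ [? ? _]]]] := joint_spectral hA hA erefl; exists E, a. Qed.

End Dim.
End Spectral.

(** * Scalar convexity: supporting lines, Jensen, Gibbs *)

Section Convexity.
Variable R : realType.
Local Notation C := R[i].

Lemma powRexp (x a : R) : 0 < x -> x `^ a = expR (a * ln x).
Proof. by move=> x0; rewrite /powR gt_eqF. Qed.

Lemma expR_weighted (t h : R) : 0 <= t <= 1 ->
  expR (t * h) <= t * expR h + (1 - t).
Proof.
move=> /andP[t0 t1].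
have e1 : expR (t * h) * (1 + (1 - t) * h) <= expR h.
  have -> : expR h = expR (t * h) * expR ((1 - t) * h).
    by rewrite -expRD; congr expR; ring.
  by rewrite ler_pM2l ?expR_gt0 // expR_ge1Dx.
have e2 : expR (t * h) * (1 - t * h) <= 1.
  rewrite -[leRHS](expRxMexpNx_1 (t * h)) ler_pM2l ?expR_gt0 //.
  by rewrite -mulNr -[leRHS](_ : expR (- t * h) = _) ?expR_ge1Dx // mulNr.
(* With weights t and 1 - t the terms linear in h cancel. *)
have := ler_wpM2l t0 e1; have := ler_wpM2l (_ : 0 <= 1 - t) e2.
by rewrite subr_ge0 => /(_ t1); nra.
Qed.

(** Convexity on the positive half-line in the form Jensen's inequality consumes: a supporting line
    at every point. Concave functions enter through their opposite. *)
Definition tangent (f : R -> R) :=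
  forall y, 0 < y -> exists c, forall x, 0 < x -> f y + c * (x - y) <= f x.

(** With x = y exp(h) the claim becomes 1 + p (exp h - 1) <= exp(p h). It follows from
    [expR_weighted] with weight 1/p when 1 <= p, and with weight 1/(1-p) when p <= 0. *)
Lemma powR_ge_tangent (p x y : R) : 1 <= p \/ p <= 0 -> 0 < x -> 0 < y ->
  y `^ p + p * y `^ (p - 1) * (x - y) <= x `^ p.
Proof.
move=> hp x0 y0; pose h := ln x - ln y.
have ex : x = y * expR h by rewrite /h expRB !lnK ?posrE // mulrCA divff ?mulr1 ?gt_eqF.
have -> : x `^ p = y `^ p * expR (p * h).
  by rewrite !powRexp // -expRD; congr expR; rewrite /h; ring.
have -> : y `^ (p - 1) = y `^ p / y.
  by rewrite !powRexp // mulrBl mul1r expRB lnK ?posrE.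
have -> : p * (y `^ p / y) * (x - y) = y `^ p * (p * (expR h - 1)).
  by rewrite ex; field; rewrite gt_eqF.
rewrite -[X in X + _]mulr1 -mulrDr ler_pM2l ?powR_gt0 //.
case: hp => hp.
  have p0 : 0 < p by rewrite (lt_le_trans ltr01).
  have pi : 0 <= p^-1 <= 1 by rewrite invr_ge0 ltW //= invf_le1.
  have := expR_weighted (p * h) pi; rewrite mulrA mulVf ?gt_eqF // mul1r.
  move=> /(ler_wpM2l (ltW p0)).
  have -> : p * (p^-1 * expR (p * h) + (1 - p^-1)) = expR (p * h) + (p - 1).
    by field; rewrite gt_eqF.
  by lra.
have q0 : 0 < 1 - p by rewrite (lt_le_trans ltr01) // lerBrDr gerDl.
have ti : 0 <= (1 - p)^-1 <= 1 by rewrite invr_ge0 ltW //= invf_le1 // lerBrDr gerDl.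
have := expR_weighted (p * h - h) ti.
have -> : (1 - p)^-1 * (p * h - h) = - h by field; rewrite gt_eqF.
move=> /(ler_wpM2l (mulr_ge0 (ltW q0) (expR_ge0 h))).
have -> : (1 - p) * expR h * ((1 - p)^-1 * expR (p * h - h) + (1 - (1 - p)^-1)) =
    expR (p * h) - p * expR h.
  rewrite (expRB (p * h) h); move: (expR h) (expR_eq0 h) (expR (p * h)) => u u0 w.
  by field; rewrite u0 gt_eqF.
by rewrite expRN mulfK ?expR_eq0 //; lra.
Qed.

Lemma powR_le_tangent (p x y : R) : 0 <= p <= 1 -> 0 < x -> 0 < y ->
  x `^ p <= y `^ p + p * y `^ (p - 1) * (x - y).
Proof.
move=> hp x0 y0; pose h := ln x - ln y.
have ex : x = y * expR h by rewrite /h expRB !lnK ?posrE // mulrCA divff ?mulr1 ?gt_eqF.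
have -> : x `^ p = y `^ p * expR (p * h).
  by rewrite !powRexp // -expRD; congr expR; rewrite /h; ring.
have -> : y `^ (p - 1) = y `^ p / y.
  by rewrite !powRexp // mulrBl mul1r expRB lnK ?posrE.
have -> : p * (y `^ p / y) * (x - y) = y `^ p * (p * (expR h - 1)).
  by rewrite ex; field; rewrite gt_eqF.
rewrite -[X in _ <= X + _]mulr1 -mulrDr ler_pM2l ?powR_gt0 //.
by have := expR_weighted h hp; lra.
Qed.

Lemma ln_le_tangent (x y : R) : 0 < x -> 0 < y -> ln x <= ln y + y^-1 * (x - y).
Proof.
move=> x0 y0; rewrite -lerBlDl -ln_div ?posrE //.
have -> : x / y = 1 + (y^-1 * (x - y)) by field; rewrite gt_eqF.
apply: le_ln1Dx; rewrite -subr_gt0 opprK.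
by have -> : y^-1 * (x - y) + 1 = x / y by [field; rewrite gt_eqF]; rewrite divr_gt0.
Qed.

Lemma tangent_powR p : 1 <= p \/ p <= 0 -> tangent (fun x => x `^ p).
Proof.
by move=> hp y y0; exists (p * y `^ (p - 1)) => x x0; exact: powR_ge_tangent.
Qed.

Lemma tangent_powRN p : 0 <= p <= 1 -> tangent (fun x => - x `^ p).
Proof.
move=> hp y y0; exists (- (p * y `^ (p - 1))) => x x0.
by rewrite mulNr -opprD lerN2; exact: powR_le_tangent.
Qed.

Lemma tangent_lnN : tangent (fun x => - ln x).
Proof.
move=> y y0; exists (- y^-1) => x x0.
by rewrite mulNr -opprD lerN2; exact: ln_le_tangent.
Qed.

Lemma weighted_sum_gt0 (I : finType) (w x : I -> R) :
  (forall i, 0 <= w i) -> \sum_i w i = 1 -> (forall i, 0 < x i) ->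
  0 < \sum_i w i * x i.
Proof.
move=> w0 w1 x0; rewrite lt_def sumr_ge0 ?andbT; last first.
  by move=> i _; rewrite mulr_ge0 // ltW.
apply/negP => /eqP /psumr_eq0P h.
have : \sum_i w i = 0.
  rewrite big1 // => i _; apply/eqP.
  have /eqP := h (fun i _ => mulr_ge0 (w0 i) (ltW (x0 i))) i isT.
  by rewrite mulf_eq0 (gt_eqF (x0 i)) orbF.
by move/eqP; rewrite w1 oner_eq0.
Qed.

Lemma jensen f (I : finType) (w x : I -> R) : tangent f ->
  (forall i, 0 <= w i) -> \sum_i w i = 1 -> (forall i, 0 < x i) ->
  f (\sum_i w i * x i) <= \sum_i w i * f (x i).
Proof.
move=> tf w0 w1 x0; set y := \sum_i _.
have [c hc] := tf y (weighted_sum_gt0 w0 w1 x0).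
apply: le_trans (ler_sum _ (fun i _ => ler_wpM2l (w0 i) (hc _ (x0 i)))).
under eq_bigr do rewrite mulrDr mulrCA mulrBr.
rewrite big_split /= -mulr_suml w1 mul1r -mulr_sumr sumrB -mulr_suml w1.
by rewrite mul1r subrr mulr0 addr0.
Qed.

Lemma jensen_ln (I : finType) (w x : I -> R) :
  (forall i, 0 <= w i) -> \sum_i w i = 1 -> (forall i, 0 < x i) ->
  \sum_i w i * ln (x i) <= ln (\sum_i w i * x i).
Proof.
move=> w0 w1 x0; have /= := jensen tangent_lnN w0 w1 x0.
by under [leRHS]eq_bigr do rewrite mulrN; rewrite sumrN lerN2.
Qed.

Lemma jensen_exp (I : finType) (w x : I -> R) :
  (forall i, 0 <= w i) -> \sum_i w i = 1 ->
  \sum_i w i * x i <= ln (\sum_i w i * expR (x i)).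
Proof.
move=> w0 w1; have := jensen_ln w0 w1 (fun i => expR_gt0 (x i)).
by under eq_bigr do rewrite expRK.
Qed.

(* Gibbs variational principle. *)
Lemma gibbs (I : finType) (p k : I -> R) :
  (forall i, 0 < p i) -> \sum_i p i = 1 ->
  \sum_i p i * (k i - ln (p i)) <= ln (\sum_i expR (k i)).
Proof.
move=> p0 p1; apply: le_trans (jensen_exp _ (fun i => ltW (p0 i)) p1) _.
rewrite le_eqVlt; apply/orP; left; apply/eqP; congr ln.
apply: eq_bigr => i _; rewrite expRB lnK ?posrE //.
by rewrite mulrCA divff ?mulr1 ?gt_eqF.
Qed.

End Convexity.

(** * Peierls inequality and monotonicity of power traces *)

Section Operators.
Variables (R : realType) (d : nat).
Local Notation C := R[i].
Implicit Types (A B E F : 'M[C]_d) (v : 'rV[C]_d) (a b : 'I_d -> R).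

Lemma qfD A B v : qf (A + B) v = qf A v + qf B v.
Proof. by rewrite !qfmxE mulmxDr mulmxDl mxE raddfD. Qed.

Lemma qfN A v : qf (- A) v = - qf A v.
Proof. by rewrite !qfmxE mulmxN mulNmx mxE raddfN. Qed.

Lemma qfB A B v : qf (A - B) v = qf A v - qf B v.
Proof. by rewrite qfD qfN. Qed.

Lemma qf_gt0 E a v : E \is unitarymx -> (forall i, 0 < a i) -> nv v = 1 ->
  0 < qf (sp E a) v.
Proof.
move=> uE a0 v1; rewrite qf_sp; under eq_bigr do rewrite mulrC.
by apply: weighted_sum_gt0 => // [i|]; rewrite ?wt_ge0 ?parseval.
Qed.

Lemma qf_ge0 E a v : (forall i, 0 <= a i) -> 0 <= qf (sp E a) v.
Proof. by move=> a0; rewrite qf_sp sumr_ge0 // => i _; rewrite mulr_ge0 ?wt_ge0. Qed.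

Lemma qf_jensen f E a v : tangent f -> E \is unitarymx -> (forall i, 0 < a i) ->
  nv v = 1 -> f (qf (sp E a) v) <= qf (sp E (f \o a)) v.
Proof.
move=> tf uE a0 v1; rewrite !qf_sp.
rewrite (eq_bigr (fun i => wt E v i * a i)); last by move=> i _; rewrite mulrC.
rewrite [leRHS](eq_bigr (fun i => wt E v i * f (a i))); last by move=> i _; rewrite mulrC.
by apply: jensen => // [i|]; rewrite ?wt_ge0 ?parseval.
Qed.

(** Jensen in each vector of the second basis; summing over that basis restores the trace. *)
Lemma peierls f E a F : tangent f -> E \is unitarymx -> F \is unitarymx ->
  (forall i, 0 < a i) ->
  \sum_i f (qf (sp E a) (row i F)) <= \sum_i f (a i).
Proof.
move=> tf uE uF a0.
apply: le_trans (ler_sum _ (fun i _ => qf_jensen tf uE a0 (nv_row i uF))) _.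
by rewrite sum_qf // tr_sp.
Qed.

Lemma peierlsN f E a F : tangent (fun x => - f x) -> E \is unitarymx ->
  F \is unitarymx -> (forall i, 0 < a i) ->
  \sum_i f (a i) <= \sum_i f (qf (sp E a) (row i F)).
Proof.
by move=> tf uE uF a0; have := peierls tf uE uF a0; rewrite !sumrN lerN2.
Qed.

Lemma trpow_le E a F b p : E \is unitarymx -> F \is unitarymx ->
  (forall i, 0 < a i) -> (forall i, 0 < b i) ->
  (forall v, qf (sp E a) v <= qf (sp F b) v) -> 0 <= p ->
  \sum_i a i `^ p <= \sum_i b i `^ p.
Proof.
move=> uE uF a0 b0 ab p0; have [p1|p1] := leP 1 p.
  apply: le_trans (peierls (tangent_powR (or_introl p1)) uF uE b0).
  apply: ler_sum => i _; rewrite -[in leLHS](qf_row_sp a i uE).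
  by apply: ge0_ler_powR => //; rewrite nnegrE ltW // qf_gt0 // nv_row.
have hp : 0 <= p <= 1 by rewrite p0 ltW.
apply: le_trans (peierlsN (tangent_powRN hp) uE uF a0) _.
apply: ler_sum => i _; rewrite -[in leRHS](qf_row_sp b i uF).
by apply: ge0_ler_powR => //; rewrite nnegrE ltW // qf_gt0 // nv_row.
Qed.

Lemma powR_npos_le (p x y : R) : p <= 0 -> 0 < x -> x <= y -> y `^ p <= x `^ p.
Proof.
move=> p0 x0 xy; rewrite !powRexp ?(lt_le_trans x0 xy) // ler_expR.
by apply: ler_wnM2l => //; rewrite ler_ln ?posrE ?(lt_le_trans x0 xy).
Qed.

Lemma trpow_ge E a F b p : E \is unitarymx -> F \is unitarymx ->
  (forall i, 0 < a i) -> (forall i, 0 < b i) ->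
  (forall v, qf (sp E a) v <= qf (sp F b) v) -> p <= 0 ->
  \sum_i b i `^ p <= \sum_i a i `^ p.
Proof.
move=> uE uF a0 b0 ab p0.
apply: le_trans (peierls (tangent_powR (or_intror p0)) uE uF a0).
apply: ler_sum => i _; rewrite -[in leLHS](qf_row_sp b i uF).
by apply: powR_npos_le => //; rewrite qf_gt0 // nv_row.
Qed.

End Operators.

(** * Operator monotonicity of the square root and of the logarithm *)

Section OperatorMonotone.
Variables (R : realType) (d : nat).
Local Notation C := R[i].
Implicit Types (A B E F : 'M[C]_d) (v : 'rV[C]_d) (a b : 'I_d -> R).

Lemma expR_le_quadratic (t : R) : t <= 2^-1 -> expR t <= 1 + t + 2 * t ^+ 2.
Proof.
move=> t2; have h := expR_ge1Dx (- t).
have t1 : 0 < 1 - t by lra.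
rewrite -[expR t]invrK -expRN.
apply: (@le_trans _ _ (1 - t)^-1); first by rewrite lef_pV2 ?posrE ?expR_gt0.
rewrite -[leLHS]mul1r ler_pdivrMr // -subr_ge0.
have -> : (1 + t + 2 * t ^+ 2) * (1 - t) - 1 = t ^+ 2 * (1 - 2 * t) by ring.
by rewrite mulr_ge0 ?sqr_ge0 //; lra.
Qed.

Lemma nvZ (g : R) v : nv (g%:C *: v) = g ^+ 2 * nv v.
Proof.
by rewrite /nv mulr_sumr; apply: eq_bigr => i _; rewrite mxE nsqZ.
Qed.

Lemma row_sp E a i : E \is unitarymx ->
  row i E *m sp E a = (a i)%:C *: row i E.
Proof.
move=> uE; rewrite !spmxE !mulmxA -row_mul (unitary_adjr uE).
apply/rowP => j; rewrite -mulmxA mxE (bigD1 i) //= big1 ?addr0; last first.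
  by move=> k ki; rewrite !mxE eq_sym (negbTE ki) mul0r.
by rewrite mul_rdiagE !mxE eqxx mul1r.
Qed.

Lemma sp_sqr E a : E \is unitarymx -> (forall i, 0 < a i) ->
  sp E (fun i => a i `^ 2^-1) *m sp E (fun i => a i `^ 2^-1) = sp E a.
Proof.
move=> uE a0; rewrite (spM _ _ uE); apply: sp_eq => i.
rewrite -powRD; last by rewrite gt_eqF // implybT.
by rewrite -[2^-1]mul1r -splitr powRr1 // ltW.
Qed.

(** If S - T had an eigenvector u with eigenvalue g > 0, then S^2 - T^2 = S (S - T) + (S - T) T
    would have the positive expectation g (<S> + <T>) at u. *)
Lemma qf_sqrt_le E a F b : E \is unitarymx -> F \is unitarymx ->
  (forall i, 0 < a i) -> (forall i, 0 < b i) ->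
  (forall v, qf (sp E a) v <= qf (sp F b) v) ->
  forall v, qf (sp E (fun i => a i `^ 2^-1)) v <= qf (sp F (fun i => b i `^ 2^-1)) v.
Proof.
move=> uE uF a0 b0 ab v; rewrite -subr_le0 -qfB.
set S := sp E _; set T := sp F _.
have hD : (S - T)^t* = S - T by rewrite linearB /= map_mxB !sp_adj.
have [G [g [uG eD]]] := spectral_sp hD; rewrite eD qf_sp.
apply: sumr_le0 => i _; rewrite mulr_le0_ge0 ?wt_ge0 //.
rewrite leNgt; apply/negP => gi0.
pose u := row i G.
have uD : u *m (S - T) = (g i)%:C *: u by rewrite eD row_sp.
have Du : (S - T) *m u^t* = (g i)%:C *: u^t*.
  have := congr1 (fun X => X^t*) uD; rewrite adjM hD => ->.
  by apply/matrixP => k l; rewrite !mxE rmorphM; congr (_ * _); exact: conjC_real_complex.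
have eAB : sp E a - sp F b = S *m (S - T) + (S - T) *m T.
  by rewrite -(sp_sqr uE a0) -(sp_sqr uF b0) mulmxBr mulmxBl addrA subrK.
have : qf (sp E a - sp F b) u <= 0 by rewrite qfB subr_le0.
have e1 : qf (S *m (S - T)) u = g i * qf S u.
  rewrite !qfmxE mulmxA -(mulmxA _ _ (u^t*)) Du -scalemxAr.
  by rewrite [X in complex.Re X]mxE ReM_real.
have e2 : qf ((S - T) *m T) u = g i * qf T u.
  by rewrite !qfmxE mulmxA uD -scalemxAl -scalemxAl [X in complex.Re X]mxE ReM_real.
rewrite eAB qfD e1 e2 -mulrDr leNgt mulr_gt0 //.
by apply: addr_gt0; apply: qf_gt0; rewrite ?nv_row // => k; rewrite powR_gt0.
Qed.

Lemma qf_root_le k E a F b : E \is unitarymx -> F \is unitarymx ->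
  (forall i, 0 < a i) -> (forall i, 0 < b i) ->
  (forall v, qf (sp E a) v <= qf (sp F b) v) ->
  forall v, qf (sp E (fun i => a i `^ (2^-1 ^+ k))) v <=
            qf (sp F (fun i => b i `^ (2^-1 ^+ k))) v.
Proof.
move=> uE uF a0 b0 ab; elim: k => [|k IH] v.
  rewrite (sp_eq _ (b := a)) 1?(sp_eq F (b := b)) //.
  - by move=> i; rewrite expr0 powRr1 // ltW.
  - by move=> i; rewrite expr0 powRr1 // ltW.
have := qf_sqrt_le uE uF (fun i => powR_gt0 _ (a0 i)) (fun i => powR_gt0 _ (b0 i)) IH v.
rewrite (sp_eq E (b := fun i => a i `^ (2^-1 ^+ k.+1))).
  rewrite (sp_eq F (b := fun i => b i `^ (2^-1 ^+ k.+1))) //.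
  by move=> i; rewrite -powRrM exprSr.
by move=> i; rewrite -powRrM exprSr.
Qed.

Lemma powR_ln_bounds (x t : R) : 0 < x -> 0 < t -> t * ln x <= 2^-1 ->
  ln x <= (x `^ t - 1) / t <= ln x + 2 * t * ln x ^+ 2.
Proof.
move=> x0 t0 tx; rewrite ler_pdivlMr // ler_pdivrMr // powRexp //.
have := expR_ge1Dx (t * ln x); have := expR_le_quadratic tx.
set h := ln x; set u := expR _ => h1 h2.
by apply/andP; split; lra.
Qed.

(** The logarithm is the limit of (x^t - 1)/t, and for t = 2^-k iterated square roots give operator
    monotonicity of x^t. *)
Lemma qf_ln_le E a F b : E \is unitarymx -> F \is unitarymx ->
  (forall i, 0 < a i) -> (forall i, 0 < b i) ->
  (forall v, qf (sp E a) v <= qf (sp F b) v) ->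
  forall v, qf (sp E (fun i => ln (a i))) v <= qf (sp F (fun i => ln (b i))) v.
Proof.
move=> uE uF a0 b0 ab v; apply/ler_addgt0Pr => e e0.
(* [M] dominates both the logarithms and the error coefficient divided by [e], so that t M <= 1/2
   makes [powR_ln_bounds] applicable and the total error at most [e]. *)
pose M := \sum_i (`|ln (a i)| + `|ln (b i)|) + (\sum_i 2 * wt F v i * ln (b i) ^+ 2) / e + 1.
have M0 : 0 < M.
  rewrite ltr_wpDl // addr_ge0 //; first by apply: sumr_ge0 => i _; rewrite addr_ge0.
  rewrite mulr_ge0 ?invr_ge0 ?(ltW e0) //.
  by apply: sumr_ge0 => i _; rewrite mulr_ge0 ?sqr_ge0 // mulr_ge0 ?wt_ge0.
have [k kM] : exists k : nat, 2^-1 ^+ k * M <= 2^-1.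
  have h : `|2^-1 : R| < 1 by rewrite ger0_norm ?invr_ge0 // invf_lt1 // ltr1n.
  have /cvgrPdist_le /(_ (2^-1 / M)) := cvg_geometric (1 : R) h.
  rewrite divr_gt0 ?invr_gt0 // => /(_ isT) [k _ /(_ k (leqnn k))].
  rewrite /= sub0r normrN /geometric /= mul1r ger0_norm ?exprn_ge0 ?invr_ge0 //.
  by rewrite ler_pdivlMr //; exists k.
set t := 2^-1 ^+ k in kM; have t0 : 0 < t by rewrite exprn_gt0 ?invr_gt0.
have lnM (i : 'I_d) : `|ln (a i)| + `|ln (b i)| <= M.
  rewrite /M (bigD1 i) //= -!addrA lerD2l lerDl.
  rewrite addr_ge0 //; first by apply: sumr_ge0 => j _; rewrite addr_ge0.
  rewrite addr_ge0 // mulr_ge0 ?invr_ge0 ?(ltW e0) //.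
  by apply: sumr_ge0 => j _; rewrite mulr_ge0 ?sqr_ge0 // mulr_ge0 ?wt_ge0.
have ta i : t * ln (a i) <= 2^-1.
  apply: le_trans kM; rewrite ler_pM2l //; apply: le_trans (lnM i).
  by rewrite (le_trans (ler_norm _)) // lerDl.
have tb i : t * ln (b i) <= 2^-1.
  apply: le_trans kM; rewrite ler_pM2l //; apply: le_trans (lnM i).
  by rewrite (le_trans (ler_norm _)) // lerDr.
have qt (G : 'M[C]_d) g : G \is unitarymx -> \sum_i ((g i `^ t - 1) / t) * wt G v i =
    (qf (sp G (fun i => g i `^ t)) v - nv v) / t.
  move=> uG; rewrite qf_sp -(parseval v uG) -sumrB mulr_suml.
  by apply: eq_bigr => i _; rewrite mulrBl mulrBl mul1r mulrAC [in RHS]mulrBl mulrAC; ring.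
rewrite 2!qf_sp.
apply: (@le_trans _ _ (\sum_i ((a i `^ t - 1) / t) * wt E v i)).
  by apply: ler_sum => i _; apply: ler_wpM2r; rewrite ?wt_ge0 //;
    have /andP[] := powR_ln_bounds (a0 i) t0 (ta i).
rewrite qt //.
apply: (@le_trans _ _ (\sum_i ((b i `^ t - 1) / t) * wt F v i)).
  by rewrite qt // ler_pM2r ?invr_gt0 // lerD2r; apply: qf_root_le.
apply: (@le_trans _ _ (\sum_i (ln (b i) + 2 * t * ln (b i) ^+ 2) * wt F v i)).
  by apply: ler_sum => i _; apply: ler_wpM2r; rewrite ?wt_ge0 //;
    have /andP[] := powR_ln_bounds (b0 i) t0 (tb i).
under eq_bigr do rewrite mulrDl.
rewrite big_split /= lerD2l.
have -> : \sum_i 2 * t * ln (b i) ^+ 2 * wt F v i = t * \sum_i 2 * wt F v i * ln (b i) ^+ 2.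
  by rewrite mulr_sumr; apply: eq_bigr => i _; ring.
set S := \sum_i 2 * wt F v i * ln (b i) ^+ 2 in M M0 kM lnM *.
have SM : S / e <= M.
  rewrite /M addrAC lerDr addr_ge0 //.
  by apply: sumr_ge0 => i _; rewrite addr_ge0.
have : t * (S / e) <= t * M by rewrite ler_pM2l.
move=> /(ler_wpM2r (ltW e0)); rewrite -mulrA divfK ?gt_eqF // => h.
by apply: le_trans h _; have := ler_wpM2r (ltW e0) kM; lra.
Qed.

End OperatorMonotone.

(** * Hilbert-Schmidt estimates, Klein inequality, positive definite matrices *)

Section TwoBases.
Variables (R : realType) (d : nat).
Local Notation C := R[i].
Implicit Types (A B E F M : 'M[C]_d) (v : 'rV[C]_d) (a b : 'I_d -> R).

(** Squared Hilbert-Schmidt norm; [retr] below is the real part of the trace pairing. *)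
Definition hsn M : R := \sum_i \sum_j nsq (M i j).

Definition retr A B : R := complex.Re (\tr (A *m B)).

Lemma hsn_ge0 M : 0 <= hsn M.
Proof. by apply: sumr_ge0 => i _; apply: sumr_ge0 => j _; apply: nsq_ge0. Qed.

Lemma hsnE M : hsn M = complex.Re (\tr (M *m M^t*)).
Proof.
rewrite /mxtrace Re_sum; apply: eq_bigr => i _; rewrite mxE Re_sum.
by apply: eq_bigr => j _; rewrite !mxE -nsqE.
Qed.

Lemma retrC A B : retr A B = retr B A.
Proof. by rewrite /retr mxtrace_mulC. Qed.

Lemma retrDl A B M : retr (A + B) M = retr A M + retr B M.
Proof. by rewrite /retr mulmxDl mxtraceD raddfD. Qed.

Lemma retrNl A M : retr (- A) M = - retr A M.
Proof. by rewrite /retr mulNmx linearN raddfN. Qed.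

Lemma retrBl A B M : retr (A - B) M = retr A M - retr B M.
Proof. by rewrite retrDl retrNl. Qed.

Lemma retrBr A B M : retr M (A - B) = retr M A - retr M B.
Proof. by rewrite retrC retrBl ![retr _ M]retrC. Qed.

Lemma retr_spl E a B : E \is unitarymx ->
  retr (sp E a) B = \sum_i a i * qf B (row i E).
Proof.
move=> uE; rewrite /retr -(sum_qf _ uE); apply: eq_bigr => i _.
by rewrite !qfmxE mulmxA (row_sp _ _ uE) -2!scalemxAl mxE ReM_real.
Qed.

Lemma retr_sp E a F b : E \is unitarymx ->
  retr (sp E a) (sp F b) = \sum_i \sum_j wt F (row i E) j * (a i * b j).
Proof.
move=> uE; rewrite retr_spl //; apply: eq_bigr => i _; rewrite qf_sp mulr_sumr.
by apply: eq_bigr => j _; ring.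
Qed.

Lemma hsn_sp E a F b : E \is unitarymx -> F \is unitarymx ->
  hsn (sp E a - sp F b) = \sum_i \sum_j wt F (row i E) j * (a i - b j) ^+ 2.
Proof.
move=> uE uF; rewrite hsnE.
have -> : (sp E a - sp F b)^t* = sp E a - sp F b.
  by rewrite linearB /= map_mxB !sp_adj.
rewrite -/(retr _ _) retrBl !retrBr (retrC (sp F b) (sp E a)).
have -> : retr (sp E a) (sp E a) = \sum_i \sum_j wt F (row i E) j * a i ^+ 2.
  rewrite retr_spl //; apply: eq_bigr => i _.
  by rewrite qf_row_sp // -mulr_suml sum_wt_row // mul1r.
have -> : retr (sp F b) (sp F b) = \sum_i \sum_j wt F (row i E) j * b j ^+ 2.
  rewrite retr_spl // exchange_big /=; apply: eq_bigr => j _.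
  by rewrite qf_row_sp // -mulr_suml sum_wt_rowC // mul1r.
rewrite retr_sp // -!sumrB; apply: eq_bigr => i _; rewrite -!sumrB.
by apply: eq_bigr => j _; ring.
Qed.

(** Cauchy-Schwarz in its arithmetic-geometric form; the free parameter [t] later balances a small
    distance against a large logarithm. *)
Lemma retr_amgm A B (t : R) : 0 < t -> B^t* = B ->
  `|retr A B| <= 2^-1 * (t * hsn A + hsn B / t).
Proof.
move=> t0 hB.
have key (x y : C) : `|complex.Re (x * y^*%R)| <= 2^-1 * (t * nsq x + nsq y / t).
  case: x y => x1 x2 [y1 y2]; rewrite /nsq /=.
  have e (x y : R) : `|x * y| <= 2^-1 * (t * x ^+ 2 + y ^+ 2 / t).
    rewrite normrM -(real_normK (num_real x)) -(real_normK (num_real y)) -subr_ge0.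
    have -> : 2^-1 * (t * `|x| ^+ 2 + `|y| ^+ 2 / t) - `|x| * `|y| =
      (2 * t)^-1 * (t * `|x| - `|y|) ^+ 2 by field; rewrite gt_eqF.
    by rewrite mulr_ge0 ?sqr_ge0 // invr_ge0 mulr_ge0 // ltW.
  rewrite mulrN opprK; apply: le_trans (ler_normD _ _) _.
  by apply: le_trans (lerD (e _ _) (e _ _)) _; rewrite le_eqVlt; apply/orP; left; apply/eqP; ring.
have -> : 2^-1 * (t * hsn A + hsn B / t) =
    \sum_i \sum_j 2^-1 * (t * nsq (A i j) + nsq (B i j) / t).
  rewrite /hsn mulr_sumr mulr_suml -big_split /= mulr_sumr; apply: eq_bigr => i _.
  by rewrite mulr_sumr mulr_suml -big_split /= mulr_sumr.
rewrite /retr /mxtrace Re_sum; apply: le_trans (ler_norm_sum _ _ _) _.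
apply: ler_sum => i _; rewrite mxE Re_sum; apply: le_trans (ler_norm_sum _ _ _) _.
by apply: ler_sum => j _; rewrite -[in leLHS]hB !mxE; apply: key.
Qed.

(** With q = s^2 and r = t^2 the tangent line of ln gives the lower bound (s - t)^2, and (s^2 -
    t^2)^2 <= 4 (s - t)^2 because s + t <= 2. *)
Lemma klein_scalar (q r : R) : 0 < q <= 1 -> 0 < r <= 1 ->
  4^-1 * (q - r) ^+ 2 <= q * ln q - q * ln r - q + r.
Proof.
move=> /andP[q0 q1] /andP[r0 r1].
pose s := Num.sqrt q; pose t := Num.sqrt r.
have s0 : 0 < s by rewrite sqrtr_gt0.
have t0 : 0 < t by rewrite sqrtr_gt0.
have s1 : s <= 1 by rewrite -sqrtr1 ler_wsqrtr.
have t1 : t <= 1 by rewrite -sqrtr1 ler_wsqrtr.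
have qs : q = s ^+ 2 by rewrite sqr_sqrtr // ltW.
have rt : r = t ^+ 2 by rewrite sqr_sqrtr // ltW.
have h := ln_le_tangent t0 s0.
rewrite qs rt !lnXn // in q0 q1 r0 r1 *.
have h2 : s ^+ 2 * ln t <= s ^+ 2 * ln s + s * (t - s).
  rewrite -[X in _ + X](_ : s ^+ 2 * (s^-1 * (t - s)) = _); last by field; rewrite gt_eqF.
  by rewrite -mulrDr ler_pM2l ?exprn_gt0.
rewrite !mulr2n.
have : 4^-1 * (s ^+ 2 - t ^+ 2) ^+ 2 <= (s - t) ^+ 2.
  have -> : (s ^+ 2 - t ^+ 2) ^+ 2 = (s + t) ^+ 2 * (s - t) ^+ 2 by ring.
  rewrite mulrA -[leRHS]mul1r ler_wpM2r ?sqr_ge0 // ler_pdivrMl // mulr1.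
  have -> : (4 : R) = 2 ^+ 2 by rewrite -natrX.
  by rewrite ler_sqr ?nnegrE ?addr_ge0 ?(ltW s0) ?(ltW t0) //; lra.
by move=> h3; apply: le_trans h3 _; lra.
Qed.

(** Relative entropy dominates the squared Hilbert-Schmidt distance: [klein_scalar] is averaged over
    the doubly stochastic overlaps, and the linear terms cancel because the traces agree. *)
Lemma klein E a F b : E \is unitarymx -> F \is unitarymx ->
  (forall i, 0 < a i <= 1) -> (forall i, 0 < b i <= 1) ->
  \sum_i a i = \sum_i b i ->
  4^-1 * hsn (sp E a - sp F b) <=
  \sum_i a i * ln (a i) - retr (sp E a) (sp F (fun i => ln (b i))).
Proof.
move=> uE uF ha hb eab; rewrite hsn_sp // retr_sp //.
have -> : \sum_i a i * ln (a i) =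
    \sum_i \sum_j wt F (row i E) j * (a i * ln (a i) - a i + b j).
  under [RHS]eq_bigr => i _.
    under eq_bigr do rewrite mulrDr; rewrite big_split /= -mulr_suml sum_wt_row // mul1r.
    over.
  rewrite big_split /= exchange_big /=.
  under [X in _ + X]eq_bigr => j _ do rewrite -mulr_suml sum_wt_rowC // mul1r.
  by rewrite sumrB -eab subrK.
rewrite mulr_sumr -sumrB; apply: ler_sum => i _.
rewrite mulr_sumr -sumrB; apply: ler_sum => j _.
rewrite mulrCA -mulrBr ler_wpM2l ?wt_ge0 //.
by apply: le_trans (klein_scalar (ha i) (hb j)) _; lra.
Qed.

(** First-order expansion of Tr f at [sp E a] with quadratic error. Averaging a scalar estimate over
    pairs of eigenvalues avoids any perturbation theory of the spectrum. *)
Lemma trf_expand (f g : R -> R) (K : R) E a F b : E \is unitarymx -> F \is unitarymx ->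
  (forall i j, `|f (b j) - f (a i) - g (a i) * (b j - a i)| <= K * (a i - b j) ^+ 2) ->
  `|\sum_i f (b i) - \sum_i f (a i) -
    retr (sp E (fun i => g (a i))) (sp F b - sp E a)| <= K * hsn (sp E a - sp F b).
Proof.
move=> uE uF h; rewrite hsn_sp // retrBr retr_sp //.
have -> : \sum_i f (b i) = \sum_i \sum_j wt F (row i E) j * f (b j).
  rewrite exchange_big /=; apply: eq_bigr => j _.
  by rewrite -mulr_suml sum_wt_rowC // mul1r.
have -> : \sum_i f (a i) = \sum_i \sum_j wt F (row i E) j * f (a i).
  by apply: eq_bigr => i _; rewrite -mulr_suml sum_wt_row // mul1r.
have -> : retr (sp E (fun i => g (a i))) (sp E a) =
    \sum_i \sum_j wt F (row i E) j * (g (a i) * a i).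
  rewrite retr_spl //; apply: eq_bigr => i _.
  by rewrite qf_row_sp // -mulr_suml sum_wt_row // mul1r.
rewrite -!sumrB; apply: le_trans (ler_norm_sum _ _ _) _.
rewrite mulr_sumr; apply: ler_sum => i _; rewrite -!sumrB.
apply: le_trans (ler_norm_sum _ _ _) _; rewrite mulr_sumr; apply: ler_sum => j _.
rewrite -!mulrBr normrM (ger0_norm (wt_ge0 _ _ _)) mulrCA ler_wpM2l ?wt_ge0 //.
Qed.

(** The unitary is the polar factor: the rows of [E *m A] are rescaled by the inverse square roots
    of the eigenvalues. *)
Lemma adj_swap A E a : E \is unitarymx -> (forall i, 0 < a i) ->
  A *m A^t* = sp E a -> exists2 F, F \is unitarymx & A^t* *m A = sp F a.
Proof.
move=> uE a0 eA; pose D := rdiag (fun i => (Num.sqrt (a i))^-1).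
have eE : E *m (A *m A^t*) *m E^t* = rdiag a.
  rewrite eA spmxE !mulmxA (unitary_adjr uE) mul1mx -mulmxA (unitary_adjr uE).
  by rewrite mulmx1.
have hD : D *m rdiag a *m D = 1%:M.
  rewrite !rdiagM -rdiag1; apply: rdiag_eq => i.
  have s0 : Num.sqrt (a i) != 0 by rewrite gt_eqF // sqrtr_gt0.
  have := sqr_sqrtr (ltW (a0 i)).
  by move: (Num.sqrt _) s0 => s s0 <-; field.
have uF : D *m E *m A \is unitarymx.
  apply/unitarymxP; rewrite !adjM rdiag_adj -hD -eE.
  by rewrite !mulmxA.
exists (D *m E *m A) => [//|]; rewrite !spmxE !adjM rdiag_adj.
have -> : A^t* *m (E^t* *m D) *m rdiag a *m (D *m E *m A) =
    A^t* *m (E^t* *m (D *m rdiag a *m D) *m E) *m A by rewrite !mulmxA.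
by rewrite hD mulmx1 (unitary_adjl uE) mulmx1.
Qed.

(** Positive definiteness in spectral form; [posdefP] recovers it from the quadratic form. *)
Definition posdef A := exists E a,
  [/\ E \is unitarymx, (forall i, 0 < a i) & A = sp E a].

Lemma nv_ge0 v : 0 <= nv v.
Proof. by apply: sumr_ge0 => i _; apply: nsq_ge0. Qed.

Lemma nv_eq0 v : (nv v == 0) = (v == 0).
Proof.
apply/eqP/eqP => [|->]; last by rewrite /nv big1 // => i _; rewrite mxE nsq0.
move=> /psumr_eq0P h; apply/rowP => i; rewrite mxE; apply/eqP.
by rewrite -nsq_eq0; apply/eqP; apply: h => // j _; apply: nsq_ge0.
Qed.

Lemma qfZv A (g : R) v : qf A (g%:C *: v) = g ^+ 2 * qf A v.
Proof.
rewrite !qfmxE; have -> : (g%:C *: v)^t* = g%:C *: v^t*.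
  by apply/matrixP => k l; rewrite !mxE rmorphM; congr (_ * _); exact: conjC_real_complex.
rewrite -scalemxAl -scalemxAl -scalemxAr scalerA -rmorphM [X in complex.Re X]mxE.
by rewrite ReM_real expr2.
Qed.

Lemma posdef_herm A : posdef A -> A^t* = A.
Proof. by move=> [E [a [_ _ ->]]]; rewrite sp_adj. Qed.

Lemma posdef_qf A v : posdef A -> v != 0 -> 0 < qf A v.
Proof.
move=> [E [a [uE a0 ->]]] v0; rewrite qf_sp lt_def.
rewrite sumr_ge0 ?andbT; last first.
  by move=> i _; rewrite mulr_ge0 ?wt_ge0 // ltW.
apply: contra v0 => /eqP /psumr_eq0P h; rewrite -nv_eq0 -(parseval v uE).
rewrite big1 // => i _; have /eqP := h (fun i _ => mulr_ge0 (ltW (a0 i)) (wt_ge0 E v i)) i isT.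
by rewrite mulf_eq0 (gt_eqF (a0 i)) => /eqP.
Qed.

Lemma posdef_qf_ge0 A v : posdef A -> 0 <= qf A v.
Proof.
by move=> [E [a [uE a0 ->]]]; apply: qf_ge0 => i; apply: ltW.
Qed.

Lemma posdefP A : A^t* = A -> (forall v, v != 0 -> 0 < qf A v) -> posdef A.
Proof.
move=> hA pA; have [E [a [uE eA]]] := spectral_sp hA.
exists E, a; split => // i; rewrite -(qf_row_sp a i uE) -eA; apply: pA.
by rewrite -nv_eq0 nv_row // oner_eq0.
Qed.

Lemma posdef_sp E a : E \is unitarymx -> (forall i, 0 < a i) -> posdef (sp E a).
Proof. by move=> uE a0; exists E, a. Qed.

Lemma qf_conj A M v : qf (M *m A *m M^t*) v = qf A (v *m M).
Proof. by rewrite !qfmxE adjM !mulmxA. Qed.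

Lemma posdef_conj A M : posdef A -> M \in unitmx -> posdef (M *m A *m M^t*).
Proof.
move=> pA uM; apply: posdefP.
  by rewrite !adjM adjK (posdef_herm pA) mulmxA.
move=> v v0; rewrite qf_conj; apply: posdef_qf => //.
by apply: contra v0 => /eqP vM; rewrite -(mulmxK uM v) vM mul0mx.
Qed.

Definition trp (p : R) A : R := complex.Re (\tr (mxpowR A p)).

Lemma trp_sp p E a : E \is unitarymx -> trp p (sp E a) = \sum_i a i `^ p.
Proof. by move=> uE; rewrite /trp mxpow_sp // tr_sp. Qed.

Lemma trp_adj_swap p A : posdef (A *m A^t*) -> trp p (A *m A^t*) = trp p (A^t* *m A).
Proof.
move=> [E [a [uE a0 eA]]]; have [F uF ->] := adj_swap uE a0 eA.
by rewrite eA !trp_sp.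
Qed.

Lemma trp_le p A B : posdef A -> posdef B -> (forall v, qf A v <= qf B v) ->
  0 <= p -> trp p A <= trp p B.
Proof.
move=> [E [a [uE a0 ->]]] [F [b [uF b0 ->]]] ab p0.
by rewrite (trp_sp _ _ uE) (trp_sp _ _ uF) (trpow_le uE uF a0 b0 ab p0).
Qed.

Lemma trp_ge p A B : posdef A -> posdef B -> (forall v, qf A v <= qf B v) ->
  p <= 0 -> trp p B <= trp p A.
Proof.
move=> [E [a [uE a0 ->]]] [F [b [uF b0 ->]]] ab p0.
by rewrite (trp_sp _ _ uE) (trp_sp _ _ uF) (trpow_ge uE uF a0 b0 ab p0).
Qed.

Lemma trp_ge0 p A : posdef A -> 0 <= trp p A.
Proof.
by move=> [E [a [uE a0 ->]]]; rewrite trp_sp // sumr_ge0 // => i _; rewrite powR_ge0.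
Qed.

Lemma posdef_mxpow A p : posdef A -> posdef (mxpowR A p).
Proof.
move=> [E [a [uE a0 ->]]]; rewrite mxpow_sp //.
by apply: posdef_sp => // i; rewrite powR_gt0.
Qed.

Lemma posdef_unit A : posdef A -> A \in unitmx.
Proof.
move=> [E [a [uE a0 ->]]].
apply: (proj1 (@mulmx1_unit _ _ _ (sp E (fun i => (a i)^-1)) _)).
rewrite (spM _ _ uE) -(sp1 uE); apply: sp_eq => i.
by rewrite divff // gt_eqF.
Qed.

End TwoBases.

(** * Pinching with respect to a labelling of the basis *)

Section Pinching.
Variables (R : realType) (d : nat) (L : eqType) (c : 'I_d -> L).
Local Notation C := R[i].
Implicit Types (A B E F M : 'M[C]_d) (v : 'rV[C]_d) (a b : 'I_d -> R).

Definition pin A : 'M[C]_d := \matrix_(i, j) if c i == c j then A i j else 0.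

Definition homog v := forall i j, v 0 i != 0 -> v 0 j != 0 -> c i = c j.

Definition labels : seq L := undup [seq c i | i <- enum 'I_d].

Definition cut (l : L) v : 'rV[C]_d := \row_i if c i == l then v 0 i else 0.

Lemma mem_labels i : c i \in labels.
Proof. by rewrite mem_undup map_f // mem_enum. Qed.

Lemma sum_labels (V : nmodType) (l : L) (F : L -> V) : l \in labels ->
  \sum_(k <- labels | l == k) F k = F l.
Proof.
move=> hl; rewrite big_mkcond (bigD1_seq l) ?undup_uniq //= eqxx.
by rewrite big1 ?addr0 // => k; rewrite eq_sym => /negbTE ->.
Qed.

Lemma pin_herm A : A^t* = A -> (pin A)^t* = pin A.
Proof.
move=> hA; apply/matrixP => i j; rewrite !mxE eq_sym; case: eqP => _.
  by rewrite -[in RHS]hA !mxE.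
by rewrite conjC0.
Qed.

Lemma qfE A v : qf A v = complex.Re (\sum_i \sum_j v 0 i * A i j * (v 0 j)^*%R).
Proof.
rewrite !qfmxE mxE exchange_big /=; congr complex.Re; apply: eq_bigr => j _.
by rewrite !mxE mulr_suml.
Qed.

Lemma qf_pin_homog A v : homog v -> qf (pin A) v = qf A v.
Proof.
move=> hv; rewrite !qfE; congr complex.Re.
apply: eq_bigr => i _; apply: eq_bigr => j _; rewrite mxE.
have [->|vi] := eqVneq (v 0 i) 0; first by rewrite !mul0r.
have [->|vj] := eqVneq (v 0 j) 0; first by rewrite conjC0 !mulr0.
by rewrite (hv _ _ vi vj) eqxx.
Qed.

Lemma sum_cut v : v = \sum_(l <- labels) cut l v.
Proof.
apply/rowP => i; rewrite summxE.
under eq_bigr do rewrite mxE.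
by rewrite -big_mkcond /= (sum_labels (fun=> v 0 i)) // mem_labels.
Qed.

Lemma qf_pin A v : qf (pin A) v = \sum_(l <- labels) qf A (cut l v).
Proof.
under eq_bigr do rewrite qfE; rewrite qfE -Re_sum; congr complex.Re.
rewrite [RHS]exchange_big /=; apply: eq_bigr => i _.
rewrite [RHS]exchange_big /=; apply: eq_bigr => j _.
under [RHS]eq_bigr do rewrite !mxE.
rewrite (bigD1_seq (c i)) ?undup_uniq ?mem_labels //= big1_seq ?addr0; last first.
  by move=> l /andP[li _]; rewrite eq_sym (negbTE li) !mul0r.
rewrite eqxx mxE [c j == _]eq_sym; case: eqP => _ //.
by rewrite conjC0 !mulr0 mul0r.
Qed.

Lemma homog_cut l v : homog (cut l v).
Proof.
move=> i j; rewrite !mxE; case: (c i =P l) => [ei _|_]; last by rewrite eqxx.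
by case: (c j =P l) => [ej _|_]; rewrite ?eqxx // ei ej.
Qed.

Lemma nsq_sum_le (I : Type) (s : seq I) (x : I -> C) :
  nsq (\sum_(l <- s) x l) <= (size s)%:R * \sum_(l <- s) nsq (x l).
Proof.
elim: s => [|l s IH]; first by rewrite !big_nil nsq0 mul0r.
have tri (n : R) (z w : C) : 0 < n -> nsq (z + w) <= (n + 1) * nsq z + (1 + n^-1) * nsq w.
  move=> n0; case: z w => z1 z2 [w1 w2]; rewrite /nsq /=.
  rewrite -subr_ge0.
  rewrite (_ : _ - _ = n^-1 * ((n * z1 - w1) ^+ 2 + (n * z2 - w2) ^+ 2)).
    by rewrite mulr_ge0 ?invr_ge0 ?(ltW n0) // addr_ge0 // sqr_ge0.
  by field; rewrite gt_eqF.
case: s IH => [_|k s IH]; first by rewrite !big_seq1 mul1r.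
have n0 : 0 < (size (k :: s))%:R :> R by rewrite ltr0n.
have -> : (size [:: l, k & s])%:R = (size (k :: s))%:R + 1 :> R by rewrite natr1.
rewrite big_cons [in leRHS]big_cons.
set X := \sum_(_ <- _) _ in IH *; set Y := \sum_(_ <- _) _ in IH *.
apply: le_trans (tri _ (x l) X n0) _; rewrite [in leRHS]mulrDr lerD2l.
apply: le_trans (ler_wpM2l _ IH) _; first by rewrite addr_ge0 // invr_ge0 ltW.
by rewrite mulrA mulrDl mul1r mulVf ?gt_eqF.
Qed.

(** Pinching inequality: a vector is the sum of its cuts, one per label, and the square of a sum of
    K terms is at most K times the sum of the squares. *)
Lemma qf_le_pin A v : posdef A -> qf A v <= (size labels)%:R * qf (pin A) v.
Proof.
move=> [E [a [uE a0 ->]]]; rewrite qf_pin qf_sp.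
under [X in _ <= _ * X]eq_bigr do rewrite qf_sp.
rewrite exchange_big mulr_sumr /=; apply: ler_sum => i _.
rewrite -mulr_sumr mulrCA ler_pM2l // {1}/wt {1}[v]sum_cut mulmx_suml summxE.
exact: nsq_sum_le.
Qed.

Lemma pin_posdef A : posdef A -> posdef (pin A).
Proof.
move=> pA; apply: posdefP; first by apply: pin_herm; apply: posdef_herm.
move=> v v0; have q0 := posdef_qf pA v0; have := qf_le_pin v pA.
rewrite ltNge; apply: contraTN => q; rewrite -ltNge.
by apply: le_lt_trans q0; rewrite mulr_ge0_le0.
Qed.

(** Kadison-Schwarz inequality for the pinching map. It will bound the pinched power of rho from
    below by a diagonal matrix. *)
Lemma kadison A v : qf (pin A *m (pin A)^t*) v <= qf (pin (A *m A^t*)) v.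
Proof.
have nvE M (w : 'rV[C]_d) : qf (M *m M^t*) w = nv (w *m M).
  by rewrite nv_qf1 -qf_conj mulmx1.
rewrite qf_pin nvE; under [leRHS]eq_bigr do rewrite nvE.
rewrite /nv exchange_big /=; apply: ler_sum => j _.
rewrite (bigD1_seq (c j)) ?undup_uniq ?mem_labels //= -[leLHS]addr0 lerD //.
  rewrite le_eqVlt; apply/orP; left; apply/eqP; congr nsq; rewrite !mxE.
  by apply: eq_bigr => i _; rewrite !mxE; case: eqP; rewrite ?mulr0 ?mul0r.
by apply: sumr_ge0 => l _; apply: nsq_ge0.
Qed.

Definition hbasis E (lab : 'I_d -> L) :=
  forall x z, E x z != 0 -> c z = lab x.

Lemma hbasis_homog E lab x : hbasis E lab -> homog (row x E).
Proof. by move=> h i j; rewrite !mxE => /h -> /h ->. Qed.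

(** A pinched matrix has an eigenbasis of vectors living in a single block. On such vectors it has
    the same quadratic form as [A], so its eigenvalues are diagonal entries of [A] in that basis. *)
Lemma pin_basis A : posdef A -> exists E a lab,
  [/\ E \is unitarymx, (forall x, 0 < a x), pin A = sp E a, hbasis E lab &
      forall x, a x = qf A (row x E)].
Proof.
(* Labels are numbered by reals, so that the block structure becomes a Hermitian matrix commuting
   with the pinched one. *)
move=> pA; pose c' (z : 'I_d) : R := (index (c z) labels)%:R.
have c'I i j : c' i = c' j -> c i = c j.
  move=> /eqP; rewrite eqr_nat => /eqP e.
  by rewrite -(nth_index (c i) (mem_labels i)) e (nth_index _ (mem_labels j)).
have com : pin A *m rdiag c' = rdiag c' *m pin A.
  apply/matrixP => i j; rewrite mul_mx_rdiagE mul_rdiagE mxE.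
  by case: eqP => [e|_]; rewrite ?mul0r ?mulr0 // /c' e mulrC.
have hpA := pin_herm (posdef_herm pA).
have [E [a [b [uE eA eb]]]] := joint_spectral hpA (rdiag_adj c') com.
have hE x z : E x z != 0 -> c' z = b x.
  move=> Exz; have : (E *m rdiag c') x z = (rdiag b *m E) x z.
    by rewrite eb spmxE !mulmxA (unitary_adjr uE) mul1mx.
  rewrite mul_mx_rdiagE mul_rdiagE mulrC => /(mulIf Exz).
  exact: complexI.
have ex x : exists z, E x z != 0.
  apply/existsP; rewrite -[[exists z, _]]negbK negb_exists; apply/negP => /forallP h.
  have := nv_row x uE; rewrite /nv big1 => [|z _]; first by move/eqP; rewrite eq_sym oner_eq0.
  by have := h z; rewrite negbK mxE => /eqP ->; rewrite nsq0.
pose lab x := c (xchoose (ex x)).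
have hb : hbasis E lab.
  move=> x z Exz; apply: c'I; rewrite (hE _ _ Exz).
  by rewrite (hE x (xchoose (ex x)) (xchooseP (ex x))).
have ea x : a x = qf A (row x E).
  by rewrite -(qf_pin_homog A (hbasis_homog (x := x) hb)) eA qf_row_sp.
exists E, a, lab; split => // x; rewrite ea; apply: posdef_qf => //.
by rewrite -nv_eq0 nv_row // oner_eq0.
Qed.

(** Peierls in the basis of [pin_basis]. *)
Lemma trp_pin_le p A : posdef A -> 1 <= p \/ p <= 0 -> trp p (pin A) <= trp p A.
Proof.
move=> pA hp; have [E [a [lab [uE a0 eA _ ea]]]] := pin_basis pA.
case: (pA) => F [b [uF b0 eb]].
rewrite eA eb (trp_sp _ _ uE) (trp_sp _ _ uF).
rewrite (eq_bigr (fun i => qf (sp F b) (row i E) `^ p)) => [|i _]; last by rewrite ea eb.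
exact: (peierls (f := fun x => x `^ p) (tangent_powR hp) uF uE b0).
Qed.

Lemma trp_pin_ge p A : posdef A -> 0 <= p <= 1 -> trp p A <= trp p (pin A).
Proof.
move=> pA hp; have [E [a [lab [uE a0 eA _ ea]]]] := pin_basis pA.
case: (pA) => F [b [uF b0 eb]].
rewrite eA eb (trp_sp _ _ uE) (trp_sp _ _ uF).
rewrite [leRHS](eq_bigr (fun i => qf (sp F b) (row i E) `^ p)) => [|i _]; last by rewrite ea eb.
exact: (peierlsN (f := fun x => x `^ p) (tangent_powRN hp) uF uE b0).
Qed.

Lemma trpZ p A (k : R) : 0 < k -> posdef A -> trp p (k%:C *: A) = k `^ p * trp p A.
Proof.
move=> k0 [E [a [uE a0 ->]]].
have -> : k%:C *: sp E a = sp E (fun i => k * a i).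
  apply/matrixP => i j; rewrite mxE !spE mulr_sumr; apply: eq_bigr => x _.
  by rewrite rmorphM !mulrA.
rewrite !(trp_sp _ _ uE) mulr_sumr; apply: eq_bigr => i _.
by rewrite powRM // ltW.
Qed.

Lemma posdefZ A (k : R) : 0 < k -> posdef A -> posdef (k%:C *: A).
Proof.
move=> k0 [E [a [uE a0 ->]]]; exists E, (fun i => k * a i); split => //.
  by move=> i; rewrite mulr_gt0.
apply/matrixP => i j; rewrite mxE !spE mulr_sumr; apply: eq_bigr => x _.
by rewrite rmorphM !mulrA.
Qed.

Lemma qfZ A (k : R) v : qf (k%:C *: A) v = k * qf A v.
Proof. by rewrite !qfmxE -scalemxAr -scalemxAl mxE ReM_real. Qed.

Lemma trp_le_pin p A : posdef A -> 0 <= p -> (0 < size labels)%N ->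
  trp p A <= (size labels)%:R `^ p * trp p (pin A).
Proof.
move=> pA p0 K0; have K : 0 < (size labels)%:R :> R by rewrite ltr0n.
rewrite -trpZ //; last exact: pin_posdef.
apply: trp_le => //; first by apply: posdefZ => //; apply: pin_posdef.
by move=> v; rewrite qfZ; apply: qf_le_pin.
Qed.

Lemma bessel M (X : pred 'I_d) v :
  (forall x y, X x -> X y -> (row x M *m (row y M)^t*) 0 0 = (x == y)%:R) ->
  \sum_(x | X x) nsq ((v *m (row x M)^t*) 0 0) <= nv v.
Proof.
move=> hM; pose H : 'M[C]_d := \matrix_(x, z) if X x then M x z else 0.
have HH : H *m H^t* = rdiag (fun x => (X x)%:R).
  apply/matrixP => x y; rewrite rdiagE mxE.
  have [xX|xX] := boolP (X x); last first.
    rewrite big1 ?mul0rn // => z _; rewrite !mxE (negbTE xX) mul0r //.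
  have [yX|yX] := boolP (X y); last first.
    rewrite big1 => [|z _]; last by rewrite !mxE (negbTE yX) conjC0 mulr0.
    by case: eqP => // xy; rewrite xy (negbTE yX) in xX.
  rewrite -[RHS](_ : (x == y)%:R = _); last by [].
  rewrite -(hM x y) // mxE; apply: eq_bigr => z _.
  by rewrite !mxE xX yX.
have HHH : H *m H^t* *m H = H.
  rewrite HH; apply/matrixP => x z; rewrite mul_rdiagE !mxE.
  by case: ifP => _; rewrite ?mul1r // mulr0.
have eS : \sum_(x | X x) nsq ((v *m (row x M)^t*) 0 0) = nv (v *m H^t*).
  rewrite /nv big_mkcond /=; apply: eq_bigr => x _.
  case: ifP => xX; last first.
    by rewrite mxE big1 ?nsq0 // => z _; rewrite !mxE xX conjC0 mulr0.
  congr nsq; rewrite !mxE; apply: eq_bigr => z _.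
  by rewrite !mxE xX.
rewrite eS -subr_ge0.
have -> : nv v - nv (v *m H^t*) = nv (v - v *m H^t* *m H).
  rewrite !nv_qf1 !qfmxE !mulmx1.
  have -> : (v - v *m H^t* *m H)^t* = v^t* - H^t* *m H *m v^t*.
    by rewrite linearB /= map_mxB !adjM adjK !mulmxA.
  rewrite mulmxBl !mulmxBr !mulmxA adjM adjK.
  have -> : v *m H^t* *m H *m H^t* *m H *m v^t* = v *m H^t* *m H *m v^t*.
    by congr (_ *m _); rewrite -!mulmxA (mulmxA H) HHH.
  rewrite subrr subr0 [in RHS]mxE [X in _ = complex.Re (_ + X)]mxE raddfB /=.
  by rewrite !mulmxA.
exact: nv_ge0.
Qed.

(** Each label contributes at most Tr A^p. For p < 1 pinching increases the power trace, and this
    limits the increase to the number of labels. *)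
Lemma trp_pin_le_card p A : posdef A -> 0 <= p ->
  trp p (pin A) <= (size labels)%:R * trp p A.
Proof.
move=> pA p0; have [E [a [lab [uE a0 eA hb ea]]]] := pin_basis pA.
case: (pA) => F [b [uF b0 eb]].
have labI x : lab x \in labels.
  have /existsP[z Exz] : [exists z, E x z != 0].
    rewrite -[[exists z, _]]negbK negb_exists; apply/negP => /forallP h.
    have := nv_row x uE; rewrite /nv big1 => [|z _]; first by move/eqP; rewrite eq_sym oner_eq0.
    by have := h z; rewrite negbK mxE => /eqP ->; rewrite nsq0.
  by rewrite -(hb _ _ Exz) mem_labels.
rewrite eA (trp_sp _ _ uE).
have -> : \sum_i a i `^ p = \sum_(l <- labels) \sum_(i | lab i == l) a i `^ p.
  rewrite (exchange_big_dep predT) //=; apply: eq_bigr => i _.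
  by rewrite (sum_labels (fun=> a i `^ p)).
have -> : (size labels)%:R * trp p A = \sum_(l <- labels) trp p A.
  by rewrite big_const_seq count_predT iter_addr_0 mulr_natl.
apply: ler_sum => l _; rewrite eb (trp_sp _ _ uF).
(* Squared overlaps of the i-th eigenvector of [A] with the vectors a_x^(-1/2) A^(1/2) e_x. Within
   one label these are orthonormal, since [A] compressed to the block is diagonal there; Bessel
   bounds the sum by 1. *)
pose u x i := b i * wt F (row x E) i / a x.
have bes i : \sum_(x | lab x == l) u x i <= 1.
  pose M : 'M[C]_d := rdiag (fun x => (Num.sqrt (a x))^-1) *m E *m
                      sp F (fun i => b i `^ 2^-1).
  have orth x y : lab x == l -> lab y == l ->
      (row x M *m (row y M)^t*) 0 0 = (x == y)%:R.
    move=> /eqP xl /eqP yl.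
    have -> : (row x M *m (row y M)^t*) 0 0 = (M *m M^t*) x y.
      by rewrite !mxE; apply: eq_bigr => z _; rewrite !mxE.
    rewrite /M !adjM sp_adj rdiag_adj -!mulmxA (mulmxA (sp F _)) (sp_sqr uF b0).
    rewrite -eb mul_rdiagE !mulmxA mul_mx_rdiagE.
    have -> : (E *m A *m E^t*) x y = (E *m pin A *m E^t*) x y.
      rewrite !mxE; apply: eq_bigr => j _; rewrite !mxE !mulr_suml.
      apply: eq_bigr => k _; rewrite !mxE.
      have [->|Exk] := eqVneq (E x k) 0; first by rewrite !mul0r.
      have [->|Eyj] := eqVneq (E y j) 0; first by rewrite conjC0 !mulr0.
      by rewrite (hb _ _ Exk) (hb _ _ Eyj) xl yl eqxx.
    rewrite eA spmxE !mulmxA (unitary_adjr uE) mul1mx -mulmxA (unitary_adjr uE) mulmx1.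
    rewrite rdiagE; case: eqP => [->|_]; last by rewrite mulr0n mul0r mulr0.
    rewrite mulr1n -!rmorphM /=; congr (_%:C).
    have s0 : Num.sqrt (a y) != 0 by rewrite gt_eqF // sqrtr_gt0.
    have := sqr_sqrtr (ltW (a0 y)).
    by move: (Num.sqrt _) s0 => s s0 <-; field.
  rewrite -(nv_row i uF); apply: le_trans (bessel (row i F) orth).
  rewrite le_eqVlt; apply/orP; left; apply/eqP; apply: eq_bigr => x _.
  rewrite row_mul row_mul.
  have -> : row x (rdiag (fun x => (Num.sqrt (a x))^-1)) *m E =
      ((Num.sqrt (a x))^-1)%:C *: row x E.
    by rewrite -row_mul; apply/rowP => z; rewrite mxE mul_rdiagE !mxE.
  rewrite adjM sp_adj mulmxA row_sp // -scalemxAl mxE nsqZ.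
  have -> : (((Num.sqrt (a x))^-1)%:C *: row x E)^t* =
      ((Num.sqrt (a x))^-1)%:C *: (row x E)^t*.
    by apply/matrixP => k m; rewrite !mxE rmorphM; congr (_ * _); exact: conjC_real_complex.
  rewrite -scalemxAr mxE nsqZ /u exprVn sqr_sqrtr ?(ltW (a0 _)) //.
  have -> : (b i `^ 2^-1) ^+ 2 = b i.
    by rewrite -powR_mulrn ?powR_ge0 // -powRrM mulVf // powRr1 // ltW.
  have -> : nsq ((row i F *m (row x E)^t*) 0 0) = wt F (row x E) i.
    rewrite wt_rowC wt_row; congr nsq; rewrite !mxE; apply: eq_bigr => z _.
    by rewrite !mxE.
  by field; rewrite gt_eqF.
apply: (@le_trans _ _ (\sum_(x | lab x == l) \sum_i b i `^ p * u x i)).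
  apply: ler_sum => x _; rewrite -(ler_pM2r (a0 x)) mulr_suml.
  (* Jensen is used for the exponent p + 1, convex for every p >= 0; dividing by [a x] then produces
     the weights [u x i]. *)
  have p1 : 1 <= p + 1 by rewrite lerDr.
  have := qf_jensen (tangent_powR (or_introl p1)) uF b0 (nv_row x uE).
  rewrite -eb -ea qf_sp powRD ?powRr1 ?(ltW (a0 x)) //; last first.
    by rewrite (gt_eqF (a0 x)) implybT.
  move/le_trans; apply; rewrite le_eqVlt; apply/orP; left; apply/eqP.
  apply: eq_bigr => i _ /=; rewrite /u powRD; last by rewrite (gt_eqF (b0 i)) implybT.
  rewrite powRr1 ?(ltW (b0 i)) //; field; rewrite gt_eqF //.
rewrite exchange_big /=; apply: ler_sum => i _; rewrite -mulr_sumr.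
by rewrite -[leRHS]mulr1 ler_wpM2l ?powR_ge0.
Qed.

End Pinching.

(** * Tensor powers through digit expansions of indices, and counting of types *)

Section TensorPowers.
Variables (R : realType) (d : nat).
Local Notation C := R[i].

(** Reads an index of the n-fold tensor power as a word of n letters, so that entries of [tpow]
    become products over positions. *)
Fixpoint dig n : 'I_(tdim d n) -> {ffun 'I_n -> 'I_d} :=
  match n return 'I_(tdim d n) -> {ffun 'I_n -> 'I_d} with
  | 0 => fun _ => [ffun k : 'I_0 => match k with Ordinal m h => False_rect _ (notF h) end]
  | n'.+1 => fun i => let ij := mxtens_unindex i in
      [ffun k => if unlift ord0 k is Some k' then dig ij.2 k' else ij.1]
  end.

Fixpoint undig n : {ffun 'I_n -> 'I_d} -> 'I_(tdim d n) :=
  match n return {ffun 'I_n -> 'I_d} -> 'I_(tdim d n) with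
  | 0 => fun _ => ord0
  | n'.+1 => fun f =>
      mxtens_index (f ord0, undig [ffun k => f (lift ord0 k)])
  end.

Lemma dig_ord0 n (i : 'I_(tdim d n.+1)) : dig i ord0 = (mxtens_unindex i).1.
Proof. by rewrite [LHS]ffunE unlift_none. Qed.

Lemma dig_lift n (i : 'I_(tdim d n.+1)) k :
  dig i (lift ord0 k) = dig (mxtens_unindex i).2 k.
Proof. by rewrite [LHS]ffunE liftK. Qed.

Lemma undigS n (f : {ffun 'I_n.+1 -> 'I_d}) :
  undig f = mxtens_index (f ord0, undig [ffun k => f (lift ord0 k)]).
Proof. by []. Qed.

Lemma digK n : cancel (@dig n) (@undig n).
Proof.
elim: n => [|n IH] i; first by rewrite (ord1 i).
rewrite undigS dig_ord0 -[RHS]mxtens_unindexK.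
have -> : [ffun k => dig i (lift ord0 k)] = dig (mxtens_unindex i).2.
  by apply/ffunP => k; rewrite ffunE dig_lift.
by rewrite IH -surjective_pairing.
Qed.

Lemma undigK n : cancel (@undig n) (@dig n).
Proof.
elim: n => [|n IH] f; apply/ffunP => k; first by case: k.
rewrite undigS; case: (unliftP ord0 k) => [j ->|->].
  by rewrite dig_lift mxtens_indexK IH ffunE.
by rewrite dig_ord0 mxtens_indexK.
Qed.

Lemma undig_bij n : bijective (@undig n).
Proof. by exists (@dig n); [exact: undigK|exact: digK]. Qed.

Lemma tpowE n (A : 'M[C]_d) i j :
  tpow A n i j = \prod_(k < n) A (dig i k) (dig j k).
Proof.
elim: n i j => [|n IH] i j; first by rewrite big_ord0 (ord1 i) (ord1 j) mxE.
rewrite big_ord_recl !dig_ord0.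
under eq_bigr do rewrite !dig_lift.
rewrite -IH -[in LHS](mxtens_unindexK i) -[in LHS](mxtens_unindexK j).
case: (mxtens_unindex i) => a b; case: (mxtens_unindex j) => a' b'.
exact: tensmxE.
Qed.

Lemma sum_dig_prod (V : comPzSemiRingType) n (F : 'I_n -> 'I_d -> V) :
  \sum_(i < tdim d n) \prod_(k < n) F k (dig i k) = \prod_(k < n) \sum_a F k a.
Proof.
rewrite bigA_distr_bigA /= (reindex (@undig n)); last exact/onW_bij/undig_bij.
by apply: eq_bigr => f _; rewrite undigK.
Qed.

Lemma tpowM n (A B : 'M[C]_d) : tpow (A *m B) n = tpow A n *m tpow B n.
Proof.
apply/matrixP => i j; rewrite mxE tpowE.
under [RHS]eq_bigr do rewrite !tpowE -big_split /=.
rewrite (sum_dig_prod (fun k a => A (dig i k) a * B a (dig j k))).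
by apply: eq_bigr => k _; rewrite mxE.
Qed.

Lemma tpow_adj n (A : 'M[C]_d) : (tpow A n)^t* = tpow (A^t*) n.
Proof.
apply/matrixP => i j; rewrite !mxE !tpowE rmorph_prod.
by apply: eq_bigr => k _; rewrite !mxE.
Qed.

Definition tprod (a : 'I_d -> R) n (i : 'I_(tdim d n)) : R :=
  \prod_(k < n) a (dig i k).

Lemma tpow_rdiag n a : tpow (rdiag a : 'M[C]_d) n = rdiag (@tprod a n).
Proof.
apply/matrixP => i j; rewrite tpowE rdiagE /tprod.
have [->|ij] := eqVneq i j.
  rewrite mulr1n real_complex_prod; apply: eq_bigr => k _.
  by rewrite rdiagE eqxx mulr1n.
have [k kP] : exists k, dig i k != dig j k.
  apply/existsP; rewrite -[[exists k, _]]negbK negb_exists; apply/negP => /forallP h.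
  move/negP: ij; apply; apply/eqP; apply: (can_inj (@digK n)).
  by apply/ffunP => k; have := h k; rewrite negbK => /eqP.
by rewrite (bigD1 k) //= rdiagE (negbTE kP) mulr0n mul0r.
Qed.

Lemma tprod_gt0 a n i : (forall k, 0 < a k) -> 0 < @tprod a n i.
Proof. by move=> a0; apply: prodr_gt0 => k _. Qed.

Lemma tpow1 n : tpow (1%:M : 'M[C]_d) n = 1%:M.
Proof.
rewrite -[in LHS]rdiag1 tpow_rdiag -rdiag1; apply: rdiag_eq => i.
by rewrite /tprod big1.
Qed.

Lemma tpow_unitary n (E : 'M[C]_d) : E \is unitarymx -> tpow E n \is unitarymx.
Proof.
by move=> /unitary_adjr uE; apply/unitarymxP; rewrite tpow_adj -tpowM uE tpow1.
Qed.

Lemma tpow_sp n (E : 'M[C]_d) a : tpow (sp E a) n = sp (tpow E n) (@tprod a n).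
Proof. by rewrite !spmxE !tpowM tpow_rdiag tpow_adj. Qed.

Lemma tpow_herm n (A : 'M[C]_d) : A^t* = A -> (tpow A n)^t* = tpow A n.
Proof. by move=> hA; rewrite tpow_adj hA. Qed.

Lemma tpow_posdef n (A : 'M[C]_d) : posdef A -> posdef (tpow A n).
Proof.
move=> [E [a [uE a0 ->]]]; rewrite tpow_sp; apply: posdef_sp.
  exact: tpow_unitary.
by move=> i; apply: tprod_gt0.
Qed.

Lemma powR_prod (I : finType) (P : pred I) (F : I -> R) p :
  (forall i, 0 <= F i) -> (\prod_(i | P i) F i) `^ p = \prod_(i | P i) F i `^ p.
Proof.
move=> F0.
have [] // : (\prod_(i | P i) F i) `^ p = \prod_(i | P i) F i `^ p /\
    0 <= \prod_(i | P i) F i.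
apply: (big_rec2 (fun x y => x `^ p = y /\ 0 <= x)); first by rewrite powR1.
by move=> i y x _ [<- x0]; rewrite powRM // mulr_ge0.
Qed.

Lemma sum_tprod a n : \sum_i @tprod a n i = (\sum_i a i) ^+ n.
Proof. by rewrite (sum_dig_prod (fun _ => a)) prodr_const card_ord. Qed.

Lemma tprod_powR a p n i : (forall k, 0 < a k) ->
  @tprod a n i `^ p = @tprod (fun k => a k `^ p) n i.
Proof. by move=> a0; rewrite /tprod powR_prod // => k; apply: ltW. Qed.

Lemma tprodM a b n i : @tprod a n i * @tprod b n i = @tprod (fun k => a k * b k) n i.
Proof. by rewrite /tprod -big_split. Qed.

Lemma trp_tpow p n (A : 'M[C]_d) : posdef A -> trp p (tpow A n) = trp p A ^+ n.
Proof.
move=> [E [a [uE a0 ->]]]; rewrite tpow_sp (trp_sp _ _ (tpow_unitary n uE)).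
rewrite (trp_sp _ _ uE) -sum_tprod; apply: eq_bigr => i _.
exact: tprod_powR.
Qed.

Lemma mxpow_tpow p n (A : 'M[C]_d) : posdef A ->
  mxpowR (tpow A n) p = tpow (mxpowR A p) n.
Proof.
move=> [E [a [uE a0 ->]]]; rewrite tpow_sp (mxpow_sp _ _ (tpow_unitary n uE)).
rewrite (mxpow_sp _ _ uE) tpow_sp; apply: sp_eq => i; exact: tprod_powR.
Qed.

(** The type of a word: the multiplicity of each letter. A multiplicity never exceeds n, so [inord]
    loses nothing. *)
Definition cnt n (i : 'I_(tdim d n)) : {ffun 'I_d -> 'I_n.+1} :=
  [ffun a => inord #|[pred k | dig i k == a]|].

Lemma tprod_cnt a n i : @tprod a n i = \prod_b a b ^+ cnt i b.
Proof.
rewrite /tprod (partition_big (fun k => dig i k) predT) //=.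
apply: eq_bigr => b _; rewrite (eq_bigr (fun=> a b)); last by move=> k /eqP ->.
rewrite prodr_const ffunE inordK // ltnS.
by apply: leq_trans (max_card _) _; rewrite card_ord.
Qed.

Lemma size_labels (D : nat) (L : eqType) (T : finType) (c : 'I_D -> L)
  (t : 'I_D -> T) (g : T -> L) : (forall i, c i = g (t i)) ->
  (size (labels c) <= #|T|)%N.
Proof.
move=> h; rewrite cardT -(size_map g); apply: uniq_leq_size; first exact: undup_uniq.
move=> l; rewrite mem_undup => /mapP[i _ ->]; rewrite h.
by rewrite map_f // mem_enum.
Qed.

Lemma card_cnt n : #|{: {ffun 'I_d -> 'I_n.+1}}| = (n.+1 ^ d)%N.
Proof. by rewrite card_ffun !card_ord. Qed.

(** An eigenvalue of the n-fold power depends only on the type, so there are polynomially many of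
    them. *)
Lemma size_labels_tprod a n : (size (labels (@tprod a n)) <= n.+1 ^ d)%N.
Proof.
rewrite -card_cnt; apply: (size_labels (t := @cnt n)
  (g := fun t : {ffun 'I_d -> 'I_n.+1} => \prod_b a b ^+ t b)).
by move=> i; apply: tprod_cnt.
Qed.

Lemma size_labels_cnt n : (size (labels (@cnt n)) <= n.+1 ^ d)%N.
Proof. by rewrite -card_cnt; apply: (size_labels (t := @cnt n) (g := id)). Qed.

End TensorPowers.

(** * The functions [psi n] and their comparison with single-copy traces *)

Section Core.
Variables (R : realType) (d : nat) (s : 'I_d -> R) (rho : 'M[R[i]]_d).
Hypothesis s_gt0 : forall i, 0 < s i.
Hypothesis s_sum : \sum_i s i = 1.
Hypothesis rho_pos : posdef rho.
Hypothesis rho_tr : \tr rho = 1.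
Local Notation C := R[i].
Local Notation c n := (@tprod R d s n).

Definition pinned n : 'M[C]_(tdim d n) := pin (c n) (tpow rho n).

Definition qn n (a : R) : R :=
  complex.Re (\tr (mxpowR (pinned n) a *m mxpowR (rdiag (c n)) (1 - a))).

Definition psi n a := ln (qn n a).

(** A joint eigenbasis of the pinched state (eigenvalues [xx]) and of the power of sigma
    (eigenvalues [lab]). In it the two states are commuting probability vectors. *)
Definition eigdata n (E : 'M[C]_(tdim d n)) (xx lab : 'I_(tdim d n) -> R) :=
  [/\ E \is unitarymx, (forall x, 0 < xx x), pinned n = sp E xx, hbasis (c n) E lab &
      forall x, xx x = qf (tpow rho n) (row x E)].

Lemma eigdata_exists n : exists E xx lab, @eigdata n E xx lab.
Proof. exact/pin_basis/tpow_posdef. Qed.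

Lemma row_homog D (k : 'I_D -> R) (E : 'M[C]_D) lab (f : R -> R) x : hbasis k E lab ->
  row x E *m rdiag (fun z => f (k z)) = (f (lab x))%:C *: row x E.
Proof.
move=> hb; apply/rowP => z; rewrite mul_mx_rdiagE !mxE mulrC.
have [->|Exz] := eqVneq (E x z) 0; first by rewrite !mulr0.
by rewrite (hb _ _ Exz).
Qed.

Lemma rdiag_hbasis D (k : 'I_D -> R) (E : 'M[C]_D) lab (f : R -> R) :
  E \is unitarymx -> hbasis k E lab ->
  rdiag (fun z => f (k z)) = sp E (fun x => f (lab x)).
Proof.
move=> uE hb; rewrite spmxE.
have -> : rdiag (fun x => f (lab x)) = E *m rdiag (fun z => f (k z)) *m E^t*.
  apply/matrixP => x y.
  have -> : (E *m rdiag (fun z => f (k z)) *m E^t*) x y =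
      (row x E *m rdiag (fun z => f (k z)) *m E^t*) 0 y.
    by rewrite -!row_mul [RHS]mxE.
  rewrite (row_homog f x hb) -scalemxAl -row_mul (unitary_adjr uE) rdiagE !mxE.
  by case: eqP => _; rewrite !(mulr1n, mulr0n, mulr1, mulr0).
rewrite !mulmxA (unitary_adjl uE) mul1mx -mulmxA (unitary_adjl uE) mulmx1.
by [].
Qed.

Lemma hbasis_lab D (k : 'I_D -> R) (E : 'M[C]_D) lab (P : R -> Prop) x :
  E \is unitarymx -> hbasis k E lab -> (forall z, P (k z)) -> P (lab x).
Proof.
move=> uE hb Pk; have /existsP[z Exz] : [exists z, E x z != 0].
  rewrite -[[exists z, _]]negbK negb_exists; apply/negP => /forallP h.
  have := nv_row x uE; rewrite /nv big1 => [|z _]; first by move/eqP; rewrite eq_sym oner_eq0.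
  by have := h z; rewrite negbK mxE => /eqP ->; rewrite nsq0.
by rewrite -(hb _ _ Exz).
Qed.

Lemma tprod_s_gt0 n z : 0 < c n z.
Proof. exact: tprod_gt0. Qed.

Lemma eigdata_lab n E xx lab x : @eigdata n E xx lab -> 0 < lab x.
Proof.
move=> [uE _ _ hb _]; apply: (hbasis_lab (P := fun r => 0 < r) x uE hb) => z.
exact: tprod_s_gt0.
Qed.

Lemma qnE n E xx lab a : @eigdata n E xx lab ->
  qn n a = \sum_x xx x `^ a * lab x `^ (1 - a).
Proof.
move=> [uE xx0 eX hb _]; rewrite /qn eX (rdiag_hbasis id uE hb).
by rewrite !(mxpow_sp _ _ uE) (spM _ _ uE) (tr_sp _ uE).
Qed.

Lemma sum_lab n E xx lab : @eigdata n E xx lab -> \sum_x lab x = 1.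
Proof.
move=> [uE xx0 eX hb _]; apply: complexI.
rewrite -(tr_sp lab uE) -(rdiag_hbasis id uE hb) /mxtrace.
under eq_bigr do rewrite rdiagE eqxx mulr1n.
by rewrite -real_complex_sum sum_tprod s_sum expr1n.
Qed.

Lemma mxtrace_tpow n (A : 'M[C]_d) : \tr (tpow A n) = (\tr A) ^+ n.
Proof.
rewrite /mxtrace; under eq_bigr do rewrite tpowE.
by rewrite (sum_dig_prod (fun _ a => A a a)) prodr_const card_ord.
Qed.

Lemma sum_xx n E xx lab : @eigdata n E xx lab -> \sum_x xx x = 1.
Proof.
move=> [uE xx0 eX hb _]; apply: complexI.
rewrite -(tr_sp xx uE) -eX /mxtrace.
under eq_bigr do rewrite mxE eqxx.
by rewrite -/(mxtrace _) mxtrace_tpow rho_tr expr1n.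
Qed.

Lemma dim_gt0 n : (0 < tdim d n)%N.
Proof.
have d0 : (0 < d)%N.
  case: d s s_sum => [s' |//]; rewrite big_ord0 => /esym/eqP.
  by rewrite oner_eq0.
by elim: n => //= n IH; rewrite muln_gt0 d0.
Qed.

Lemma qn_gt0 n a : 0 < qn n a.
Proof.
have [E [xx [lab dat]]] := eigdata_exists n; rewrite (qnE a dat).
have [uE xx0 _ _ _] := dat.
rewrite (bigD1 (Ordinal (dim_gt0 n))) //= ltr_pwDl //.
  by rewrite mulr_gt0 // powR_gt0 // (eigdata_lab _ dat).
by apply: sumr_ge0 => x _; rewrite mulr_ge0 ?powR_ge0.
Qed.

Lemma psi0 n : psi n 0 = 0.
Proof.
have [E [xx [lab dat]]] := eigdata_exists n; rewrite /psi (qnE 0 dat) -[RHS]ln1.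
congr ln; rewrite -[RHS](sum_lab dat); apply: eq_bigr => x _.
by rewrite powRr0 mul1r subr0 powRr1 // ltW // (eigdata_lab _ dat).
Qed.

Lemma psi1 n : psi n 1 = 0.
Proof.
have [E [xx [lab dat]]] := eigdata_exists n; rewrite /psi (qnE 1 dat) -[RHS]ln1.
congr ln; rewrite -[RHS](sum_xx dat); apply: eq_bigr => x _.
have [_ xx0 _ _ _] := dat.
by rewrite subrr powRr0 mulr1 powRr1 // ltW.
Qed.

(** The normalised summands of [qn]: the exponential family joining [lab] (at a = 0) to [xx] (at a =
    1). *)
Definition gbs n (xx lab : 'I_(tdim d n) -> R) a x :=
  xx x `^ a * lab x `^ (1 - a) / qn n a.

Lemma gbs_gt0 n E xx lab a x : @eigdata n E xx lab -> 0 < gbs xx lab a x.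
Proof.
move=> dat; have [_ xx0 _ _ _] := dat.
by rewrite !mulr_gt0 ?invr_gt0 ?qn_gt0 ?powR_gt0 ?(eigdata_lab x dat).
Qed.

Lemma gbs_sum n E xx lab a : @eigdata n E xx lab -> \sum_x gbs xx lab a x = 1.
Proof.
by move=> dat; rewrite -mulr_suml -(qnE a dat) divff // gt_eqF // qn_gt0.
Qed.

Lemma gbs_expE n E xx lab a x : @eigdata n E xx lab ->
  xx x `^ a * lab x `^ (1 - a) = expR (a * ln (xx x) + (1 - a) * ln (lab x)).
Proof.
move=> dat; have [_ xx0 _ _ _] := dat.
by rewrite !powRexp ?(eigdata_lab x dat) // expRD.
Qed.

(* The mean of the log-likelihood ratio under the Gibbs weights is the slope of a
   supporting line, which is how convexity of [psi n] enters. *)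
Definition slope n (xx lab : 'I_(tdim d n) -> R) a :=
  \sum_x gbs xx lab a x * (ln (xx x) - ln (lab x)).

(** The ratio qn(b)/qn(a) is the Gibbs mean of exp((b - a) (ln xx - ln lab)); Jensen for exp gives
    the supporting line. *)
Lemma psi_support n E xx lab a b : @eigdata n E xx lab ->
  psi n a + (b - a) * slope xx lab a <= psi n b.
Proof.
move=> dat; rewrite -lerBrDl /psi -ln_div ?posrE ?qn_gt0 // /slope mulr_sumr.
have := jensen_exp (fun x => (b - a) * (ln (xx x) - ln (lab x)))
  (fun x => ltW (gbs_gt0 a x dat)) (gbs_sum a dat).
move=> h; apply: le_trans (_ : \sum_x gbs xx lab a x *
    ((b - a) * (ln (xx x) - ln (lab x))) <= _).
  by apply: ler_sum => x _; rewrite mulrCA.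
apply: le_trans h _; rewrite le_eqVlt; apply/orP; left; apply/eqP; congr ln.
rewrite (qnE b dat) mulr_suml; apply: eq_bigr => x _.
rewrite /gbs !(gbs_expE _ x dat) mulrAC -expRD; congr (expR _ / _); ring.
Qed.

(** Equality case of [gibbs]: the Gibbs weights attain the variational formula for [psi n a]. *)
Lemma gibbs_eq n E xx lab a : @eigdata n E xx lab ->
  psi n a = \sum_x gbs xx lab a x *
    (a * ln (xx x) + (1 - a) * ln (lab x) - ln (gbs xx lab a x)).
Proof.
move=> dat; have [_ xx0 _ _ _] := dat.
rewrite -[LHS]mul1r -[X in X * _](gbs_sum a dat) mulr_suml; apply: eq_bigr => x _.
congr (_ * _); rewrite /gbs (gbs_expE _ x dat) ln_div ?posrE ?expR_gt0 ?qn_gt0 //.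
by rewrite expRK /psi; ring.
Qed.

(** The sandwiched operator whose a-th power trace defines the minimal divergence for orders at
    least 1/2, with rho in the middle (see [high_link]). *)
Definition Ya (a : R) : 'M[C]_d :=
  rdiag (fun i => s i `^ ((1 - a) / (2 * a))) *m rho *m
  rdiag (fun i => s i `^ ((1 - a) / (2 * a))).

Lemma rdiag_unit D (k : 'I_D -> R) : (forall i, 0 < k i) -> rdiag k \in (unitmx : {pred 'M[C]_D}).
Proof.
move=> k0; have : rdiag k *m rdiag (fun i => (k i)^-1) = 1%:M :> 'M[C]_D.
  by rewrite rdiagM -rdiag1; apply: rdiag_eq => i; rewrite divff // gt_eqF.
by case/mulmx1_unit.
Qed.

Lemma posdef_rdiag_conj D (k : 'I_D -> R) (A : 'M[C]_D) : (forall i, 0 < k i) ->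
  posdef A -> posdef (rdiag k *m A *m rdiag k).
Proof.
by move=> k0 pA; rewrite -[X in _ *m X]rdiag_adj; apply: posdef_conj => //; apply: rdiag_unit.
Qed.

Lemma Ya_posdef a : posdef (Ya a).
Proof. by apply: posdef_rdiag_conj => // i; rewrite powR_gt0. Qed.

Lemma pin_rdiag_conj D (L : eqType) (k : 'I_D -> L) (A : 'M[C]_D) g :
  pin k (rdiag g *m A *m rdiag g) = rdiag g *m pin k A *m rdiag g.
Proof.
apply/matrixP => i j; rewrite mxE !mul_mx_rdiagE !mul_rdiagE mxE.
by case: eqP => _ //; rewrite mulr0 mul0r.
Qed.

Lemma pin_Ya n a E xx lab : @eigdata n E xx lab -> a != 0 ->
  pin (c n) (tpow (Ya a) n) = sp E (fun x => xx x * lab x `^ ((1 - a) / a)).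
Proof.
move=> dat a0; have [uE xx0 eX hb _] := dat; rewrite /Ya !tpowM !tpow_rdiag.
rewrite pin_rdiag_conj -/(pinned n) eX.
rewrite (rdiag_eq (b := fun z => c n z `^ ((1 - a) / (2 * a)))); last first.
  by move=> z; rewrite tprod_powR.
rewrite (rdiag_hbasis (fun r => r `^ ((1 - a) / (2 * a))) uE hb) !(spM _ _ uE).
apply: sp_eq => x; rewrite mulrAC mulrC; congr (_ * _).
rewrite -powRD; last by rewrite (gt_eqF (eigdata_lab x dat)) implybT.
by congr (_ `^ _); field.
Qed.

(** Pinching commutes with multiplication on both sides by powers of the commuting diagonal, so
    these powers can be absorbed under the pinching. *)
Lemma qn_trp n a : a != 0 -> qn n a = trp a (pin (c n) (tpow (Ya a) n)).
Proof.
move=> a0; have [E [xx [lab dat]]] := eigdata_exists n.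
have [uE xx0 eX hb _] := dat.
rewrite (pin_Ya dat a0) (trp_sp _ _ uE) (qnE a dat); apply: eq_bigr => x _.
rewrite powRM ?powR_ge0 ?(ltW (xx0 x)) // -powRrM; congr (_ * _ `^ _).
by field.
Qed.

Lemma trp_gt0 D p (A : 'M[C]_D) : (0 < D)%N -> posdef A -> 0 < trp p A.
Proof.
move=> D0 [E [a [uE a0 ->]]]; rewrite (trp_sp _ _ uE).
rewrite (bigD1 (Ordinal D0)) //= ltr_pwDl ?powR_gt0 //.
by apply: sumr_ge0 => i _; rewrite powR_ge0.
Qed.

Lemma labels_gt0 n : (0 < size (labels (c n)))%N.
Proof.
have := mem_labels (c n) (Ordinal (dim_gt0 n)).
by case: (labels _).
Qed.

Lemma qn_le_ge1 n a : 1 <= a -> qn n a <= trp a (Ya a) ^+ n.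
Proof.
move=> a1; have a0 : a != 0 by rewrite gt_eqF // (lt_le_trans ltr01).
rewrite (qn_trp n a0) -(trp_tpow _ _ (Ya_posdef a)).
by apply: trp_pin_le; [exact/tpow_posdef/Ya_posdef|left].
Qed.

Lemma qn_ge_le1 n a : 0 < a <= 1 -> trp a (Ya a) ^+ n <= qn n a.
Proof.
move=> /andP[a0 a1]; rewrite (qn_trp n (lt0r_neq0 a0)) -(trp_tpow _ _ (Ya_posdef a)).
by apply: trp_pin_ge; [exact/tpow_posdef/Ya_posdef|rewrite ltW].
Qed.

(** Together with [qn_card_ge] this determines the exponential rate of [qn] for a > 0: pinching
    costs only the polynomial number of labels. *)
Lemma qn_le_card n a : 0 < a -> qn n a <= (n.+1 ^ d)%:R * trp a (Ya a) ^+ n.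
Proof.
move=> a0; rewrite (qn_trp n (lt0r_neq0 a0)) -(trp_tpow _ _ (Ya_posdef a)).
apply: le_trans (trp_pin_le_card _ (tpow_posdef n (Ya_posdef a)) (ltW a0)) _.
apply: ler_wpM2r; first exact/trp_ge0/tpow_posdef/Ya_posdef.
by rewrite ler_nat size_labels_tprod.
Qed.

Lemma qn_card_ge n a : 0 < a -> trp a (Ya a) ^+ n <= (n.+1 ^ d)%:R `^ a * qn n a.
Proof.
move=> a0; rewrite (qn_trp n (lt0r_neq0 a0)) -(trp_tpow _ _ (Ya_posdef a)).
have pY := tpow_posdef n (Ya_posdef a).
apply: le_trans (trp_le_pin pY (ltW a0) (labels_gt0 n)) _.
apply: ler_wpM2r; first exact/trp_ge0/pin_posdef.
by apply: ge0_ler_powR; rewrite ?nnegrE ?ler0n ?(ltW a0) // ler_nat size_labels_tprod.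
Qed.

(* [Qlow] is the trace in the definition of the minimal divergence for [a < 1/2]. *)
Definition Wlow (a : R) : 'M[C]_d :=
  rdiag (fun i => s i `^ 2^-1) *m mxpowR rho (a / (1 - a)) *m rdiag (fun i => s i `^ 2^-1).

Lemma Wlow_posdef a : posdef (Wlow a).
Proof.
by apply: posdef_rdiag_conj => [i|]; [rewrite powR_gt0|exact: posdef_mxpow].
Qed.

Lemma qf_Wlow n a E xx lab x : @eigdata n E xx lab ->
  qf (tpow (Wlow a) n) (row x E) =
  lab x * qf (mxpowR (tpow rho n) (a / (1 - a))) (row x E).
Proof.
move=> dat; have [uE xx0 eX hb _] := dat.
rewrite /Wlow 2!tpowM !tpow_rdiag -[X in _ *m X]rdiag_adj qf_conj.
rewrite (rdiag_eq (b := fun z => c n z `^ 2^-1)); last by move=> z; rewrite tprod_powR.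
rewrite (row_homog (fun r => r `^ 2^-1) x hb) qfZv (mxpow_tpow _ _ rho_pos).
have l0 := eigdata_lab x dat.
have e : (lab x `^ 2^-1) ^+ 2 = lab x; last by rewrite e.
by rewrite -powR_mulrn ?powR_ge0 // -powRrM mulVf // powRr1 // ltW.
Qed.

(** Two concave Jensen inequalities, for x^(1-a) in the basis [E] and for x^(a/(1-a)) in an
    eigenbasis of the power of rho; both exponents lie in [0, 1] on this range. For a <= 0 both
    powers are convex and the inequality reverses ([qn_le_Wlow]). *)
Lemma qn_ge_Wlow n a : 0 <= a <= 2^-1 -> trp (1 - a) (Wlow a) ^+ n <= qn n a.
Proof.
move=> /andP[a0 a2]; have [E [xx [lab dat]]] := eigdata_exists n.
have [uE xx0 eX hb exx] := dat.
have l0 x := eigdata_lab x dat.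
have q1 : 0 < 1 - a by lra.
have [F [f [uF f0 eF]]] := tpow_posdef n (Wlow_posdef a).
have [G [g [uG g0 eG]]] := tpow_posdef n rho_pos.
rewrite -(trp_tpow _ _ (Wlow_posdef a)) eF (trp_sp _ _ uF) (qnE a dat).
have hq : 0 <= 1 - a <= 1 by apply/andP; split; lra.
apply: le_trans (peierlsN (tangent_powRN hq) uF uE f0) _.
apply: ler_sum => x _; rewrite -eF (qf_Wlow a x dat).
have hg : 0 <= a / (1 - a) <= 1.
  by rewrite divr_ge0 ?(ltW q1) //= ler_pdivrMr // mul1r; lra.
have := qf_jensen (tangent_powRN hg) uG g0 (nv_row x uE).
rewrite -eG -exx => h.
have h2 : qf (mxpowR (tpow rho n) (a / (1 - a))) (row x E) <= xx x `^ (a / (1 - a)).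
  rewrite eG (mxpow_sp _ _ uG); move: h; rewrite !qf_sp.
  by under [leRHS]eq_bigr do rewrite /= mulNr; rewrite sumrN lerN2.
have W0 : 0 <= qf (mxpowR (tpow rho n) (a / (1 - a))) (row x E).
  exact/posdef_qf_ge0/posdef_mxpow/tpow_posdef.
rewrite powRM ?(ltW (l0 x)) // mulrC ler_pM2r ?powR_gt0 //.
rewrite [leRHS](_ : _ = (xx x `^ (a / (1 - a))) `^ (1 - a)); last first.
  by rewrite -powRrM divfK // gt_eqF.
by apply: ge0_ler_powR; rewrite ?nnegrE ?powR_ge0 // ltW.
Qed.

Lemma qn_le_Wlow n a : a <= 0 -> qn n a <= trp (1 - a) (Wlow a) ^+ n.
Proof.
move=> a0; have [E [xx [lab dat]]] := eigdata_exists n.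
have [uE xx0 eX hb exx] := dat.
have l0 x := eigdata_lab x dat.
have q1 : 0 < 1 - a by lra.
have [F [f [uF f0 eF]]] := tpow_posdef n (Wlow_posdef a).
have [G [g [uG g0 eG]]] := tpow_posdef n rho_pos.
rewrite -(trp_tpow _ _ (Wlow_posdef a)) eF (trp_sp _ _ uF) (qnE a dat).
have hq : 1 <= 1 - a \/ 1 - a <= 0 by left; lra.
apply: le_trans (peierls (tangent_powR hq) uF uE f0).
apply: ler_sum => x _; rewrite -eF (qf_Wlow a x dat).
have hg : 1 <= a / (1 - a) \/ a / (1 - a) <= 0.
  by right; rewrite mulr_le0_ge0 // invr_ge0 ltW.
have := qf_jensen (tangent_powR hg) uG g0 (nv_row x uE).
rewrite -eG -exx => h.
have h2 : xx x `^ (a / (1 - a)) <= qf (mxpowR (tpow rho n) (a / (1 - a))) (row x E).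
  by rewrite eG (mxpow_sp _ _ uG).
have W0 : 0 <= qf (mxpowR (tpow rho n) (a / (1 - a))) (row x E).
  exact/posdef_qf_ge0/posdef_mxpow/tpow_posdef.
rewrite powRM ?(ltW (l0 x)) // mulrC ler_pM2l ?powR_gt0 //.
rewrite [leLHS](_ : _ = (xx x `^ (a / (1 - a))) `^ (1 - a)); last first.
  by rewrite -powRrM divfK // gt_eqF.
by apply: ge0_ler_powR; rewrite ?nnegrE ?powR_ge0 // ltW.
Qed.

End Core.

(** * Tensor products of different factors, local operators and partial traces *)

Section MultiIndex.
Variables (R : realType) (D e n : nat) (k : 'I_D -> {ffun 'I_n -> 'I_e}).
Hypothesis k_bij : bijective k.
Local Notation C := R[i].

(** The indexing bijection [k] is a parameter so that the same algebra serves single letters ([dig])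
    and both ways of cutting a grid ([gcol], [grow]). *)
Definition ktens (F : 'I_n -> 'M[C]_e) : 'M[C]_D :=
  \matrix_(z, w) \prod_j F j (k z j) (k w j).

Lemma eq_ktens F G : (forall j, F j = G j) -> ktens F = ktens G.
Proof.
by move=> FG; apply/matrixP => z w; rewrite !mxE; apply: eq_bigr => j _; rewrite FG.
Qed.

Lemma sum_kprod (V : comPzSemiRingType) (F : 'I_n -> 'I_e -> V) :
  \sum_z \prod_j F j (k z j) = \prod_j \sum_a F j a.
Proof.
have [g kg gk] := k_bij.
rewrite bigA_distr_bigA /= (reindex g); last by exists k => ? _.
by apply: eq_bigr => f _; rewrite gk.
Qed.

Lemma ktensM F G : ktens (fun j => F j *m G j) = ktens F *m ktens G.
Proof.
apply/matrixP => z w; rewrite !mxE.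
under [RHS]eq_bigr do rewrite !mxE -big_split /=.
rewrite (sum_kprod (fun j a => F j (k z j) a * G j a (k w j))).
by apply: eq_bigr => j _; rewrite mxE.
Qed.

Lemma ktens_adj F : (ktens F)^t* = ktens (fun j => (F j)^t*).
Proof.
apply/matrixP => z w; rewrite !mxE rmorph_prod.
by apply: eq_bigr => j _; rewrite !mxE.
Qed.

Lemma ktens_rdiag (a : 'I_n -> 'I_e -> R) :
  ktens (fun j => rdiag (a j)) = rdiag (fun z => \prod_j a j (k z j)).
Proof.
apply/matrixP => z w; rewrite mxE rdiagE.
have [->|zw] := eqVneq z w.
  rewrite mulr1n real_complex_prod; apply: eq_bigr => j _.
  by rewrite rdiagE eqxx mulr1n.
have [j jP] : exists j, k z j != k w j.
  apply/existsP; rewrite -[[exists j, _]]negbK negb_exists; apply/negP => /forallP h.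
  move/negP: zw; apply; apply/eqP; apply: (bij_inj k_bij).
  by apply/ffunP => j; have := h j; rewrite negbK => /eqP.
by rewrite (bigD1 j) //= rdiagE (negbTE jP) mulr0n mul0r.
Qed.

Lemma ktens1 : ktens (fun=> 1%:M) = 1%:M.
Proof.
rewrite (eq_ktens (G := fun=> rdiag (fun=> 1))); last by move=> j; rewrite rdiag1.
by rewrite ktens_rdiag -rdiag1; apply: rdiag_eq => z; rewrite big1.
Qed.

Lemma ktens_unitary F : (forall j, F j \is unitarymx) -> ktens F \is unitarymx.
Proof.
move=> uF; apply/unitarymxP; rewrite ktens_adj -ktensM -ktens1.
by apply: eq_ktens => j; rewrite unitary_adjr.
Qed.

Lemma ktens_sp F (a : 'I_n -> 'I_e -> R) :
  ktens (fun j => sp (F j) (a j)) = sp (ktens F) (fun z => \prod_j a j (k z j)).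
Proof.
rewrite spmxE ktens_adj -ktens_rdiag -!ktensM.
by apply: eq_ktens => j; rewrite spmxE.
Qed.

Definition embed j (A : 'M[C]_e) : 'M[C]_D :=
  ktens (fun i => if i == j then A else 1%:M).

Lemma embed_sp F j (g : 'I_e -> R) : (forall i, F i \is unitarymx) ->
  embed j (sp (F j) g) = sp (ktens F) (fun z => g (k z j)).
Proof.
move=> uF; rewrite /embed.
rewrite (eq_ktens (G := fun i => sp (F i) (if i == j then g else (fun=> 1)))).
  rewrite ktens_sp; apply: sp_eq => z.
  rewrite (bigD1 j) //= eqxx big1 ?mulr1 // => i /negbTE ij.
  by rewrite ij.
by move=> i; case: eqP => [->|_] //; rewrite sp1.
Qed.

Lemma embed1 j : embed j 1%:M = 1%:M.
Proof. by rewrite /embed -[RHS]ktens1; apply: eq_ktens => i; case: eqP. Qed.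

Definition off j z w : C := \prod_(i | i != j) (k z i == k w i)%:R.

Lemma offC j z w : off j z w = off j w z.
Proof. by apply: eq_bigr => i _; rewrite eq_sym. Qed.

Lemma conj_off j z w : (off j z w)^*%R = off j z w.
Proof. by rewrite rmorph_prod; apply: eq_bigr => i _; exact: conjC_nat. Qed.

Lemma embedE j A z w : embed j A z w = A (k z j) (k w j) * off j z w.
Proof.
rewrite mxE (bigD1 j) //= eqxx; congr (_ * _).
by apply: eq_bigr => i /negbTE ->; rewrite mxE.
Qed.

(** Partial trace onto factor [j], the adjoint of [embed j] for the trace pairing ([tr_embed]). *)
Definition ptr j (M : 'M[C]_D) : 'M[C]_e := \matrix_(a, b)
  \sum_z \sum_w (k z j == a)%:R * (k w j == b)%:R * off j z w * M z w.

Lemma sum_pick2 (V : comPzSemiRingType) (I : finType) (x y : I) (F : I -> I -> V) :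
  \sum_a \sum_b (x == a)%:R * (y == b)%:R * F a b = F x y.
Proof.
rewrite (bigD1 x) //= [X in _ + X]big1 ?addr0 => [|a]; last first.
  rewrite eq_sym => /negbTE ax; rewrite big1 // => b _.
  by rewrite ax !mul0r.
rewrite (bigD1 y) //= [X in _ + X]big1 ?addr0 => [|b]; last first.
  by rewrite eq_sym => /negbTE by_; rewrite by_ mulr0 mul0r.
by rewrite !eqxx !mul1r.
Qed.

Lemma exchange_big4 (V : nmodType) (I J : finType) (F : I -> I -> J -> J -> V) :
  \sum_a \sum_b \sum_z \sum_w F a b z w = \sum_z \sum_w \sum_a \sum_b F a b z w.
Proof.
transitivity (\sum_a \sum_z \sum_w \sum_b F a b z w).
  apply: eq_bigr => a _; rewrite exchange_big /=; apply: eq_bigr => z _.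
  by rewrite exchange_big.
by rewrite exchange_big /=; apply: eq_bigr => z _; rewrite exchange_big.
Qed.

Lemma tr_embed j A M : \tr (embed j A *m M) = \tr (A *m ptr j M).
Proof.
transitivity (\sum_w \sum_z A (k z j) (k w j) * off j w z * M w z).
  rewrite exchange_big /mxtrace; apply: eq_bigr => z _; rewrite mxE.
  by apply: eq_bigr => w _; rewrite embedE offC.
transitivity (\sum_b \sum_a \sum_w \sum_z
    A a b * ((k w j == b)%:R * (k z j == a)%:R * off j w z * M w z)).
  rewrite exchange_big4; apply: eq_bigr => w _; apply: eq_bigr => z _.
  rewrite -(sum_pick2 (k w j) (k z j) (fun b a => A a b * off j w z * M w z)).
  by apply: eq_bigr => b _; apply: eq_bigr => a _; ring.
rewrite exchange_big /mxtrace; apply: eq_bigr => a _; rewrite mxE.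
apply: eq_bigr => b _; rewrite mxE mulr_sumr; apply: eq_bigr => w _.
by rewrite mulr_sumr.
Qed.

Lemma retr_embed j A M : retr (embed j A) M = retr A (ptr j M).
Proof. by rewrite /retr tr_embed. Qed.

Lemma ptr_adj j M : (ptr j M)^t* = ptr j (M^t*).
Proof.
apply/matrixP => a b; rewrite !mxE exchange_big raddf_sum /=; apply: eq_bigr => z _.
rewrite raddf_sum /=; apply: eq_bigr => w _; rewrite !rmorphM /=.
congr (_ * _ * _); last by rewrite !mxE.
  rewrite mulrC; congr (_ * _); exact: conjC_nat.
by rewrite offC conj_off.
Qed.

Lemma ptrD j M N : ptr j (M + N) = ptr j M + ptr j N.
Proof.
apply/matrixP => a b; rewrite !mxE -big_split /=; apply: eq_bigr => z _.
rewrite -big_split /=; apply: eq_bigr => w _; rewrite mxE; ring.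
Qed.

Lemma ptrZ j (x : C) M : ptr j (x *: M) = x *: ptr j M.
Proof.
apply/matrixP => a b; rewrite !mxE mulr_sumr; apply: eq_bigr => z _.
rewrite mulr_sumr; apply: eq_bigr => w _; rewrite mxE; ring.
Qed.

Lemma ptr_tr j M : \tr (ptr j M) = \tr M.
Proof. by rewrite -[ptr j M]mul1mx -tr_embed embed1 mul1mx. Qed.

Lemma qf_retr m (M F : 'M[C]_m) b : F \is unitarymx ->
  qf M (row b F) = retr (sp F (fun a => (a == b)%:R)) M.
Proof.
move=> uF; rewrite retr_spl // (bigD1 b) //= eqxx mul1r big1 ?addr0 // => a /negbTE ->.
by rewrite mul0r.
Qed.

Lemma qf_ptr j M (F : 'M[C]_e) a : F \is unitarymx ->
  qf (ptr j M) (row a F) = \sum_(y | k y j == a) qf M (row y (ktens (fun=> F))).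
Proof.
move=> uF; rewrite qf_retr // -retr_embed (embed_sp (F := fun=> F)) //.
rewrite retr_spl; last exact: ktens_unitary.
rewrite [RHS]big_mkcond /=; apply: eq_bigr => y _.
by case: eqP => _; rewrite ?mul1r ?mul0r.
Qed.

(** Eigenvalues of the marginal are sums of expectations of [M] over a product basis. *)
Lemma ptr_posdef j M : posdef M -> posdef (ptr j M).
Proof.
move=> pM; have hM : (ptr j M)^t* = ptr j M by rewrite ptr_adj (posdef_herm pM).
have [F [f [uF ef]]] := spectral_sp hM.
rewrite ef; apply: posdef_sp => // a.
rewrite -(qf_row_sp f a uF) -ef qf_ptr //.
have [g kg gk] := k_bij.
rewrite (bigD1 (g [ffun=> a])) /=; last by rewrite gk ffunE.
rewrite ltr_pwDl //.
  apply: posdef_qf => //; rewrite -nv_eq0 nv_row ?oner_eq0 //.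
  exact: ktens_unitary.
by apply: sumr_ge0 => y _; apply: posdef_qf_ge0.
Qed.

End MultiIndex.

(** * The n by m grid of copies *)

Section Grid.
Variables (R : realType) (d n m : nat).
Local Notation C := R[i].
Local Notation N := (tdim d (n * m)).

(** Positions are pairs (j, h). [gcol z j] collects the m letters with first coordinate j, and
    [grow z h] the n letters with second coordinate h. *)
Definition gcol (z : 'I_N) : {ffun 'I_n -> 'I_(tdim d m)} :=
  [ffun j => undig [ffun h => dig z (mxtens_index (j, h))]].

Definition grow (z : 'I_N) : {ffun 'I_m -> 'I_(tdim d n)} :=
  [ffun h => undig [ffun j => dig z (mxtens_index (j, h))]].

Lemma dig_gcol z j h : dig (gcol z j) h = dig z (mxtens_index (j, h)).
Proof. by rewrite ffunE undigK ffunE. Qed.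

Lemma dig_grow z j h : dig (grow z h) j = dig z (mxtens_index (j, h)).
Proof. by rewrite ffunE undigK ffunE. Qed.

Lemma gcol_bij : bijective gcol.
Proof.
exists (fun f : {ffun 'I_n -> 'I_(tdim d m)} =>
  undig [ffun p => dig (f (mxtens_unindex p).1) (mxtens_unindex p).2]).
  move=> z; apply: (can_inj (@digK d _)); apply/ffunP => p.
  by rewrite undigK ffunE dig_gcol -surjective_pairing mxtens_unindexK.
move=> f; apply/ffunP => j; apply: (can_inj (@digK d _)); apply/ffunP => h.
by rewrite dig_gcol undigK ffunE mxtens_indexK.
Qed.

Lemma grow_bij : bijective grow.
Proof.
exists (fun f : {ffun 'I_m -> 'I_(tdim d n)} =>
  undig [ffun p => dig (f (mxtens_unindex p).2) (mxtens_unindex p).1]).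
  move=> z; apply: (can_inj (@digK d _)); apply/ffunP => p.
  by rewrite undigK ffunE dig_grow -surjective_pairing mxtens_unindexK.
move=> f; apply/ffunP => j; apply: (can_inj (@digK d _)); apply/ffunP => h.
by rewrite dig_grow undigK ffunE mxtens_indexK.
Qed.

Lemma dig_bij l : bijective (@dig d l).
Proof. by exists (@undig d l); [exact: digK|exact: undigK]. Qed.

Lemma prod_grid (V : comPzSemiRingType) (F : 'I_(n * m) -> V) :
  \prod_p F p = \prod_h \prod_j F (mxtens_index (j, h)).
Proof.
rewrite (reindex (@mxtens_index n m)) /=; last first.
  by exists (@mxtens_unindex n m) => ? _; [exact: mxtens_indexK|exact: mxtens_unindexK].
by rewrite exchange_big pair_big /=; apply: eq_bigr => -[].
Qed.

Lemma tpow_grow (A : 'M[C]_d) : tpow A (n * m) = ktens grow (fun=> tpow A n).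
Proof.
apply/matrixP => z w; rewrite mxE tpowE prod_grid; apply: eq_bigr => h _.
by rewrite tpowE; apply: eq_bigr => j _; rewrite !dig_grow.
Qed.

Lemma tprod_grow (a : 'I_d -> R) z :
  tprod a (n := n * m) z = \prod_h tprod a (n := n) (grow z h).
Proof.
by rewrite /tprod prod_grid; apply: eq_bigr => h _; apply: eq_bigr => j _; rewrite dig_grow.
Qed.

Lemma eq_ffun_prod (p q : nat) (x y : {ffun 'I_p -> 'I_q}) :
  (x == y)%:R = \prod_i (x i == y i)%:R :> C.
Proof.
have [->|xy] := eqVneq x y; first by rewrite big1 // => i _; rewrite eqxx.
have [i iP] : exists i, x i != y i.
  apply/existsP; rewrite -[[exists i, _]]negbK negb_exists; apply/negP => /forallP h.
  by move/negP: xy; apply; apply/eqP/ffunP => i; have := h i; rewrite negbK => /eqP.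
by rewrite (bigD1 i) //= (negbTE iP) mul0r.
Qed.

(** For m independent copies of an n-partite matrix, the m parties with the same j carry m
    independent copies of the j-th marginal. *)
Lemma ptr_grow j (M : 'M[C]_(tdim d n)) :
  ptr gcol j (ktens grow (fun=> M)) = tpow (ptr (@dig d n) j M) m.
Proof.
apply/matrixP => a b; rewrite tpowE.
under [RHS]eq_bigr do rewrite mxE.
rewrite -(sum_kprod grow_bij (fun h x => \sum_w (dig x j == dig a h)%:R *
  (dig w j == dig b h)%:R * off R (@dig d n) j x w * M x w)) mxE.
apply: eq_bigr => z _.
rewrite -(sum_kprod grow_bij (fun h w => (dig (grow z h) j == dig a h)%:R *
  (dig w j == dig b h)%:R * off R (@dig d n) j (grow z h) w * M (grow z h) w)).
apply: eq_bigr => w _; rewrite mxE !big_split /=.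
have dE (x y : 'I_(tdim d m)) : (x == y)%:R = \prod_h (dig x h == dig y h)%:R :> C.
  by rewrite -eq_ffun_prod (inj_eq (can_inj (@digK d m))).
congr (_ * _ * _ * _).
- by rewrite dE; apply: eq_bigr => h _; rewrite dig_gcol dig_grow.
- by rewrite dE; apply: eq_bigr => h _; rewrite dig_gcol dig_grow.
rewrite /off exchange_big /=; apply: eq_bigr => i _; rewrite dE.
by apply: eq_bigr => h _; rewrite !dig_gcol !dig_grow.
Qed.

End Grid.

(** * A universal bound for permutation-invariant operators *)

Section Universal.
Variable R : realType.
Local Notation C := R[i].

Lemma nsq_cauchy_schwarz (I : finType) (x y : I -> C) :
  nsq (\sum_t x t * y t) <= (\sum_t nsq (x t)) * \sum_t nsq (y t).
Proof.
set z := \sum_t _; set S := \sum_t nsq (y t).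
have S0 : 0 <= S by apply: sumr_ge0 => t _; apply: nsq_ge0.
have [Sz|Sz] := eqVneq S 0.
  have y0 t : y t = 0.
    apply/eqP; rewrite -nsq_eq0; apply/eqP.
    by move/psumr_eq0P: Sz => ->// i _; apply: nsq_ge0.
  by rewrite /z big1 ?nsq0 ?Sz ?mulr0 // => t _; rewrite y0 mulr0.
have Sp : 0 < S by rewrite lt_def Sz.
pose l : C := (S^-1)%:C * z.
have expand (a b : C) : nsq (a - l * b^*%R) =
    nsq a - 2 * complex.Re (l^*%R * (a * b)) + nsq l * nsq b.
  by move: l => l; case: a b l => a1 a2 [b1 b2] [l1 l2]; rewrite /nsq /=; ring.
have : 0 <= \sum_t nsq (x t - l * (y t)^*%R).
  by apply: sumr_ge0 => t _; apply: nsq_ge0.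
under eq_bigr do rewrite expand.
rewrite big_split sumrB /= -mulr_sumr -Re_sum -!mulr_sumr -/z -/S.
have -> : complex.Re (l^*%R * z) = S^-1 * nsq z.
  have e (r : R) (u : C) : complex.Re ((r%:C * u)^*%R * u) = r * nsq u.
    by case: u => u1 u2; rewrite /nsq /=; ring.
  exact: e.
have -> : nsq l = S^-1 ^+ 2 * nsq z by rewrite /l nsqZ.
have -> : S^-1 ^+ 2 * nsq z * S = S^-1 * nsq z by field.
rewrite -(ler_pM2r Sp) => h; rewrite -subr_ge0.
have -> : (\sum_t nsq (x t)) * S - nsq z =
  (\sum_t nsq (x t) - 2 * (S^-1 * nsq z) + S^-1 * nsq z) * S by field.
by rewrite mul0r in h.
Qed.

Variables (d n m : nat).
Local Notation N := (tdim d (n * m)).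

(** Joint types of two words of length m: they index the orbits of the symmetric group on matrix
    positions. *)
Definition ptype := {ffun ('I_d * 'I_d) -> 'I_m.+1}.

Definition pt (x y : 'I_(tdim d m)) : ptype :=
  [ffun ab => inord #|[pred h | (dig x h, dig y h) == ab]|].

Definition npt (t : ptype) : R := \sum_x \sum_y (pt x y == t)%:R.

Definition kap (t : ptype) : R := (Num.sqrt (npt t))^-1.

(** Normalised indicators of the orbits; those of the nonempty orbits form a Hilbert-Schmidt
    orthonormal basis of the permutation-invariant matrices. *)
Definition bt (t : ptype) : 'M[C]_(tdim d m) :=
  \matrix_(x, y) ((pt x y == t)%:R * kap t)%:C.

(* Every positive [Y] in the span of the [bt t] satisfies [Y <= tr Y * um]. *)
Definition um : 'M[C]_(tdim d m) := \sum_t bt t *m (bt t)^t*.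

Lemma npt_ge0 t : 0 <= npt t.
Proof. by apply: sumr_ge0 => x _; apply: sumr_ge0 => y _; rewrite ler0n. Qed.

Lemma npt_gt0 x y : 0 < npt (pt x y).
Proof.
rewrite /npt (bigD1 x) //= (bigD1 y) //= eqxx -addrA ltr_pwDl // addr_ge0 //.
  by apply: sumr_ge0 => ? _; rewrite ler0n.
by apply: sumr_ge0 => ? _; apply: sumr_ge0 => ? _; rewrite ler0n.
Qed.

Lemma kap_sqr t : 0 < npt t -> kap t ^+ 2 * npt t = 1.
Proof.
by move=> t0; rewrite exprVn sqr_sqrtr ?(ltW t0) // mulVf // gt_eqF.
Qed.

Lemma kap_gt0 t : 0 < npt t -> 0 < kap t.
Proof. by move=> t0; rewrite invr_gt0 sqrtr_gt0. Qed.

Lemma hsn_bt t : hsn (bt t) <= 1.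
Proof.
have -> : hsn (bt t) = kap t ^+ 2 * npt t.
  rewrite mulr_sumr; apply: eq_bigr => x _; rewrite mulr_sumr.
  apply: eq_bigr => y _; rewrite mxE /nsq /=.
  by case: eqP => _ /=; rewrite ?mul1r ?mul0r; ring.
have := npt_ge0 t; rewrite le_eqVlt => /predU1P[<-|t0]; first by rewrite mulr0 ler01.
by rewrite kap_sqr.
Qed.

(** Each orbit contributes at most 1, and there are polynomially many joint types. *)
Lemma tr_um : complex.Re (\tr um) <= (m.+1 ^ (d * d))%:R.
Proof.
have -> : \tr um = \sum_t \tr (bt t *m (bt t)^t*) by rewrite /um raddf_sum.
rewrite Re_sum.
apply: (@le_trans _ _ (\sum_(t : ptype) 1)).
  by apply: ler_sum => t _; rewrite -hsnE hsn_bt.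
by rewrite sumr_const card_ffun card_prod !card_ord.
Qed.

Lemma um_herm : um^t* = um.
Proof.
apply/matrixP => x y; rewrite !mxE /um !summxE rmorph_sum.
apply: eq_bigr => t _; have /matrixP/(_ x y) : (bt t *m (bt t)^t*)^t* = bt t *m (bt t)^t*.
  by rewrite adjM adjK.
by move=> <-; rewrite [RHS]mxE [in RHS]mxE.
Qed.

Lemma qf_sum D (I : Type) (r : seq I) (P : pred I) (A : I -> 'M[C]_D) v :
  qf (\sum_(t <- r | P t) A t) v = \sum_(t <- r | P t) qf (A t) v.
Proof.
under [RHS]eq_bigr do rewrite qfmxE.
by rewrite qfmxE mulmx_sumr mulmx_suml summxE Re_sum.
Qed.

Lemma qf_gram D (A : 'M[C]_D) v : qf (A *m A^t*) v = nv (v *m A).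
Proof. by rewrite nv_qf1 -qf_conj mulmx1. Qed.

(** A joint type supported on the diagonal forces equal words; hence the summand of [um] with a
    diagonal type is diagonal, which gives [um_posdef]. *)
Lemma pt_diag x y : pt x y = pt y y -> x = y.
Proof.
move=> e; apply: (can_inj (@digK d m)); apply/ffunP => h; apply/eqP.
have := congr1 (fun t : ptype => t (dig x h, dig y h)) e.
rewrite !ffunE => /(congr1 (@nat_of_ord _)); rewrite !inordK ?ltnS; last 2 first.
- by apply: leq_trans (max_card _) _; rewrite card_ord.
- by apply: leq_trans (max_card _) _; rewrite card_ord.
move=> e2; have : (0 < #|[pred h0 | (dig y h0, dig y h0) == (dig x h, dig y h)]|)%N.
  by rewrite -e2; apply/card_gt0P; exists h; rewrite inE eqxx.
by case/card_gt0P => h0; rewrite inE => /eqP [<- <-].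
Qed.

Lemma um_posdef : posdef um.
Proof.
apply: posdefP => [|v v0]; first exact: um_herm.
have [y vy] : exists y, v 0 y != 0.
  apply/existsP; rewrite -[[exists y, _]]negbK negb_exists; apply/negP => /forallP h.
  move/negP: v0; apply; apply/eqP/rowP => y; rewrite mxE.
  by have := h y; rewrite negbK => /eqP.
rewrite /um qf_sum (bigD1 (pt y y)) //= ltr_pwDl //; last first.
  by apply: sumr_ge0 => t _; rewrite qf_gram nv_ge0.
rewrite qf_gram /nv (bigD1 y) //= ltr_pwDl //; last first.
  by apply: sumr_ge0 => t _; apply: nsq_ge0.
rewrite mxE (bigD1 y) //= big1 ?addr0 => [|x xy]; last first.
  rewrite mxE; case: (pt x y =P pt y y) => [/pt_diag e|_]; first by rewrite e eqxx in xy.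
  by rewrite /= mul0r mulr0.
rewrite mxE eqxx mul1r mulrC nsqZ mulr_gt0 //.
  by rewrite exprn_gt0 // kap_gt0 // npt_gt0.
by rewrite lt_def nsq_ge0 nsq_eq0 vy.
Qed.

Definition TT (z w : 'I_N) : {ffun 'I_n -> ptype} :=
  [ffun j => pt (gcol z j) (gcol w j)].

Lemma TTE z w j : TT z w j = pt (gcol z j) (gcol w j).
Proof. by rewrite [LHS]ffunE. Qed.

Definition BT (T : {ffun 'I_n -> ptype}) : 'M[C]_N := ktens (@gcol d n m) (fun j => bt (T j)).

Definition KT (T : {ffun 'I_n -> ptype}) : R := \prod_j kap (T j).

Lemma BTE T z w : BT T z w = ((TT z w == T)%:R * KT T)%:C.
Proof.
rewrite mxE; under eq_bigr do rewrite mxE.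
rewrite -real_complex_prod big_split /=; congr ((_ * _)%:C).
have [<-|TzT] := eqVneq (TT z w) T.
  by rewrite big1 // => j _; rewrite TTE eqxx.
have [j jP] : exists j, TT z w j != T j.
  apply/existsP; rewrite -[[exists j, _]]negbK negb_exists; apply/negP => /forallP h.
  by move/negP: TzT; apply; apply/eqP/ffunP => j; have := h j; rewrite negbK => /eqP.
by rewrite TTE in jP; rewrite (bigD1 j) //= (negbTE jP) mul0r.
Qed.

Definition UM : 'M[C]_N := ktens (@gcol d n m) (fun=> um).

Lemma UM_sum : UM = \sum_T BT T *m (BT T)^t*.
Proof.
apply/matrixP => z w; rewrite mxE summxE /um.
under eq_bigr do rewrite summxE.
rewrite bigA_distr_bigA /=; apply: eq_bigr => T _.
rewrite ktens_adj -(ktensM (@gcol_bij d n m)) mxE.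
by apply: eq_bigr => j _.
Qed.

Lemma card_TT T : \sum_z \sum_w (TT z w == T)%:R = \prod_j npt (T j) :> R.
Proof.
rewrite -(sum_kprod (@gcol_bij d n m) (fun j x => \sum_y (pt x y == T j)%:R)).
apply: eq_bigr => z _.
rewrite -(sum_kprod (@gcol_bij d n m) (fun j y => (pt (gcol z j) y == T j)%:R)).
apply: eq_bigr => w _.
have [<-|TzT] := eqVneq (TT z w) T.
  by rewrite big1 // => j _; rewrite TTE eqxx.
have [j jP] : exists j, TT z w j != T j.
  apply/existsP; rewrite -[[exists j, _]]negbK negb_exists; apply/negP => /forallP h.
  by move/negP: TzT; apply; apply/eqP/ffunP => j; have := h j; rewrite negbK => /eqP.
by rewrite TTE in jP; rewrite (bigD1 j) //= (negbTE jP) mul0r.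
Qed.

(** Expand [Z] in the matrices [BT T]. The squared coefficients sum to at most [hsn Z], and
    Cauchy-Schwarz over T leaves the sum of the Gram matrices, which is [UM]. *)
Lemma universal_bound (Z : 'M[C]_N) v :
  (forall z w z' w', TT z w = TT z' w' -> Z z w = Z z' w') ->
  qf (Z *m Z^t*) v <= hsn Z * qf UM v.
Proof.
move=> hZ.
(* The coefficient is read off at any position of type T; it is 0 when no position has that type. *)
pose zeta T : C := if [pick zw : 'I_N * 'I_N | TT zw.1 zw.2 == T] is Some zw
  then ((KT T)^-1)%:C * Z zw.1 zw.2 else 0.
have KT0 z w : 0 < KT (TT z w).
  by apply: prodr_gt0 => j _; rewrite TTE kap_gt0 // npt_gt0.
have eZ z w : Z z w = \sum_T zeta T * BT T z w.
  rewrite (bigD1 (TT z w)) //= big1 ?addr0 => [|T]; last first.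
    by rewrite eq_sym BTE => /negbTE ->; rewrite mul0r mulr0.
  rewrite BTE eqxx mul1r /zeta; case: pickP => [zw /eqP e|/(_ (z, w))]; last first.
    by rewrite /= eqxx.
  rewrite (hZ _ _ _ _ e) mulrAC -rmorphM /= mulVf ?mul1r // gt_eqF //.
have hz : \sum_T nsq (zeta T) <= hsn Z.
  have -> : hsn Z = \sum_T \sum_z \sum_w (TT z w == T)%:R * nsq (Z z w).
    rewrite exchange_big /=; apply: eq_bigr => z _.
    rewrite exchange_big /=; apply: eq_bigr => w _.
    rewrite (bigD1 (TT z w)) //= eqxx mul1r big1 ?addr0 // => T.
    by rewrite eq_sym => /negbTE ->; rewrite mul0r.
  apply: ler_sum => T _; rewrite /zeta; case: pickP => [[z0 w0] /= /eqP e|_]; last first.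
    rewrite nsq0; apply: sumr_ge0 => z _; apply: sumr_ge0 => w _.
    by rewrite mulr_ge0 ?nsq_ge0.
  have -> : \sum_z \sum_w (TT z w == T)%:R * nsq (Z z w) =
      (\sum_z \sum_w (TT z w == T)%:R) * nsq (Z z0 w0).
    rewrite mulr_suml; apply: eq_bigr => z _; rewrite mulr_suml.
    apply: eq_bigr => w _; case: eqP => [eT|_]; last by rewrite !mul0r.
    by rewrite (hZ z w z0 w0) // eT e.
  rewrite nsqZ card_TT le_eqVlt; apply/orP; left; apply/eqP; congr (_ * _).
  have KT2 : KT T ^+ 2 != 0 by rewrite sqrf_eq0 -e gt_eqF.
  apply: (mulfI KT2); rewrite exprVn divff // -prodrXl -big_split /= big1 // => j _.
  by rewrite kap_sqr // -e TTE npt_gt0.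
rewrite qf_gram.
apply: (@le_trans _ _ ((\sum_T nsq (zeta T)) * qf UM v)); last first.
  apply: ler_wpM2r => //; rewrite UM_sum qf_sum; apply: sumr_ge0 => T _.
  by rewrite qf_gram nv_ge0.
rewrite UM_sum qf_sum; under [X in _ <= _ * X]eq_bigr do rewrite qf_gram.
rewrite /nv exchange_big /= mulr_sumr; apply: ler_sum => w _.
apply: le_trans (nsq_cauchy_schwarz _ _).
rewrite le_eqVlt; apply/orP; left; apply/eqP; congr nsq.
rewrite mxE; under eq_bigr do rewrite eZ mulr_sumr.
rewrite exchange_big /=; apply: eq_bigr => T _.
rewrite mxE mulr_sumr; apply: eq_bigr => z _; ring.
Qed.

End Universal.

(** * Permutation invariance and functional calculus *)

Section Invariance.
Variable R : realType.
Local Notation C := R[i].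

Lemma ln_prod (I : finType) (F : I -> R) : (forall i, 0 < F i) ->
  ln (\prod_i F i) = \sum_i ln (F i).
Proof.
move=> F0; have [] // : 0 < \prod_i F i /\ ln (\prod_i F i) = \sum_i ln (F i).
apply: (big_rec2 (fun x y => 0 < x /\ ln x = y)); first by rewrite ln1.
by move=> i y x _ [x0 <-]; rewrite mulr_gt0 // lnM ?posrE.
Qed.

(** Invariance means commuting with a permutation unitary, a property inherited by functions of the
    matrix. *)
Lemma sp_invariant D (E : 'M[C]_D) a (f : R -> R) (g : 'I_D -> 'I_D) :
  E \is unitarymx -> bijective g ->
  (forall z w, sp E a (g z) (g w) = sp E a z w) ->
  forall z w, sp E (fun i => f (a i)) (g z) (g w) = sp E (fun i => f (a i)) z w.
Proof.
move=> uE bg inv; pose P : 'M[C]_D := \matrix_(z, w) (g z == w)%:R.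
have PA (A : 'M[C]_D) z w : (P *m A *m P^t*) z w = A (g z) (g w).
  have e (B : 'M[C]_D) x y : (P *m B) x y = B (g x) y.
    rewrite mxE (bigD1 (g x)) //= mxE eqxx mul1r big1 ?addr0 // => i.
    by rewrite mxE eq_sym => /negbTE ->; rewrite mul0r.
  rewrite -mulmxA e mxE (bigD1 (g w)) //= !mxE eqxx conjC1 mulr1 big1 ?addr0 // => i.
  by rewrite !mxE eq_sym => /negbTE ->; rewrite conjC0 mulr0.
have uP : P \is unitarymx.
  apply/unitarymxP; apply/matrixP => z w; rewrite -[P in P *m _]mulmx1 PA !mxE.
  by rewrite (bij_eq bg).
have spP b : P *m sp E b *m P^t* = sp (E *m P^t*) b.
  by rewrite !spmxE adjM adjK !mulmxA.
have uEP : E *m P^t* \is unitarymx by apply: (mul_unitarymx uE); rewrite trmxC_unitary.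
have e1 : sp E a = sp (E *m P^t*) a.
  by rewrite -spP; apply/matrixP => z w; rewrite PA inv.
move=> z w; rewrite -(PA (sp E _)) spP.
by rewrite -(mxfun_sp f a uE) -(mxfun_sp f a uEP) e1.
Qed.

Variables (d n m : nat).
Local Notation N := (n * m)%N.
Local Notation DN := (tdim d (n * m)).

Definition act (pi : 'S_N) (z : 'I_DN) : 'I_DN := undig [ffun p => dig z (pi p)].

Lemma dig_act pi z p : dig (act pi z) p = dig z (pi p).
Proof. by rewrite undigK ffunE. Qed.

Lemma act_bij pi : bijective (act pi).
Proof.
exists (act (pi^-1)%g) => z; apply: (can_inj (@digK d N)); apply/ffunP => p.
  by rewrite !dig_act permKV.
by rewrite !dig_act permK.
Qed.

Lemma tpow_act (A : 'M[C]_d) pi z w : tpow A N (act pi z) (act pi w) = tpow A N z w.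
Proof.
rewrite !tpowE [RHS](reindex_inj (@perm_inj _ pi)) /=.
by apply: eq_bigr => p _; rewrite !dig_act.
Qed.

Lemma tprod_act (a : 'I_d -> R) pi z : @tprod R d a N (act pi z) = @tprod R d a N z.
Proof.
rewrite /tprod [RHS](reindex_inj (@perm_inj _ pi)) /=.
by apply: eq_bigr => p _; rewrite dig_act.
Qed.

Lemma card_pt (x y : 'I_(tdim d m)) ab :
  pt x y ab = #|[pred h | (dig x h, dig y h) == ab]| :> nat.
Proof.
rewrite ffunE inordK // ltnS.
by apply: leq_trans (max_card _) _; rewrite card_ord.
Qed.

(** Equal joint types in every line give equal multisets of letter pairs over the whole grid, hence
    a permutation of all positions. So invariance under all permutations yields the hypothesis of
    [universal_bound]. *)
Lemma TT_act (z w z' w' : 'I_DN) : TT z w = TT z' w' ->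
  exists pi, z' = act pi z /\ w' = act pi w.
Proof.
move=> eT.
pose t (z w : 'I_DN) := [tuple (dig z p, dig w p) | p < N].
have cE (z0 w0 : 'I_DN) ab : count_mem ab (t z0 w0) = (\sum_j TT z0 w0 j ab)%N.
  rewrite -sum1_count big_map val_ord_tuple big_enum_cond /=.
  rewrite (reindex (@mxtens_index n m)) /=; last first.
    by exists (@mxtens_unindex n m) => ? _; [exact: mxtens_indexK|exact: mxtens_unindexK].
  under [RHS]eq_bigr => j _ do rewrite TTE card_pt -sum1_card.
  rewrite pair_big_dep /=; apply: eq_bigl => -[j h] /=.
  by rewrite inE !dig_gcol.
have : perm_eq (t z' w') (t z w).
  by apply/allP => ab _ /=; rewrite !cE eT.
case/tuple_permP => pi /val_inj e; exists pi.
have e2 p : (dig z' p, dig w' p) = (dig z (pi p), dig w (pi p)).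
  by have := congr1 (fun u : N.-tuple _ => tnth u p) e; rewrite !tnth_mktuple.
split; apply: (can_inj (@digK d N)); apply/ffunP => p; rewrite dig_act.
  by case: (e2 p).
by case: (e2 p).
Qed.

End Invariance.

(** * The universal bound in logarithmic form *)

Section Star.
Variables (R : realType) (d : nat) (s : 'I_d -> R) (rho : 'M[R[i]]_d).
Hypothesis s_gt0 : forall i, 0 < s i.
Hypothesis s_sum : \sum_i s i = 1.
Hypothesis rho_pos : posdef rho.
Hypothesis rho_tr : \tr rho = 1.
Local Notation C := R[i].
Local Notation psi := (psi s rho).
Local Notation qn := (qn s rho).
Local Notation pinned := (pinned s rho).
Local Notation eigdata := (eigdata s rho).

Lemma pinned_act n m pi z w :
  pinned (n * m) (act pi z) (act pi w) = pinned (n * m) z w.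
Proof. by rewrite !mxE !tprod_act tpow_act. Qed.

Lemma qf_lin_sp D (E : 'M[C]_D) a b (k l : R) v :
  qf (sp E (fun i => k * a i + l * b i)) v = k * qf (sp E a) v + l * qf (sp E b) v.
Proof.
apply: (etrans (qf_sp _ _ _)); apply: esym.
apply: (etrans (congr2 (fun x y => k * x + l * y) (qf_sp E a v) (qf_sp E b v))).
rewrite !mulr_sumr -big_split /=; apply: eq_bigr => i _; ring.
Qed.

Lemma qf_affine_sp D (E : 'M[C]_D) a (k : R) v : E \is unitarymx -> nv v = 1 ->
  qf (sp E (fun i => k + a i)) v = k + qf (sp E a) v.
Proof.
move=> uE v1; apply: (etrans (qf_sp _ _ _)); apply: esym.
apply: (etrans (congr1 (fun x => k + x) (qf_sp E a v))).
rewrite -[X in X + _]mulr1 -v1 -(parseval v uE) mulr_sumr -big_split /=.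
by apply: eq_bigr => i _; rewrite mulrDl.
Qed.

Lemma qf_scale_sp D (E : 'M[C]_D) a (k : R) v :
  qf (sp E (fun i => k * a i)) v = k * qf (sp E a) v.
Proof.
apply: (etrans (qf_sp _ _ _)); apply: esym.
apply: (etrans (congr1 (fun x => k * x) (qf_sp E a v))).
by rewrite mulr_sumr; apply: eq_bigr => i _; rewrite mulrA.
Qed.

Lemma le_of_eq (x y : R) : x = y -> x <= y.
Proof. by move=> ->. Qed.

(** The operator X^a S^(1-a) at size n*m is at most its trace [qn] times [UM]; operator monotonicity
    of ln turns this into an additive inequality of quadratic forms. *)
Lemma log_universal n m a (a0 : a != 0) EN XX LL G r :
  @eigdata (n * m) EN XX LL -> G \is unitarymx -> (forall i, 0 < r i) ->
  um R d m = sp G r -> forall v, nv v = 1 ->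
  a * qf (sp EN (fun x => ln (XX x))) v + (1 - a) * qf (sp EN (fun x => ln (LL x))) v <=
  psi (n * m) a + qf (sp (ktens (@gcol d n m) (fun=> G))
      (fun z => \sum_j ln (r (gcol z j)))) v.
Proof.
move=> dat uG r0 eu v v1; have [uE X0 eX hb _] := dat.
have L0 x := eigdata_lab s_gt0 x dat.
pose y x := XX x `^ a * LL x `^ (1 - a).
have y0 x : 0 < y x by rewrite mulr_gt0 ?powR_gt0.
(* The square root is taken so that Z times its adjoint is the operator to be bounded and [hsn Z] is
   its trace. *)
pose Z := sp EN (fun x => y x `^ 2^-1).
have ZZ : Z *m Z^t* = sp EN y.
  exact: (etrans (congr1 (mulmx Z) (sp_adj _ _)) (sp_sqr uE y0)).
have hZ : hsn Z = qn (n * m) a.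
  by rewrite hsnE ZZ (tr_sp _ uE) (qnE a dat).
have eZ : Z = mxpowR (pinned (n * m)) (a / 2) *m
    rdiag (fun z => @tprod R d s (n * m) z `^ ((1 - a) / 2)).
  rewrite (rdiag_hbasis (fun u => u `^ ((1 - a) / 2)) uE hb) eX (mxpow_sp _ _ uE).
  rewrite (spM _ _ uE); apply: sp_eq => x.
  by rewrite /y powRM ?powR_ge0 // -!powRrM.
have invZ z w z' w' : TT z w = TT z' w' -> Z z w = Z z' w'.
  case/TT_act => pi [-> ->]; rewrite eZ !mul_mx_rdiagE tprod_act; congr (_ * _).
  rewrite eX (mxpow_sp _ _ uE); apply/esym.
  have inv z1 w1 : sp EN XX (act pi z1) (act pi w1) = sp EN XX z1 w1.
    by rewrite -eX pinned_act.
  have H := @sp_invariant R _ EN XX (fun u => u `^ (a / 2)) (act pi) uE (act_bij _ pi) inv z w.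
  exact: H.
pose KG := ktens (@gcol d n m) (fun=> G).
have uKG : KG \is unitarymx by apply: ktens_unitary => //; exact: gcol_bij.
pose rr z := \prod_j r (@gcol d n m z j).
have rr0 z : 0 < rr z by apply: prodr_gt0 => j _.
have eU : UM R d n m = sp KG rr.
  rewrite /UM (eq_ktens _ (G := fun=> sp G r)); last by move=> j; rewrite eu.
  by rewrite (ktens_sp (@gcol_bij d n m)).
have q0 : 0 < qn (n * m) a by exact: (qn_gt0 s_gt0 s_sum rho_pos).
have le1 w : qf (sp EN y) w <= qf (sp KG (fun z => qn (n * m) a * rr z)) w.
  by rewrite qf_scale_sp -ZZ -hZ -eU; apply: universal_bound.
have h := qf_ln_le uE uKG y0 (fun z => mulr_gt0 q0 (rr0 z)) le1 v.
have e1 : sp EN (fun x => ln (y x)) = sp EN (fun x => a * ln (XX x) + (1 - a) * ln (LL x)).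
  by apply: sp_eq => x; rewrite /y lnM ?posrE ?powR_gt0 // !ln_powR.
have e2 : sp KG (fun z => ln (qn (n * m) a * rr z)) =
    sp KG (fun z => psi (n * m) a + \sum_j ln (r (gcol z j))).
  by apply: sp_eq => z; rewrite lnM ?posrE // ln_prod.
rewrite e1 e2 in h.
apply: le_trans (le_trans (le_of_eq (esym (qf_lin_sp _ _ _ _ _ _))) h) _.
exact: le_of_eq (qf_affine_sp _ _ uKG v1).
Qed.

End Star.

(** * The key inequality on the grid *)

Section StarInequality.
Variables (R : realType) (d : nat) (s : 'I_d -> R) (rho : 'M[R[i]]_d).
Hypothesis s_gt0 : forall i, 0 < s i.
Hypothesis s_sum : \sum_i s i = 1.
Hypothesis rho_pos : posdef rho.
Hypothesis rho_tr : \tr rho = 1.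
Local Notation C := R[i].
Local Notation psi := (psi s rho).
Local Notation qn := (qn s rho).
Local Notation pinned := (pinned s rho).
Local Notation eigdata := (eigdata s rho).

Lemma sum_kprod_one D e n (k : 'I_D -> {ffun 'I_n -> 'I_e}) (p g : 'I_e -> R) j :
  bijective k -> \sum_i p i = 1 ->
  \sum_z (\prod_h p (k z h)) * g (k z j) = \sum_i p i * g i.
Proof.
move=> kb p1.
pose F h a := p a * (if h == j then g a else 1).
transitivity (\sum_z \prod_h F h (k z h)).
  apply: eq_bigr => z _; rewrite big_split /=; congr (_ * _).
  by rewrite (bigD1 j) //= eqxx big1 ?mulr1 // => h /negPf hj; rewrite hj.
rewrite (sum_kprod kb F) (bigD1 j) //= [X in _ * X]big1 ?mulr1 => [|h hj]; last first.
  by rewrite /F (negbTE hj) -[RHS]p1; apply: eq_bigr => i _; rewrite mulr1.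
by apply: eq_bigr => i _; rewrite /F eqxx.

Qed.

Lemma sum_kprod_sum D e n (k : 'I_D -> {ffun 'I_n -> 'I_e}) (p g : 'I_e -> R) :
  bijective k -> \sum_i p i = 1 ->
  \sum_z (\prod_h p (k z h)) * (\sum_h g (k z h)) = n%:R * \sum_i p i * g i.
Proof.
move=> kb p1; under eq_bigr do rewrite mulr_sumr.
rewrite exchange_big /=; under eq_bigr => h _ do rewrite (sum_kprod_one g h kb p1).
by rewrite sumr_const card_ord mulr_natl.
Qed.

Lemma qf_jensen_ln D (E : 'M[C]_D) a v : E \is unitarymx -> (forall i, 0 < a i) ->
  nv v = 1 -> qf (sp E (fun i => ln (a i))) v <= ln (qf (sp E a) v).
Proof.
move=> uE a0 v1; have w1 : \sum_i wt E v i = 1 by rewrite parseval.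
have := jensen_ln (wt_ge0 E v) w1 a0.
have -> : \sum_i wt E v i * a i = qf (sp E a) v.
  by apply: esym; apply: (etrans (qf_sp _ _ _)); apply: eq_bigr => i _; rewrite mulrC.
apply: le_trans; apply: le_of_eq; apply: (etrans (qf_sp _ _ _)).
by apply: eq_bigr => i _; rewrite mulrC.
Qed.

(** In an eigenbasis of the product state, Jensen replaces ln [um] by the logarithm of the diagonal
    of [um]. Gibbs then bounds the cross term by the negative entropy plus the logarithm of the
    trace of [um], which is polynomial. *)
Lemma klein_um m (F : 'M[C]_d) f (GU : 'M[C]_(tdim d m)) r :
  F \is unitarymx -> (forall i, 0 < f i) -> \sum_i f i = 1 ->
  GU \is unitarymx -> (forall i, 0 < r i) -> um R d m = sp GU r ->
  retr (sp GU (fun i => ln (r i))) (tpow (sp F f) m) <=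
  m%:R * (\sum_i f i * ln (f i)) + ln ((m.+1 ^ (d * d))%:R).
Proof.
move=> uF f0 f1 uG r0 eu; rewrite retrC tpow_sp.
have uFm := tpow_unitary m uF.
rewrite (retr_spl _ _ uFm).
have P0 y : 0 < tprod f (n := m) y by apply: tprod_gt0.
have P1 : \sum_y tprod f (n := m) y = 1 by rewrite sum_tprod f1 expr1n.
pose q y := qf (um R d m) (row y (tpow F m)).
have q0 y : 0 < q y.
  by rewrite /q eu; apply: qf_gt0 => //; rewrite nv_row.
have hq : \sum_y q y <= (m.+1 ^ (d * d))%:R.
  by rewrite /q (sum_qf _ uFm) tr_um.
have sq0 : 0 < \sum_y q y.
  rewrite /q (sum_qf _ uFm) eu (tr_sp _ uG) /= lt_def; apply/andP; split; last first.
    by apply: sumr_ge0 => i _; apply: ltW.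
  apply/negP => /eqP /psumr_eq0P h0.
  have : \sum_y tprod f (n := m) y = 0.
    by apply: big1 => y _; have := r0 y; rewrite h0 ?ltxx // => i _; apply: ltW.
  by rewrite P1 => /eqP; rewrite oner_eq0.
apply: (@le_trans _ _ (\sum_y tprod f (n := m) y * ln (q y))).
  apply: ler_sum => y _; rewrite ler_pM2l // /q eu.
  by apply: qf_jensen_ln => //; rewrite nv_row.
have := gibbs (fun y => ln (q y)) P0 P1.
have -> : \sum_y expR (ln (q y)) = \sum_y q y.
  by apply: eq_bigr => y _; rewrite lnK ?posrE.
have e : \sum_y tprod f (n := m) y * ln (tprod f (n := m) y) = m%:R * \sum_i f i * ln (f i).
  rewrite -(sum_kprod_sum (fun i => ln (f i)) (dig_bij d m) f1).
  by apply: eq_bigr => y _; rewrite /tprod ln_prod.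
rewrite -e; under eq_bigr do rewrite mulrBr.
rewrite sumrB lerBlDl => /le_trans; apply.
by rewrite lerD2l ler_ln ?posrE // (lt_le_trans sq0).
Qed.

Lemma retr_suml D (I : Type) (q : seq I) (P : pred I) (A : I -> 'M[C]_D) M :
  retr (\sum_(t <- q | P t) A t) M = \sum_(t <- q | P t) retr (A t) M.
Proof.
elim/big_rec2: _ => [|t x y _ <-]; last by rewrite retrDl.
by rewrite /retr mul0mx mxtrace0.
Qed.

Lemma sp_sum D (E : 'M[C]_D) (I : finType) (a : I -> 'I_D -> R) :
  sp E (fun z => \sum_j a j z) = \sum_j sp E (a j).
Proof.
apply/matrixP => z w; rewrite spE summxE; under [RHS]eq_bigr do rewrite spE.
rewrite exchange_big /=; apply: eq_bigr => x _.
by rewrite real_complex_sum !mulr_suml.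
Qed.

Lemma diag_conj_real D (A : 'M[C]_D) (E : 'M[C]_D) y : A^t* = A ->
  (E *m A *m E^t*) y y = (qf A (row y E))%:C.
Proof.
move=> hA; have e : (E *m A *m E^t*) y y = (row y E *m A *m (row y E)^t*) 0 0.
  rewrite -row_mul !mxE; apply: eq_bigr => j _; rewrite !mxE //.
rewrite qfmxE -e RRe_real //; apply/CrealP.
have : (E *m A *m E^t*)^t* = E *m A *m E^t* by rewrite !adjM adjK hA mulmxA.
by move/matrixP/(_ y y); rewrite mxE mxE.
Qed.

Section Tensor.
Variables (n m : nat) (E : 'M[C]_(tdim d n)) (xx lab : 'I_(tdim d n) -> R).
Hypothesis dat : eigdata E xx lab.
Local Notation V := (ktens (@grow d n m) (fun=> E)).
Local Notation cN := (@tprod R d s (n * m)).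

Lemma tensor_unitary : V \is unitarymx.
Proof.
have [uE _ _ _ _] := dat; apply: ktens_unitary => //; exact: grow_bij.
Qed.

Lemma tensor_hbasis : hbasis cN V (fun x => \prod_h lab (grow x h)).
Proof.
have [_ _ _ hb _] := dat.
move=> x z; rewrite mxE tprod_grow => /prodf_neq0 h; apply: eq_bigr => k _.
by apply: hb; apply: h.
Qed.

Lemma tensor_qf x : qf (pinned (n * m)) (row x V) = \prod_h xx (grow x h).
Proof.
have [uE _ _ hb exx] := dat.
rewrite (qf_pin_homog _ (hbasis_homog (x := x) tensor_hbasis)).
have hr := posdef_herm rho_pos.
apply: complexI; rewrite -(diag_conj_real _ _ (tpow_herm _ hr)).
rewrite tpow_grow ktens_adj -!(ktensM (@grow_bij d n m)) mxE real_complex_prod.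
apply: eq_bigr => h _; rewrite exx -(diag_conj_real _ _ (tpow_herm _ hr)).
by [].
Qed.

(** [log_universal] is averaged over the m-fold power of the state with weights [p] in the basis
    [E]. On the right only the one-copy marginals of that state appear, through [ptr_grow] and
    [klein_um]. *)
Lemma star a (p : 'I_(tdim d n) -> R) (F : 'I_n -> 'M[C]_d) (f : 'I_n -> 'I_d -> R) :
  a < 0 -> (forall x, 0 < p x) -> \sum_x p x = 1 ->
  (forall j, F j \is unitarymx) -> (forall j i, 0 < f j i) ->
  (forall j, ptr (@dig d n) j (sp E p) = sp (F j) (f j)) ->
  m%:R * \sum_x p x * (a * ln (xx x) + (1 - a) * ln (lab x)) <=
  psi (n * m) a + \sum_j (m%:R * (\sum_i f j i * ln (f j i)) + ln ((m.+1 ^ (d * d))%:R)).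
Proof.
move=> a0 p0 p1 uF f0 ef.
have [uE xx0 _ hb exx] := dat.
have lab0 x := eigdata_lab s_gt0 x dat.
have [EN [XX [LL datN]]] := eigdata_exists s rho_pos (n * m).
have [uEN XX0 eX hbN _] := datN.
have [GU [r [uG r0 eu]]] := um_posdef R d m.
have uV := tensor_unitary.
pose P x := \prod_h p (@grow d n m x h).
have P0 x : 0 < P x by apply: prodr_gt0.
have P1 : \sum_x P x = 1.
  by rewrite (sum_kprod (@grow_bij d n m) (fun=> p)) big1 // => h _; rewrite p1.
have eP : sp V P = ktens (@grow d n m) (fun=> sp E p).
  by rewrite (ktens_sp (@grow_bij d n m)).
pose L := sp (ktens (@gcol d n m) (fun=> GU)) (fun z => \sum_j ln (r (gcol z j))).
have eL : \sum_x P x * qf L (row x V) =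
    \sum_j retr (sp GU (fun i => ln (r i))) (tpow (sp (F j) (f j)) m).
  rewrite -(retr_spl _ _ uV) retrC eP /L sp_sum retr_suml; apply: eq_bigr => j _.
  rewrite -(embed_sp (@gcol_bij d n m) (F := fun=> GU) j (fun i => ln (r i))) //.
  by rewrite (retr_embed (@gcol d n m)) ptr_grow ef.
have f1 j : \sum_i f j i = 1.
  apply: complexI; rewrite -(tr_sp _ (uF j)) -ef (ptr_tr (dig_bij d n)).
  by rewrite (tr_sp _ uE) p1.
(* Jensen for ln bounds the mean of ln XX from above by the logarithm of its mean, a product of
   [xx]; the sign a < 0 turns this into the required direction. *)
have key x : \sum_h (a * ln (xx (grow x h)) + (1 - a) * ln (lab (grow x h))) <=
    psi (n * m) a + qf L (row x V).
  have := log_universal s_gt0 s_sum rho_pos (ltr0_neq0 a0) datN uG r0 eu (nv_row x uV).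
  apply: le_trans; rewrite big_split /= -!mulr_sumr lerD //.
    rewrite ler_wnM2l ?(ltW a0) //.
    apply: le_trans (qf_jensen_ln uEN XX0 (nv_row x uV)) _.
    by rewrite -eX tensor_qf ln_prod.
  apply: le_of_eq; congr (_ * _).
  rewrite -(rdiag_hbasis (@ln R) uEN hbN) (rdiag_hbasis (@ln R) uV tensor_hbasis).
  by rewrite (qf_row_sp _ _ uV) ln_prod.
rewrite -(sum_kprod_sum (fun x => a * ln (xx x) + (1 - a) * ln (lab x)) (@grow_bij d n m) p1).
apply: le_trans (ler_sum _ (fun x _ => ler_wpM2l (ltW (P0 x)) (key x))) _.
under eq_bigr do rewrite mulrDr; rewrite big_split /= -mulr_suml P1 mul1r lerD2l eL.
apply: ler_sum => j _; exact: klein_um.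
Qed.

End Tensor.
End StarInequality.

(** * Near superadditivity for negative orders *)

Section NegativeOrders.
Variables (R : realType) (d : nat) (s : 'I_d -> R) (rho : 'M[R[i]]_d).
Hypothesis s_gt0 : forall i, 0 < s i.
Hypothesis s_sum : \sum_i s i = 1.
Hypothesis rho_pos : posdef rho.
Hypothesis rho_tr : \tr rho = 1.
Local Notation C := R[i].
Local Notation psi := (psi s rho).
Local Notation qn := (qn s rho).
Local Notation pinned := (pinned s rho).
Local Notation eigdata := (eigdata s rho).

Section FixedSize.
Variables (n : nat) (E : 'M[C]_(tdim d n)) (xx lab : 'I_(tdim d n) -> R).
Hypothesis dat : eigdata E xx lab.

Definition marginals (p : 'I_(tdim d n) -> R) (F : 'I_n -> 'M[C]_d) (f : 'I_n -> 'I_d -> R) :=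
  forall j, [/\ F j \is unitarymx, (forall i, 0 < f j i),
    ptr (@dig d n) j (sp E p) = sp (F j) (f j) & \sum_i f j i = \sum_x p x].

Lemma marginals_exist p : (forall x, 0 < p x) -> exists F f, marginals p F f.
Proof.
have [uE _ _ _ _] := dat.
move=> p0; have h j : exists Ff : 'M[C]_d * ('I_d -> R),
  [/\ Ff.1 \is unitarymx, (forall i, 0 < Ff.2 i),
    ptr (@dig d n) j (sp E p) = sp Ff.1 Ff.2 & \sum_i Ff.2 i = \sum_x p x].
  have [F [f [uF f0 e]]] := ptr_posdef (dig_bij d n) j (posdef_sp uE p0).
  exists (F, f); split => //=; apply: complexI.
  by rewrite -(tr_sp f uF) -e (ptr_tr (dig_bij d n)) (tr_sp _ uE).
have [g hg] := choice h.
by exists (fun j => (g j).1), (fun j => (g j).2) => j; apply: hg.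
Qed.

(** Negative von Neumann entropy of a state, expressed through its spectrum. *)
Definition negent (q : 'I_d -> R) := \sum_i q i * ln (q i).

Lemma retr_self D (F : 'M[C]_D) a b : F \is unitarymx ->
  retr (sp F a) (sp F b) = \sum_i a i * b i.
Proof.
move=> uF; rewrite (retr_spl _ _ uF); apply: eq_bigr => i _.
by rewrite (qf_row_sp _ _ uF).
Qed.

(** Subadditivity of entropy: Gibbs and Jensen compare the state with the product of its marginals,
    whose logarithm is a sum of local terms. *)
Lemma entropy_subadd p F f : (forall x, 0 < p x) -> \sum_x p x = 1 ->
  marginals p F f -> \sum_j negent (f j) <= \sum_x p x * ln (p x).
Proof.
move=> p0 p1 mg; have [uE _ _ _ _] := dat.
have uF j : F j \is unitarymx by have [] := mg j.
have f0 j i : 0 < f j i by have [_ h] := mg j.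
have ef j : ptr (@dig d n) j (sp E p) = sp (F j) (f j) by have [] := mg j.
have f1 j : \sum_i f j i = 1 by have [_ _ _ ->] := mg j.
pose H := ktens (@dig d n) F.
have uH : H \is unitarymx by apply: ktens_unitary => //; exact: dig_bij.
pose w y := \prod_j f j (@dig d n y j).
have w0 y : 0 < w y by apply: prodr_gt0.
have w1 : \sum_y w y = 1 by rewrite (sum_kprod (dig_bij d n) f) big1.
have -> : \sum_j negent (f j) = \sum_x p x * qf (sp H (fun y => ln (w y))) (row x E).
  rewrite -(retr_spl _ _ uE) retrC.
  have -> : sp H (fun y => ln (w y)) = \sum_j embed (@dig d n) j (sp (F j) (fun i => ln (f j i))).
    rewrite (sp_eq H (b := fun y => \sum_j ln (f j (dig y j)))); last first.
      by move=> y; rewrite /w ln_prod.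
    rewrite sp_sum; apply: eq_bigr => j _.
    by rewrite (embed_sp (dig_bij d n) j (fun i => ln (f j i)) uF).
  rewrite retr_suml; apply: eq_bigr => j _.
  rewrite (retr_embed (@dig d n)) ef (retr_self _ _ (uF j)).
  by apply: eq_bigr => i _; rewrite mulrC.
pose q x := qf (sp H w) (row x E).
have q0 x : 0 < q x by apply: qf_gt0; rewrite ?nv_row.
apply: (@le_trans _ _ (\sum_x p x * ln (q x))).
  apply: ler_sum => x _; rewrite ler_pM2l //.
  by apply: qf_jensen_ln => //; rewrite nv_row.
have := gibbs (fun y => ln (q y)) p0 p1.
have -> : \sum_y expR (ln (q y)) = 1.
  rewrite (eq_bigr q) => [|y _]; last by rewrite lnK ?posrE.
  by rewrite /q (sum_qf _ uE) (tr_sp _ uH) w1.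
rewrite ln1; under eq_bigr do rewrite mulrBr.
by rewrite sumrB subr_le0.
Qed.

End FixedSize.

(** [star] for the Gibbs weights: by [gibbs_eq] the left side misses only their entropy, and
    subadditivity absorbs the marginal entropies. *)
Lemma psi_mul n m a : a < 0 ->
  m%:R * psi n a <= psi (n * m) a + n%:R * ln ((m.+1 ^ (d * d))%:R).
Proof.
move=> a0; have [E [xx [lab dat]]] := eigdata_exists s rho_pos n.
pose g := gbs s rho xx lab a.
have g0 x : 0 < g x := gbs_gt0 s_gt0 s_sum rho_pos a x dat.
have g1 : \sum_x g x = 1 := gbs_sum s_gt0 s_sum rho_pos a dat.
have [F [f mg]] := marginals_exist dat g0.
have uF j : F j \is unitarymx by have [] := mg j.
have f0 j i : 0 < f j i by have [_ h] := mg j.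
have ef j : ptr (@dig d n) j (sp E g) = sp (F j) (f j) by have [] := mg j.
have := star s_gt0 s_sum rho_pos m dat a0 g0 g1 uF f0 ef.
have sub := entropy_subadd dat g0 g1 mg.
rewrite (gibbs_eq s_gt0 s_sum rho_pos a dat) -/g.
under [\sum_x g x * (_ - _)]eq_bigr do rewrite mulrBr.
rewrite sumrB big_split /= sumr_const card_ord -mulr_natl -mulr_sumr mulrBr => h.
have := ler_wpM2l (ler0n R m) sub; rewrite /negent; move: h.
by lra.
Qed.

Lemma tensmx_unE m n (A : 'M[C]_m) (B : 'M[C]_n) h l :
  (A *t B) h l = A (mxtens_unindex h).1 (mxtens_unindex l).1 *
                 B (mxtens_unindex h).2 (mxtens_unindex l).2.
Proof.
rewrite -[in LHS](mxtens_unindexK h) -[in LHS](mxtens_unindexK l).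
by case: (mxtens_unindex h) (mxtens_unindex l) => h1 h2 [l1 l2]; rewrite tensmxE.
Qed.

Lemma sum_unindex m n (V : zmodType) (f : 'I_m * 'I_n -> V) :
  \sum_(h < m * n) f (mxtens_unindex h) = \sum_h f h.
Proof.
rewrite (reindex (@mxtens_index m n)) /=; last first.
  by exists (@mxtens_unindex m n) => ? _; [exact: mxtens_indexK|exact: mxtens_unindexK].
by apply: eq_bigr => h _; rewrite mxtens_indexK.
Qed.

(** Append one copy and test in the product of the standard basis with an adapted eigenbasis at size
    n. Diagonal entries factor, and Peierls for the convex power a < 0 gives the lower bound. It
    handles sizes that are not multiples in Fekete's argument. *)
Lemma psi_step a : a < 0 -> exists k, forall n, psi n a + k <= psi n.+1 a.
Proof.
move=> a0; pose k := \sum_i complex.Re (Ya s rho a i i) `^ a.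
have d0 : (0 < d)%N.
  have := dim_gt0 s_sum 1; rewrite /= muln1 //.
have pY := Ya_posdef s_gt0 rho_pos a.
have Yii i : Ya s rho a i i = (qf (Ya s rho a) (row i 1%:M))%:C.
  by rewrite -(diag_conj_real _ _ (posdef_herm pY)) mul1mx adj1 mulmx1.
have u1 : (1%:M : 'M[C]_d) \is unitarymx by apply/unitarymxP; rewrite adj1 mulmx1.
have Y0 i : 0 < qf (Ya s rho a) (row i 1%:M).
  by apply: posdef_qf => //; rewrite -nv_eq0 nv_row ?oner_eq0.
have k0 : 0 < k.
  rewrite /k (bigD1 (Ordinal d0)) //= ltr_pwDl //.
    by rewrite Yii /= powR_gt0.
  by apply: sumr_ge0 => i _; apply: powR_ge0.
exists (ln k) => n.
rewrite /psi -lnM ?posrE ?(qn_gt0 s_gt0 s_sum rho_pos) //.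
rewrite ler_ln ?posrE ?mulr_gt0 ?(qn_gt0 s_gt0 s_sum rho_pos) //.
rewrite !(qn_trp s_gt0 rho_pos _ (ltr0_neq0 a0)).
have pT := tpow_posdef n pY; have pT1 := tpow_posdef n.+1 pY.
have [E [z [lab [uE z0 eX hb ez]]]] := pin_basis (@tprod R d s n) pT.
have [G [g [uG g0 eG]]] := pin_posdef (@tprod R d s n.+1) pT1.
rewrite eX eG (trp_sp _ _ uE) (trp_sp _ _ uG).
pose V : 'M[C]_(tdim d n.+1) := 1%:M *t E.
have adjT (A : 'M[C]_d) (B : 'M[C]_(tdim d n)) : (A *t B)^t* = A^t* *t B^t*.
  by rewrite trmx_tens map_mxT.
have uV : V \is unitarymx.
  apply/unitarymxP; rewrite /V adjT tensmx_mul (unitary_adjr u1) (unitary_adjr uE).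
  by rewrite -[X in _ *t X](tpow1 R d n); exact: (tpow1 R d n.+1).
have tS l : @tprod R d s n.+1 l =
    s (mxtens_unindex l).1 * @tprod R d s n (mxtens_unindex l).2.
  rewrite /tprod big_ord_recl dig_ord0; congr (_ * _).
  by apply: eq_bigr => h _; rewrite dig_lift.
have VE h l : V h l = ((mxtens_unindex h).1 == (mxtens_unindex l).1)%:R *
    E (mxtens_unindex h).2 (mxtens_unindex l).2.
  by rewrite /V tensmx_unE mxE.
have hbV : hbasis (@tprod R d s n.+1) V
    (fun h => s (mxtens_unindex h).1 * lab (mxtens_unindex h).2).
  move=> h l; rewrite VE tS; case: (_ =P (mxtens_unindex l).1) => [->|_]; last by rewrite mul0r eqxx.
  by rewrite mul1r => /hb ->.
apply: le_trans (peierls (tangent_powR (or_intror (ltW a0))) uG uV g0).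
have qV h : qf (sp G g) (row h V) =
    complex.Re (Ya s rho a (mxtens_unindex h).1 (mxtens_unindex h).1) *
    z (mxtens_unindex h).2.
  rewrite -eG (qf_pin_homog _ (hbasis_homog (x := h) hbV)).
  apply: complexI; rewrite -(diag_conj_real _ _ (posdef_herm pT1)) /V adjT /= !tensmx_mul.
  rewrite mul1mx adj1 mulmx1 tensmx_unE.
  by rewrite (diag_conj_real _ _ (posdef_herm pT)) -ez Yii -rmorphM.
under [leRHS]eq_bigr do rewrite qV.
rewrite (@sum_unindex d (tdim d n) R (fun h => (complex.Re (Ya s rho a h.1 h.1) * z h.2) `^ a)).
rewrite mulrC /k big_distrlr pair_big; apply: ler_sum => -[h1 h2] _.
rewrite /=; apply: le_of_eq; symmetry; apply: powRM; last exact: ltW (z0 _).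
by rewrite Yii; exact: ltW (Y0 _).
Qed.

End NegativeOrders.

(** * Fekete's argument with a sublinear error *)

Section RealSequences.
Variable R : realType.

Lemma ln_succ_le_affine (k : nat) (e : R) : 0 < e ->
  exists2 K, 0 <= K & forall m, ln ((m.+1 ^ k)%:R : R) <= e * m%:R + K.
Proof.
move=> e0; pose t := e / k.+1%:R.
have t0 : 0 < t by rewrite divr_gt0.
exists (k%:R * `|t - ln t|) => [|m]; first by rewrite mulr_ge0.
rewrite natrX lnXn ?ltr0Sn // -[X in X <= _]mulr_natl.
have h : ln (m.+1%:R : R) <= t * m%:R + `|t - ln t|.
  have : ln (t * m.+1%:R) <= t * m.+1%:R.
    by apply/ltW/ln_sublinear; rewrite mulr_gt0 ?ltr0Sn.
  rewrite lnM ?posrE ?ltr0Sn // -[m.+1]addn1 natrD mulrDr mulr1.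
  by have := ler_norm (t - ln t); lra.
apply: (le_trans (ler_wpM2l (ler0n _ k) h)); rewrite mulrDr lerD2r mulrA.
apply: ler_wpM2r => //; rewrite /t mulrCA ger_pMr // ler_pdivrMr ?ltr0Sn // mul1r.
by rewrite ler_nat.
Qed.

(* Fekete's argument for sequences superadditive up to a sublinear error [e]. *)
Lemma mul_step_cvg (u e : nat -> R) (U k : R) : u 0%N = 0 ->
  (forall n, u n <= n%:R * U) -> (forall n, u n + k <= u n.+1) ->
  (forall n m, m%:R * u n <= u (n * m)%N + n%:R * e m) ->
  (forall x, 0 < x -> exists2 K, 0 <= K & forall m, e m <= x * m%:R + K) ->
  exists l : R, (fun n => n%:R^-1 * u n) @ \oo --> l /\ forall n, u n <= n%:R * l.
Proof.
move=> u0 hU hk hm he.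
(* Removing the linear term makes the sequence nondecreasing, so it can be compared at [N] and at
   the multiple [n * q] just below. *)
pose w n := u n - n%:R * k.
have wS n : w n <= w n.+1.
  by have := hk n; rewrite /w -[n.+1]addn1 natrD mulrDl mul1r; lra.
have w_mono : {homo w : m n / (m <= n)%N >-> m <= n} by apply: homo_leq wS => [?|? ? ?]; [exact: lexx|exact: le_trans].
pose A := [set r : R | exists2 n, (0 < n)%N & r = n%:R^-1 * u n].
have Aub : has_ubound A.
  exists U => r [n n0 ->]; rewrite mulrC ler_pdivrMr ?ltr0n // mulrC; exact: hU.
have A1 : A (1%:R^-1 * u 1%N) by exists 1%N.
have supA : has_sup A by split; first by exists (1%:R^-1 * u 1%N).
have le_sup n : (0 < n)%N -> n%:R^-1 * u n <= sup A.
  by move=> n0; apply: (sup_upper_bound supA); exists n.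
exists (sup A); split; last first.
  move=> [|n]; first by rewrite u0 mul0r.
  have := le_sup n.+1 isT; rewrite mulrC ler_pdivrMr ?ltr0Sn //.
  by rewrite mulrC.
apply/cvgrPdist_le => x x0.
have x2 : 0 < x / 2 by rewrite divr_gt0.
(* A size [n] nearly attaining the supremum is fixed; [N] is then taken large compared with it. *)
have [_ [n n0 ->] hn] := sup_adherent x2 supA.
have nR : 0 < n%:R :> R by rewrite ltr0n.
have y0 : 0 < x / 4 / n%:R by rewrite !divr_gt0.
have [K K0 hK] := he _ y0.
near=> N.
have N0 : (0 < N)%N by near: N; exists 1%N.
have NR : 0 < N%:R :> R by rewrite ltr0n.
have hN : `|w n| + n%:R * K <= N%:R * (x / 4).
  rewrite -ler_pdivrMr ?divr_gt0 //; near: N; exact: nbhs_infty_ger.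
rewrite ger0_norm ?subr_ge0 ?le_sup // lerBlDr -lerBlDl mulrC ler_pdivlMr //.
set q := (N %/ n)%N.
have qN : (n * q <= N)%N by rewrite mulnC leq_divM.
have Nq : (N < n * q.+1)%N by rewrite mulnC ltn_ceil.
have h1 : w (n * q)%N <= w N by exact: w_mono.
have h2 : q%:R * w n <= w (n * q)%N + n%:R * e q.
  have := hm n q; rewrite /w natrM; set a := u n; set b := u (n * q)%N.
  by nra.
have h3 := hK q.
have qn : n%:R * (q%:R : R) <= N%:R by rewrite -natrM ler_nat.
have qn' : N%:R <= n%:R * (q%:R + 1) :> R by rewrite natr1 -natrM ler_nat ltnW.
have wn0 : 0 <= w n.
  by have := w_mono 0%N n isT; rewrite /w u0 mul0r subr0.
rewrite ger0_norm // in hN.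
have h4 : n%:R * e q <= x / 4 * N%:R + n%:R * K.
  apply: (le_trans (ler_wpM2l (ltW nR) h3)).
  rewrite mulrDr lerD2r mulrA [_ * (_ / _ / _)]mulrC divfK ?gt_eqF //.
  by apply: ler_wpM2l; [exact/ltW/divr_gt0|rewrite ler_nat leq_div].
have hu : (sup A - x / 2) * n%:R < u n by rewrite -ltr_pdivlMr // [u n / _]mulrC.
have h5 : (sup A - x / 2 - k) * N%:R <= q%:R * w n + w n.
  have : 0 < w n - (sup A - x / 2 - k) * n%:R by rewrite /w; lra.
  have [h|h] := ltP 0 (sup A - x / 2 - k).
    by nra.
  by nra.
have : w N = u N - N%:R * k by [].
by nra.
Unshelve. all: by end_near.
Qed.

End RealSequences.

(** * The limit for negative orders and its variational lower bound *)

Section NegativeLimit.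
Variables (R : realType) (d : nat) (s : 'I_d -> R) (rho : 'M[R[i]]_d).
Hypothesis s_gt0 : forall i, 0 < s i.
Hypothesis s_sum : \sum_i s i = 1.
Hypothesis rho_pos : posdef rho.
Hypothesis rho_tr : \tr rho = 1.
Local Notation C := R[i].
Local Notation psi := (psi s rho).
Local Notation qn := (qn s rho).
Local Notation eigdata := (eigdata s rho).

Lemma psi_size0 a : psi 0 a = 0.
Proof.
have [E [xx [lab dat]]] := eigdata_exists s rho_pos 0.
have := sum_xx rho_tr dat; have := sum_lab s_sum dat.
rewrite /psi (qnE a dat).
have e (f : 'I_(tdim d 0) -> R) : \sum_i f i = f ord0 by exact: (big_ord1 _ f).
by rewrite !e => -> ->; rewrite !powR1 mulr1 ln1.
Qed.

Lemma tprod_ln_ge (f : 'I_d -> R) K : (forall i, 0 < f i) -> (forall i, - K <= ln (f i)) ->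
  forall n x, - (n%:R * K) <= ln (@tprod R d f n x).
Proof.
move=> f0 fK n x; rewrite /tprod ln_prod // -mulrN mulrC.
apply: le_trans (_ : \sum_(k < n) - K <= _); last by apply: ler_sum.
by rewrite sumr_const card_ord mulr_natr.
Qed.

(** All log-eigenvalues at size n are at most of order n: below by Jensen from one copy, above
    because the eigenvalues sum to 1. *)
Lemma data_bounds : exists2 K, 0 <= K & forall n E xx lab x, @eigdata n E xx lab ->
  (- (n%:R * K) <= ln (xx x) <= 0) /\ (- (n%:R * K) <= ln (lab x) <= 0).
Proof.
have [F [f [uF f0 ef]]] := rho_pos.
pose K := \sum_i `|ln (f i)| + \sum_i `|ln (s i)|.
have h1 (g : 'I_d -> R) i : - \sum_i `|ln (g i)| <= ln (g i).
  rewrite lerNl; apply: le_trans (_ : `|ln (g i)| <= _); first by rewrite ler_normr lexx orbT.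
  by rewrite (bigD1 i) //= lerDl sumr_ge0.
have fK i : - K <= ln (f i).
  by apply: le_trans (h1 f i); rewrite lerN2 lerDl sumr_ge0.
have sK i : - K <= ln (s i).
  by apply: le_trans (h1 s i); rewrite lerN2 lerDr sumr_ge0.
exists K => [|n E xx lab x dat]; first by rewrite addr_ge0 ?sumr_ge0.
have [uE x0 _ hb exx] := dat.
have le1 (g : 'I_(tdim d n) -> R) : (forall y, 0 < g y) -> \sum_y g y = 1 -> ln (g x) <= 0.
  move=> g0 g1; apply: ln_le0; rewrite -g1 (bigD1 x) //= lerDl sumr_ge0 // => y _.
  exact: ltW.
split; apply/andP; split.
- have uT := tpow_unitary n uF.
  have T0 y : 0 < @tprod R d f n y by exact: tprod_gt0.
  rewrite exx ef tpow_sp; apply: le_trans (qf_jensen_ln uT T0 (nv_row x uE)).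
  rewrite qf_sp -[leLHS]mulr1 -[X in _ * X](sum_wt_row x uT uE) mulr_sumr.
  by apply: ler_sum => y _; apply: ler_wpM2r; [exact: wt_ge0|exact: (tprod_ln_ge f0 fK)].
- by apply: le1 => //; exact: (sum_xx rho_tr dat).
- apply: (hbasis_lab (P := fun r => - (n%:R * K) <= ln r) x uE hb) => z.
  exact: (tprod_ln_ge s_gt0 sK).
- by apply: le1 => [y|]; [exact: (eigdata_lab s_gt0 y dat)|exact: (sum_lab s_sum dat)].
Qed.

Lemma psi_le_trp n a : a < 0 -> psi n a <= n%:R * ln (trp a (Ya s rho a)).
Proof.
move=> a0; have pY := Ya_posdef s_gt0 rho_pos a.
have d0 : (0 < d)%N by have := dim_gt0 s_sum 1; rewrite /= muln1.
have T0 := trp_gt0 a d0 pY.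
rewrite /psi mulr_natl -lnXn // ler_ln ?posrE ?exprn_gt0 ?(qn_gt0 s_gt0 s_sum rho_pos) //.
rewrite (qn_trp s_gt0 rho_pos n (ltr0_neq0 a0)) -(trp_tpow _ _ pY).
by apply: trp_pin_le; [exact: tpow_posdef|right; exact: ltW].
Qed.

Lemma neg_limit a : a < 0 ->
  exists l : R, (fun n => n%:R^-1 * psi n a) @ \oo --> l /\ forall n, psi n a <= n%:R * l.
Proof.
move=> a0; have [k hk] := psi_step s_gt0 s_sum rho_pos a0.
apply: (mul_step_cvg (U := ln (trp a (Ya s rho a))) (k := k)
  (e := fun m => ln ((m.+1 ^ (d * d))%:R)) (psi_size0 a)) => //.
- by move=> n; exact: psi_le_trp.
- by move=> n m; exact: (psi_mul s_gt0 s_sum rho_pos).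
- by move=> x x0; exact: ln_succ_le_affine.
Qed.

(** Divide by m, let m grow, then let x tend to 0. *)
Lemma archimedean_le0 (A B K : R) : 
  (forall x, 0 < x -> exists2 C, 0 <= C & forall m : nat, m%:R * A <= B * (x * m%:R + C)) ->
  0 <= B -> A <= 0.
Proof.
move=> h B0; rewrite leNgt; apply/negP => A0.
have x0 : 0 < A / 2 / (B + 1) by rewrite !divr_gt0 // ltr_wpDl.
have [C C0 hC] := h _ x0.
have [m hm] : exists m : nat, B * C / (A / 2) < m%:R.
  by exists (Num.bound (B * C / (A / 2))); apply: archi_boundP; rewrite divr_ge0 ?mulr_ge0 ?(ltW A0).
move: (hC m); rewrite ltr_pdivrMr in hm; last by rewrite divr_gt0.
suff : B * (A / 2 / (B + 1) * m%:R) <= A / 2 * m%:R by lra.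
rewrite mulrA; apply: ler_wpM2r => //.
by rewrite mulrA ler_pdivrMr ?ltr_wpDl //; nra.
Qed.

(** [star] divided by m as m grows, with [psi] at size n*m replaced by its linear upper bound. It
    holds for every weight [p], so the limit dominates the whole variational functional. *)
Lemma star_limit n E xx lab a l p F f : a < 0 -> @eigdata n E xx lab ->
  (forall m, psi m a <= m%:R * l) -> (forall x, 0 < p x) -> \sum_x p x = 1 ->
  marginals E p F f ->
  \sum_x p x * (a * ln (xx x) + (1 - a) * ln (lab x)) - \sum_j negent (f j) <= n%:R * l.
Proof.
move=> a0 dat hl p0 p1 mg; rewrite -subr_le0.
apply: (@archimedean_le0 _ n%:R 0) => // x x0.
have [K K0 hK] := ln_succ_le_affine (d * d) x0.
exists K => // m.
have uF j : F j \is unitarymx by have [] := mg j.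
have f0 j i : 0 < f j i by have [_ h] := mg j.
have ef j : ptr (@dig d n) j (sp E p) = sp (F j) (f j) by have [] := mg j.
have := star s_gt0 s_sum rho_pos m dat a0 p0 p1 uF f0 ef.
rewrite big_split /= sumr_const card_ord -mulr_sumr -mulr_natl => h.
have h1 := hl (n * m)%N; rewrite natrM in h1.
have h2 := ler_wpM2l (ler0n R n) (hK m).
move: h h1 h2; rewrite /negent; lra.
Qed.

End NegativeLimit.

(** * Strong convexity and continuity of the negative entropy *)

Section EntropyContinuity.
Variables (R : realType) (d : nat).
Local Notation C := R[i].
Implicit Types (E F : 'M[C]_d) (f : 'I_d -> R).

Lemma hsnZ (c : R) (A : 'M[C]_d) : hsn (c%:C *: A) = c ^+ 2 * hsn A.
Proof.
rewrite /hsn mulr_sumr; apply: eq_bigr => i _; rewrite mulr_sumr.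
by apply: eq_bigr => j _; rewrite mxE nsqZ.
Qed.

Lemma hsnBC (A B : 'M[C]_d) : hsn (A - B) = hsn (B - A).
Proof.
have -> : A - B = (-1)%:C *: (B - A) by rewrite rmorphN1 scaleN1r opprB.
by rewrite hsnZ sqrrN expr1n mul1r.
Qed.

Lemma hsn_sp0 E (a : 'I_d -> R) : E \is unitarymx -> hsn (sp E a) = \sum_i a i ^+ 2.
Proof.
move=> uE; rewrite hsnE sp_adj -/(retr _ _) (retr_self _ _ uE).
by apply: eq_bigr => i _; rewrite expr2.
Qed.

Lemma sp_half D (E : 'M[C]_D) (a b : 'I_D -> R) :
  sp E (fun x => 2^-1 * (a x + b x)) = (2^-1 : R)%:C *: (sp E a + sp E b).
Proof.
apply/matrixP => i j; rewrite spE [RHS]mxE [X in _ = _ * X]mxE 2!spE -big_split mulr_sumr.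
apply: eq_bigr => k _; rewrite rmorphM rmorphD -!mulrA; congr (_ * _).
by rewrite /= -mulrDl.
Qed.

Lemma retr_half (A B M : 'M[C]_d) :
  retr ((2^-1 : R)%:C *: (A + B)) M = 2^-1 * (retr A M + retr B M).
Proof. by rewrite -retrDl /retr -scalemxAl mxtraceZ ReM_real. Qed.

Lemma half_sub (A B : 'M[C]_d) :
  A - (2^-1 : R)%:C *: (A + B) = (2^-1 : R)%:C *: (A - B).
Proof.
have h : (2^-1 : R)%:C + (2^-1 : R)%:C = 1 :> C.
  by rewrite -rmorphD -[RHS](rmorph1 (real_complex R)); congr (_%:C); field.
rewrite -[X in X - _]scale1r -[X in X *: _ - _]h scalerDl scalerDr scalerBr opprD.
by rewrite addrACA subrr add0r.
Qed.

(** Klein from each endpoint to the midpoint, at distance half the difference; averaging turns the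
    two cross terms into the negative entropy of the midpoint. *)
Lemma entropy_gap F f F1 f1 F2 f2 :
  F \is unitarymx -> F1 \is unitarymx -> F2 \is unitarymx ->
  (forall i, 0 < f i <= 1) -> (forall i, 0 < f1 i <= 1) -> (forall i, 0 < f2 i <= 1) ->
  \sum_i f i = 1 -> \sum_i f1 i = 1 -> \sum_i f2 i = 1 ->
  sp F f = (2^-1 : R)%:C *: (sp F1 f1 + sp F2 f2) ->
  16^-1 * hsn (sp F1 f1 - sp F2 f2) <= 2^-1 * (negent f1 + negent f2) - negent f.
Proof.
move=> uF uF1 uF2 hf hf1 hf2 s0 s1 s2 e.
have k1 := klein uF1 uF hf1 hf (etrans s1 (esym s0)).
have k2 := klein uF2 uF hf2 hf (etrans s2 (esym s0)).
have e1 := half_sub (sp F1 f1) (sp F2 f2); rewrite -e in e1.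
have e2 := half_sub (sp F2 f2) (sp F1 f1); rewrite [sp F2 f2 + sp F1 f1]addrC -e in e2.
rewrite e1 hsnZ in k1; rewrite e2 hsnZ hsnBC in k2.
have : negent f = 2^-1 * (retr (sp F1 f1) (sp F (fun i => ln (f i))) +
    retr (sp F2 f2) (sp F (fun i => ln (f i)))).
  by rewrite -retr_half -e (retr_self _ _ uF).
move: k1 k2; rewrite -!/(negent _); set H := hsn _; set r1 := retr _ _; set r2 := retr _ _.
by lra.
Qed.

(** By Klein the difference is at most a trace pairing with ln of the second state, estimated by
    [retr_amgm]. *)
Lemma negent_le F1 f1 F2 f2 t Q : F1 \is unitarymx -> F2 \is unitarymx ->
  (forall i, 0 < f1 i <= 1) -> (forall i, 0 < f2 i <= 1) ->
  \sum_i f1 i = 1 -> \sum_i f2 i = 1 -> 0 < t ->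
  \sum_i ln (f2 i) ^+ 2 <= Q ->
  negent f2 - negent f1 <= 2^-1 * (t * hsn (sp F1 f1 - sp F2 f2) + Q / t).
Proof.
move=> uF1 uF2 hf1 hf2 s1 s2 t0 hQ.
have k := klein uF1 uF2 hf1 hf2 (etrans s1 (esym s2)).
have := retr_amgm (sp F2 f2 - sp F1 f1) t0 (sp_adj F2 (fun i => ln (f2 i))).
rewrite retrBl (retr_self _ _ uF2) (hsn_sp0 _ uF2) hsnBC => h.
have h1 := le_trans (ler_norm _) h.
have h2 : (\sum_i ln (f2 i) ^+ 2) / t <= Q / t by rewrite ler_pM2r ?invr_gt0.
have := hsn_ge0 (sp F1 f1 - sp F2 f2).
move: k h1 h2; rewrite /negent; set H := hsn _; set r := retr _ _.
set a := \sum_i _ * _; set b := \sum_i _ * _; set c := \sum_i _; set z := _ / t; set w := _ / t.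
by lra.
Qed.

Lemma avg_norm_le (I : finType) (p g : I -> R) B :
  (forall i, 0 <= p i) -> \sum_i p i = 1 -> (forall i, `|g i| <= B) ->
  `|\sum_i p i * g i| <= B.
Proof.
move=> p0 p1 gB; apply: le_trans (ler_norm_sum _ _ _) _.
rewrite -[leRHS]mul1r -p1 mulr_suml; apply: ler_sum => i _.
by rewrite normrM ger0_norm // ler_wpM2l.
Qed.

End EntropyContinuity.

(** * Near-maximisers with marginals bounded below *)

Section Mixture.
Variables (R : realType) (d : nat) (s : 'I_d -> R) (rho : 'M[R[i]]_d).
Hypothesis s_gt0 : forall i, 0 < s i.
Hypothesis s_sum : \sum_i s i = 1.
Hypothesis rho_pos : posdef rho.
Hypothesis rho_tr : \tr rho = 1.
Local Notation C := R[i].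
Local Notation psi := (psi s rho).
Local Notation slope := (slope s rho).
Variables (n : nat) (E : 'M[C]_(tdim d n)) (xx lab : 'I_(tdim d n) -> R).
Hypothesis dat : eigdata s rho E xx lab.
Variable K : R.
Hypothesis K_bd : forall x,
  (- (n%:R * K) <= ln (xx x) <= 0) /\ (- (n%:R * K) <= ln (lab x) <= 0).

Lemma slope_le a : `|slope xx lab a| <= n%:R * K.
Proof.
apply: avg_norm_le => [x||x]; first exact/ltW/(gbs_gt0 s_gt0 s_sum rho_pos a x dat).
  exact: (gbs_sum s_gt0 s_sum rho_pos a dat).
have [/andP[h1 h2] /andP[h3 h4]] := K_bd x.
by rewrite ler_norml; apply/andP; split; lra.
Qed.

(** The logarithm of a product state is a sum of local terms, so its mean depends on [p] only
    through the marginals. *)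
Lemma sum_lab_marginals p F f : marginals E p F f ->
  \sum_x p x * ln (lab x) = \sum_j retr (sp (F j) (f j)) (rdiag (fun i => ln (s i))).
Proof.
move=> mg; have [uE _ _ hb _] := dat.
have u1 D : (1%:M : 'M[C]_D) \is unitarymx by apply/unitarymxP; rewrite adj1 mulmx1.
have rd D (a : 'I_D -> R) : rdiag a = sp 1%:M a by rewrite spmxE adj1 mul1mx mulmx1.
rewrite -(retr_self p (fun x => ln (lab x)) uE) -(rdiag_hbasis (@ln R) uE hb).
have -> : rdiag (fun z => ln (tprod s z)) =
    \sum_j embed (@dig d n) j (rdiag (fun i => ln (s i))).
  rewrite (rdiag_eq (b := fun z => \sum_j ln (s (dig z j)))); last first.
    by move=> z; rewrite /tprod ln_prod.
  rewrite !rd sp_sum; apply: eq_bigr => j _.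
  rewrite (embed_sp (dig_bij d n) (F := fun=> 1%:M)) // ktens1 //; exact: dig_bij.
rewrite retrC retr_suml; apply: eq_bigr => j _.
have [_ _ <- _] := mg j.
by rewrite retr_embed retrC.
Qed.

Let u : R := d%:R^-1 ^+ n.

(** Gibbs weights mixed with the uniform weight [u] in proportion [e]. The mixture bounds the
    marginal eigenvalues below, so that their logarithms are controlled, while value and slope
    change by O(e n) only. *)
Lemma mixed_gibbs b l e : b < 0 -> (forall m, psi m b <= m%:R * l) -> 0 < e <= 1 ->
  exists p F f, [/\ (forall x, 0 < p x), \sum_x p x = 1, marginals E p F f &
   [/\ forall j i, e / d%:R <= f j i,
    psi n b - e * (n%:R * K * (1 - 2 * b)) <=
      \sum_x p x * (b * ln (xx x) + (1 - b) * ln (lab x)) - \sum_j negent (f j),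
    \sum_x p x * (b * ln (xx x) + (1 - b) * ln (lab x)) - \sum_j negent (f j) <= n%:R * l &
    `|\sum_x p x * (ln (xx x) - ln (lab x)) - slope xx lab b| <= 2 * e * (n%:R * K)]].
Proof.
move=> b0 hl /andP[e0 e1]; have [uE xx0 _ hb _] := dat.
have d0 : (0 < d)%N by have := dim_gt0 s_sum 1; rewrite /= muln1.
have dR : 0 < d%:R :> R by rewrite ltr0n.
have u0 : 0 < u by rewrite exprn_gt0 // invr_gt0.
have sumd : \sum_(i < d) d%:R^-1 = 1 :> R.
  by rewrite sumr_const card_ord -[LHS]mulr_natr mulVf // gt_eqF.
have u1 : \sum_(x < tdim d n) u = 1.
  transitivity (\sum_(x < tdim d n) \prod_(j < n) (fun (_ : 'I_n) (_ : 'I_d) => d%:R^-1 : R) j (dig x j)).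
    by apply: eq_bigr => x _; rewrite prodr_const card_ord.
  by rewrite (sum_kprod (dig_bij d n) (fun _ _ => d%:R^-1 : R)) big1.
pose g := gbs s rho xx lab b.
have g0 x : 0 < g x := gbs_gt0 s_gt0 s_sum rho_pos b x dat.
have g1 : \sum_x g x = 1 := gbs_sum s_gt0 s_sum rho_pos b dat.
pose p x := (1 - e) * g x + e * u.
have p0 x : 0 < p x by rewrite ltr_wpDl ?mulr_gt0 // mulr_ge0 ?subr_ge0 // ltW.
have p1 : \sum_x p x = 1.
  by rewrite big_split /= -!mulr_sumr g1 u1 !mulr1 subrK.
have sum_p (h : 'I_(tdim d n) -> R) :
    \sum_x p x * h x = (1 - e) * (\sum_x g x * h x) + e * (\sum_x u * h x).
  rewrite !mulr_sumr -big_split; apply: eq_bigr => x _ /=.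
  by rewrite /p mulrDl !mulrA.
have [F [f mg]] := marginals_exist dat p0.
exists p, F, f; split => //; split.
- move=> j i; have [uF _ ef _] := mg j.
  rewrite -(qf_row_sp (f j) i uF) -ef (qf_ptr (dig_bij d n) _ _ _ uF).
  have -> : e / d%:R = \sum_(y < tdim d n | dig y j == i) e * u.
    rewrite -mulr_sumr; congr (_ * _).
    transitivity (\sum_(y < tdim d n) (\prod_(h < n) (fun _ : 'I_d => d%:R^-1 : R) (dig y h)) *
        (dig y j == i)%:R).
      rewrite (sum_kprod_one (fun a => (a == i)%:R) j (dig_bij d n) sumd).
      rewrite (bigD1 i) //= eqxx mulr1 big1 ?addr0 // => a /negbTE ->.
      by rewrite mulr0.
    rewrite [RHS]big_mkcond; apply: eq_bigr => y _; rewrite prodr_const card_ord.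
    by case: eqP => _; rewrite ?mulr1 ?mulr0.
  apply: ler_sum => y _; rewrite qf_sp.
  have uK : ktens (@dig d n) (fun=> F j) \is unitarymx.
    by apply: ktens_unitary => //; exact: dig_bij.
  rewrite -[leLHS]mulr1 -[X in _ * X](sum_wt_row y uE uK) mulr_sumr.
  apply: ler_sum => x _; apply: ler_wpM2r; first exact: wt_ge0.
  by rewrite /p lerDr mulr_ge0 ?subr_ge0 // ltW.
- have sub := entropy_subadd dat p0 p1 mg.
  have gb := gibbs (fun x => ln (p x)) g0 g1.
  have e' : \sum_x expR (ln (p x)) = 1.
    by rewrite -[RHS]p1; apply: eq_bigr => x _; rewrite lnK ?posrE.
  rewrite e' ln1 in gb.
  (* The supporting line at b is evaluated at 0, where [psi n] vanishes. *)
  have ps : psi n b <= - b * (n%:R * K).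
    have := psi_support s_gt0 s_sum rho_pos b 0 dat.
    rewrite psi0 // sub0r => h; have := slope_le b.
    rewrite ler_norml => /andP[h1 h2]; nra.
  have lower : - ((1 - b) * (n%:R * K)) <=
      \sum_x u * (b * ln (xx x) + (1 - b) * ln (lab x) - ln (p x)).
    rewrite -[leLHS]mul1r -u1 mulr_suml; apply: ler_sum => x _.
    apply: ler_wpM2l; first exact: ltW.
    have [/andP[h1 h2] /andP[h3 h4]] := K_bd x.
    have lp : ln (p x) <= 0.
      apply: ln_le0; rewrite -p1 (bigD1 x) //= lerDl sumr_ge0 // => y _; exact: ltW.
    by nra.
  have gq := gibbs_eq s_gt0 s_sum rho_pos b dat.
  apply: le_trans (_ : \sum_x p x * (b * ln (xx x) + (1 - b) * ln (lab x) - ln (p x)) <= _).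
    rewrite sum_p.
    have -> : \sum_x g x * (b * ln (xx x) + (1 - b) * ln (lab x) - ln (p x)) =
        psi n b - \sum_x g x * (ln (p x) - ln (g x)).
      by rewrite gq -sumrB; apply: eq_bigr => x _; rewrite -/g; ring.
    move: gb lower ps; set A := \sum_x _; set B := \sum_x _; set P := psi n b.
    set nK := n%:R * K => gb lower ps.
    have := ler_wpM2l (ltW e0) lower; have := ler_wpM2l (ltW e0) ps.
    have := mulr_ge0_le0 (_ : 0 <= 1 - e) gb; rewrite subr_ge0 => /(_ e1).
    by nra.
  under eq_bigr do rewrite mulrBr.
  by rewrite sumrB lerD2l lerN2.
- exact: (star_limit s_gt0 s_sum rho_pos b0 dat hl p0 p1 mg).
- rewrite sum_p /slope -/g.
  have bd x : `|ln (xx x) - ln (lab x)| <= n%:R * K.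
    have [/andP[h1 h2] /andP[h3 h4]] := K_bd x.
    by rewrite ler_norml; apply/andP; split; lra.
  have := avg_norm_le (fun x => ltW (g0 x)) g1 bd.
  have := avg_norm_le (fun=> ltW u0) u1 bd.
  set A := \sum_x _; set B := \sum_x _; rewrite !ler_norml => /andP[a1 a2] /andP[b1 b2].
  by apply/andP; split; nra.
Qed.

End Mixture.

(** * Arithmetic of the second difference *)

Section SecondDifference.
Variable R : realType.

(** The scale is e = t^4. P, Pp, Pm are the values of [psi n] at a, a+e, a-e, and l, lp, lm the
    limits. B, L, X are means of ln xx, of ln lab, and marginal negative entropies for the two
    near-maximisers; S are slopes, H is the total squared distance of the marginals, and the X
    without suffix belongs to the midpoint. *)
Lemma second_difference_arith (a e t K D Q N H P Pp Pm l lp lm Bp Lp Xp Sp Bm Lm Xm Sm X : R) :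
  a < 0 -> 0 < t <= 1 -> e = t ^+ 4 -> 0 <= K -> 0 <= D -> 0 <= Q -> 0 < N -> 0 <= H ->
  N * (l - e * t) <= P -> N * (lp - e * t) <= Pp -> N * (lm - e * t) <= Pm ->
  P <= N * l ->
  `|Bp - Lp| <= N * K -> `|Bm - Lm| <= N * K ->
  `|Sp| <= N * K -> `|Sm| <= N * K ->
  2 * P <= Pp + Pm -> Pp - e * Sp <= P -> Pm + e * Sm <= P ->
  `|Pp - Pm| <= 2 * e * (N * K) ->
  Pp - e * (N * K * (1 - 2 * (a + e))) <= (a + e) * Bp + (1 - (a + e)) * Lp - Xp ->
  (a + e) * Bp + (1 - (a + e)) * Lp - Xp <= N * lp ->
  `|Bp - Lp - Sp| <= 2 * e * (N * K) ->
  Pm - e * (N * K * (1 - 2 * (a - e))) <= (a - e) * Bm + (1 - (a - e)) * Lm - Xm ->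
  (a - e) * Bm + (1 - (a - e)) * Lm - Xm <= N * lm ->
  `|Bm - Lm - Sm| <= 2 * e * (N * K) ->
  2^-1 * (a * (Bp + Bm) + (1 - a) * (Lp + Lm)) - X <= N * l ->
  16^-1 * H <= 2^-1 * (Xp + Xm) - X ->
  `|Xp - Xm| <= 2^-1 * (t ^- 3 * H + N * (D * t)) ->
  `|Lp - Lm| <= 2^-1 * (t ^- 3 * H + N * (Q * t)) ->
  forall C3 Cx Cl C5, C3 = 1 + K * (2 - 2 * a) ->
  Cx = 8 * C3 + D / 2 -> Cl = 8 * C3 + Q / 2 ->
  C5 = K * (7 - 2 * a) + 1 + (1 - a) * Cl + Cx ->
  lp + lm - 2 * l <= (C5 / (- a) + Cl + 4 * K + 2) * t * e.
Proof.
move=> a0 /andP[t0 t1] ee K0 D0 Q0 N0 H0 nl nlp nlm Pl BLp BLm hSp hSm conv sup1 sup2 lip.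
move=> m1 m2 m3 m1' m2' m3' mix gap ent lb C3 Cx Cl C5 eC3 eCx eCl eC5.
have e0 : 0 < e by rewrite ee exprn_gt0.
have et : e <= t by rewrite ee exprS ger_pMr // exprn_ile1 // ltW.
have e1 : e <= 1 := le_trans et t1.
have NK0 : 0 <= N * K by rewrite mulr_ge0 // ltW.
have C30 : 0 <= C3.
  by clear -eC3 K0 a0; rewrite eC3 addr_ge0 // mulr_ge0 //; lra.
(* The midpoint cannot exceed N l while both endpoints are nearly optimal, so the convexity gap, and
   with it H, is O(N e). *)
have hH : H <= 16 * N * e * C3.
  have := BLp; rewrite ler_norml => /andP[b1 b2].
  have := BLm; rewrite ler_norml => /andP[b3 b4].
  have h1 := ler_wpM2l (ltW e0) b2; have h2 := ler_wpM2l (ltW e0) b3.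
  have h3 : N * (e * t) <= N * e by rewrite ler_pM2l // ler_piMr // ltW.
  clear hSp hSm sup1 sup2 lip m3 m3' ent lb eCx eCl eC5; rewrite eC3; lra.
have hh : t ^- 3 * H <= 16 * N * t * C3.
  rewrite mulrC ler_pdivrMr ?exprn_gt0 //; apply: (le_trans hH).
  rewrite ee; apply: le_of_eq; ring.
have Nt0 : 0 <= N * t by rewrite mulr_ge0 // ltW.
have hX : `|Xp - Xm| <= N * t * Cx.
  apply: (le_trans ent); rewrite eCx; move: hh; clear; set z := _ * H; lra.
have hL : `|Lp - Lm| <= N * t * Cl.
  apply: (le_trans lb); rewrite eCl; move: hh; clear; set z := _ * H; lra.
have Net : N * e <= N * t by rewrite ler_pM2l.
have NKt : N * K * e <= N * K * t by rewrite ler_wpM2l.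
(* Both functionals are within O(N e) of Pp and Pm, which are themselves that close; as L and X are
   already compared, dividing by -a > 0 compares B. *)
have hB : - a * `|Bp - Bm| <= N * t * C5.
  have -> : - a * `|Bp - Bm| = `|a * (Bp - Bm)| by rewrite normrM ltr0_norm.
  have := lip; rewrite ler_norml => /andP[p1 p2].
  have := hX; rewrite ler_norml => /andP[x1 x2].
  have := hL; rewrite ler_norml => /andP[y1 y2].
  have a1 : 0 <= 1 - a by clear -a0; lra.
  have z1 := ler_wpM2l a1 y1; have z2 := ler_wpM2l a1 y2.
  have := BLp; rewrite ler_norml => /andP[b1 b2].
  have := BLm; rewrite ler_norml => /andP[b3 b4].
  have w1 := ler_wpM2l (ltW e0) b1; have w2 := ler_wpM2l (ltW e0) b2.
  have w3 := ler_wpM2l (ltW e0) b3; have w4 := ler_wpM2l (ltW e0) b4.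
  have h3 : N * (e * t) <= N * e by rewrite ler_pM2l // ler_piMr // ltW.
  have h4 : N * K * e * e <= N * K * e by rewrite ler_piMr // mulr_ge0 // ltW.
  have h5 : 0 <= N * K * t by rewrite mulr_ge0 // ltW.
  have h6 : 0 <= (- a) * (N * K * (t - e)).
    by rewrite mulr_ge0 ?oppr_ge0 ?(ltW a0) // mulr_ge0 // subr_ge0.
  have h7 : 0 <= N * K * e * e by rewrite !mulr_ge0 // ltW.
  clear nl Pl BLp BLm hSp hSm conv sup1 sup2 lip m3 m3' mix gap ent lb eC3 eCx eCl hH hh hX hL.
  by rewrite ler_norml; apply/andP; split; rewrite eC5; lra.
have hB' : `|Bp - Bm| <= N * t * (C5 / - a).
  by rewrite mulrA ler_pdivlMr ?oppr_gt0 // mulrC.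
have hS : Sp - Sm <= N * t * (C5 / (- a) + Cl + 4 * K).
  have := hB'; rewrite ler_norml => /andP[_ x2].
  have := hL; rewrite ler_norml => /andP[y1 _].
  have := m3; rewrite ler_norml => /andP[z1 z2].
  have := m3'; rewrite ler_norml => /andP[z3 z4].
  move: x2 y1 z1 z2 z3 z4 NKt; clear; set q := C5 / _; lra.
(* The supporting lines at a+e and a-e bound the second difference by e times the difference of
   slopes, which is O(N t). *)
have fin : N * (lp + lm - 2 * l) <= N * ((C5 / - a + Cl + 4 * K + 2) * t * e).
  have := ler_wpM2l (ltW e0) hS.
  move: nlp nlm sup1 sup2 Pl; clear; set q := C5 / - a + Cl + 4 * K; lra.
by move: fin; rewrite ler_pM2l.
Qed.

End SecondDifference.

(** * Second differences at negative orders *)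

Section NegativeDerivative.
Variables (R : realType) (d : nat) (s : 'I_d -> R) (rho : 'M[R[i]]_d).
Hypothesis s_gt0 : forall i, 0 < s i.
Hypothesis s_sum : \sum_i s i = 1.
Hypothesis rho_pos : posdef rho.
Hypothesis rho_tr : \tr rho = 1.
Local Notation C := R[i].
Local Notation psi := (psi s rho).

Lemma half_two : 2^-1 * (1 + 1) = 1 :> R.
Proof. by rewrite mulVf // pnatr_eq0. Qed.

Lemma marginals_gap n (E : 'M[C]_(tdim d n)) xx lab p1 F1 f1 p2 F2 f2 p F f :
  eigdata s rho E xx lab ->
  (forall x, p x = 2^-1 * (p1 x + p2 x)) ->
  \sum_x p1 x = 1 -> \sum_x p2 x = 1 ->
  marginals E p1 F1 f1 -> marginals E p2 F2 f2 -> marginals E p F f ->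
  16^-1 * \sum_j hsn (sp (F1 j) (f1 j) - sp (F2 j) (f2 j)) <=
  2^-1 * (\sum_j negent (f1 j) + \sum_j negent (f2 j)) - \sum_j negent (f j).
Proof.
move=> dat ep s1 s2 mg1 mg2 mg.
have sp1 : \sum_x p x = 1.
  by under eq_bigr do rewrite ep; rewrite -mulr_sumr big_split /= s1 s2 half_two.
rewrite -big_split /= 2!mulr_sumr -sumrB; apply: ler_sum => j _.
have le1 (h : 'I_d -> R) : (forall i, 0 < h i) -> \sum_i h i = 1 -> forall i, 0 < h i <= 1.
  move=> h0 h1 i; rewrite h0 -h1 (bigD1 i) //= lerDl sumr_ge0 // => k _; exact: ltW.
have [u1 g1 e1 r1] := mg1 j; have [u2 g2 e2 r2] := mg2 j; have [u0 g0 e0 r0] := mg j.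
have e : sp (F j) (f j) = (2^-1 : R)%:C *: (sp (F1 j) (f1 j) + sp (F2 j) (f2 j)).
  by rewrite -e0 (sp_eq E ep) sp_half ptrZ ptrD e1 e2.
have t1 := etrans r1 s1; have t2 := etrans r2 s2; have t0 := etrans r0 sp1.
exact: (entropy_gap u0 u1 u2 (le1 _ g0 t0) (le1 _ g1 t1) (le1 _ g2 t2) t0 t1 t2 e).
Qed.

Lemma sqr_ln_bound (D t y : R) : 1 <= D -> 0 < t <= 1 -> t ^+ 4 / D <= y -> y <= 1 ->
  ln y ^+ 2 <= ((D + 4) / t) ^+ 2.
Proof.
move=> D1 /andP[t0 t1] hy y1.
have D0 : 0 < D by exact: lt_le_trans D1.
have y0 : 0 < y by apply: lt_le_trans hy; rewrite divr_gt0 ?exprn_gt0.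
have h1 : ln (t ^+ 4 / D) <= ln y by rewrite ler_ln ?posrE ?divr_gt0 ?exprn_gt0.
rewrite ln_div ?posrE ?exprn_gt0 // lnXn // in h1.
have h2 : ln (t^-1) < t^-1 by rewrite ln_sublinear // invr_gt0.
rewrite lnV ?posrE // in h2.
have h3 : ln D < D by exact: ln_sublinear.
have h4 : ln y <= 0 by exact: ln_le0.
have h5 : D <= D / t by rewrite ler_pdivlMr // ger_pMr.
rewrite -[ln y ^+ 2]sqrrN; apply: lerXn2r; rewrite ?nnegrE ?oppr_ge0 //.
  by rewrite divr_ge0 // ?ltW // addr_gt0.
rewrite mulrDl; move: h1; rewrite -mulr_natl; lra.
Qed.

Lemma abs_diff_le (k x y : R) : - k <= x <= 0 -> - k <= y <= 0 -> `|x - y| <= k.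
Proof.
by move=> /andP[h1 h2] /andP[h3 h4]; rewrite ler_norml; apply/andP; split; lra.
Qed.

Lemma three_points (a e P Pp Pm S : R) :
  P + (a + e - a) * S <= Pp -> P + (a - e - a) * S <= Pm -> 2 * P <= Pp + Pm.
Proof. lra. Qed.

Lemma two_slopes (a e k Pp Pm Sp Sm : R) : 0 < e -> `|Sp| <= k -> `|Sm| <= k ->
  Pp + (a - e - (a + e)) * Sp <= Pm -> Pm + (a + e - (a - e)) * Sm <= Pp ->
  `|Pp - Pm| <= 2 * e * k.
Proof.
move=> e0; rewrite !ler_norml => /andP[b1 b2] /andP[b3 b4] h1 h2.
by apply/andP; split; nra.
Qed.

Lemma avg_sum_norm (n : nat) (A B : 'I_n -> R) (k : R) (t : R) :
  (forall j, `|A j| <= 2^-1 * (t * B j + k)) ->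
  `|\sum_j A j| <= 2^-1 * (t * \sum_j B j + n%:R * k).
Proof.
move=> h; apply: le_trans (ler_norm_sum _ _ _) _.
apply: le_trans (ler_sum _ (fun j _ => h j)) _.
by rewrite -mulr_sumr big_split /= -mulr_sumr sumr_const card_ord -[X in _ * (_ + X)]mulr_natl.
Qed.

(** Near-maximisers at a+e and a-e, with e = t^4, are averaged into a competitor at a; the resulting
    inequalities feed [second_difference_arith]. *)
Lemma neg_second_difference a : a < 0 -> exists M t0 : R, 0 < t0 /\
  forall t l lp lm : R, 0 < t <= t0 ->
   (fun n => n%:R^-1 * psi n a) @ \oo --> l ->
   (fun n => n%:R^-1 * psi n (a + t ^+ 4)) @ \oo --> lp ->
   (fun n => n%:R^-1 * psi n (a - t ^+ 4)) @ \oo --> lm ->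
   lp + lm - 2 * l <= M * t * t ^+ 4.
Proof.
move=> a0; have [K K0 hK] := data_bounds s_gt0 s_sum rho_pos rho_tr.
have d0 : (0 < d)%N by have := dim_gt0 s_sum 1; rewrite /= muln1.
have d1 : 1 <= d%:R :> R by rewrite ler1n.
pose D : R := d%:R * (d%:R + 4) ^+ 2.
pose Q : R := hsn (rdiag (fun i => ln (s i)) : 'M[C]_d).
pose C3 := 1 + K * (2 - 2 * a).
pose Cx := 8 * C3 + D / 2.
pose Cl := 8 * C3 + Q / 2.
pose C5 := K * (7 - 2 * a) + 1 + (1 - a) * Cl + Cx.
exists (C5 / (- a) + Cl + 4 * K + 2), (Num.min 1 (- a / 2)); split.
  by rewrite lt_min ltr01 /= divr_gt0 // oppr_gt0.
move=> t l lp lm /andP[t0]; rewrite le_min => /andP[t1 ta] cl clp clm.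
have ht : 0 < t <= 1 by rewrite t0.
(* The marginal eigenvalues are at least e/d, so squared logarithms are O(1/t^2). With parameter
   t^-3 in [retr_amgm] both t^-3 e and t^3 t^-2 equal t. *)
pose e := t ^+ 4.
have e0 : 0 < e by rewrite exprn_gt0.
have et : e <= t by rewrite /e exprS ger_pMr // exprn_ile1 // ltW.
have e1 : 0 < e <= 1 by rewrite e0 (le_trans et).
have ap : a + e < 0 by lra.
have am : a - e < 0 by lra.
have uniq b (x : R) : b < 0 -> (fun n => n%:R^-1 * psi n b) @ \oo --> x ->
    forall m, psi m b <= m%:R * x.
  move=> b0 cx; have [y [cy hy]] := neg_limit s_gt0 s_sum rho_pos rho_tr b0.
  by rewrite (cvg_unique _ cx cy).
have ul := uniq _ _ a0 cl; have ulp := uniq _ _ ap clp; have ulm := uniq _ _ am clm.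
have low b (x : R) : (fun n => n%:R^-1 * psi n b) @ \oo --> x ->
    \forall n \near \oo, x - e * t <= n%:R^-1 * psi n b.
  move=> /cvgrPdist_le /(_ (e * t)); rewrite mulr_gt0 // => /(_ isT).
  apply: filterS => n; rewrite ler_norml => /andP[_ h]; lra.
(* One size n, chosen after t, at which all three values are within e t of their limits from
   below. *)
have [n [[n0 nl] [nlp nlm]]] := filter_ex (filterI (filterI (nbhs_infty_gt 0) (low _ _ cl))
  (filterI (low _ _ clp) (low _ _ clm))).
have nR : 0 < n%:R :> R by rewrite ltr0n.
have scale (x y : R) : x <= n%:R^-1 * y -> n%:R * x <= y.
  by rewrite -[x <= _](ler_pM2l nR) mulVKf ?gt_eqF.
have [E [xx [lab dat]]] := eigdata_exists s rho_pos n.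
have Kb x := hK n E xx lab x dat.
have [p1 [F1 [f1 [q1 s1 mg1 [lo1 m1 m2 m3]]]]] :=
  mixed_gibbs s_gt0 s_sum rho_pos dat Kb ap ulp e1.
have [p2 [F2 [f2 [q2 s2 mg2 [lo2 m1' m2' m3']]]]] :=
  mixed_gibbs s_gt0 s_sum rho_pos dat Kb am ulm e1.
pose p x := 2^-1 * (p1 x + p2 x).
have q0 x : 0 < p x by rewrite mulr_gt0 ?addr_gt0.
have s0 : \sum_x p x = 1 by rewrite -mulr_sumr big_split /= s1 s2 half_two.
have [F [f mg]] := marginals_exist dat q0.
have gap := marginals_gap (p := p) dat (fun=> erefl) s1 s2 mg1 mg2 mg.
have mix := star_limit s_gt0 s_sum rho_pos a0 dat ul q0 s0 mg.
pose Bp := \sum_x p1 x * ln (xx x); pose Lp := \sum_x p1 x * ln (lab x).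
pose Bm := \sum_x p2 x * ln (xx x); pose Lm := \sum_x p2 x * ln (lab x).
have split_k (r : 'I_(tdim d n) -> R) (b : R) :
    \sum_x r x * (b * ln (xx x) + (1 - b) * ln (lab x)) =
    b * (\sum_x r x * ln (xx x)) + (1 - b) * \sum_x r x * ln (lab x).
  by rewrite !mulr_sumr -big_split; apply: eq_bigr => x _ /=; ring.
have split_B (r : 'I_(tdim d n) -> R) : \sum_x r x * (ln (xx x) - ln (lab x)) =
    \sum_x r x * ln (xx x) - \sum_x r x * ln (lab x).
  by rewrite -sumrB; apply: eq_bigr => x _; ring.
have bd x : `|ln (xx x) - ln (lab x)| <= n%:R * K.
  by have [h1 h2] := Kb x; exact: abs_diff_le.
rewrite split_k -/Bp -/Lp in m1 m2; rewrite split_k -/Bm -/Lm in m1' m2'.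
rewrite split_B -/Bp -/Lp in m3; rewrite split_B -/Bm -/Lm in m3'.
have sup b b' := psi_support s_gt0 s_sum rho_pos b b' dat.
have sl b := slope_le s_gt0 s_sum rho_pos dat Kb b.
have tn j i : (0 < f1 j i) /\ f1 j i <= 1.
  have [_ h _ h1] := mg1 j; split => //; rewrite -s1 -h1 (bigD1 i) //= lerDl sumr_ge0 // => k _.
  exact: ltW.
have tn' j i : (0 < f2 j i) /\ f2 j i <= 1.
  have [_ h _ h1] := mg2 j; split => //; rewrite -s2 -h1 (bigD1 i) //= lerDl sumr_ge0 // => k _.
  exact: ltW.
have t30 : 0 < t ^- 3 by rewrite invr_gt0 exprn_gt0.
have sq g : (forall i : 'I_d, e / d%:R <= g i) -> (forall i, g i <= 1) ->
    \sum_i ln (g i) ^+ 2 <= d%:R * ((d%:R + 4) / t) ^+ 2.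
  move=> g1 g2; apply: le_trans (_ : \sum_(i < d) ((d%:R + 4) / t) ^+ 2 <= _).
    by apply: ler_sum => i _; apply: sqr_ln_bound.
  by rewrite sumr_const card_ord mulr_natl.
have DT : d%:R * ((d%:R + 4) / t) ^+ 2 / t ^- 3 = D * t.
  by rewrite /D; field; rewrite gt_eqF.
pose H : R := \sum_j hsn (sp (F1 j) (f1 j) - sp (F2 j) (f2 j)).
have H0 : 0 <= H by apply: sumr_ge0 => j _; exact: hsn_ge0.
have ent : `|\sum_j negent (f1 j) - \sum_j negent (f2 j)| <= 2^-1 * (t ^- 3 * H + n%:R * (D * t)).
  rewrite -sumrB; apply: avg_sum_norm => j.
  have [u1 _ _ r1] := mg1 j; have [u2 _ _ r2] := mg2 j.
  have h1 := negent_le u1 u2 (fun i => introT andP (tn j i)) (fun i => introT andP (tn' j i))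
    (etrans r1 s1) (etrans r2 s2) t30 (sq _ (lo2 j) (fun i => (tn' j i).2)).
  have h2 := negent_le u2 u1 (fun i => introT andP (tn' j i)) (fun i => introT andP (tn j i))
    (etrans r2 s2) (etrans r1 s1) t30 (sq _ (lo1 j) (fun i => (tn j i).2)).
  rewrite DT in h1; rewrite DT hsnBC in h2.
  rewrite ler_norml; apply/andP; split; last exact: h2.
  by rewrite -lerN2 opprK opprB.
have lb : `|Lp - Lm| <= 2^-1 * (t ^- 3 * H + n%:R * (Q * t)).
  rewrite /Lp /Lm (sum_lab_marginals s_gt0 dat mg1) (sum_lab_marginals s_gt0 dat mg2) -sumrB.
  apply: avg_sum_norm => j; rewrite -retrBl.
  apply: le_trans (retr_amgm _ t30 (rdiag_adj _)) _.
  rewrite ler_pM2l ?invr_gt0 ?ltr0n // lerD2l -/Q invrK.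
  apply: ler_wpM2l; first exact: hsn_ge0.
  by rewrite exprS ger_pMr // exprn_ile1 // ltW.
have absB r : (forall x, 0 < r x) -> \sum_x r x = 1 ->
    `|\sum_x r x * ln (xx x) - \sum_x r x * ln (lab x)| <= n%:R * K.
  by move=> r0 r1; rewrite -split_B; apply: avg_norm_le => // x; exact: ltW.
have eX : \sum_x p x * (a * ln (xx x) + (1 - a) * ln (lab x)) =
    2^-1 * (a * (Bp + Bm) + (1 - a) * (Lp + Lm)).
  rewrite /Bp /Bm /Lp /Lm -!big_split /= 2!mulr_sumr -big_split mulr_sumr.
  by apply: eq_bigr => x _; rewrite /p /=; ring.
rewrite eX in mix.
have D0 : 0 <= D by rewrite mulr_ge0 // sqr_ge0.
have sup1 : psi n (a + e) - e * slope s rho xx lab (a + e) <= psi n a.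
  by have := sup (a + e) a; rewrite opprD addNKr mulNr.
have sup2 : psi n (a - e) + e * slope s rho xx lab (a - e) <= psi n a.
  by have := sup (a - e) a; rewrite opprB addrCA subrr addr0.
have h := second_difference_arith a0 ht (erefl e) K0 D0 (hsn_ge0 _ : 0 <= Q) nR H0
  (scale _ _ nl) (scale _ _ nlp) (scale _ _ nlm) (ul n) (absB _ q1 s1) (absB _ q2 s2)
  (sl (a + e)) (sl (a - e)) (three_points (sup a (a + e)) (sup a (a - e))) sup1 sup2
  (two_slopes e0 (sl _) (sl _) (sup (a + e) (a - e)) (sup (a - e) (a + e)))
  m1 m2 m3 m1' m2' m3' mix gap ent lb.
exact: (h C3 Cx Cl C5 erefl erefl erefl erefl).
Qed.

End NegativeDerivative.

(** * Triangular factorisation adapted to sigma *)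

Section AdaptedBasis.
Variables (R : realType) (d : nat).
Local Notation C := R[i].
Implicit Types (s : 'I_d -> R) (rho G : 'M[C]_d).

(* The factor [G] is triangular for the order of the eigenvalues [s] of sigma. *)
Definition adapted s rho G (del : 'I_d -> R) :=
  [/\ rho = G *m G^t*, (forall i j, G i j != 0 -> s i <= s j), (forall i, 0 < del i) &
      pin s G *m (pin s G)^t* = rdiag del].

Lemma decreasing_perm s : exists p : 'S_d, forall i j : 'I_d, (i <= j)%N -> s (p j) <= s (p i).
Proof.
pose t := [tuple s i | i < d].
pose r := [rel x y : R | y <= x].
have /tuple_permP[p hp] : perm_eq (sort r t) t by rewrite perm_sort.
exists p => i j ij.
have e k : nth 0 (sort r t) k = nth 0 [tuple tnth t (p i) | i < d] k by rewrite hp.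
have e' (k : 'I_d) : nth 0 (sort r t) k = s (p k).
  by rewrite e -tnth_nth !tnth_mktuple.
have tot : total r by move=> x y /=; exact: le_total.
have tr : transitive r by move=> y x z /= yx zy; exact: le_trans zy yx.
have sz : size (sort r t) = d by rewrite size_sort size_tuple.
rewrite -!e'; apply: (sorted_leq_nth tr _ 0 (sort_sorted tot t)) => //.
- by move=> x /=.
- by rewrite inE sz.
- by rewrite inE sz.
Qed.

(** Cholesky factorisation, obtained from Gram-Schmidt applied to the rows of a square root factor
    of rho. *)
Lemma triangular_factor rho : posdef rho ->
  exists2 G, rho = G *m G^t* & forall i j : 'I_d, G i j != 0 -> (j <= i)%N.
Proof.
move=> [F [f [uF f0 ->]]].
pose A : 'M[C]_d := F^t* *m rdiag (fun i => Num.sqrt (f i)).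
have uU : schmidt A \is unitarymx by exact: schmidt_unitarymx.
set U := schmidt A in uU; exists (A *m U^t*).
  rewrite adjM adjK mulmxA -[A *m _ *m U]mulmxA (unitary_adjl uU) mulmx1.
  rewrite /A adjM adjK rdiag_adj mulmxA -[_ *m _ *m rdiag _]mulmxA rdiagM spmxE.
  congr (_ *m _ *m _); apply: rdiag_eq => i.
  by rewrite -expr2 sqr_sqrtr // ltW.
move=> i j; rewrite leqNgt; apply: contraNN => ij.
have : (row i A <= kermx ((row j U)^t*))%MS.
  apply: submx_trans (row_schmidt_sub A i) _; apply/sumsmx_subP => k ki.
  rewrite genmxE; apply/sub_kermxP/matrixP => a b; rewrite !ord1 -/U.
  have := unitary_adjr uU => /matrixP /(_ k j); rewrite !mxE => h.
  have kj : (k == j) = false by apply/negbTE; rewrite -val_eqE neq_ltn (leq_ltn_trans ki ij).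
  rewrite kj in h; rewrite -[RHS]h; apply: eq_bigr => l _; rewrite !mxE //.
move=> /sub_kermxP /matrixP /(_ 0 0); rewrite !mxE => h; apply/eqP.
by rewrite -[RHS]h; apply: eq_bigr => l _; rewrite !mxE.
Qed.

Lemma adapted_exists rho sigma : posdef rho -> posdef sigma -> exists E s G del,
  [/\ E \is unitarymx, (forall i, 0 < s i), sigma = sp E s &
      adapted s (E *m rho *m E^t*) G del].
Proof.
move=> pr [F0 [s0 [uF0 s00 esig]]].
have [p hp] := decreasing_perm s0.
pose F : 'M[C]_d := row_perm p F0; pose s i := s0 (p i).
have uF : F \is unitarymx.
  apply/unitarymxP/matrixP => i j.
  have := unitary_adjr uF0 => /matrixP /(_ (p i) (p j)); rewrite !mxE (inj_eq perm_inj) => <-.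
  by apply: eq_bigr => k _; rewrite !mxE.
have eF : sigma = sp F s.
  rewrite esig; apply/matrixP => i j; rewrite !spE (reindex_inj (@perm_inj _ p)) /=.
  by apply: eq_bigr => k _; rewrite !mxE.
have pr' : posdef (F *m rho *m F^t*).
  apply: posdef_conj => //; exact: unitarymx_unit.
have [T eT trT] := triangular_factor pr'.
have sT i j : T i j != 0 -> s i <= s j by move=> /trT ji; exact: hp.
pose B := pin s T.
have uT : T \in unitmx.
  by have := posdef_unit pr'; rewrite eT unitmx_mul => /andP[].
have uB : B \in unitmx.
  have trig (M : 'M[C]_d) : (forall i j : 'I_d, M i j != 0 -> (j <= i)%N) -> is_trig_mx M.
    move=> h; apply/is_trig_mxP => i j ij; apply/eqP.
    by apply: contraTT ij => /h; rewrite -leqNgt.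
  move: uT; rewrite !unitmxE (det_trig (trig _ trT)) det_trig; last first.
    by apply: trig => i j; rewrite mxE; case: ifP => // _; [exact: trT|rewrite eqxx].
  by congr (_ \is a GRing.unit); apply: eq_bigr => i _; rewrite [RHS]mxE eqxx.
have pB : posdef (B *m B^t*).
  rewrite -[B in B *m _]mulmx1; apply: posdef_conj => //.
  have u1 : (1%:M : 'M[C]_d) \is unitarymx by apply/unitarymxP; rewrite adj1 mulmx1.
  by rewrite -(sp1 u1); apply: posdef_sp.
have cB : B *m rdiag s = rdiag s *m B.
  apply/matrixP => i j; rewrite mul_mx_rdiagE mul_rdiagE mulrC mxE.
  by case: eqP => [->|_] //; rewrite !mulr0.
have cB' : rdiag s *m B^t* = B^t* *m rdiag s.
  by have := congr1 (fun M => M^t*) cB; rewrite /= !adjM rdiag_adj.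
have cBB : B *m B^t* *m rdiag s = rdiag s *m (B *m B^t*).
  by rewrite -mulmxA -cB' mulmxA cB mulmxA.
(* A further rotation inside the eigenspaces of sigma diagonalises the block-diagonal part times its
   adjoint, and preserves block triangularity. *)
have [W [del [b [uW eW eb]]]] := joint_spectral (posdef_herm pB) (rdiag_adj s) cBB.
have WE i k : W i k != 0 -> b i = s k.
  have : W *m rdiag s = rdiag b *m W.
    by rewrite eb spmxE !mulmxA (unitary_adjr uW) mul1mx.
  move=> /matrixP /(_ i k); rewrite mul_mx_rdiagE mul_rdiagE mulrC => h Wik.
  by have /complexI := mulIf Wik h.
have cWB (M : 'M[C]_d) i j : (W *m M *m W^t*) i j =
    \sum_k \sum_l W i k * M k l * (W j l)^*%R.
  rewrite mxE exchange_big /=; apply: eq_bigr => l _; rewrite mxE mulr_suml.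
  by apply: eq_bigr => k _; rewrite !mxE.
have pinW : pin b (W *m T *m W^t*) = W *m B *m W^t*.
  apply/matrixP => i j; rewrite mxE !cWB.
  case: eqP => [bij|bij]; last first.
    rewrite big1 // => k _; rewrite big1 // => l _.
    have [->|Wi] := eqVneq (W i k) 0; first by rewrite !mul0r.
    have [->|Wj] := eqVneq (W j l) 0; first by rewrite conjC0 !mulr0.
    rewrite mxE -(WE _ _ Wi) -(WE _ _ Wj); case: eqP => [//|_].
    by rewrite mulr0 mul0r.
  apply: eq_bigr => k _; apply: eq_bigr => l _.
  have [->|Wi] := eqVneq (W i k) 0; first by rewrite !mul0r.
  have [->|Wj] := eqVneq (W j l) 0; first by rewrite conjC0 !mulr0.
  by rewrite [B _ _]mxE -(WE _ _ Wi) -(WE _ _ Wj) bij eqxx.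
have eGG (M N : 'M[C]_d) : W *m M *m W^t* *m (W *m N *m W^t*)^t* = W *m (M *m N^t*) *m W^t*.
  rewrite !adjM adjK !mulmxA; congr (_ *m _).
  by rewrite -[_ *m W^t* *m W]mulmxA (unitary_adjl uW) mulmx1.
exists (W *m F), b, (W *m T *m W^t*), del; split.
- by apply/unitarymxP; rewrite adjM mulmxA -[_ *m F *m _]mulmxA (unitary_adjr uF) mulmx1 unitary_adjr.
- move=> i; have [k Wik] : exists k, W i k != 0.
    apply/existsP; rewrite -[[exists k, _]]negbK negb_exists; apply/negP => /forallP h.
    have := nv_row i uW; rewrite /nv big1 => [|k _]; first by move/eqP; rewrite eq_sym oner_eq0.
    by have := h k; rewrite negbK mxE => /eqP ->; rewrite nsq0.
  by rewrite (WE i k Wik) s00.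
- by rewrite eF spmxE eb !spmxE adjM !mulmxA.
split.
- by rewrite eGG -eT adjM !mulmxA.
- move=> i j; rewrite cWB => h.
  have [k [l [Wi Tkl Wj]]] : exists k l, [/\ W i k != 0, T k l != 0 & W j l != 0].
    apply: contrapT => nh; move/eqP: h; apply; rewrite big1 // => k _; rewrite big1 // => l _.
    have [->|Wi] := eqVneq (W i k) 0; first by rewrite !mul0r.
    have [->|Wj] := eqVneq (W j l) 0; first by rewrite conjC0 !mulr0.
    have [->|Tkl] := eqVneq (T k l) 0; first by rewrite mulr0 mul0r.
    by case: nh; exists k, l.
  by rewrite (WE _ _ Wi) (WE _ _ Wj) sT.
- move=> i; rewrite -(qf_row_sp del i uW) -eW; apply: posdef_qf => //.
  by rewrite -nv_eq0 nv_row ?oner_eq0.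
- rewrite pinW eGG -/B eW spmxE !mulmxA (unitary_adjr uW) mul1mx.
  by rewrite -mulmxA (unitary_adjr uW) mulmx1.
Qed.

End AdaptedBasis.

(** * Upper bounds near order 0 *)

Section NearZeroUpper.
Variables (R : realType) (d : nat) (s : 'I_d -> R) (rho : 'M[R[i]]_d).
Hypothesis s_gt0 : forall i, 0 < s i.
Hypothesis s_sum : \sum_i s i = 1.
Hypothesis rho_pos : posdef rho.
Local Notation C := R[i].
Local Notation tw w := (rdiag w *m rho *m rdiag w).

Lemma qf_rdiag_homog D (k : 'I_D -> R) (E : 'M[C]_D) lab (A : 'M[C]_D) (f : R -> R) y :
  hbasis k E lab ->
  qf (rdiag (fun z => f (k z)) *m A *m rdiag (fun z => f (k z))) (row y E) =
  f (lab y) ^+ 2 * qf A (row y E).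
Proof.
move=> hb; have e := qf_conj A (rdiag (fun z => f (k z))) (row y E).
by rewrite rdiag_adj (row_homog f y hb) qfZv in e.
Qed.

(** Concavity of x^b moves the power outside the expectation in a basis adapted to types; there the
    weights [th] are constant and can be absorbed, leaving a pinched power trace. *)
Lemma retr_pow_le n E xx lab (th : 'I_d -> R) b : eigdata s rho (n := n) E xx lab ->
  (forall i, 0 < th i) -> 0 < b <= 1 ->
  retr (sp E (fun x => xx x `^ b)) (rdiag (@tprod R d th n)) <=
  (n.+1 ^ d)%:R * trp b (tw (fun i => th i `^ (2 * b)^-1)) ^+ n.
Proof.
move=> dat th0 /andP[b0 b1]; have [uE xx0 eX hb _] := dat.
set A := tw _.
have pA : posdef A by apply: posdef_rdiag_conj => // i; rewrite powR_gt0.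
(* Types refine the level sets of both products, so these vectors are homogeneous for both. *)
have [F [a [l [uF a0 eF hF ea]]]] := pin_basis (@cnt d n) (tpow_posdef n pA).
pose tc (t : {ffun 'I_d -> 'I_n.+1}) := \prod_i th i ^+ t i.
have hT : hbasis (@tprod R d th n) F (fun y => tc (l y)).
  by move=> y z /hF <-; exact: tprod_cnt.
have hS : homog (@tprod R d s n) (row _ F).
  by move=> y i j hi hj; rewrite !tprod_cnt (hbasis_homog (x := y) hF hi hj).
have T0 y : 0 < tc (l y) by apply: prodr_gt0 => i _; rewrite exprn_gt0.
rewrite (rdiag_hbasis id uF hT) retrC (retr_spl _ _ uF).
apply: (@le_trans _ _ (\sum_y a y `^ b)); last first.
  rewrite -(trp_sp _ _ uF) -eF.
  apply: le_trans (trp_pin_le_card _ (tpow_posdef n pA) (ltW b0)) _.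
  rewrite (trp_tpow _ _ pA); apply: ler_wpM2r; first by apply: exprn_ge0; exact: trp_ge0.
  by rewrite ler_nat size_labels_cnt.
apply: ler_sum => y _.
have jen : qf (sp E (fun x => xx x `^ b)) (row y F) <= qf (sp E xx) (row y F) `^ b.
  have hb1 : 0 <= b <= 1 by rewrite (ltW b0).
  have e : qf (sp E ((fun r => - r `^ b) \o xx)) (row y F) =
      - qf (sp E (fun x => xx x `^ b)) (row y F).
    rewrite (sp_eq E (a := (fun r => - r `^ b) \o xx) (b := fun x => -1 * xx x `^ b)) => [|x].
      by apply: etrans (qf_scale_sp _ _ _ _) _; exact: mulN1r.
    by rewrite /= mulN1r.
  have h := qf_jensen (tangent_powRN hb1) uE xx0 (nv_row y uF).
  by rewrite -lerN2; exact: (le_trans h (le_of_eq e)).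
have qX : qf (sp E xx) (row y F) = qf (tpow rho n) (row y F).
  by rewrite -eX; exact: qf_pin_homog (hS y).
have qA : a y = tc (l y) `^ b^-1 * qf (tpow rho n) (row y F).
  rewrite ea /A 2!tpowM !tpow_rdiag.
  rewrite (rdiag_eq (b := fun z => tprod th z `^ (2 * b)^-1)); last first.
    by move=> z; rewrite tprod_powR.
  rewrite (qf_rdiag_homog _ (fun r => r `^ (2 * b)^-1) _ hT); congr (_ * _).
  rewrite -powR_mulrn ?powR_ge0 // -powRrM; congr (_ `^ _); field.
  exact: lt0r_neq0.
rewrite qA powRM ?powR_ge0 ?posdef_qf_ge0 //; last exact: tpow_posdef.
rewrite -powRrM mulVf ?lt0r_neq0 // powRr1 ?(ltW (T0 y)) //.
by apply: ler_wpM2l; [exact: ltW|rewrite -qX].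
Qed.

Variables (G : 'M[C]_d) (del : 'I_d -> R).
Hypothesis adp : adapted s rho G del.
Local Notation B := (pin s G).

Lemma qf_adj_mul m (A : 'M[C]_m) v : qf (A *m A^t*) v = nv (v *m A).
Proof. by rewrite nv_qf1 -qf_conj mulmx1. Qed.

Lemma nv_add_le (v w : 'rV[C]_d) (e : R) : 0 < e ->
  nv (v + w) <= (1 + e) * nv v + (1 + e^-1) * nv w.
Proof.
move=> e0; rewrite /nv !mulr_sumr -big_split; apply: ler_sum => i _; rewrite !mxE /=.
case: (v 0 i) (w 0 i) => z1 z2 [w1 w2]; rewrite /nsq /= -subr_ge0.
rewrite (_ : _ - _ = e^-1 * ((e * z1 - w1) ^+ 2 + (e * z2 - w2) ^+ 2)).
  by rewrite mulr_ge0 ?invr_ge0 ?(ltW e0) // addr_ge0 // sqr_ge0.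
by field; rewrite gt_eqF.
Qed.

Lemma nv_mul_le (v : 'rV[C]_d) (L : 'M[C]_d) : nv (v *m L) <= hsn L * nv v.
Proof.
rewrite /hsn exchange_big mulr_suml; apply: ler_sum => j _.
rewrite mxE mulrC; exact: nsq_cauchy_schwarz.
Qed.

(** Replacing the factor [G] by its block-diagonal part multiplies vectors by 1 + L. If L has
    Hilbert-Schmidt norm at most [e], quadratic forms grow by at most (1 + e)^2. *)
Lemma trp_adapted_le t e b : (forall i, 0 < t i) -> 0 < e -> 0 <= b ->
  (forall M : 'M[C]_d, (forall k j, M k j =
     (t j / t k)%:C * (rdiag (fun i => (del i)^-1) *m B *m (G - B)^t*) k j) -> hsn M <= e ^+ 2) ->
  trp b (tw t) <= ((1 + e) ^+ 2) `^ b * \sum_i (t i ^+ 2 * del i) `^ b.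
Proof.
have [eG sG del0 eB] := adp => t0 e0 b0 hM.
pose M := rdiag t *m G; pose N := rdiag t *m B.
have eMM : tw t = M *m M^t* by rewrite /M adjM rdiag_adj eG !mulmxA.
have pM : posdef (M *m M^t*) by rewrite -eMM; exact: posdef_rdiag_conj.
have eNN : N *m N^t* = rdiag (fun i => t i ^+ 2 * del i).
  rewrite /N adjM rdiag_adj !mulmxA -[_ *m B *m _]mulmxA eB !rdiagM.
  by apply: rdiag_eq => i; rewrite mulrAC expr2.
have u1 : (1%:M : 'M[C]_d) \is unitarymx by apply/unitarymxP; rewrite adj1 mulmx1.
have rd (a : 'I_d -> R) : rdiag a = sp 1%:M a by rewrite spmxE adj1 mul1mx mulmx1.
have pN : posdef (N *m N^t*).
  by rewrite eNN rd; apply: posdef_sp => // i; rewrite mulr_gt0 ?exprn_gt0.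
have swap (A : 'M[C]_d) : posdef (A *m A^t*) -> posdef (A^t* *m A).
  by move=> [E [a [uE a0 eA]]]; have [F uF ->] := adj_swap uE a0 eA; exact: posdef_sp.
have e1 : 0 < (1 + e) ^+ 2 by rewrite exprn_gt0 // addr_gt0.
rewrite eMM (trp_adj_swap _ pM).
apply: (@le_trans _ _ (trp b (((1 + e) ^+ 2)%:C *: (N^t* *m N)))); last first.
  rewrite (trpZ _ e1 (swap _ pN)) -(trp_adj_swap _ pN) eNN rd (trp_sp _ _ u1).
  exact: lexx.
apply: (trp_le (swap _ pM) (posdefZ e1 (swap _ pN)) _ b0) => v.
have qa (A : 'M[C]_d) : qf (A^t* *m A) v = nv (v *m A^t*) by rewrite -qf_adj_mul adjK.
rewrite qfZ qa qa.
pose w := v *m N^t*.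
pose P := rdiag (fun i => (del i)^-1) *m B *m (G - B)^t*.
pose L := rdiag (fun i => (t i)^-1) *m P *m rdiag t.
have L2 : hsn L <= e ^+ 2.
  apply: hM => k j; rewrite /L mul_mx_rdiagE mul_rdiagE.
  by rewrite (rmorphM (real_complex R)) mulrC mulrA.
have inv : B^t* *m (rdiag (fun i => (del i)^-1) *m B) = 1%:M.
  apply: mulmx1C; rewrite -mulmxA eB rdiagM -rdiag1; apply: rdiag_eq => i.
  by rewrite mulVf // gt_eqF.
have tt : rdiag t *m rdiag (fun i => (t i)^-1) = 1%:M :> 'M[C]_d.
  by rewrite rdiagM -rdiag1; apply: rdiag_eq => i; rewrite divff // gt_eqF.
have BP : B^t* *m P = (G - B)^t* by rewrite /P mulmxA inv mul1mx.
clearbody P.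
have NL : N^t* *m L = (G - B)^t* *m rdiag t.
  by rewrite /N /L adjM rdiag_adj !mulmxA -[B^t* *m _ *m rdiag _]mulmxA tt mulmx1 BP.
have eM : v *m M^t* = w + w *m L.
  rewrite /w -[v *m _ *m L]mulmxA NL -mulmxDr; congr (v *m _).
  rewrite /M /N !adjM rdiag_adj -mulmxDl; congr (_ *m _).
  by rewrite -[in LHS](subrK B G) linearD map_mxD addrC.
rewrite eM -/w; apply: le_trans (nv_add_le w (w *m L) e0) _.
have h : nv (w *m L) <= e ^+ 2 * nv w.
  by apply: le_trans (nv_mul_le w L) _; apply: ler_wpM2r => //; exact: nv_ge0.
have := ler_wpM2l (_ : 0 <= 1 + e^-1) h => /(_ _) h2.
apply: le_trans (_ : (1 + e) * nv w + (1 + e^-1) * (e ^+ 2 * nv w) <= _).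
  by rewrite lerD2l h2 // addr_ge0 // invr_ge0 ltW.
by apply: le_of_eq; field; rewrite gt_eqF.
Qed.

End NearZeroUpper.

(** * Cubic accuracy of the block-diagonal approximation *)

Section NearZero.
Variables (R : realType) (d : nat) (s : 'I_d -> R) (rho : 'M[R[i]]_d).
Hypothesis s_gt0 : forall i, 0 < s i.
Hypothesis s_sum : \sum_i s i = 1.
Hypothesis rho_pos : posdef rho.
Local Notation C := R[i].
Local Notation psi := (psi s rho).
Local Notation qn := (qn s rho).
Local Notation pinned := (pinned s rho).
Local Notation tw w := (rdiag w *m rho *m rdiag w).
Variables (G : 'M[C]_d) (del : 'I_d -> R).
Hypothesis adp : adapted s rho G del.
Local Notation B := (pin s G).

Lemma expRN_le_pow4 (h b : R) : 0 < h -> 0 < b -> expR (- (h / b)) <= 24 / h ^+ 4 * b ^+ 4.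
Proof.
move=> h0 b0; have x0 : 0 < h / b by rewrite divr_gt0.
have := expR_ge1Dxn 3 (ltW x0); rewrite -[(3.+1)`!]/24%N => hx.
have h1 : (h / b) ^+ 4 / 24 <= expR (h / b) by lra.
have p0 : 0 < (h / b) ^+ 4 / 24 by rewrite divr_gt0 ?exprn_gt0.
rewrite expRN; apply: (@le_trans _ _ ((h / b) ^+ 4 / 24)^-1).
  by rewrite lef_pV2 ?posrE ?expR_gt0.
by apply: le_of_eq; field; rewrite !gt_eqF.
Qed.

(** Off-block entries connect s_j < s_k and carry the squared ratio (s_j/s_k)^(1/b) up to a
    constant, exponentially small in 1/b and hence O(b^4). So e = O(b^2) in [trp_adapted_le], and
    the logarithm of the factor is O(b e). *)
Lemma adapted_trp_bound (g : 'I_d -> R) : (forall i, 0 < g i) ->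
  exists2 K, 0 <= K & forall b, 0 < b <= 1 ->
  ln (trp b (tw (fun i => (s i * g i `^ b) `^ (2 * b)^-1))) <=
  ln (\sum_i s i * (g i * del i) `^ b) + K * b ^+ 3.
Proof.
move=> g0; have [eG sG del0 eB] := adp.
pose P := rdiag (fun i => (del i)^-1) *m B *m (G - B)^t*.
have P0 k j : P k j != 0 -> s j < s k.
  move=> h; have [l [hB hG]] : exists l, B k l != 0 /\ (G - B) j l != 0.
    apply: contrapT => nh; move/eqP: h; apply.
    rewrite /P mxE big1 // => l _; rewrite mul_rdiagE.
    have [->|hB] := eqVneq (B k l) 0; first by rewrite mulr0 mul0r.
    have [e|hG] := eqVneq ((G - B) j l) 0; last by case: nh; exists l.
    have -> : (G - B)^t* l j = ((G - B) j l)^*%R by rewrite [LHS]mxE [in LHS]mxE.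
    by rewrite e conjC0 mulr0.
  move: hB hG; rewrite !mxE; case: (s k =P s l) => [-> _|_]; last by rewrite eqxx.
  case: (s j =P s l) => [_|ne]; first by rewrite subrr eqxx.
  by rewrite subr0 => /sG; rewrite le_eqVlt => /orP[/eqP //|].
pose c k j := if s j < s k then
  24 / (ln (s k) - ln (s j)) ^+ 4 * (g j / g k * nsq (P k j)) else 0.
have lns k j : s j < s k -> 0 < ln (s k) - ln (s j).
  by move=> h; rewrite subr_gt0 ltr_ln ?posrE.
have c0 k j : 0 <= c k j.
  rewrite /c; case: ifP => // h; have h1 := lns _ _ h.
  by rewrite !mulr_ge0 ?nsq_ge0 ?invr_ge0 ?(ltW (g0 _)) ?exprn_ge0 ?(ltW h1).
pose K := \sum_k \sum_j c k j.
have K0 : 0 <= K by apply: sumr_ge0 => k _; apply: sumr_ge0 => j _.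
exists (2 * (1 + K)); first by rewrite mulr_ge0 // addr_ge0.
move=> b /andP[b0 b1]; set t := fun i => _.
have t0 i : 0 < t i by rewrite /t powR_gt0 // mulr_gt0 // powR_gt0.
have lt i : ln (t i) = (2 * b)^-1 * (ln (s i) + b * ln (g i)).
  by rewrite /t ln_powR lnM ?posrE ?powR_gt0 // ln_powR.
(* Its square dominates K b^4, and it stays positive when K = 0. *)
pose e := (1 + K) * b ^+ 2.
have e0 : 0 < e by rewrite mulr_gt0 ?exprn_gt0 // ltr_pwDl.
have hM (M : 'M[C]_d) : (forall k j, M k j = (t j / t k)%:C * P k j) -> hsn M <= e ^+ 2.
  move=> eM; apply: (@le_trans _ _ (K * b ^+ 4)).
    rewrite /hsn /K mulr_suml; apply: ler_sum => k _; rewrite mulr_suml.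
    apply: ler_sum => j _; rewrite eM nsqZ /c; case: ifP => h; last first.
      have [->|Pk] := eqVneq (P k j) 0; first by rewrite nsq0 mulr0 mul0r.
      by move: (P0 k j Pk); rewrite h.
    have -> : (t j / t k) ^+ 2 = expR (- ((ln (s k) - ln (s j)) / b)) * (g j / g k).
      have et i : t i = expR ((2 * b)^-1 * (ln (s i) + b * ln (g i))) by rewrite -lt lnK ?posrE.
      have -> : g j / g k = expR (ln (g j) - ln (g k)) by rewrite expRD expRN !lnK ?posrE.
      rewrite !et -expRN -expRD -expRM_natl -expRD; congr expR.
      by field; rewrite gt_eqF.
    rewrite -mulrA [leRHS]mulrAC; apply: ler_wpM2r.
      by rewrite mulr_ge0 ?nsq_ge0 // divr_ge0 // ltW.
    exact: expRN_le_pow4 (lns _ _ h) b0.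
  rewrite /e exprMn -exprM; apply: ler_wpM2r; first by rewrite exprn_ge0 // ltW.
  by rewrite expr2; nra.
have h := trp_adapted_le rho_pos adp t0 e0 (ltW b0) hM.
have d0 : (0 < d)%N by have := dim_gt0 s_sum 1; rewrite /= muln1.
have sum0 : 0 < \sum_i s i * (g i * del i) `^ b.
  rewrite (bigD1 (Ordinal d0)) //= ltr_pwDl //.
    by rewrite mulr_gt0 ?powR_gt0 ?mulr_gt0.
  by apply: sumr_ge0 => i _; rewrite mulr_ge0 ?powR_ge0 // ltW.
have es : \sum_i (t i ^+ 2 * del i) `^ b = \sum_i s i * (g i * del i) `^ b.
  apply: eq_bigr => i _.
  have tt : 0 <= t i ^+ 2 by rewrite exprn_ge0 // ltW.
  rewrite (powRM _ tt (ltW (del0 i))) (powRM _ (ltW (g0 i)) (ltW (del0 i))) mulrA.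
  congr (_ * _).
  rewrite /t -powR_mulrn ?powR_ge0 // -!powRrM.
  have p1 p : p = 1 -> (s i * g i `^ b) `^ p = s i * g i `^ b.
    by move=> ->; rewrite powRr1 // mulr_ge0 ?powR_ge0 // ltW.
  by apply: p1; field; rewrite gt_eqF.
have e1 : 0 < 1 + e by rewrite addr_gt0.
have T0 : 0 < trp b (tw t) by apply: trp_gt0 => //; exact: posdef_rdiag_conj.
rewrite es in h; rewrite -(ler_ln (x := trp b (tw t))) ?posrE ?mulr_gt0 ?powR_gt0 ?exprn_gt0 // in h.
apply: le_trans h _; rewrite lnM ?posrE ?powR_gt0 ?exprn_gt0 // addrC lerD2l ln_powR lnXn //.
have le : ln (1 + e) <= e by apply: le_ln1Dx; rewrite (lt_trans _ e0) // ltrN10.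
have -> : 2 * (1 + K) * b ^+ 3 = b * (e + e) by rewrite /e; ring.
by rewrite ler_pM2l // mulr2n lerD.
Qed.

Lemma prod_le_eq (I : finType) (a b : I -> R) : (forall i, 0 < a i) ->
  (forall i, a i <= b i) -> \prod_i a i = \prod_i b i -> forall i, a i = b i.
Proof.
move=> a0 ab e i; have b0 j : 0 < b j := lt_le_trans (a0 j) (ab j).
have : \sum_j (ln (b j) - ln (a j)) = 0.
  by rewrite sumrB -!ln_prod // e subrr.
move=> /psumr_eq0P h; apply: ln_inj; rewrite ?posrE //.
apply/esym/eqP; rewrite -subr_eq0; apply/eqP/h => // j _.
by rewrite subr_ge0 ler_ln ?posrE.
Qed.

(** Along nonzero entries of [G] the eigenvalues of sigma can only increase from row to column, so
    equal products force equality in every factor. *)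
Lemma pin_tpow n : pin (@tprod R d s n) (tpow G n) = tpow B n.
Proof.
have [_ sG _ _] := adp.
apply/matrixP => z w; rewrite mxE !tpowE.
case: (pselect (forall k, s (dig z k) = s (dig w k))) => h.
  have -> : tprod s z == tprod s w.
    by apply/eqP; apply: eq_bigr => k _; exact: h.
  by apply: eq_bigr => k _; rewrite mxE h eqxx.
have [k hk] : exists k, s (dig z k) <> s (dig w k) by apply/existsNP.
rewrite [RHS](bigD1 k) //= [X in _ = X * _]mxE.
case: (s (dig z k) =P s (dig w k)) => // _; rewrite mul0r.
case: eqP => // ezw; apply/eqP; apply: contra_notT hk => /prodf_neq0 hG.
apply: (prod_le_eq (a := fun k => s (dig z k)) (b := fun k => s (dig w k)) _ _ ezw k) => //.
by move=> j; apply: sG; exact: hG.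
Qed.

(** Kadison-Schwarz applied to the power of [G], whose pinching is the power of the block-diagonal
    part. *)
Lemma pinned_ge n v : qf (rdiag (@tprod R d del n)) v <= qf (pinned n) v.
Proof.
have [eG _ _ eB] := adp.
have := kadison (@tprod R d s n) (tpow G n) v.
by rewrite pin_tpow !tpow_adj -!tpowM eB -eG tpow_rdiag.
Qed.

End NearZero.

(** * Two-sided comparison of [psi] with [phi] near order 0 *)

Section NearZeroBounds.
Variables (R : realType) (d : nat) (s : 'I_d -> R) (rho : 'M[R[i]]_d).
Hypothesis s_gt0 : forall i, 0 < s i.
Hypothesis s_sum : \sum_i s i = 1.
Hypothesis rho_pos : posdef rho.
Local Notation C := R[i].
Local Notation psi := (psi s rho).
Local Notation qn := (qn s rho).
Local Notation pinned := (pinned s rho).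
Local Notation tw w := (rdiag w *m rho *m rdiag w).
Variables (G : 'M[C]_d) (del : 'I_d -> R).
Hypothesis adp : adapted s rho G del.

(** The single-copy function with [del] in place of the spectrum of the pinched state; it is the
    second-order model of the limit at 0. *)
Definition phi (b : R) := ln (\sum_i del i `^ b * s i `^ (1 - b)).

Lemma phi_sum_gt0 b : 0 < \sum_i del i `^ b * s i `^ (1 - b).
Proof.
have [_ _ del0 _] := adp.
have d0 : (0 < d)%N by have := dim_gt0 s_sum 1; rewrite /= muln1.
rewrite (bigD1 (Ordinal d0)) //= ltr_pwDl ?mulr_gt0 ?powR_gt0 //.
by apply: sumr_ge0 => i _; rewrite mulr_ge0 ?powR_ge0.
Qed.

Lemma pin_tpow_Ya n b : pin (@tprod R d s n) (tpow (Ya s rho b) n) =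
  rdiag (@tprod R d (fun i => s i `^ ((1 - b) / (2 * b))) n) *m pinned n *m
  rdiag (@tprod R d (fun i => s i `^ ((1 - b) / (2 * b))) n).
Proof. by rewrite /Ya 2!tpowM !tpow_rdiag pin_rdiag_conj. Qed.

Lemma phi_compare n b : b != 0 ->
  exists A B : 'M[C]_(tdim d n), [/\ posdef A, posdef B, (forall v, qf A v <= qf B v),
    trp b A = expR (n%:R * phi b) & trp b B = qn n b].
Proof.
move=> b0; have [_ _ del0 _] := adp.
pose w := @tprod R d (fun i => s i `^ ((1 - b) / (2 * b))) n.
have w0 z : 0 < w z by apply: tprod_gt0 => i; rewrite powR_gt0.
exists (rdiag w *m rdiag (@tprod R d del n) *m rdiag w).
exists (pin (@tprod R d s n) (tpow (Ya s rho b) n)).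
have u1 : (1%:M : 'M[C]_(tdim d n)) \is unitarymx by apply/unitarymxP; rewrite adj1 mulmx1.
have rd (a : 'I_(tdim d n) -> R) : rdiag a = sp 1%:M a by rewrite spmxE adj1 mul1mx mulmx1.
have T0 z : 0 < @tprod R d del n z by exact: tprod_gt0.
split.
- by rewrite !rdiagM rd; apply: posdef_sp => // z; rewrite !mulr_gt0.
- by apply/pin_posdef/tpow_posdef/Ya_posdef.
- move=> v; rewrite pin_tpow_Ya -/w.
  have e A := qf_conj A (rdiag w) v; rewrite rdiag_adj in e.
  rewrite !e; exact: (pinned_ge s_gt0 adp).
- rewrite !rdiagM rd (trp_sp _ _ u1) mulr_natl -lnXn ?phi_sum_gt0 //.
  rewrite lnK ?posrE ?exprn_gt0 ?phi_sum_gt0 // -sum_tprod; apply: eq_bigr => z _.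
  rewrite !tprodM tprod_powR; last by move=> i; rewrite !mulr_gt0 ?powR_gt0.
  apply: eq_bigr => k _; set i := dig z k.
  rewrite mulrAC mulrC powRM ?mulr_ge0 ?powR_ge0 ?(ltW (del0 i)) //; congr (_ * _).
  rewrite -powRD; last by rewrite (gt_eqF (s_gt0 i)) implybT.
  by rewrite -powRrM; congr (_ `^ _); field.
- by rewrite (qn_trp s_gt0 rho_pos).
Qed.

Lemma qn_gt0' n b : 0 < qn n b.
Proof. exact: qn_gt0 s_gt0 s_sum rho_pos n b. Qed.

Lemma psi_ge_phi n b : 0 < b -> n%:R * phi b <= psi n b.
Proof.
move=> b0; have [A [B [pA pB h eA eB]]] := phi_compare n (lt0r_neq0 b0).
rewrite -[leLHS]expRK ler_ln ?posrE ?expR_gt0 ?qn_gt0' // -eA -eB.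
exact: (trp_le pA pB h (ltW b0)).
Qed.

Lemma psi_le_phi n b : b < 0 -> psi n b <= n%:R * phi b.
Proof.
move=> b0; have [A [B [pA pB h eA eB]]] := phi_compare n (ltr0_neq0 b0).
rewrite -[leRHS]expRK ler_ln ?posrE ?expR_gt0 ?qn_gt0' // -eA -eB.
exact: (trp_ge pA pB h (ltW b0)).
Qed.

Lemma ln_pow_bound n (x y : R) : 0 < x -> 0 < y -> 
  x <= (n.+1 ^ d)%:R * y ^+ n -> ln x <= ln ((n.+1 ^ d)%:R) + n%:R * ln y.
Proof.
move=> x0 y0 h; have k0 : 0 < (n.+1 ^ d)%:R :> R by rewrite ltr0n expn_gt0.
rewrite -(ler_ln (x := x)) ?posrE ?mulr_gt0 ?exprn_gt0 // in h; apply: le_trans h _.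
by rewrite lnM ?posrE ?exprn_gt0 // lnXn // mulr_natl.
Qed.

Lemma qf_rdiag D (g : 'I_D -> R) v : qf (rdiag g) v = \sum_z g z * nsq (v 0 z).
Proof.
have u1 : (1%:M : 'M[C]_D) \is unitarymx by apply/unitarymxP; rewrite adj1 mulmx1.
have -> : rdiag g = sp 1%:M g by rewrite spmxE adj1 mul1mx mulmx1.
by rewrite qf_sp; apply: eq_bigr => z _; rewrite /wt adj1 mulmx1.
Qed.

Lemma cauchy_schwarz_weighted (I : finType) (w a T : I -> R) : (forall i, 0 < a i) ->
  (forall i, 0 < w i) ->
  (\sum_i w i * T i) ^+ 2 <= (\sum_i w i / a i) * \sum_i w i * a i * T i ^+ 2.
Proof.
move=> a0 w0.
pose x i : C := (Num.sqrt (w i / a i))%:C.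
pose y i : C := (Num.sqrt (w i * a i) * T i)%:C.
have := nsq_cauchy_schwarz x y.
have nr (r : R) : nsq (r%:C) = r ^+ 2 by rewrite /nsq /= expr0n addr0.
have -> : \sum_i x i * y i = (\sum_i w i * T i)%:C.
  rewrite real_complex_sum; apply: eq_bigr => i _.
  rewrite -(rmorphM (real_complex R)); congr (_%:C); rewrite mulrA -sqrtrM; last first.
    by rewrite divr_ge0 // ltW.
  have -> : w i / a i * (w i * a i) = w i ^+ 2 by field; rewrite gt_eqF.
  by rewrite sqrtr_sqr ger0_norm // ltW.
rewrite nr; congr (_ <= _ * _); apply: eq_bigr => i _; rewrite nr.
  by rewrite sqr_sqrtr // divr_ge0 // ltW.
by rewrite exprMn sqr_sqrtr // mulr_ge0 // ltW.
Qed.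

(** Cauchy-Schwarz with weights xx^b and xx^(-b) converts the lower bound at -b into an upper bound
    on a trace with the positive power b, within reach of [retr_pow_le]. *)
Lemma qn_neg_cs n b E xx lab : eigdata s rho (n := n) E xx lab ->
  expR (n%:R * phi (- b)) ^+ 2 <= qn n (- b) *
  retr (sp E (fun x => xx x `^ b)) (rdiag (@tprod R d (fun i => s i * (s i * del i ^- 2) `^ b) n)).
Proof.
move=> dat; have [_ _ del0 _] := adp; have [uE xx0 eX hb _] := dat.
have lab0 x := eigdata_lab s_gt0 x dat.
pose T x := qf (rdiag (@tprod R d (fun i => del i `^ (- b)) n)) (row x E).
pose W x := lab x `^ (1 + b).
have W0 x : 0 < W x by rewrite powR_gt0.
have a0 x : 0 < xx x `^ b by rewrite powR_gt0.
have := cauchy_schwarz_weighted T a0 W0.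
have qh (f : R -> R) (g : 'I_(tdim d n) -> R) x :
    qf (rdiag (fun z => f (@tprod R d s n z) * g z)) (row x E) = f (lab x) * qf (rdiag g) (row x E).
  rewrite !qf_rdiag mulr_sumr; apply: eq_bigr => z _; rewrite !mxE.
  have [->|h] := eqVneq (E x z) 0; first by rewrite nsq0 !mulr0.
  by rewrite (hb x z h) mulrA.
have -> : \sum_x W x * T x = expR (n%:R * phi (- b)).
  have e x : W x * T x = qf (rdiag (fun z => @tprod R d s n z `^ (1 + b) *
      @tprod R d (fun i => del i `^ (- b)) n z)) (row x E).
    by rewrite (qh (fun r => r `^ (1 + b))).
  under eq_bigr do rewrite e.
  rewrite (sum_qf _ uE) /mxtrace Re_sum mulr_natl -lnXn ?phi_sum_gt0 //.
  rewrite lnK ?posrE ?exprn_gt0 ?phi_sum_gt0 // -sum_tprod; apply: eq_bigr => z _.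
  rewrite rdiagE eqxx mulr1n /= tprod_powR // tprodM.
  by apply: eq_bigr => k _; rewrite opprK mulrC.
move=> h; apply: le_trans h _.
have -> : \sum_x W x / xx x `^ b = qn n (- b).
  rewrite (qnE _ dat); apply: eq_bigr => x _.
  by rewrite opprK /W mulrC powRN.
apply: ler_wpM2l; first exact/ltW/qn_gt0'.
rewrite (retr_spl _ _ uE); apply: ler_sum => x _.
rewrite [W x * _]mulrC -mulrA; apply: ler_wpM2l; first exact/ltW.
have e : qf (rdiag (@tprod R d (fun i => s i * (s i * del i ^- 2) `^ b) n)) (row x E) =
    W x * qf (rdiag (fun z => @tprod R d (fun i => del i `^ (- b)) n z ^+ 2)) (row x E).
  rewrite -(qh (fun r => r `^ (1 + b))); congr qf; apply: rdiag_eq => z.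
  rewrite tprod_powR // expr2 2!tprodM; apply: eq_bigr => k _; set i := dig z k.
  have di : 0 < del i ^- 2 by rewrite invr_gt0 exprn_gt0.
  rewrite !powRexp ?mulr_gt0 // (lnM (x := s i)) ?posrE // lnV ?posrE ?exprn_gt0 // lnXn //.
  rewrite -[X in X * expR _ = _]lnK ?posrE // -!expRD; congr expR.
  by rewrite mulr2n; ring.
rewrite e; apply: ler_wpM2l; first exact/ltW.
(* The square of a mean is at most the mean of the squares: nonnegativity of a variance. *)
rewrite /T !qf_rdiag; set g := @tprod R d _ n.
have w1 : \sum_z nsq (row x E 0 z) = 1 by have := nv_row x uE.
set m := \sum_z _ * _.
have : 0 <= \sum_z (g z - m) ^+ 2 * nsq (row x E 0 z).
  by apply: sumr_ge0 => z _; rewrite mulr_ge0 ?sqr_ge0 ?nsq_ge0.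
have -> : \sum_z (g z - m) ^+ 2 * nsq (row x E 0 z) =
    \sum_z g z ^+ 2 * nsq (row x E 0 z) - 2 * m * m + m ^+ 2 * 1.
  rewrite (eq_bigr (fun z => g z ^+ 2 * nsq (row x E 0 z) -
    2 * m * (g z * nsq (row x E 0 z)) + m ^+ 2 * nsq (row x E 0 z))) => [|z _]; last by ring.
  by rewrite big_split sumrB -!mulr_sumr w1.
by set q := \sum_z _; nra.
Qed.

Lemma near_zero : exists2 K, 0 <= K & forall b, 0 < b <= 1 -> forall n,
  [/\ n%:R * phi b <= psi n b,
      psi n b <= ln ((n.+1 ^ d)%:R) + n%:R * (phi b + K * b ^+ 3),
      psi n (- b) <= n%:R * phi (- b) &
      n%:R * (phi (- b) - K * b ^+ 3) <= psi n (- b) + ln ((n.+1 ^ d)%:R)].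
Proof.
have [_ _ del0 _] := adp.
have d0 : (0 < d)%N by have := dim_gt0 s_sum 1; rewrite /= muln1.
(* The choice g = 1/s makes the diagonal weight s^(1-b), so the trace is [qn n b] itself; the choice
   g = s/del^2 below is the weight left by [qn_neg_cs]. *)
have [K1 K10 h1] := adapted_trp_bound s_gt0 s_sum rho_pos adp
  (g := fun i => (s i)^-1) (fun i => etrans (invr_gt0 (s i)) (s_gt0 i)).
have g0 i : 0 < s i * del i ^- 2 by rewrite mulr_gt0 ?invr_gt0 ?exprn_gt0.
have [K2 K20 h2] := adapted_trp_bound s_gt0 s_sum rho_pos adp g0.
exists (K1 + K2) => [|b hb n]; first exact: addr_ge0.
have /andP[b0 b1] := hb; have b3 : 0 <= b ^+ 3 by rewrite exprn_ge0 // ltW.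
have [E [xx [lab dat]]] := eigdata_exists s rho_pos n.
have [uE xx0 eX hbs _] := dat.
have th0 (g : 'I_d -> R) : (forall i, 0 < g i) -> forall i, 0 < s i * g i `^ b.
  by move=> g1 i; rewrite mulr_gt0 ?powR_gt0.
have tw0 (g : 'I_d -> R) : (forall i, 0 < g i) ->
    0 < trp b (tw (fun i => (s i * g i `^ b) `^ (2 * b)^-1)).
  move=> g1; apply: trp_gt0 => //; apply: posdef_rdiag_conj => // i.
  by rewrite powR_gt0 // th0.
have nR : 0 <= n%:R :> R by [].
split; [exact: psi_ge_phi| | |].
- have si0 i : 0 < (s i)^-1 by rewrite invr_gt0.
  have h := retr_pow_le rho_pos dat (th0 _ si0) hb.
  have e : retr (sp E (fun x => xx x `^ b))
      (rdiag (@tprod R d (fun i => s i * (s i)^-1 `^ b) n)) = qn n b.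
    rewrite (rdiag_eq (b := fun z => @tprod R d s n z `^ (1 - b))); last first.
      move=> z; rewrite tprod_powR //; apply: eq_bigr => k _.
      by rewrite !powRexp ?invr_gt0 // lnV ?posrE // -[X in X * expR _]lnK ?posrE // -expRD;
        congr expR; ring.
    rewrite (rdiag_hbasis (fun r => r `^ (1 - b)) uE hbs) (retr_self _ _ uE).
    by rewrite (qnE _ dat).
  rewrite e in h.
  have := ln_pow_bound (qn_gt0' n b) (tw0 _ si0) h => hl.
  apply: le_trans hl _; rewrite lerD2l; apply: ler_wpM2l => //.
  apply: le_trans (h1 b hb) _.
  have -> : \sum_i s i * ((s i)^-1 * del i) `^ b = \sum_i del i `^ b * s i `^ (1 - b).
    apply: eq_bigr => i _; rewrite powRM ?invr_ge0 ?(ltW (s_gt0 i)) ?(ltW (del0 i)) //.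
    rewrite mulrA mulrC; congr (_ * _).
    by rewrite !powRexp ?invr_gt0 // lnV ?posrE // -[X in X * expR _]lnK ?posrE // -expRD;
      congr expR; ring.
  by rewrite lerD2l ler_wpM2r // lerDl.
- by apply: psi_le_phi; rewrite oppr_lt0.
- have cs := qn_neg_cs b dat.
  have h := retr_pow_le rho_pos dat (th0 _ g0) hb.
  have := le_trans cs (ler_wpM2l (ltW (qn_gt0' n (- b))) h) => {cs h} h.
  have t0 := tw0 _ g0.
  have k0 : 0 < (n.+1 ^ d)%:R :> R by rewrite ltr0n expn_gt0.
  rewrite -(ler_ln (x := expR _ ^+ 2)) ?posrE ?exprn_gt0 ?expR_gt0 ?mulr_gt0 ?exprn_gt0 ?qn_gt0' // in h.
  rewrite lnXn ?expR_gt0 // expRK lnM ?posrE ?qn_gt0' ?mulr_gt0 ?exprn_gt0 // in h.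
  rewrite lnM ?posrE ?exprn_gt0 // lnXn // -[X in _ <= _ + (_ + X)]mulr_natl in h.
  have e : \sum_i s i * ((s i * del i ^- 2) * del i) `^ b = \sum_i del i `^ (- b) * s i `^ (1 - - b).
    apply: eq_bigr => i _.
    have -> : s i * del i ^- 2 * del i = s i / del i by field; rewrite gt_eqF.
    rewrite !powRexp ?divr_gt0 // ln_div ?posrE // -[X in X * expR _]lnK ?posrE // -!expRD.
    by congr expR; ring.
  have h3 := h2 b hb; rewrite e -/(phi (- b)) in h3.
  have h4 := ler_wpM2l nR h3.
  have h5 : 0 <= n%:R * (K1 * b ^+ 3) by exact: mulr_ge0 nR (mulr_ge0 K10 b3).
  move: h h4 h5; rewrite /psi mulr2n.
  set A := ln (trp _ _); set q := ln (qn _ _); set k := ln (_ ^ _)%:R; set f := phi _.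
  by clear; lra.
Qed.

End NearZeroBounds.

(** * Calculus of second-order expansions *)

Section SecondOrder.
Variable R : realType.
Implicit Types f g : R -> R.

Lemma mvt (f df : R -> R) (x y : R) :
  (forall z : R, Num.min x y <= z <= Num.max x y -> is_derive z 1 f (df z)) ->
  exists2 c, Num.min x y <= c <= Num.max x y & f y - f x = df c * (y - x).
Proof.
wlog xy : x y / x <= y => [H hd|].
  have [xy|] := boolP (x <= y); first exact: (H x y xy hd).
  rewrite -ltNge => /ltW yx.
  have [|c hc e] := H y x yx; first by move=> z; rewrite minC maxC; exact: hd.
  by exists c; [rewrite minC maxC|rewrite -[LHS]opprB e -mulrN opprB].
rewrite min_l // max_r // => hd.
have hdo z : z \in `]x, y[%R -> is_derive z 1 f (df z).
  by rewrite in_itv /= => /andP[h1 h2]; apply: hd; rewrite !ltW.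
have hc : {within `[x, y], continuous f}.
  apply: derivable_within_continuous => z; rewrite in_itv /= => hz.
  by have := hd z hz; case.
have [c hc' e] := MVT_segment xy hdo hc.
by exists c => //; rewrite in_itv in hc'.
Qed.

Lemma between_norm (x y c : R) : Num.min x y <= c <= Num.max x y -> `|c - x| <= `|y - x|.
Proof.
case: (leP x y) => xy /andP[h1 h2].
  by rewrite !ger0_norm ?subr_ge0 // lerB.
by rewrite -![`|_ - x|]distrC !ger0_norm ?subr_ge0 ?(ltW xy) // lerB.
Qed.

(** A quadratic expansion at 0 with cubic error. Unlike twice differentiability it survives
    perturbations of cubic size ([t2_close]), and it suffices to differentiate F(x)/(x - x0) at
    x0. *)
Definition t2 f := exists c1 c2 K r, [/\ 0 < r, 0 <= K &
  forall t, `|t| <= r -> `|f t - (f 0 + c1 * t + c2 * t ^+ 2)| <= K * `|t| ^+ 3].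

Lemma t2_mvt f (df : R -> R) : f 0 = 0 -> (forall z : R, `|z| <= 2^-1 -> is_derive z 1 f (df z)) ->
  (forall z : R, `|z| <= 2^-1 -> `|df z| <= 2 * `|z| ^+ 2) ->
  forall t, `|t| <= 2^-1 -> `|f t| <= 2 * `|t| ^+ 3.
Proof.
move=> f0 hd hb t ht.
have hz z : Num.min 0 t <= z <= Num.max 0 t -> `|z| <= `|t|.
  by move/between_norm; rewrite !subr0.
have [z /hz zt|c /hz ct e] := mvt (f := f) (df := df) (x := 0) (y := t).
  exact/hd/(le_trans zt).
rewrite f0 !subr0 in e; rewrite e normrM exprSr mulrA ler_wpM2r //.
apply: le_trans (hb c (le_trans ct ht)) _.
by rewrite ler_pM2l // lerXn2r ?nnegrE.
Qed.

Lemma t2_close f g (K r : R) : 0 < r -> 0 <= K -> t2 g ->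
  (forall t, `|t| <= r -> `|f t - g t| <= K * `|t| ^+ 3) -> t2 f.
Proof.
move=> r0 K0 [c1 [c2 [K' [r' [r'0 K'0 hg]]]]] hfg.
exists c1, c2, (K + K'), (Num.min r r'); split; first by rewrite lt_min r0.
  exact: addr_ge0.
have f0 : f 0 = g 0.
  have := hfg 0; rewrite normr0 expr0n mulr0 normr_le0 subr_eq0 => h.
  exact/eqP/h/ltW.
move=> t; rewrite le_min => /andP[h1 h2]; rewrite f0 mulrDl.
apply: (le_trans _ (lerD (hfg t h1) (hg t h2))).
by apply: le_trans (ler_normD _ _); rewrite addrA subrK.
Qed.

Lemma t2_eq f g : f =1 g -> t2 g -> t2 f.
Proof. by move=> fg; have -> : f = g by apply/funext. Qed.

Lemma t2_poly (c0 c1 c2 : R) : t2 (fun t => c0 + c1 * t + c2 * t ^+ 2).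
Proof.
exists c1, c2, 0, 1; split => // t _.
by rewrite !mulr0 expr0n mulr0 !addr0 subrr normr0 mul0r.
Qed.

Lemma t2_cst (c : R) : t2 (fun=> c).
Proof. by apply: t2_eq (t2_poly c 0 0) => t; rewrite !mul0r !addr0. Qed.

Lemma t2_lin (c : R) : t2 (fun t => c * t).
Proof. by apply: t2_eq (t2_poly 0 c 0) => t; rewrite mul0r addr0 add0r. Qed.

Lemma t2D f g : t2 f -> t2 g -> t2 (fun t => f t + g t).
Proof.
move=> [c1 [c2 [K [r [r0 K0 hf]]]]] [d1 [d2 [K' [r' [r'0 K'0 hg]]]]].
exists (c1 + d1), (c2 + d2), (K + K'), (Num.min r r'); split.
- by rewrite lt_min r0.
- exact: addr_ge0.
move=> t; rewrite le_min => /andP[h1 h2]; rewrite [leRHS]mulrDl.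
apply: (le_trans _ (lerD (hf t h1) (hg t h2))).
by apply: le_trans (ler_normD _ _); apply: le_of_eq; congr (`|_|); ring.
Qed.

Lemma t2_lip f : t2 f -> exists L r, [/\ 0 < r, r <= 1, 0 < L &
  forall t, `|t| <= r -> `|f t - f 0| <= L * `|t|].
Proof.
move=> [c1 [c2 [K [r [r0 K0 hf]]]]].
exists (`|c1| + `|c2| + K + 1), (Num.min r 1); split.
- by rewrite lt_min r0 ltr01.
- by rewrite ge_min lexx orbT.
- by rewrite ltr_wpDl // addr_ge0 // addr_ge0.
move=> t; rewrite le_min => /andP[h1 h2]; have h := hf t h1.
have t2' : `|t| ^+ 2 <= `|t| by rewrite expr2 ler_piMr.
have t3 : `|t| ^+ 3 <= `|t| by rewrite exprS ler_piMr // exprn_ile1.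
have e : f t - f 0 = (f t - (f 0 + c1 * t + c2 * t ^+ 2)) + c1 * t + c2 * t ^+ 2 by ring.
rewrite e; apply: (le_trans (ler_normD _ _)); apply: (le_trans (lerD (ler_normD _ _) (lexx _))).
rewrite [`|c1 * _|]normrM [`|c2 * _|]normrM normrX.
have h4 := ler_wpM2l (normr_ge0 c2) t2'; have h5 := ler_wpM2l K0 t3.
move: h h4 h5 (normr_ge0 t); set a := `|f t - _|; set b := `|t| ^+ 2; set c := `|t| ^+ 3.
by nra.
Qed.

Lemma t2M f g : t2 f -> t2 g -> t2 (fun t => f t * g t).
Proof.
move=> tf tg; have [L [r1 [r10 r11 L0 lf]]] := t2_lip tf.
move: tf tg => [c1 [c2 [K [r [r0 K0 hf]]]]] [d1 [d2 [K' [r' [r'0 K'0 hg]]]]].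
pose G t := g 0 + d1 * t + d2 * t ^+ 2.
pose A := `|f 0| + L; pose B := `|g 0| + `|d1| + `|d2|.
pose D := `|c1 * d2 + c2 * d1| + `|c2 * d2|.
have A0 : 0 <= A by rewrite addr_ge0 // ltW.
have B0 : 0 <= B by rewrite !addr_ge0.
apply: (t2_close (r := Num.min r1 (Num.min r r')) (K := A * K' + K * B + D)
  (g := fun t => f 0 * g 0 + (f 0 * d1 + c1 * g 0) * t + (f 0 * d2 + c1 * d1 + c2 * g 0) * t ^+ 2)).
- by rewrite !lt_min r10 r0.
- by rewrite !addr_ge0 ?mulr_ge0.
- exact: t2_poly.
move=> t; rewrite !le_min => /and3P[h1 h2 h3].
have t1 : `|t| <= 1 := le_trans h1 r11.
have t30 : 0 <= `|t| ^+ 3 by rewrite exprn_ge0.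
have hA : `|f t| <= A.
  have := lf t h1; rewrite -[f t in X in _ -> X](subrK (f 0)) => h.
  apply: le_trans (ler_normD _ _) _; rewrite addrC lerD2l; apply: le_trans h _.
  by rewrite ler_piMr // ltW.
have hB : `|G t| <= B.
  apply: (le_trans (ler_normD _ _)); apply: (le_trans (lerD (ler_normD _ _) (lexx _))).
  rewrite [`|d1 * _|]normrM [`|d2 * _|]normrM normrX /B.
  have q1 : `|d1| * `|t| <= `|d1| by rewrite ler_piMr.
  have q2 : `|d2| * `|t| ^+ 2 <= `|d2| by rewrite ler_piMr // exprn_ile1.
  by apply: lerD q2; apply: lerD q1.
have e : f t * g t - (f 0 * g 0 + (f 0 * d1 + c1 * g 0) * t + (f 0 * d2 + c1 * d1 + c2 * g 0) * t ^+ 2) =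
  f t * (g t - G t) + (f t - (f 0 + c1 * t + c2 * t ^+ 2)) * G t +
  t ^+ 3 * ((c1 * d2 + c2 * d1) + c2 * d2 * t) by rewrite /G; ring.
rewrite e; apply: le_trans (ler_normD _ _) _; rewrite [leRHS]mulrDl; apply: lerD.
  apply: le_trans (ler_normD _ _) _; rewrite [leRHS]mulrDl; apply: lerD; rewrite normrM.
    by rewrite -[leRHS]mulrA; apply: ler_pM => //; exact: hg.
  by rewrite [leRHS]mulrAC; apply: ler_pM => //; exact: hf.
rewrite normrM normrX mulrC; apply: ler_wpM2r => //.
apply: le_trans (ler_normD _ _) _; rewrite lerD2l normrM.
by rewrite ler_piMr.
Qed.

Lemma t2_sum (I : finType) (F : I -> R -> R) : (forall i, t2 (F i)) ->
  t2 (fun t => \sum_i F i t).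
Proof.
move=> hF; rewrite /index_enum; elim: (Finite.enum I) => [|i r IH].
  by apply: t2_eq (t2_cst 0) => t; rewrite big_nil.
by apply: t2_eq (t2D (hF i) IH) => t; rewrite big_cons.
Qed.

Lemma t2_comp g f : t2 f -> t2 (fun y => g (f 0 + y)) -> t2 (fun t => g (f t)).
Proof.
move=> tf [g1 [g2 [K [r [r0 K0 hg]]]]]; have [L [r1 [r10 r11 L0 lf]]] := t2_lip tf.
pose y t := f t - f 0.
have ty : t2 y by apply: t2_eq (t2D tf (t2_cst (- f 0))).
apply: (t2_close (r := Num.min r1 (r / L)) (K := K * L ^+ 3)
  (g := fun t => (g (f 0) + g1 * y t) + g2 * (y t * y t))).
- by rewrite lt_min r10 divr_gt0.
- by rewrite mulr_ge0 // exprn_ge0 // ltW.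
- apply: t2D; [apply: t2D; [exact: t2_cst|]|]; apply: t2M => //; try exact: t2_cst.
  exact: t2M.
move=> t; rewrite le_min ler_pdivlMr // => /andP[h1 h2].
have yL : `|y t| <= L * `|t| by exact: lf.
have yr : `|y t| <= r by apply: le_trans yL _; rewrite mulrC.
have fy : f 0 + y t = f t by rewrite /y addrC subrK.
have := hg (y t) yr; rewrite addr0 fy expr2 => h.
apply: le_trans h _; rewrite -mulrA; apply: ler_wpM2l => //.
by rewrite -exprMn lerXn2r ?nnegrE // mulr_ge0 // ltW.
Qed.

Lemma t2_expR0 : t2 (@expR R).
Proof.
apply: (t2_close (r := 2^-1) (K := 2) (g := fun t => 1 + 1 * t + 2^-1 * t ^+ 2)) => //.
  exact: t2_poly.
apply: (t2_mvt (df := fun z => expR z - 1 - z)).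
- by rewrite expR0 mulr0 expr0n mulr0 !addr0 subrr.
- move=> z _; apply: is_derive_eq.
  by rewrite /GRing.scale /=; lra.
- move=> z hz; have [z1 z2] : - 2^-1 <= z /\ z <= 2^-1 by move: hz; rewrite ler_norml => /andP.
  have h1 := expR_le_quadratic z2; have h2 := expR_ge1Dx z.
  rewrite ger0_norm ?real_normK ?num_real //; lra.
Qed.

Lemma t2_expR f : t2 f -> t2 (fun t => expR (f t)).
Proof.
move=> tf; apply: (t2_comp tf).
by apply: t2_eq (t2M (t2_cst (expR (f 0))) t2_expR0) => y; rewrite expRD.
Qed.

Lemma t2_ln f : 0 < f 0 -> t2 f -> t2 (fun t => ln (f t)).
Proof.
move=> f0 tf; pose y t := (f 0)^-1 * f t.
have ty : t2 y by apply: t2M => //; exact: t2_cst.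
have y0 : y 0 = 1 by rewrite /y mulVf // gt_eqF.
have tl : t2 (fun t => ln (y t)).
  apply: (t2_comp ty); rewrite y0.
  apply: (t2_close (r := 2^-1) (K := 2) (g := fun t => 0 + 1 * t + (- 2^-1) * t ^+ 2)) => //.
    exact: t2_poly.
  have pos (z : R) : `|z| <= 2^-1 -> 2^-1 <= 1 + z by rewrite ler_norml => /andP[h1 _]; lra.
  apply: (t2_mvt (df := fun z => z ^+ 2 / (1 + z))).
  - by rewrite addr0 ln1 mulr0 expr0n mulr0 !addr0 subrr.
  - move=> z hz; have p := pos z hz; have p0 : 0 < 1 + z by lra.
    have h := is_derive1_ln p0.
    have hc : is_derive z 1 (fun t : R => ln (1 + t)) ((1 + z)^-1).
      have h2 : is_derive z 1 (fun t : R => 1 + t) 1 by apply: is_derive_eq; rewrite ?add0r; rewrite /GRing.scale /=; lra.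
      have h3 := @is_derive1_comp R (@ln R) (fun t => 1 + t) z _ _ h h2.
      by rewrite mulr1 in h3.
    apply: is_derive_eq.
    by rewrite /GRing.scale /=; field; rewrite gt_eqF.
  - move=> z hz; have p := pos z hz; have p0 : 0 < 1 + z by lra.
    rewrite normrM normrX mulrC ler_wpM2r ?exprn_ge0 // normfV gtr0_norm // -[leRHS]invrK.
    by rewrite lef_pV2 ?posrE ?invr_gt0.
have [L [r [r0 r1 L0 lf]]] := t2_lip tf.
apply: (t2_close (r := Num.min r (f 0 / (2 * L))) (K := 0) (g := fun t => ln (f 0) + ln (y t))) => //.
- by rewrite lt_min r0 divr_gt0 // mulr_gt0.
- by apply: t2D => //; exact: t2_cst.
move=> t; rewrite le_min ler_pdivlMr ?mulr_gt0 // => /andP[h1 h2].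
have ft : 0 < f t.
  have := lf t h1; rewrite ler_norml => /andP[h3 _]; nra.
by rewrite /y lnM ?posrE ?invr_gt0 // lnV ?posrE // addrA subrr add0r subrr normr0 mul0r.
Qed.

Lemma t2_inv f : 0 < f 0 -> t2 f -> t2 (fun t => (f t)^-1).
Proof.
move=> f0 tf; have [L [r [r0 r1 L0 lf]]] := t2_lip tf.
have tN : t2 (fun t => expR (-1 * ln (f t))).
  by apply: t2_expR; apply: t2M; [exact: t2_cst|exact: t2_ln].
apply: (t2_close (r := Num.min r (f 0 / (2 * L))) (K := 0) _ _ tN) => //.
  by rewrite lt_min r0 divr_gt0 // mulr_gt0.
move=> t; rewrite le_min ler_pdivlMr ?mulr_gt0 // => /andP[h1 h2].
have ft : 0 < f t.
  have := lf t h1; rewrite ler_norml => /andP[h3 _]; nra.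
by rewrite mulN1r expRN lnK ?posrE // subrr normr0 mul0r.
Qed.

Lemma t2_pow (c : R) f : 0 < c -> t2 f -> t2 (fun t => c `^ f t).
Proof.
move=> c0 tf; apply: (t2_eq (g := fun t => expR (f t * ln c))).
  by move=> t; rewrite powRexp.
by apply: t2_expR; apply: t2M => //; exact: t2_cst.
Qed.

Lemma quot_is_derive f (x c K r : R) : 0 < r ->
  (forall h, h != 0 -> `|h| <= r -> `|h^-1 * (f (x + h) - f x) - c| <= K * `|h|) ->
  is_derive x 1 f c.
Proof.
move=> r0 hq.
have cv : (fun h => h^-1 *: ((f \o shift x) (h *: (1 : R)) - f x)) @ 0^' --> c.
  apply/cvgrPdist_le => e e0.
  near=> h.
  have hn : h != 0 by near: h; exact: nbhs_dnbhs_neq.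
  have hr : `|h| <= Num.min r (e / (`|K| + 1)).
    near: h; apply: dnbhs0_le; rewrite lt_min r0 divr_gt0 // ltr_wpDl //.
  move: hr; rewrite le_min ler_pdivlMr ?ltr_wpDl // => /andP[hr hK].
  rewrite distrC /= /GRing.scale /= mulr1 [h + x]addrC.
  apply: le_trans (hq h hn hr) _; apply: le_trans hK; rewrite mulrC ler_wpM2l //.
  by apply: le_trans (ler_norm K) _; rewrite lerDl.
by split; [apply/cvg_ex; exists c|exact: cvg_lim cv].
Unshelve. all: by end_near.
Qed.

Lemma t2_is_derive (F : R -> R) (x : R) : t2 (fun t => F (x + t)) -> exists c : R, is_derive x 1 F c.
Proof.
move=> [c1 [c2 [K [r [r0 K0 hf]]]]]; exists c1.
apply: (@quot_is_derive _ _ _ (`|c2| + K) (Num.min r 1)); first by rewrite lt_min r0 ltr01.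
move=> h h0; rewrite le_min => /andP[hr h1].
have hp : 0 < `|h| by rewrite normr_gt0.
rewrite -(ler_pM2l hp) -normrM mulrBr mulrA divff // mul1r.
have := hf h hr; rewrite addr0 => hh.
have e : F (x + h) - F x - h * c1 = (F (x + h) - (F x + c1 * h + c2 * h ^+ 2)) + c2 * h ^+ 2 by ring.
rewrite e; apply: le_trans (ler_normD _ _) _; rewrite normrM normrX.
have h3 : K * `|h| ^+ 3 <= K * `|h| ^+ 2.
  by rewrite ler_wpM2l // exprSr ler_piMr // exprn_ge0.
have := le_trans hh h3; lra.
Qed.

(* [H] is the quotient [F x / (x - x0)] extended by [F^`() x0] at [x0]. *)
Lemma t2_quotient (F H : R -> R) (x : R) : t2 (fun t => F (x + t)) -> F x = 0 ->
  (forall y, y != x -> H y = F y / (y - x)) -> (forall c, is_derive x 1 F c -> H x = c) ->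
  derivable H x 1.
Proof.
move=> tF F0 HF Hx; have := tF; move=> [c1 [c2 [K [r [r0 K0 hf]]]]].
rewrite addr0 F0 in hf.
have dF : is_derive x 1 F c1.
  apply: (@quot_is_derive _ _ _ (`|c2| + K) (Num.min r 1)); first by rewrite lt_min r0 ltr01.
  move=> h h0; rewrite le_min => /andP[hr h1].
  have hp : 0 < `|h| by rewrite normr_gt0.
  rewrite -(ler_pM2l hp) -normrM mulrBr mulrA divff // mul1r F0.
  have hh := hf h hr.
  have e : F (x + h) - 0 - h * c1 = (F (x + h) - (0 + c1 * h + c2 * h ^+ 2)) + c2 * h ^+ 2 by ring.
  rewrite e; apply: le_trans (ler_normD _ _) _; rewrite normrM normrX.
  have h3 : K * `|h| ^+ 3 <= K * `|h| ^+ 2.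
    by rewrite ler_wpM2l // exprSr ler_piMr // exprn_ge0.
  have := le_trans hh h3; lra.
suff [] : is_derive x 1 H c2 by [].
apply: (@quot_is_derive _ _ _ K r r0) => h h0 hr.
have hp : 0 < `|h| ^+ 2 by rewrite exprn_gt0 // normr_gt0.
rewrite (Hx _ dF) HF; last by rewrite -subr_eq0 addrC addKr.
rewrite [x + h - x]addrC addKr -(ler_pM2l hp) -{1}normrX -normrM.
rewrite mulrCA -exprSr -[X in K * X]/(`|h| ^+ 3).
apply: le_trans (hf h hr); apply: le_of_eq; congr (`|_|).
by field.
Qed.

(* A convex function with vanishing second differences at [a] is differentiable there. *)
Lemma convex_is_derive f (a : R) :
  (forall x y t, 0 <= t <= 1 -> f ((1 - t) * x + t * y) <= (1 - t) * f x + t * f y) ->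
  (forall e, 0 < e -> exists2 h, 0 < h & f (a + h) + f (a - h) - 2 * f a <= e * h) ->
  derivable f a 1.
Proof.
move=> cvx h2.
pose S h := h^-1 * (f (a + h) - f a).
have S_mono h k : 0 < h -> h <= k -> S h <= S k.
  move=> h0 hk; have k0 := lt_le_trans h0 hk.
  have := cvx a (a + k) (h / k); rewrite divr_ge0 ?(ltW h0) ?(ltW k0) // ler_pdivrMr // mul1r hk.
  move=> /(_ isT); have -> : (1 - h / k) * a + h / k * (a + k) = a + h by field; rewrite gt_eqF.
  move=> H; rewrite /S mulrC ler_pdivrMr //.
  have -> : k^-1 * (f (a + k) - f a) * h = h / k * (f (a + k) - f a) by ring.
  set q := h / k in H *; lra.
have S_monoN h k : 0 < h -> h <= k -> S (- k) <= S (- h).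
  move=> h0 hk; have k0 := lt_le_trans h0 hk.
  have := cvx a (a - k) (h / k); rewrite divr_ge0 ?(ltW h0) ?(ltW k0) // ler_pdivrMr // mul1r hk.
  move=> /(_ isT); have -> : (1 - h / k) * a + h / k * (a - k) = a - h by field; rewrite gt_eqF.
  move=> H; rewrite /S !invrN !mulNr lerN2 mulrC ler_pdivrMr //.
  have -> : k^-1 * (f (a - k) - f a) * h = h / k * (f (a - k) - f a) by ring.
  set q := h / k in H *; lra.
have S_le h k : 0 < h -> 0 < k -> S (- h) <= S k.
  move=> h0 k0; pose m := Num.min h k.
  have m0 : 0 < m by rewrite lt_min h0.
  apply: le_trans (S_monoN m h m0 _) _; first by rewrite ge_min lexx.
  apply: le_trans _ (S_mono m k m0 _); last by rewrite ge_min lexx orbT.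
  rewrite /S invrN mulNr -subr_ge0 opprK -mulrDr mulr_ge0 ?invr_ge0 ?(ltW m0) //.
  have := cvx (a - m) (a + m) 2^-1; rewrite invr_ge0 ler0n invf_le1 ?ltr0n // ler1n => /(_ isT).
  have -> : (1 - 2^-1) * (a - m) + 2^-1 * (a + m) = a by field.
  lra.
(* By convexity the difference quotients [S] increase; the infimum of the right ones is the
   candidate derivative, and a small second difference closes the gap to the left ones. *)
pose A := [set S h | h in [set h : R | 0 < h]].
have A0 : has_inf A.
  split; first by exists (S 1), 1 => //=.
  by exists (S (- 1)) => _ [h /= h0 <-]; exact: S_le.
have infle h : 0 < h -> inf A <= S h.
  by move=> h0; apply: (inf_lbound A0.2); exists h.
have lein h : 0 < h -> S (- h) <= inf A.
  by move=> h0; apply: lb_le_inf A0.1 _ => _ [k /= k0 <-]; exact: S_le.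
apply/cvg_ex; exists (inf A); apply/cvgrPdist_le => e e0.
have [k k0 hk] := h2 e e0.
have gap : S k - S (- k) <= e.
  rewrite /S invrN mulNr opprK -mulrDr mulrC ler_pdivrMr //; lra.
near=> h.
have hn : h != 0 by near: h; exact: nbhs_dnbhs_neq.
have hr : `|h| <= k by near: h; exact: dnbhs0_le.
have eS : h^-1 *: ((f \o shift a) (h *: (1 : R)) - f a) = S h.
  by rewrite /S /= /GRing.scale /= mulr1 [h + a]addrC.
rewrite eS; have [h0|h0] := ltP 0 h.
  have hk' : h <= k by move: hr; rewrite gtr0_norm.
  have h3 := S_mono h k h0 hk'; have h4 := infle h h0; have h5 := lein k k0.
  by rewrite ler_norml; apply/andP; split; lra.
have h0' : 0 < - h by rewrite oppr_gt0 lt_neqAle hn.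
have hk' : - h <= k by move: hr; rewrite ler0_norm.
have h3 := S_monoN (- h) k h0' hk'; have h4 := lein (- h) h0'; have h5 := infle k k0.
rewrite opprK in h3 h4.
by rewrite ler_norml; apply/andP; split; lra.
Unshelve. all: by end_near.
Qed.

End SecondOrder.

(** * Smoothness of the limit at positive orders *)

Section PositiveOrders.
Variables (R : realType) (d : nat) (s : 'I_d -> R) (rho : 'M[R[i]]_d).
Hypothesis s_gt0 : forall i, 0 < s i.
Hypothesis s_sum : \sum_i s i = 1.
Hypothesis rho_pos : posdef rho.
Local Notation C := R[i].
Local Notation Ya := (Ya s rho).

Lemma between_ln (x y c Z : R) : 0 < x -> 0 < y -> `|ln x| <= Z -> `|ln y| <= Z ->
  Num.min x y <= c <= Num.max x y -> 0 < c /\ `|ln c| <= Z.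
Proof.
move=> x0 y0; rewrite !ler_norml => /andP[a1 a2] /andP[b1 b2] /andP[h1 h2].
have c0 : 0 < c by apply: lt_le_trans h1; rewrite lt_min x0.
split=> //; move: h1 h2; rewrite ge_min le_max => /orP h1 /orP h2.
apply/andP; split.
  by case: h1 => h; [apply: le_trans a1 _|apply: le_trans b1 _]; rewrite ler_ln ?posrE.
by case: h2 => h; [apply: le_trans a2|apply: le_trans b2]; rewrite ler_ln ?posrE.
Qed.

(** Two applications of the mean value theorem. The factor |p - 1| comes from the second derivative
    and is what yields a cubic error at order 1. *)
Lemma powR_expand (x y p P Z : R) : 0 < x -> 0 < y -> `|ln x| <= Z -> `|ln y| <= Z ->
  0 < p <= P ->
  `|y `^ p - x `^ p - p * x `^ (p - 1) * (y - x)| <=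
  P * expR ((P + 2) * Z) * `|p - 1| * (x - y) ^+ 2.
Proof.
move=> x0 y0 hx hy /andP[p0 pP].
have Z0 : 0 <= Z := le_trans (normr_ge0 _) hx.
have P0 : 0 < P := lt_le_trans p0 pP.
pose h z := z `^ p - p * x `^ (p - 1) * z.
have dh (z : R) : 0 < z -> is_derive z 1 h (p * z `^ (p - 1) - p * x `^ (p - 1)).
  move=> z0; have d1 := is_derive1_powR p z0.
  by apply: is_derive_eq; rewrite /GRing.scale /= mulr1.
have [z hz|c hc e1] := mvt (f := h) (df := fun z => p * z `^ (p - 1) - p * x `^ (p - 1)) (x := x) (y := y).
  by apply: dh; have [] := between_ln x0 y0 hx hy hz.
have [c0 lc] := between_ln x0 y0 hx hy hc.
have [z hz|c' hc' e2] := mvt (f := fun z => z `^ (p - 1)) (df := fun z => (p - 1) * z `^ (p - 1 - 1))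
    (x := x) (y := c).
  by apply: is_derive1_powR; have [] := between_ln x0 c0 hx lc hz.
have [c0' lc'] := between_ln x0 c0 hx lc hc'.
have -> : y `^ p - x `^ p - p * x `^ (p - 1) * (y - x) = h y - h x by rewrite /h; ring.
rewrite e1 -mulrBr e2 !normrM (ger0_norm (ltW p0)).
have k1 : `|c' `^ (p - 1 - 1)| <= expR ((P + 2) * Z).
  rewrite ger0_norm ?powR_ge0 // powRexp // ler_expR.
  have pb : `|p - 1 - 1| <= P + 2 by rewrite ler_norml; apply/andP; split; lra.
  by apply: le_trans (ler_norm _) _; rewrite normrM; apply: ler_pM.
have k2 : `|c - x| <= `|y - x| by exact: between_norm hc.
rewrite -[(x - y) ^+ 2]real_normK ?num_real // [`|x - y|]distrC expr2.
have -> : p * (`|p - 1| * `|c' `^ (p - 1 - 1)| * `|c - x|) * `|y - x| =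
  (p * `|c' `^ (p - 1 - 1)| * `|p - 1|) * (`|c - x| * `|y - x|) by ring.
apply: ler_pM.
- by rewrite !mulr_ge0 // ltW.
- by rewrite mulr_ge0.
- by apply: ler_wpM2r => //; apply: ler_pM => //; exact: ltW.
- exact: ler_wpM2r.
Qed.

Lemma t2_lip_fin (I : finType) (F : I -> R -> R) : (forall i, t2 (F i)) ->
  exists L r, [/\ 0 < r, r <= 1, 0 <= L &
    forall i t, `|t| <= r -> `|F i t - F i 0| <= L * `|t|].
Proof.
move=> hF; suff [L [r [r0 r1 L0 h]]] : exists L r, [/\ 0 < r, r <= 1, 0 <= L &
    forall i, i \in enum I -> forall t, `|t| <= r -> `|F i t - F i 0| <= L * `|t|].
  by exists L, r; split => // i; apply: h; rewrite mem_enum.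
elim: (enum I) => [|i q [L [r [r0 r1 L0 h]]]]; first by exists 0, 1; split.
have [L' [r' [r'0 r'1 L'0 h']]] := t2_lip (hF i).
exists (L + L'), (Num.min r r'); split.
- by rewrite lt_min r0.
- by rewrite ge_min r1.
- by rewrite addr_ge0 // ltW.
move=> k; rewrite inE => /orP[/eqP ->|kq] t; rewrite le_min mulrDl => /andP[h1 h2].
  by apply: le_trans (h' t h2) _; rewrite lerDr mulr_ge0.
by apply: le_trans (h k kq t h1) _; rewrite lerDl mulr_ge0 // ltW.
Qed.

Lemma qf_bounds D (A : 'M[C]_D) E f v Z : A = sp E f -> E \is unitarymx -> (forall i, 0 < f i) ->
  (forall i, `|ln (f i)| <= Z) -> expR (- Z) * nv v <= qf A v <= expR Z * nv v.
Proof.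
move=> -> uE f0 hZ; rewrite qf_sp -(parseval v uE) !mulr_sumr.
have b i : expR (- Z) <= f i <= expR Z.
  have := hZ i; rewrite ler_norml => /andP[h1 h2].
  by rewrite -[f i]lnK ?posrE // !ler_expR h1.
by apply/andP; split; apply: ler_sum => i _; apply: ler_wpM2r; rewrite ?wt_ge0 //; have /andP[] := b i.
Qed.

(** Eigenvalues of [Ya b] are expectations of rho in rescaled unit vectors, with rescaling bounded
    uniformly for b >= a/2. *)
Lemma Ya_spectrum a : 0 < a -> exists Z, forall b F y i, a / 2 <= b ->
  Ya b = sp F y -> F \is unitarymx -> 0 < y i -> `|ln (y i)| <= Z.
Proof.
move=> a0; have [E [f [uE f0 ef]]] := rho_pos.
pose Zf := \sum_i `|ln (f i)|; pose Zs := \sum_i `|ln (s i)|.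
have le1 (g : 'I_d -> R) i : `|g i| <= \sum_i `|g i|.
  by rewrite (bigD1 i) //= lerDl sumr_ge0.
pose H := (a^-1 + 2^-1) * Zs.
exists (Zf + 2 * H) => b F y i ab eY uF y0.
have b0 : 0 < b by apply: lt_le_trans ab; rewrite divr_gt0.
pose w i := s i `^ ((1 - b) / (2 * b)).
have lw k : `|ln (w k)| <= H.
  rewrite /w ln_powR normrM; apply: ler_pM => //; last exact: (le1 (fun i => ln (s i))).
  have -> : (1 - b) / (2 * b) = 2^-1 * b^-1 - 2^-1 by field; rewrite gt_eqF.
  have ib : b^-1 <= 2 * a^-1.
    have -> : 2 * a^-1 = (a / 2)^-1 by field; rewrite gt_eqF.
    by rewrite lef_pV2 ?posrE ?divr_gt0.
  have ib0 : 0 < b^-1 by rewrite invr_gt0.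
  have ia0 : 0 < a^-1 by rewrite invr_gt0.
  by rewrite ler_norml; apply/andP; split; lra.
have w0 k : 0 < w k by rewrite powR_gt0.
pose u := row i F *m rdiag w.
have ey : y i = qf rho u.
  rewrite -(qf_row_sp y i uF) -eY; have := qf_conj rho (rdiag w) (row i F).
  by rewrite rdiag_adj.
have nu : expR (- (2 * H)) <= nv u <= expR (2 * H).
  have -> : nv u = \sum_k w k ^+ 2 * nsq (row i F 0 k).
    by apply: eq_bigr => k _; rewrite /u mul_mx_rdiagE mulrC nsqZ.
  have n1 : \sum_k nsq (row i F 0 k) = 1 by exact: (nv_row i uF).
  have b2 k : expR (- (2 * H)) <= w k ^+ 2 <= expR (2 * H).
    have := lw k; rewrite ler_norml => /andP[h1 h2].
    by rewrite -[w k]lnK ?posrE // -expRM_natl !ler_expR; apply/andP; split; lra.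
  apply/andP; split.
    rewrite -[leLHS]mulr1 -[X in _ * X <= _]n1 mulr_sumr; apply: ler_sum => k _.
    by apply: ler_wpM2r; rewrite ?nsq_ge0 //; have /andP[] := b2 k.
  rewrite -[leRHS]mulr1 -[X in _ <= _ * X]n1 mulr_sumr; apply: ler_sum => k _.
  by apply: ler_wpM2r; rewrite ?nsq_ge0 //; have /andP[] := b2 k.
have /andP[q1 q2] := qf_bounds u ef uE f0 (fun k => le1 (fun i => ln (f i)) k).
have /andP[n1 n2] := nu.
rewrite -ey -/Zf in q1 q2.
have l1 : expR (- (Zf + 2 * H)) <= y i.
  by rewrite opprD expRD; apply: le_trans q1; rewrite ler_wpM2l ?expR_ge0.
have l2 : y i <= expR (Zf + 2 * H).
  by rewrite expRD; apply: le_trans q2 _; rewrite ler_wpM2l ?expR_ge0.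
rewrite ler_norml -(ler_expR _ (ln (y i))) -(ler_expR (ln (y i))) lnK ?posrE //.
by rewrite l1.
Qed.

Definition wexp (a : R) i j (t : R) :=
  s i `^ ((1 - (a + t)) / (2 * (a + t))) * s j `^ ((1 - (a + t)) / (2 * (a + t))).

Lemma t2_wexp a i j : 0 < a -> t2 (wexp a i j).
Proof.
move=> a0; have tk : t2 (fun t => (1 - (a + t)) / (2 * (a + t))).
  apply: t2M.
    by apply: t2_eq (t2_poly (1 - a) (-1) 0) => t; lra.
  apply: t2_inv; first by rewrite addr0 mulr_gt0.
  by apply: t2_eq (t2_poly (2 * a) 2 0) => t; lra.
by apply: t2M; apply: t2_pow.
Qed.

Lemma YaE a t i j : Ya (a + t) i j = (wexp a i j t)%:C * rho i j.
Proof.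
rewrite /Ya mul_mx_rdiagE mul_rdiagE /wexp (rmorphM (real_complex R)).
by rewrite mulrAC.
Qed.

(** [v] freezes the eigenbasis at order a and keeps the first-order part of the trace, which is
    explicit in t. The error is quadratic in general and cubic at a = 1. *)
Lemma trp_Ya_expand a : 0 < a -> exists v K r, [/\ t2 v, 0 < r, 0 <= K &
  forall t, `|t| <= r -> `|trp (a + t) (Ya (a + t)) - v t| <= K * `|a + t - 1| * `|t| ^+ 2].
Proof.
move=> a0; have [E [x [uE x0 eA]]] := Ya_posdef s_gt0 rho_pos a.
have [Z hZ] := Ya_spectrum a0.
have [L [r [r0 r1 L0 hL]]] := t2_lip_fin (fun ij : 'I_d * 'I_d => t2_wexp ij.1 ij.2 a0).
pose v t := \sum_k x k `^ (a + t) +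
  \sum_k ((a + t) * x k `^ (a + t - 1)) * (qf (Ya (a + t)) (row k E) - x k).
pose N := \sum_i \sum_j L ^+ 2 * nsq (rho i j).
have N0 : 0 <= N by apply: sumr_ge0 => i _; apply: sumr_ge0 => j _; rewrite mulr_ge0 ?sqr_ge0 ?nsq_ge0.
pose P := 2 * a.
exists v, (P * expR ((P + 2) * Z) * N), (Num.min r (a / 2)); split.
- apply: t2D; apply: t2_sum => k.
    by apply: t2_pow => //; apply: t2_eq (t2_poly a 1 0) => t; lra.
  apply: t2M; first apply: t2M.
  + by apply: t2_eq (t2_poly a 1 0) => t; lra.
  + by apply: t2_pow => //; apply: t2_eq (t2_poly (a - 1) 1 0) => t; lra.
  apply: t2D; last exact: t2_cst.
  apply: (t2_eq (g := fun t => \sum_i \sum_j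
    wexp a i j t * complex.Re (row k E 0 i * rho i j * (row k E 0 j)^*%R))).
    move=> t; rewrite qfE Re_sum; apply: eq_bigr => i _; rewrite Re_sum.
    apply: eq_bigr => j _; rewrite YaE mulrCA -mulrA -ReM_real; congr complex.Re.
    by rewrite !mulrA.
  by apply: t2_sum => i; apply: t2_sum => j; apply: t2M; [exact: t2_wexp|exact: t2_cst].
- by rewrite lt_min r0 divr_gt0.
- by rewrite !mulr_ge0 ?expR_ge0 // ltW.
move=> t; rewrite le_min => /andP[tr ta].
have [t1 t2] : - (a / 2) <= t /\ t <= a / 2 by move: ta; rewrite ler_norml => /andP.
have b2 : a / 2 <= a + t by lra.
have p1 : 0 < a + t <= P by rewrite /P; apply/andP; split; lra.
have [F [y [uF y0 eY]]] := Ya_posdef s_gt0 rho_pos (a + t).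
have Zx i : `|ln (x i)| <= Z by apply: (hZ a E x i) => //; lra.
have Zy i : `|ln (y i)| <= Z by exact: (hZ (a + t) F y i).
have := trf_expand (f := fun u => u `^ (a + t)) (g := fun u => (a + t) * u `^ (a + t - 1)) uE uF
  (fun i j => powR_expand (x0 i) (y0 j) (Zx i) (Zy j) p1).
rewrite -eY -eA => h.
have hs : hsn (Ya a - Ya (a + t)) <= N * `|t| ^+ 2.
  rewrite /N mulr_suml; apply: ler_sum => i _; rewrite mulr_suml; apply: ler_sum => j _.
  have ea : Ya a i j = (wexp a i j 0)%:C * rho i j by rewrite -(YaE a 0) addr0.
  have mB (A B : 'M[C]_d) : (A - B) i j = A i j - B i j by rewrite mxE [X in _ + X]mxE.
  rewrite mB ea YaE -mulrBl -(rmorphB (real_complex R)) nsqZ.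
  rewrite [leRHS]mulrAC ler_wpM2r ?nsq_ge0 // -exprMn -real_normK ?num_real //.
  rewrite lerXn2r ?nnegrE ?mulr_ge0 // distrC; exact: (hL (i, j) t tr).
have ev : trp (a + t) (Ya (a + t)) - v t = \sum_i y i `^ (a + t) - \sum_i x i `^ (a + t) -
    retr (sp E (fun i => (a + t) * x i `^ (a + t - 1))) (Ya (a + t) - Ya a).
  rewrite {1}eY (trp_sp _ _ uF) /v opprD addrA; congr (_ - _).
  rewrite (retr_spl _ _ uE); apply: eq_bigr => k _.
  by rewrite qfB eA (qf_row_sp _ _ uE).
rewrite ev; apply: le_trans h _.
apply: le_trans (ler_wpM2l _ hs) _.
  by rewrite !mulr_ge0 ?expR_ge0 // ltW // /P mulr_gt0.
by apply: le_of_eq; ring.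
Qed.

Lemma trp_Ya_gt0 a : 0 < trp a (Ya a).
Proof.
apply: trp_gt0; last exact: Ya_posdef.
by have := dim_gt0 s_sum 1; rewrite /= muln1.
Qed.

Lemma ln_trp_derivable a : 0 < a -> derivable (fun b => ln (trp b (Ya b))) a 1.
Proof.
move=> a0; have [v [K [r [tv r0 K0 h]]]] := trp_Ya_expand a0.
have v0 : trp a (Ya a) = v 0.
  have := h 0; rewrite normr0 addr0 expr0n mulr0 normr_le0 subr_eq0 => /(_ (ltW r0)).
  by move/eqP.
have [c1 [c2 [K' [r' [r'0 K'0 hv]]]]] := tv.
have dT : is_derive a 1 (fun b => trp b (Ya b)) c1.
  apply: (@quot_is_derive _ _ _ _ (`|c2| + K' + K * (`|a - 1| + 1)) (Num.min (Num.min r r') 1)).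
    by rewrite !lt_min r0 r'0 ltr01.
  move=> t t0; rewrite !le_min => /andP[/andP[h1 h2] h3].
  have hp : 0 < `|t| by rewrite normr_gt0.
  rewrite -(ler_pM2l hp) -normrM mulrBr mulrA divff // mul1r v0.
  have e : trp (a + t) (Ya (a + t)) - v 0 - t * c1 =
    (trp (a + t) (Ya (a + t)) - v t) + (v t - (v 0 + c1 * t + c2 * t ^+ 2)) + c2 * t ^+ 2 by ring.
  rewrite e; apply: (le_trans (ler_normD _ _)); apply: (le_trans (lerD (ler_normD _ _) (lexx _))).
  rewrite normrM normrX.
  have g1 := h t h1; have g2 := hv t h2.
  have g3 : K' * `|t| ^+ 3 <= K' * `|t| ^+ 2.
    by rewrite ler_wpM2l // exprSr ler_piMr // exprn_ge0.
  have g4 : K * `|a + t - 1| * `|t| ^+ 2 <= K * (`|a - 1| + 1) * `|t| ^+ 2.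
    apply: ler_wpM2r; first exact: exprn_ge0.
    apply: ler_wpM2l => //; rewrite addrAC; apply: le_trans (ler_normD _ _) _.
    by rewrite lerD2l.
  move: g1 g2 g3 g4; set q1 := `|_ - v t|; set q2 := `|v t - _|.
  set q3 := `|a + t - 1|; set q4 := `|a - 1|; set q5 := `|c2|; clear; lra.
have dl := is_derive1_ln (trp_Ya_gt0 a).
have [dd _] := is_derive1_comp dl dT; exact: dd.
Qed.

Lemma t2_ln_trp : t2 (fun t => ln (trp (1 + t) (Ya (1 + t)))).
Proof.
have [v [K [r [tv r0 K0 h]]]] := trp_Ya_expand (@ltr01 R).
apply: t2_ln; first exact: trp_Ya_gt0.
apply: (t2_close r0 K0 tv) => t ht; apply: le_trans (h t ht) _.
have -> : 1 + t - 1 = t by ring.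
by rewrite -mulrA -exprS.
Qed.

End PositiveOrders.

(** * Limits of F(x)/(x - 1) at 1 and at infinity *)

Section DifferenceQuotients.
Variable R : realType.
Local Notation quot F := (fun x : R => (x - 1)^-1 * F x).

Lemma near1_le (r : R) : 0 < r -> \forall x \near (1 : R)^', `|x - 1| <= r.
Proof.
move=> r0; apply: nbhs_dnbhs; near=> x; rewrite distrC.
by near: x; exact: (@cvgr_dist_le _ _ _ (nbhs (1 : R)) _ id 1 (@cvg_id _ _) r r0).
Unshelve. all: by end_near.
Qed.

Lemma t2_cvg_quot (F : R -> R) : t2 (fun t => F (1 + t)) -> F 1 = 0 ->
  exists2 c, is_derive (1 : R) 1 F c & quot F @ (1 : R)^' --> c.
Proof.
move=> tF F1; have [c dF] := t2_is_derive tF; exists c => //.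
have [[c1 [c2 [K [r [r0 K0 hF]]]]] [d1 _]] := (tF, dF).
have [c' dF' cv] : exists2 c' : R, is_derive (1 : R) 1 F c' & quot F @ (1 : R)^' --> c'.
  exists c1.
    apply: (@quot_is_derive _ _ _ _ (`|c2| + K) (Num.min r 1)); first by rewrite lt_min r0 ltr01.
    move=> h h0; rewrite le_min => /andP[hr h1].
    have hp : 0 < `|h| by rewrite normr_gt0.
    rewrite -(ler_pM2l hp) -normrM mulrBr mulrA divff // mul1r F1.
    have := hF h hr; rewrite addr0 F1 => hh.
    have e : F (1 + h) - 0 - h * c1 = (F (1 + h) - (0 + c1 * h + c2 * h ^+ 2)) + c2 * h ^+ 2 by ring.
    rewrite e; apply: le_trans (ler_normD _ _) _; rewrite normrM normrX.
    have h3 : K * `|h| ^+ 3 <= K * `|h| ^+ 2.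
      by rewrite ler_wpM2l // exprSr ler_piMr // exprn_ge0.
    have := le_trans hh h3; lra.
  apply/cvgrPdist_le => e e0; near=> x.
  have xn : x != 1 by near: x; exact: nbhs_dnbhs_neq.
  have hx : `|x - 1| <= Num.min (Num.min r 1) (e / (`|c2| + K + 1)).
    near: x; apply: near1_le; rewrite !lt_min r0 ltr01 divr_gt0 //.
    by rewrite ltr_wpDl // addr_ge0.
  pose h := x - 1; have h0 : h != 0 by rewrite subr_eq0.
  have hp : 0 < `|h| by rewrite normr_gt0.
  move: hx; rewrite -/h !le_min => /andP[/andP[hr h1]].
  rewrite ler_pdivlMr; last by rewrite ltr_wpDl // addr_ge0.
  move=> he; have := hF h hr; rewrite addr0 F1 [1 + h]addrC subrK => hh.
  rewrite -(ler_pM2l hp) -normrM mulrBr mulrA divff // mul1r distrC.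
  have eq : F x - h * c1 = (F x - (0 + c1 * h + c2 * h ^+ 2)) + c2 * h ^+ 2 by ring.
  rewrite eq; apply: le_trans (ler_normD _ _) _; rewrite normrM normrX.
  have h3 : K * `|h| ^+ 3 <= K * `|h| ^+ 2.
    by rewrite ler_wpM2l // exprSr ler_piMr // exprn_ge0.
  have h4 := le_trans hh h3; have h5 : `|h| ^+ 2 * (`|c2| + K) <= `|h| * e.
    rewrite expr2 -mulrA ler_pM2l //; apply: le_trans he.
    by rewrite ler_pM2l // lerDl.
  by move: h4 h5; set q := `|_ - _|; set w := `|h|; lra.
suff -> : c = c' by [].
by case: dF => _ <-; case: dF' => _ <-.
Unshelve. all: by end_near.
Qed.

Lemma cvg_pinfty_quot (F : R -> R) (g K : R) :
  (forall x, 1 < x -> `|F x - (x - 1) * g| <= K) -> quot F @ +oo --> g.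
Proof.
move=> h; have K0 : 0 <= K by apply: le_trans (h 2 _) => //; rewrite ltr1n.
apply/cvgrPdist_le => e e0; near=> x.
have x1 : 1 < x by near: x; apply: nbhs_pinfty_gt; exact: num_real.
have xe : 1 + K / e <= x by near: x; apply: nbhs_pinfty_ge; exact: num_real.
have p : 0 < x - 1 by rewrite subr_gt0.
rewrite distrC -(ler_pM2l p) -{1}(gtr0_norm p) -normrM mulrBr mulrA divff ?gt_eqF // mul1r.
by apply: le_trans (h x x1) _; rewrite -ler_pdivrMr // lerBrDl.
Unshelve. all: by end_near.
Qed.

Lemma cvg_ninfty_quot (F : R -> R) (g K : R) :
  (forall x, x < 0 -> `|F x - (x - 1) * g| <= K) -> quot F @ -oo --> g.
Proof.
move=> h; have K0 : 0 <= K by apply: le_trans (h (- 1) _) => //; rewrite oppr_lt0.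
apply/cvgrPdist_le => e e0; near=> x.
have x1 : x < 0 by near: x; apply: nbhs_ninfty_lt; exact: num_real.
have xe : x <= - (K / e) by near: x; apply: nbhs_ninfty_le; exact: num_real.
have p : x - 1 < 0 by lra.
have p' : 0 < `|x - 1| by rewrite normr_gt0 lt_eqF.
rewrite distrC -(ler_pM2l p') -normrM mulrBr mulrA divff ?lt_eqF // mul1r.
apply: le_trans (h x x1) _; rewrite -ler_pdivrMr // ltr0_norm //.
by set q := K / e in xe *; lra.
Unshelve. all: by end_near.
Qed.

(* The slopes [g n] converge as soon as the functions do at arbitrarily large arguments. *)
Lemma cvg_slopes (P : nat -> R -> R) (f : R -> R) (g : nat -> R) (K : R) (A : set R) : 0 <= K ->
  (forall x, A x -> (fun n => n%:R^-1 * P n x) @ \oo --> f x) ->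
  (forall n x, A x -> `|P n x - (x - 1) * g n| <= n%:R * K) ->
  (forall B : R, exists2 x, A x & B < `|x - 1|) ->
  exists2 G, (fun n => n%:R^-1 * g n) @ \oo --> G & forall x, A x -> `|f x - (x - 1) * G| <= K.
Proof.
move=> K0 cf hg big.
have scale n x : A x -> (0 < n)%N -> `|n%:R^-1 * P n x - (x - 1) * (n%:R^-1 * g n)| <= K.
  move=> Ax n0; have nR : 0 < n%:R :> R by rewrite ltr0n.
  rewrite -(ler_pM2l nR) -{1}(gtr0_norm nR) -normrM mulrBr mulVKf ?gt_eqF // mulrCA.
  by rewrite mulVKf ?gt_eqF //; exact: hg.
have [G cG] : exists G : R, (fun n => n%:R^-1 * g n) @ \oo --> G.
  apply/cvg_ex/cauchy_cvgP/cauchy_exP => e e0.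
  have [x Ax xB] := big (2 * K / e).
  have x1 : 0 < `|x - 1|.
    by apply: le_lt_trans xB; rewrite divr_ge0 ?mulr_ge0 // ltW.
  exists ((x - 1)^-1 * f x).
  change (\forall n \near \oo, ball ((x - 1)^-1 * f x) e (n%:R^-1 * g n)).
  near=> n.
  have n0 : (0 < n)%N by near: n; exact: nbhs_infty_gt.
  rewrite /ball /= /ball_ -(ltr_pM2l x1) -normrM mulrBr mulrA divff; last by rewrite -normr_gt0.
  rewrite mul1r.
  have h1 := scale n x Ax n0.
  have h2 : `|f x - n%:R^-1 * P n x| <= `|x - 1| * e / 4.
    near: n; move/cvgrPdist_le: (cf x Ax); apply.
    by rewrite divr_gt0 // mulr_gt0.
  have h3 : 2 * K < `|x - 1| * e by rewrite -ltr_pdivrMr.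
  have e1 : f x - (x - 1) * (n%:R^-1 * g n) =
    (f x - n%:R^-1 * P n x) + (n%:R^-1 * P n x - (x - 1) * (n%:R^-1 * g n)) by ring.
  rewrite e1; apply: le_lt_trans (ler_normD _ _) _.
  have := mulr_gt0 x1 e0; move: h1 h2 h3; set a := `|_ - _|; set b := `|_ - _|; set w := `|x - 1|.
  by lra.
exists G => // x Ax.
have c1 : (fun n => `|n%:R^-1 * P n x - (x - 1) * (n%:R^-1 * g n)|) @ \oo --> `|f x - (x - 1) * G|.
  by apply: cvg_norm; apply: cvgB; [exact: cf|apply: cvgM => //; exact: cvg_cst].
apply: (cvgr_to_le c1); near=> n; apply: scale => //.
by near: n; exact: nbhs_infty_gt.
Unshelve. all: by end_near.
Qed.

End DifferenceQuotients.

(** * From limits of log-partition functions to the divergences *)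

Section LimitFamily.
Variables (R : realType) (P : nat -> R -> R) (f M : R -> R) (K : R).
Local Notation quot F := (fun x : R => (x - 1)^-1 * F x).
Hypothesis K0 : 0 <= K.
Hypothesis P_t2 : forall n, t2 (fun t => P n (1 + t)).
Hypothesis P_1 : forall n, P n 1 = 0.
Hypothesis P_support : forall n, exists m, forall x, (x - 1) * m <= P n x.
Hypothesis P_cvg : forall x, (fun n => n%:R^-1 * P n x) @ \oo --> f x.
Hypothesis P_pinfty : forall n, exists g, forall x, 1 < x -> `|P n x - (x - 1) * g| <= n%:R * K.
Hypothesis P_ninfty : forall n, exists g, forall x, x < 0 -> `|P n x - (x - 1) * g| <= n%:R * K.
Hypothesis f_t2 : t2 (fun t => f (1 + t)).
Hypothesis f_1 : f 1 = 0.
Hypothesis f_derivable : forall x, derivable f x 1.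
Hypothesis f_ge1 : forall x, 1 <= x -> 0 <= f x.
Hypothesis f_01 : forall x, 0 <= x <= 1 -> f x <= 0.
Hypothesis f_neg : forall x, x <= 0 -> 0 <= f x.
Hypothesis M_1 : cvg (quot M @ (1 : R)^').
Hypothesis M_pinfty : cvg (quot M @ +oo).
Hypothesis M_ninfty : cvg (quot M @ -oo).
Hypothesis M_ge1 : forall x, 1 <= x -> f x <= M x.
Hypothesis M_01 : forall x, 0 <= x < 1 -> M x <= f x.
Hypothesis M_neg : forall x, x <= 0 -> f x <= M x.

(** The regularised divergences with P n x in the role of (x - 1) D_x. The left and right sequences
    are both instances. *)
Definition Dseq (a : \bar R) (n : nat) : R := n%:R^-1 * ext_by_limits (quot (P n)) a.

(** A line below [F] through its zero at 1 has slope F'(1). *)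
Lemma quot_near (F : R -> R) (x m c : R) : is_derive (1 : R) 1 F c ->
  quot F @ (1 : R)^' --> c -> (forall x, (x - 1) * m <= F x) -> m = c.
Proof.
move=> dF cF hm.
have cx (h : R) : 0 < h -> exists2 e : R, 0 < e < h & True.
  by move=> h0; exists (h / 2) => //; apply/andP; split; lra.
apply/le_anti/andP; split; rewrite leNgt; apply/negP => mc.
  have e0 : 0 < (m - c) / 2 by lra.
  move/cvgrPdist_le: (cF) => /(_ _ e0) /= H.
  have [h /= h0 hh] := H.
  have := hh (1 + h / 2).
  rewrite /ball_ /= opprD addrA subrr sub0r normrN gtr0_norm ?divr_gt0 //.
  have hlt : h / 2 < h by lra.
  have ne : 1 + h / 2 != 1 by rewrite -subr_eq0 addrC addKr gt_eqF // divr_gt0.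
  move=> /(_ hlt ne); rewrite [1 + _ - 1]addrC addKr => hle.
  have := hm (1 + h / 2); rewrite [1 + _ - 1]addrC addKr => hs.
  have hq : m <= (h / 2)^-1 * F (1 + h / 2).
    by rewrite mulrC ler_pdivlMr ?divr_gt0 // mulrC.
  by move: hle; rewrite ler_norml => /andP[h1 h2]; lra.
have e0 : 0 < (c - m) / 2 by lra.
move/cvgrPdist_le: (cF) => /(_ _ e0) /= H.
have [h /= h0 hh] := H.
have := hh (1 - h / 2).
rewrite /ball_ /= opprB addrCA subrr addr0 gtr0_norm ?divr_gt0 //.
have hlt : h / 2 < h by lra.
have ne : 1 - h / 2 != 1 by rewrite -subr_eq0 addrC addKr oppr_eq0 gt_eqF // divr_gt0.
move=> /(_ hlt ne); rewrite [1 - _ - 1]addrC addKr => hle.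
have := hm (1 - h / 2); rewrite [1 - _ - 1]addrC addKr => hs.
have hq : (- (h / 2))^-1 * F (1 - h / 2) <= m.
  by rewrite invrN mulNr lerNl mulrC ler_pdivlMr ?divr_gt0 //; lra.
by move: hle; rewrite ler_norml => /andP[h1 h2]; lra.
Qed.

Lemma Dseq_real (x : R) : x != 1 -> Dseq x%:E @ \oo --> (x - 1)^-1 * f x.
Proof.
move=> x1.
have -> : Dseq x%:E = (fun n => (x - 1)^-1 * (n%:R^-1 * P n x)).
  by apply/funext => n; rewrite /Dseq /= (negbTE x1) mulrCA.
by apply: cvgM; [exact: cvg_cst|exact: P_cvg].
Qed.

(** The divergence of order 1 at size n is the supporting slope at 1, trapped between difference
    quotients at 1 + h/2 and 1 - h/2. These converge to quotients of [f], so pointwise convergence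
    suffices. *)
Lemma Dseq_one c : is_derive (1 : R) 1 f c -> quot f @ (1 : R)^' --> c -> Dseq 1%:E @ \oo --> c.
Proof.
move=> df cf.
have [m hm] := choice P_support.
have em n : ext_by_limits (quot (P n)) 1%:E = m n.
  have [c' d' cv] := t2_cvg_quot (P_t2 n) (P_1 n).
  rewrite /= eqxx (quot_near 1 d' cv (hm n)); apply: cvg_lim => //.
have -> : Dseq 1%:E = (fun n => n%:R^-1 * m n) by apply/funext => n; rewrite /Dseq em.
apply/cvgrPdist_le => e e0.
have e2 : 0 < e / 2 by lra.
move/cvgrPdist_le: (cf) => /(_ _ e2) [h /= h0 hh].
have hlt : h / 2 < h by lra.
have p2 : 0 < h / 2 by lra.
have f1 : `|c - (h / 2)^-1 * f (1 + h / 2)| <= e / 2.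
  have := hh (1 + h / 2); rewrite /ball_ /= opprD addrA subrr sub0r normrN gtr0_norm //.
  have ne : 1 + h / 2 != 1 by rewrite -subr_eq0 addrC addKr gt_eqF.
  by move=> /(_ hlt ne); rewrite [1 + _ - 1]addrC addKr.
have f2 : `|c + (h / 2)^-1 * f (1 - h / 2)| <= e / 2.
  have := hh (1 - h / 2); rewrite /ball_ /= opprB addrCA subrr addr0 gtr0_norm //.
  have ne : 1 - h / 2 != 1 by rewrite -subr_eq0 addrC addKr oppr_eq0 gt_eqF.
  by move=> /(_ hlt ne); rewrite [1 - _ - 1]addrC addKr invrN mulNr opprK.
have pe : 0 < h / 2 * (e / 2) by rewrite mulr_gt0.
near=> n.
have k1 : `|f (1 + h / 2) - n%:R^-1 * P n (1 + h / 2)| <= h / 2 * (e / 2).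
  by near: n; move/cvgrPdist_le: (P_cvg (x := 1 + h / 2)); apply.
have k2 : `|f (1 - h / 2) - n%:R^-1 * P n (1 - h / 2)| <= h / 2 * (e / 2).
  by near: n; move/cvgrPdist_le: (P_cvg (x := 1 - h / 2)); apply.
have nV : 0 <= n%:R^-1 :> R by rewrite invr_ge0.
have s1 := ler_wpM2l nV (hm n (1 + h / 2)); have s2 := ler_wpM2l nV (hm n (1 - h / 2)).
rewrite [1 + _ - 1]addrC addKr in s1; rewrite [1 - _ - 1]addrC addKr in s2.
move: f1 f2 k1 k2 s1 s2.
set A := f (1 + _); set B := f (1 - _); set A' := n%:R^-1 * P n (1 + _); set B' := n%:R^-1 * P n (1 - _).
set y := n%:R^-1 * m n => f1 f2 k1 k2.
have -> : n%:R^-1 * (h / 2 * m n) = h / 2 * y by rewrite /y mulrCA.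
have -> : n%:R^-1 * (- (h / 2) * m n) = - (h / 2 * y) by rewrite /y; ring.
move=> s1 s2.
rewrite -(ler_pM2l p2) -{1}(gtr0_norm p2) -normrM mulrBr in f1.
rewrite mulVKf ?gt_eqF // in f1.
rewrite -(ler_pM2l p2) -{1}(gtr0_norm p2) -normrM mulrDr in f2.
rewrite mulVKf ?gt_eqF // in f2.
rewrite -(ler_pM2l p2) -{1}(gtr0_norm p2) -normrM mulrBr.
move: f1 f2 k1 k2; rewrite !ler_norml => /andP[a1 a2] /andP[b1 b2] /andP[c1 c2] /andP[d1 d2].
by apply/andP; split; lra.
Unshelve. all: by end_near.
Qed.

Lemma family_limit : exists c Gp Gn : R,
  [/\ is_derive (1 : R) 1 f c, quot f @ (1 : R)^' --> c, quot f @ +oo --> Gp & quot f @ -oo --> Gn] /\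
  [/\ Dseq 1%:E @ \oo --> c, Dseq +oo @ \oo --> Gp & Dseq -oo @ \oo --> Gn].
Proof.
have [c df cf] := t2_cvg_quot f_t2 f_1.
have [gp hp] := choice P_pinfty; have [gn hn] := choice P_ninfty.
have bigp (B : R) : exists2 x, [set x | 1 < x] x & B < `|x - 1|.
  have B0 := normr_ge0 B; have B1 := ler_norm B.
  by exists (`|B| + 2) => /=; [lra|rewrite gtr0_norm; lra].
have bign (B : R) : exists2 x, [set x | x < 0] x & B < `|x - 1|.
  have B0 := normr_ge0 B; have B1 := ler_norm B.
  by exists (- `|B| - 1) => /=; [lra|rewrite ltr0_norm; lra].
have [Gp cp fp] := cvg_slopes K0 (fun x _ => P_cvg (x := x)) (fun n x h => hp n x h) bigp.
have [Gn cn fn] := cvg_slopes K0 (fun x _ => P_cvg (x := x)) (fun n x h => hn n x h) bign.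
exists c, Gp, Gn; split; split => //.
- exact: cvg_pinfty_quot fp.
- exact: cvg_ninfty_quot fn.
- exact: Dseq_one.
- have -> // : Dseq +oo = (fun n => n%:R^-1 * gp n).
  apply/funext => n; rewrite /Dseq; congr (_ * _).
  by apply: cvg_lim => //; exact: cvg_pinfty_quot (hp n).
- have -> // : Dseq -oo = (fun n => n%:R^-1 * gn n).
  apply/funext => n; rewrite /Dseq; congr (_ * _).
  by apply: cvg_lim => //; exact: cvg_ninfty_quot (hn n).
Qed.

(** At finite orders other than 1 everything is read off the quotient of [f], with the sign of x - 1
    fixing directions; the exceptional orders follow by limits of the inequalities, and
    differentiability at 1 by [t2_quotient]. *)
Theorem family_properties :
  (forall a, cvgn (Dseq a)) /\
  [/\ (forall a, (0 <= a)%E -> 0 <= limn (Dseq a)),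
      (forall a, (a <= 0)%E -> limn (Dseq a) <= 0),
      (forall a, (0 <= a)%E -> limn (Dseq a) <= ext_by_limits (quot M) a),
      (forall a, (a <= 0)%E -> ext_by_limits (quot M) a <= limn (Dseq a))
    & (forall a : R, derivable (fun x : R => limn (Dseq x%:E)) a 1)].
Proof.
have [c [Gp [Gn [[df cf cfp cfn] [c1 cp cn]]]]] := family_limit.
have l1 : limn (Dseq 1%:E) = c by apply: cvg_lim.
have lp : limn (Dseq +oo) = Gp by apply: cvg_lim.
have ln : limn (Dseq -oo) = Gn by apply: cvg_lim.
have lr x : x != 1 -> limn (Dseq x%:E) = (x - 1)^-1 * f x.
  by move=> x1; apply: cvg_lim => //; exact: Dseq_real.
have pos (x : R) : 1 < x -> 0 < (x - 1)^-1 by move=> x1; rewrite invr_gt0 subr_gt0.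
have neg (x : R) : x < 1 -> (x - 1)^-1 < 0 by move=> x1; rewrite invr_lt0 subr_lt0.
have q_ge0 x : x != 1 -> 0 <= x -> 0 <= (x - 1)^-1 * f x.
  rewrite neq_lt => /orP[x1|x1] x0.
    by apply: mulr_le0; [exact: ltW (neg _ x1)|apply: f_01; rewrite x0 ltW].
  by apply: mulr_ge0; [exact: ltW (pos _ x1)|exact/f_ge1/ltW].
have q_le0 x : x <= 0 -> (x - 1)^-1 * f x <= 0.
  by move=> x0; apply: mulr_le0_ge0; [apply/ltW/neg; exact: le_lt_trans x0 _|exact: f_neg].
have q_leM x : x != 1 -> 0 <= x -> (x - 1)^-1 * f x <= (x - 1)^-1 * M x.
  rewrite neq_lt => /orP[x1|x1] x0.
    by rewrite ler_nM2l ?neg // M_01 // x0.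
  by rewrite ler_pM2l ?pos // M_ge1 // ltW.
have q_geM x : x <= 0 -> (x - 1)^-1 * M x <= (x - 1)^-1 * f x.
  by move=> x0; rewrite ler_nM2l ?M_neg // neg // (le_lt_trans x0).
have near1 : \forall x \near (1 : R)^', 0 <= x /\ x != 1.
  near=> x; split; last by near: x; exact: nbhs_dnbhs_neq.
  have : `|x - 1| <= 1 by near: x; exact: near1_le.
  by rewrite ler_norml => /andP[h _]; lra.
have nearp : \forall x \near (+oo : set_system R), 0 <= x /\ x != 1.
  near=> x; have x1 : 1 < x by near: x; apply: nbhs_pinfty_gt; exact: num_real.
  by split; [exact: le_trans (ltW x1)|rewrite gt_eqF].
have nearn : \forall x \near (-oo : set_system R), x <= 0.
  by apply: nbhs_ninfty_le; exact: num_real.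
split.
  move=> [x| |]; [|by apply/cvg_ex; exists Gp|by apply/cvg_ex; exists Gn].
  have [->|x1] := eqVneq x 1; first by apply/cvg_ex; exists c.
  by apply/cvg_ex; exists ((x - 1)^-1 * f x); exact: Dseq_real.
split.
- move=> [x| |] //.
  + rewrite lee_fin => x0; have [->|x1] := eqVneq x 1; last by rewrite lr // q_ge0.
    rewrite l1; apply: (cvgr_to_ge cf); apply: filterS near1 => y [y0 y1]; exact: q_ge0.
  + by move=> _; rewrite lp; apply: (cvgr_to_ge cfp); apply: filterS nearp => y [y0 y1]; exact: q_ge0.
- move=> [x| |] //.
  + rewrite lee_fin => x0; rewrite lr ?q_le0 // lt_eqF // (le_lt_trans x0) //.
  + by move=> _; rewrite ln; apply: (cvgr_to_le cfn); apply: filterS nearn => y; exact: q_le0.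
- move=> [x| |] //.
  + rewrite lee_fin => x0; have [->|x1] := eqVneq x 1; last first.
      by rewrite lr //= (negbTE x1) q_leM.
    rewrite l1 /= eqxx; apply: (ler_cvg_to cf M_1).
    by apply: filterS near1 => y [y0 y1]; exact: q_leM.
  + move=> _; rewrite lp /=; apply: (ler_cvg_to cfp M_pinfty).
    by apply: filterS nearp => y [y0 y1]; exact: q_leM.
- move=> [x| |] //.
  + rewrite lee_fin => x0; have x1 : x != 1 by rewrite lt_eqF // (le_lt_trans x0).
    by rewrite lr //= (negbTE x1) q_geM.
  + move=> _; rewrite ln /=; apply: (ler_cvg_to M_ninfty cfn).
    by apply: filterS nearn => y; exact: q_geM.
move=> a; have [->|a1] := eqVneq a 1.
  apply: (t2_quotient f_t2 f_1) => [y y1|c' d'].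
    by rewrite lr // mulrC.
  by rewrite l1; case: df => _ <-; case: d' => _ <-.
apply: (@near_eq_derivable _ _ _ (fun x : R => (x - 1)^-1 * f x)).
  near=> x; rewrite lr //; near: x.
  have o : open [set x : R | x != 1] by exact: open_neq.
  by apply: open_nbhs_nbhs; split.
apply: derivableM; last exact: f_derivable.
apply: derivableV; first by rewrite subr_eq0.
by apply: derivableB; [exact: derivable_id|exact: derivable_cst].
Unshelve. all: by end_near.
Qed.

End LimitFamily.

(** * The limit function [Psi] *)

Section LimitFunction.
Variables (R : realType) (d : nat) (s : 'I_d -> R) (rho : 'M[R[i]]_d).
Hypothesis s_gt0 : forall i, 0 < s i.
Hypothesis s_sum : \sum_i s i = 1.
Hypothesis rho_pos : posdef rho.
Hypothesis rho_tr : \tr rho = 1.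
Local Notation C := R[i].
Local Notation psi := (psi s rho).
Local Notation qn := (qn s rho).
Local Notation Ya := (Ya s rho).
Local Notation Wlow := (Wlow s rho).
Variables (G : 'M[C]_d) (del : 'I_d -> R).
Hypothesis adp : adapted s rho G del.

Definition Psi (a : R) : R := limn (fun n => n%:R^-1 * psi n a).

Lemma cvg_sublinear (u : nat -> R) (l k : R) : 0 <= k ->
  (forall n, `|u n - n%:R * l| <= k * ln ((n.+1 ^ d)%:R)) -> (fun n => n%:R^-1 * u n) @ \oo --> l.
Proof.
move=> k0 h; apply/cvgrPdist_le => e e0.
have e1 : 0 < e / (2 * (k + 1)) by rewrite divr_gt0 // mulr_gt0 // ltr_wpDl.
have [K K0 hK] := ln_succ_le_affine d e1.
near=> n.
have n0 : (0 < n)%N by near: n; exact: nbhs_infty_gt.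
have nR : 0 < n%:R :> R by rewrite ltr0n.
have hn : k * K / (e / 2) <= n%:R by near: n; exact: nbhs_infty_ger.
rewrite distrC -(ler_pM2l nR) -{1}(gtr0_norm nR) -normrM mulrBr mulVKf ?gt_eqF //.
apply: le_trans (h n) _; apply: le_trans (ler_wpM2l k0 (hK n)) _.
rewrite ler_pdivrMr ?divr_gt0 // in hn.
have h1 : k * (e / (2 * (k + 1)) * n%:R) <= e / 2 * n%:R.
  rewrite mulrA; apply: ler_wpM2r => //.
  have -> : k * (e / (2 * (k + 1))) = e / 2 * (k / (k + 1)) by field; rewrite gt_eqF // ltr_wpDl.
  by rewrite ler_piMr ?divr_ge0 ?(ltW e0) // ler_pdivrMr ?ltr_wpDl // mul1r lerDl.
by rewrite mulrDr; move: h1 hn; set A := k * (_ * _); set B := k * K; lra.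
Unshelve. all: by end_near.
Qed.

Lemma psi_cvg_pos a : 0 < a -> (fun n => n%:R^-1 * psi n a) @ \oo --> ln (trp a (Ya a)).
Proof.
move=> a0; have T0 := trp_Ya_gt0 s_gt0 s_sum rho_pos a.
apply: (@cvg_sublinear _ _ (1 + a)) => [|n]; first by rewrite addr_ge0 // ltW.
have q0 := qn_gt0 s_gt0 s_sum rho_pos n a.
have k0 : 0 < (n.+1 ^ d)%:R :> R by rewrite ltr0n expn_gt0.
have k1 : 0 <= ln ((n.+1 ^ d)%:R : R) by rewrite ln_ge0 // ler1n expn_gt0.
have h1 := qn_le_card s_gt0 rho_pos n a0.
have h2 := qn_card_ge s_gt0 s_sum rho_pos n a0.
rewrite -(ler_ln (x := qn n a)) ?posrE ?mulr_gt0 ?exprn_gt0 // lnM ?posrE ?exprn_gt0 // in h1.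
rewrite -(ler_ln (x := _ ^+ n)) ?posrE ?mulr_gt0 ?exprn_gt0 ?powR_gt0 // lnM ?posrE ?powR_gt0 // in h2.
rewrite lnXn // -[X in _ <= _ + X]mulr_natl in h1.
rewrite lnXn // -[X in X <= _]mulr_natl ln_powR in h2.
rewrite mulrDl mul1r; have ak := mulr_ge0 (ltW a0) k1.
move: h1 h2 k1 ak; rewrite -/(psi n a).
set k := ln _%:R; set l := ln (trp _ _); set p := psi n a; set q := a * k; clear.
by move=> h1 h2 k1 ak; rewrite ler_norml; apply/andP; split; lra.
Qed.

Lemma psi_cvg a : (fun n => n%:R^-1 * psi n a) @ \oo --> Psi a.
Proof.
have [a0|a0] := ltP 0 a; first by apply/cvgP/(psi_cvg_pos a0).
move: a0; rewrite le_eqVlt => /orP[/eqP ->|a0].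
  have c0 : (fun n => n%:R^-1 * psi n 0) @ \oo --> (0 : R).
    have -> : (fun n => n%:R^-1 * psi n 0) = fun=> 0.
      by apply/funext => n; rewrite psi0 // mulr0.
    exact: cvg_cst.
  exact: cvgP c0.
have [l [cl _]] := neg_limit s_gt0 s_sum rho_pos rho_tr a0.
exact: cvgP cl.
Qed.

Lemma Psi_pos a : 0 < a -> Psi a = ln (trp a (Ya a)).
Proof. by move=> a0; apply: cvg_lim => //; exact: psi_cvg_pos. Qed.

Lemma Psi0 : Psi 0 = 0.
Proof.
apply: cvg_lim => //; have -> : (fun n => n%:R^-1 * psi n 0) = fun=> 0.
  by apply/funext => n; rewrite psi0 // mulr0.
exact: cvg_cst.
Qed.

Lemma Psi1 : Psi 1 = 0.
Proof.
apply: cvg_lim => //; have -> : (fun n => n%:R^-1 * psi n 1) = fun=> 0.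
  by apply/funext => n; rewrite (psi1 s rho_pos rho_tr) mulr0.
exact: cvg_cst.
Qed.

Lemma psi_convex n x y t : 0 <= t <= 1 ->
  psi n ((1 - t) * x + t * y) <= (1 - t) * psi n x + t * psi n y.
Proof.
move=> /andP[t0 t1]; have [E [xx [lab dat]]] := eigdata_exists s rho_pos n.
set z := _ + _.
have h1 := psi_support s_gt0 s_sum rho_pos z x dat.
have h2 := psi_support s_gt0 s_sum rho_pos z y dat.
have t1' : 0 <= 1 - t by rewrite subr_ge0.
have := lerD (ler_wpM2l t1' h1) (ler_wpM2l t0 h2).
set S := slope _ _ _ _ _ => h; apply: le_trans h; apply: le_of_eq; rewrite /z; ring.
Qed.

Lemma Psi_convex x y t : 0 <= t <= 1 ->
  Psi ((1 - t) * x + t * y) <= (1 - t) * Psi x + t * Psi y.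
Proof.
move=> ht.
have c2 : (fun n => (1 - t) * (n%:R^-1 * psi n x) + t * (n%:R^-1 * psi n y)) @ \oo -->
    (1 - t) * Psi x + t * Psi y.
  by apply: cvgD; apply: cvgM; [exact: cvg_cst|exact: psi_cvg|exact: cvg_cst|exact: psi_cvg].
apply: (ler_cvg_to (@psi_cvg _) c2).
near=> n; have nV : 0 <= n%:R^-1 :> R by rewrite invr_ge0.
apply: le_trans (ler_wpM2l nV (psi_convex n x y ht)) _.
set A := psi n x; set B := psi n y; apply: le_of_eq; ring.
Unshelve. all: by end_near.
Qed.

Lemma Psi_ge1 x : 1 <= x -> 0 <= Psi x.
Proof.
move=> x1; have x0 : 0 < x := lt_le_trans ltr01 x1.
have := @Psi_convex 0 x x^-1; rewrite invr_ge0 (ltW x0) invf_le1 // x1 => /(_ isT).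
by rewrite mulr0 add0r mulVf ?gt_eqF // Psi0 Psi1 mulr0 add0r pmulr_rge0 // invr_gt0.
Qed.

Lemma Psi_01 x : 0 <= x <= 1 -> Psi x <= 0.
Proof.
by move=> hx; have := @Psi_convex 0 1 x hx; rewrite mulr0 add0r mulr1 Psi0 Psi1 !mulr0 addr0.
Qed.

Lemma Psi_neg x : x <= 0 -> 0 <= Psi x.
Proof.
move=> x0; have p : 0 < 1 - x by lra.
(* Here 0 is a convex combination of x and 1, and [Psi] vanishes at 0 and 1. *)
have := @Psi_convex x 1 (- x / (1 - x)).
rewrite divr_ge0 ?oppr_ge0 ?(ltW p) // ler_pdivrMr // mul1r => /(_ _).
have -> : (1 - - x / (1 - x)) * x + - x / (1 - x) * 1 = 0 by field; rewrite gt_eqF.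
have -> : 1 - - x / (1 - x) = (1 - x)^-1 by field; rewrite gt_eqF.
rewrite Psi0 Psi1 mulr0 addr0 pmulr_rge0 ?invr_gt0 //; apply; lra.
Qed.

Lemma t2_phi : t2 (phi s del).
Proof.
have [_ _ del0 _] := adp.
apply: t2_ln; first exact: (phi_sum_gt0 s_gt0 s_sum adp).
apply: t2_sum => i; apply: t2M; apply: t2_pow => //.
  by apply: t2_eq (t2_lin 1) => t; rewrite mul1r.
by apply: t2_eq (t2_poly 1 (- 1) 0) => t; lra.
Qed.

Lemma Psi_t2_0 : t2 Psi.
Proof.
have [K K0 h] := near_zero s_gt0 s_sum rho_pos adp.
have phi0 : phi s del 0 = 0.
  rewrite /phi -[RHS]ln1 -[X in _ = ln X]s_sum; congr ln; apply: eq_bigr => i _.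
  by rewrite powRr0 mul1r subr0 powRr1 // ltW.
have lnk : (fun n => n%:R^-1 * ln ((n.+1 ^ d)%:R : R)) @ \oo --> (0 : R).
  apply: (@cvg_sublinear _ 0 1) => // n; rewrite mulr0 subr0 mul1r ger0_norm //.
  by rewrite ln_ge0 // ler1n expn_gt0.
have div n (x y : R) : (0 < n)%N -> n%:R * x <= y -> x <= n%:R^-1 * y.
  move=> n0; have nR : 0 < n%:R :> R by rewrite ltr0n.
  by move=> h1; rewrite -(ler_pM2l nR) mulVKf ?gt_eqF.
apply: (t2_close ltr01 K0 t2_phi) => t; rewrite ler_norml => /andP[t1 t2'].
have [t0|t0|->] := ltgtP t 0; last first.
- by rewrite Psi0 phi0 subrr normr0 expr0n mulr0.
- have ht : 0 < t <= 1 by rewrite t0.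
  have a1 : phi s del t <= Psi t.
    apply: (cvgr_to_ge (@psi_cvg t)); near=> n; apply: div; first by near: n; exact: nbhs_infty_gt.
    by have [] := h t ht n.
  have a2 : Psi t <= 0 + (phi s del t + K * t ^+ 3).
    apply: (ler_cvg_to (@psi_cvg t) (cvgD lnk (cvg_cst _))); near=> n.
    have n0 : (0 < n)%N by near: n; exact: nbhs_infty_gt.
    have [_ hh _ _] := h t ht n.
    have nR : 0 < n%:R :> R by rewrite ltr0n.
    rewrite -(ler_pM2l nR) mulVKf ?gt_eqF // mulrDr mulVKf ?gt_eqF //.
  by rewrite [`|t|]gtr0_norm // ler_norml; apply/andP; split; lra.
have ht : 0 < - t <= 1 by rewrite oppr_gt0 t0 lerNl.
have a1 : Psi t <= phi s del t.
  apply: (cvgr_to_le (@psi_cvg t)); near=> n.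
  have n0 : (0 < n)%N by near: n; exact: nbhs_infty_gt.
  have nR : 0 < n%:R :> R by rewrite ltr0n.
  have [_ _ hh _] := h (- t) ht n; rewrite opprK in hh.
  by rewrite -(ler_pM2l nR) mulVKf ?gt_eqF.
have a2 : phi s del t - K * (- t) ^+ 3 <= Psi t + 0.
  apply: (cvgr_to_ge (cvgD (@psi_cvg t) lnk)); near=> n.
  have n0 : (0 < n)%N by near: n; exact: nbhs_infty_gt.
  have nR : 0 < n%:R :> R by rewrite ltr0n.
  have [_ _ _ hh] := h (- t) ht n; rewrite !opprK in hh.
  by rewrite -(ler_pM2l nR) /= [leRHS]mulrDr !mulVKf ?gt_eqF.
by rewrite [`|t|]ltr0_norm // ler_norml; apply/andP; split; lra.
Unshelve. all: by end_near.
Qed.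

Lemma Psi_t2_1 : t2 (fun t => Psi (1 + t)).
Proof.
apply: (t2_close (r := 2^-1) (K := 0) _ _ (t2_ln_trp s_gt0 s_sum rho_pos)) => // t.
rewrite ler_norml => /andP[h1 h2]; rewrite Psi_pos; last lra.
by rewrite subrr normr0 mul0r.
Qed.

(** Explicit formula for a > 0, second-order model at 0, convexity with small second differences for
    a < 0. *)
Lemma Psi_derivable a : derivable Psi a 1.
Proof.
have [a0|a0] := ltP 0 a.
  apply: (@near_eq_derivable _ _ _ (fun b => ln (trp b (Ya b)))).
    near=> b; rewrite Psi_pos //; near: b.
    have o : open [set b : R | 0 < b] by exact: open_gt.
    by apply: open_nbhs_nbhs; split.
  exact: ln_trp_derivable.
move: a0; rewrite le_eqVlt => /orP[/eqP ->|a0].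
  have [c [dd _]] : exists c : R, is_derive (0 : R) 1 Psi c.
    by apply: t2_is_derive; apply: t2_eq Psi_t2_0 => t; rewrite add0r.
  exact: dd.
have [M [t0 [t00 h]]] := neg_second_difference s_gt0 s_sum rho_pos rho_tr a0.
apply: (convex_is_derive Psi_convex) => e e0.
pose t := Num.min t0 (e / (`|M| + 1)).
have M1 : 0 < `|M| + 1 by rewrite ltr_wpDl.
have tp : 0 < t by rewrite lt_min t00 divr_gt0.
exists (t ^+ 4); first by rewrite exprn_gt0.
have ht : 0 < t <= t0 by rewrite tp ge_min lexx.
apply: le_trans (h t _ _ _ ht (@psi_cvg a) (@psi_cvg _) (@psi_cvg _)) _.
apply: ler_wpM2r; first by rewrite exprn_ge0 // ltW.
have te : t * (`|M| + 1) <= e by rewrite -ler_pdivlMr // ge_min lexx orbT.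
have := ler_norm M; nra.
Unshelve. all: by end_near.
Qed.

Lemma psi_t2 n x0 : t2 (fun t => psi n (x0 + t)).
Proof.
have [E [xx [lab dat]]] := eigdata_exists s rho_pos n.
have [_ xx_gt0 _ _ _] := dat.
apply: t2_ln; first exact: qn_gt0.
apply: (t2_eq (g := fun t => \sum_x xx x `^ (x0 + t) * lab x `^ (1 - (x0 + t)))).
  by move=> t; rewrite (qnE _ dat).
apply: t2_sum => x; apply: t2M; apply: t2_pow => //.
- by apply: t2_eq (t2_poly x0 1 0) => t; lra.
- exact: eigdata_lab dat.
- by apply: t2_eq (t2_poly (1 - x0) (- 1) 0) => t; lra.
Qed.

Lemma psi_support_at n x0 : psi n x0 = 0 -> exists m, forall x, (x - x0) * m <= psi n x.
Proof.
move=> p0; have [E [xx [lab dat]]] := eigdata_exists s rho_pos n.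
exists (slope s rho xx lab x0) => x.
by have := psi_support s_gt0 s_sum rho_pos x0 x dat; rewrite p0 add0r.
Qed.

(** [psi n a] is the logarithm of the [lab]-mean of exp(a T). An extremal T both bounds it above
    and, through its own term, below up to the logarithm of its weight. *)
Lemma psi_linear : exists2 K, 0 <= K & forall n,
  (exists2 e, `|e| <= n%:R * K & forall a, 0 < a -> `|psi n a - a * e| <= n%:R * K) /\
  (exists2 e, `|e| <= n%:R * K & forall a, a < 0 -> `|psi n a - a * e| <= n%:R * K).
Proof.
have [K K0 hK] := data_bounds s_gt0 s_sum rho_pos rho_tr.
exists K => // n; have [E [xx [lab dat]]] := eigdata_exists s rho_pos n.
have [_ xx0 _ _ _] := dat.
have lab0 x : 0 < lab x := eigdata_lab s_gt0 x dat.
pose T x := ln (xx x) - ln (lab x).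
have TK x : `|T x| <= n%:R * K by have [h1 h2] := hK n E xx lab x dat; exact: abs_diff_le.
have qT a : qn n a = \sum_x lab x * expR (a * T x).
  rewrite (qnE a dat); apply: eq_bigr => x _.
  rewrite (gbs_expE s_gt0 a x dat) -[X in _ = X * _]lnK ?posrE // -expRD; congr expR.
  by rewrite /T; ring.
have ext a x0 : (forall x, a * T x <= a * T x0) -> `|psi n a - a * T x0| <= n%:R * K.
  move=> hx; have q0 := qn_gt0 s_gt0 s_sum rho_pos n a.
  have u : psi n a <= a * T x0.
    rewrite -[leRHS]expRK ler_ln ?posrE ?expR_gt0 // qT -[leRHS]mul1r -(sum_lab s_sum dat) mulr_suml.
    by apply: ler_sum => x _; rewrite ler_pM2l // ler_expR.
  have l : ln (lab x0) + a * T x0 <= psi n a.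
    rewrite -[X in _ + X]expRK -lnM ?posrE ?expR_gt0 // ler_ln ?posrE ?mulr_gt0 ?expR_gt0 // qT.
    rewrite (bigD1 x0) //= lerDl; apply: sumr_ge0 => x _.
    by rewrite mulr_ge0 ?expR_ge0 // ltW.
  have [_ /andP[b1 b2]] := hK n E xx lab x0 dat.
  rewrite ler_norml; apply/andP; split; [lra|].
  by apply: le_trans (_ : 0 <= _); [rewrite subr_le0|rewrite mulr_ge0].
have i0 : 'I_(tdim d n) := Ordinal (dim_gt0 s_sum n).
split.
  have [x0 _ mx] := @arg_maxP _ _ _ i0 predT T isT.
  exists (T x0) => // a a0; apply: ext => x; rewrite ler_pM2l //; exact: mx.
have [x0 _ mx] := @arg_minP _ _ _ i0 predT T isT.
exists (T x0) => // a a0; apply: ext => x; rewrite ler_nM2l //; exact: mx.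
Qed.

Lemma psi_slopes : exists2 K, 0 <= K & forall n,
  [/\ exists g, forall x, 1 < x -> `|psi n x - (x - 1) * g| <= n%:R * K,
      exists g, forall x, x < 0 -> `|psi n x - (x - 1) * g| <= n%:R * K,
      exists g, forall x, 1 < x -> `|psi n (1 - x) - (x - 1) * g| <= n%:R * K &
      exists g, forall x, x < 0 -> `|psi n (1 - x) - (x - 1) * g| <= n%:R * K].
Proof.
have [K K0 h] := psi_linear; exists (2 * K) => [|n]; first by rewrite mulr_ge0.
have [[e ek he] [e' ek' he']] := h n.
have nK0 : 0 <= n%:R * K by rewrite mulr_ge0.
have shift (x y p : R) : `|p - x * y| <= n%:R * K -> `|y| <= n%:R * K ->
    `|p - (x - 1) * y| <= n%:R * (2 * K).
  move=> h1 h2; have -> : p - (x - 1) * y = (p - x * y) + y by ring.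
  by apply: le_trans (ler_normD _ _) _; lra.
have flip (x y p : R) : `|p - (1 - x) * y| <= n%:R * K -> `|p - (x - 1) * (- y)| <= n%:R * (2 * K).
  move=> h1; have -> : p - (x - 1) * (- y) = p - (1 - x) * y by ring.
  by apply: le_trans h1 _; lra.
split.
- exists e => x x1; apply: shift => //; apply: he; lra.
- by exists e' => x x0; apply: shift => //; apply: he'.
- exists (- e') => x x1; apply: flip; apply: he'; lra.
- exists (- e) => x x0; apply: flip; apply: he; lra.
Qed.

Lemma Psi_asymptote : exists H K, forall x, 1 < x -> `|Psi x - (x - 1) * H| <= K.
Proof.
have [K K0 h] := psi_slopes.
have ex n : exists g : R, forall x, 1 < x -> `|psi n x - (x - 1) * g| <= n%:R * K.
  by have [h1 _ _ _] := h n; exact: h1.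
have [g hg] := choice ex.
have big (B : R) : exists2 x, [set x | 1 < x] x & B < `|x - 1|.
  have B0 := normr_ge0 B; have B1 := ler_norm B.
  by exists (`|B| + 2) => /=; [lra|rewrite gtr0_norm; lra].
have [H _ hH] := cvg_slopes K0 (fun x _ => @psi_cvg x) (fun n x h => hg n x h) big.
by exists H, K.
Qed.

Variable M : R -> R.
Local Notation quot F := (fun x : R => (x - 1)^-1 * F x).

(** Both formulas are allowed at 1/2: this point is fixed by a -> 1 - a, while the branch chosen
    there is exchanged by the swap. *)
Definition minimal_values (N : R -> R) :=
  [/\ (forall a, 2^-1 < a -> N a = ln (trp a (Ya a))),
      (forall a, a < 2^-1 -> N a = ln (trp (1 - a) (Wlow a))) &
      N 2^-1 = ln (trp 2^-1 (Ya 2^-1)) \/ N 2^-1 = ln (trp (1 - 2^-1) (Wlow 2^-1))].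

Lemma Wlow_gt0 a : 0 < trp (1 - a) (Wlow a).
Proof.
apply: trp_gt0; last exact: Wlow_posdef.
by have := dim_gt0 s_sum 1; rewrite /= muln1.
Qed.

Lemma Psi_ge_Wlow a : 0 <= a <= 2^-1 -> ln (trp (1 - a) (Wlow a)) <= Psi a.
Proof.
move=> ha; have W0 := Wlow_gt0 a.
apply: (cvgr_to_ge (@psi_cvg a)); near=> n.
have n0 : (0 < n)%N by near: n; exact: nbhs_infty_gt.
have nR : 0 < n%:R :> R by rewrite ltr0n.
have := qn_ge_Wlow s_gt0 rho_pos n ha.
rewrite -(ler_ln (x := _ ^+ n)) ?posrE ?exprn_gt0 ?(qn_gt0 s_gt0 s_sum rho_pos) // lnXn //.
by move=> h; rewrite -(ler_pM2l nR) mulVKf ?gt_eqF // mulr_natl.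
Unshelve. all: by end_near.
Qed.

Lemma Psi_le_Wlow a : a <= 0 -> Psi a <= ln (trp (1 - a) (Wlow a)).
Proof.
move=> ha; have W0 := Wlow_gt0 a.
apply: (cvgr_to_le (@psi_cvg a)); near=> n.
have n0 : (0 < n)%N by near: n; exact: nbhs_infty_gt.
have nR : 0 < n%:R :> R by rewrite ltr0n.
have := qn_le_Wlow s_gt0 rho_pos n ha.
rewrite -(ler_ln (y := _ ^+ n)) ?posrE ?exprn_gt0 ?(qn_gt0 s_gt0 s_sum rho_pos) // lnXn //.
by move=> h; rewrite -(ler_pM2l nR) mulVKf ?gt_eqF // mulr_natl.
Unshelve. all: by end_near.
Qed.

Lemma minimal_compare N : minimal_values N ->
  [/\ (forall x, 1 <= x -> Psi x = N x), (forall x, 0 <= x <= 1 -> N x <= Psi x) &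
      (forall x, x <= 0 -> Psi x <= N x)].
Proof.
move=> [h1 h2 h3]; split=> x.
- move=> x1; have x0 : 0 < x := lt_le_trans ltr01 x1.
  have x2 : 2^-1 < x by apply: lt_le_trans x1; rewrite invf_lt1 // ltr1n.
  exact: etrans (Psi_pos x0) (esym (h1 x x2)).
- move=> /andP[x0 x1]; have [x2|x2|->] := ltgtP x 2^-1.
  + rewrite (h2 x x2); apply: Psi_ge_Wlow; apply/andP; split; [exact: x0|exact: ltW].
  + have xp : 0 < x by apply: lt_trans x2; rewrite invr_gt0.
    apply: le_of_eq; exact: etrans (h1 x x2) (esym (Psi_pos xp)).
  + have hp : 0 < 2^-1 :> R by rewrite invr_gt0.
    case: h3 => ->; first by apply: le_of_eq; exact: esym (Psi_pos hp).
    by apply: Psi_ge_Wlow; rewrite lexx andbT ltW.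
- move=> x0; have x2 : x < 2^-1 by apply: le_lt_trans x0 _; rewrite invr_gt0.
  by rewrite (h2 x x2); exact: Psi_le_Wlow.
Qed.

Hypothesis M_1 : cvg (quot M @ (1 : R)^').
Hypothesis M_pinfty : cvg (quot M @ +oo).
Hypothesis M_ninfty : cvg (quot M @ -oo).

Theorem left_family : minimal_values M ->
  (forall a, cvgn (Dseq psi a)) /\
  [/\ (forall a, (0 <= a)%E -> 0 <= limn (Dseq psi a)),
      (forall a, (a <= 0)%E -> limn (Dseq psi a) <= 0),
      (forall a, (0 <= a)%E -> limn (Dseq psi a) <= ext_by_limits (quot M) a),
      (forall a, (a <= 0)%E -> ext_by_limits (quot M) a <= limn (Dseq psi a))
    & (forall a : R, derivable (fun x : R => limn (Dseq psi x%:E)) a 1)].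
Proof.
move=> /minimal_compare [m1 m2 m3]; have [K K0 hK] := psi_slopes.
apply: (@family_properties R psi Psi M K K0).
- by move=> n; exact: psi_t2.
- by move=> n; exact: (psi1 s rho_pos rho_tr).
- by move=> n; apply: psi_support_at; exact: (psi1 s rho_pos rho_tr).
- exact: psi_cvg.
- by move=> n; have [k _ _ _] := hK n; exact: k.
- by move=> n; have [_ k _ _] := hK n; exact: k.
- exact: Psi_t2_1.
- exact: Psi1.
- exact: Psi_derivable.
- exact: Psi_ge1.
- exact: Psi_01.
- exact: Psi_neg.
- exact: M_1.
- exact: M_pinfty.
- exact: M_ninfty.
- by move=> x x1; apply: le_of_eq; exact: m1.
- by move=> x /andP[x0 x1]; apply: m2; rewrite x0 ltW.
- exact: m3.
Qed.

(** The reflection x -> 1 - x exchanges the roles of 0 and 1, so [Psi_t2_0] supplies what [Psi_t2_1]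
    supplies in [left_family]. *)
Theorem right_family : minimal_values (fun x => M (1 - x)) ->
  let P n x := psi n (1 - x) in
  (forall a, cvgn (Dseq P a)) /\
  [/\ (forall a, (0 <= a)%E -> 0 <= limn (Dseq P a)),
      (forall a, (a <= 0)%E -> limn (Dseq P a) <= 0),
      (forall a, (0 <= a)%E -> limn (Dseq P a) <= ext_by_limits (quot M) a),
      (forall a, (a <= 0)%E -> ext_by_limits (quot M) a <= limn (Dseq P a))
    & (forall a : R, derivable (fun x : R => limn (Dseq P x%:E)) a 1)].
Proof.
move=> /minimal_compare [m1 m2 m3] P; have [K K0 hK] := psi_slopes.
have M1 x : M x = M (1 - (1 - x)) by rewrite opprB addrC subrK.
have neg (f : R -> R) : t2 f -> t2 (fun t => f (- t)).
  move=> tf; apply: (t2_eq (g := fun t => f (-1 * t))); first by move=> t; rewrite mulN1r.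
  apply: (t2_comp (g := f) (t2_lin (-1))).
  by rewrite mulr0; apply: (t2_eq _ tf) => y; rewrite add0r.
apply: (@family_properties R P (fun x => Psi (1 - x)) M K K0).
- move=> n; apply: (t2_eq _ (neg _ (psi_t2 n 0))) => t.
  by rewrite /P opprD addrA subrr.
- by move=> n; rewrite /P subrr psi0.
- move=> n; have [m hm] := psi_support_at (psi0 s_gt0 s_sum rho_pos n).
  by exists (- m) => x; have := hm (1 - x); rewrite /P subr0 mulrN -mulNr opprB.
- by move=> x; exact: psi_cvg.
- by move=> n; have [_ _ k _] := hK n; exact: k.
- by move=> n; have [_ _ _ k] := hK n; exact: k.
- by apply: (t2_eq _ (neg _ Psi_t2_0)) => t; rewrite opprD addrA subrr add0r.
- by rewrite subrr Psi0.
- move=> x; have d1 : is_derive x (1 : R) (fun x : R => 1 - x) (-1).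
    by apply: is_derive_eq; rewrite /GRing.scale /=; lra.
  have dP : is_derive (1 - x) (1 : R) Psi ('D_1 Psi (1 - x)).
    exact: (DeriveDef (@Psi_derivable (1 - x)) erefl).
  have [dd _] := @is_derive1_comp R Psi (fun y => 1 - y) x _ _ dP d1; exact: dd.
- by move=> x x1; apply: Psi_neg; lra.
- by move=> x /andP[x0 x1]; apply: Psi_01; apply/andP; split; lra.
- by move=> x x0; apply: Psi_ge1; lra.
- exact: M_1.
- exact: M_pinfty.
- exact: M_ninfty.
- by move=> x x1; rewrite [M x]M1; apply: m3; lra.
- by move=> x /andP[x0 x1]; rewrite [M x]M1; apply: m2; apply/andP; split; lra.
- move=> x x0; rewrite [M x]M1; apply: le_of_eq; apply: m1.
  by rewrite lerDl oppr_ge0.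
Qed.

End LimitFunction.

(** * Identification with the stated divergences *)

Section Link.
Variables (R : realType) (d : nat).
Local Notation C := R[i].

Lemma conj_sp D (U W : 'M[C]_D) a : W^t* *m sp U a *m W = sp (U *m W) a.
Proof. by rewrite !spmxE adjM !mulmxA. Qed.

Lemma conj_mul D (W A B : 'M[C]_D) : W \is unitarymx ->
  W^t* *m A *m W *m (W^t* *m B *m W) = W^t* *m (A *m B) *m W.
Proof.
move=> uW; rewrite -[W^t* *m B *m W]mulmxA [_ *m W *m _]mulmxA -[_ *m W *m W^t*]mulmxA.
by rewrite (unitary_adjr uW) mulmx1 !mulmxA.
Qed.

Lemma conj_mxpow D (W A : 'M[C]_D) p : W \is unitarymx -> posdef A ->
  mxpowR (W^t* *m A *m W) p = W^t* *m mxpowR A p *m W.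
Proof.
move=> uW [U [a [uU a0 ->]]].
have uUW : U *m W \is unitarymx by exact: (mul_unitarymx uU uW).
by rewrite conj_sp (mxpow_sp _ _ uUW) (mxpow_sp _ _ uU) conj_sp.
Qed.

Lemma conj_trp D (W A : 'M[C]_D) p : W \is unitarymx -> posdef A ->
  trp p (W^t* *m A *m W) = trp p A.
Proof.
move=> uW pA; rewrite /trp (conj_mxpow _ uW pA) mxtrace_mulC mulmxA.
by rewrite (unitary_adjr uW) mul1mx.
Qed.

Lemma mxtrace_conj D (W A B : 'M[C]_D) : W \is unitarymx ->
  \tr (W^t* *m A *m W *m (W^t* *m B *m W)) = \tr (A *m B).
Proof.
by move=> uW; rewrite (conj_mul _ _ uW) mxtrace_mulC mulmxA (unitary_adjr uW) mul1mx.
Qed.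

(** A product and its adjoint give Gram matrices with the same spectrum, so rho and sigma may
    exchange places in the sandwich. *)
Lemma sandwich_swap D p (X Y A S : 'M[C]_D) : X^t* = X -> Y^t* = Y ->
  X *m X = A -> Y *m Y = S -> posdef S -> X \in unitmx ->
  trp p (X *m S *m X) = trp p (Y *m A *m Y).
Proof.
move=> hX hY <- <- pS uX.
have eA : (X *m Y) *m (X *m Y)^t* = X *m (Y *m Y) *m X by rewrite adjM hX hY !mulmxA.
have pA : posdef ((X *m Y) *m (X *m Y)^t*).
  by rewrite eA -[X in _ *m X]hX; exact: posdef_conj.
by rewrite -eA (trp_adj_swap _ pA) adjM hX hY !mulmxA.
Qed.

Lemma mem_eigvals D (W : 'M[C]_D) c i : W \is unitarymx -> c i \in eigvals (sp W c).
Proof.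
move=> uW; rewrite mem_undup; apply: contraT => ni.
(* If c_i were not listed, its spectral projection would vanish, contradicting its positive
   trace. *)
have e0 : mxfun (fun x => (x == c i)%:R) (sp W c) = 0.
  rewrite /mxfun (_ : map_mx _ _ = 0) ?linear0 ?mulmx0 ?mul0mx //.
  apply/rowP => k; rewrite !mxE; case: eqP => [e|//].
  by case/negP: ni; rewrite -e; apply/mapP; exists k; rewrite ?mem_enum.
have := congr1 mxtrace e0; rewrite (mxfun_sp _ _ uW) (tr_sp _ uW) mxtrace0.
move=> /complexI /eqP; rewrite psumr_eq0 => [/allP /(_ i)|k _]; last exact: ler0n.
by rewrite mem_index_enum eqxx oner_eq0 => /(_ isT).
Qed.

(** The sum over spectral projections keeps exactly the entries between equal eigenvalues in the
    eigenbasis. *)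
Lemma pinch_sp D (W X : 'M[C]_D) c : W \is unitarymx ->
  pinch (sp W c) X = W^t* *m pin c (W *m X *m W^t*) *m W.
Proof.
move=> uW; set Y := W *m X *m W^t*.
have -> : pin c Y = \sum_(l <- eigvals (sp W c))
    rdiag (fun i => (c i == l)%:R) *m Y *m rdiag (fun i => (c i == l)%:R).
  apply/matrixP => i j; rewrite mxE summxE.
  under eq_bigr do rewrite mul_mx_rdiagE mul_rdiagE.
  rewrite (bigD1_seq (c i)) ?undup_uniq ?mem_eigvals //= eqxx big1 => [|l /negbTE li].
    by rewrite addr0 mul1r eq_sym; case: eqP; rewrite ?mulr1 ?mulr0.
  by rewrite eq_sym li !mul0r.
rewrite /pinch mulmx_sumr mulmx_suml; apply: eq_bigr => l _.
rewrite /eigproj (mxfun_sp _ _ uW) spmxE /Y !mulmxA.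
by [].
Qed.

Section Pair.
Variables (rho sigma E : 'M[C]_d) (s : 'I_d -> R).
Hypothesis uE : E \is unitarymx.
Hypothesis s0 : forall i, 0 < s i.
Hypothesis esig : sigma = sp E s.
Hypothesis pr : posdef rho.
Local Notation rho' := (E *m rho *m E^t*).

Lemma pr' : posdef rho'.
Proof. by apply: posdef_conj => //; exact: unitarymx_unit. Qed.

Lemma unconj (A : 'M[C]_d) : E^t* *m (E *m A *m E^t*) *m E = A.
Proof.
rewrite !mulmxA (unitary_adjl uE) mul1mx -mulmxA (unitary_adjl uE).
by rewrite mulmx1.
Qed.

Lemma qn_link n a : complex.Re (\tr (mxpowR (pinch (tpow sigma n) (tpow rho n)) a *m
  mxpowR (tpow sigma n) (1 - a))) = qn s rho' n a.
Proof.
have uW := tpow_unitary n uE; set W := tpow E n in uW.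
rewrite esig tpow_sp -/W (pinch_sp _ _ uW).
have eX : W *m tpow rho n *m W^t* = tpow rho' n by rewrite /W tpow_adj -2!tpowM.
rewrite eX -/(pinned s rho' n).
have pX : posdef (pinned s rho' n) by apply/pin_posdef/tpow_posdef/pr'.
rewrite (conj_mxpow _ uW pX) (mxpow_sp _ _ uW) spmxE.
have u1 : (1%:M : 'M[C]_(tdim d n)) \is unitarymx by apply/unitarymxP; rewrite adj1 mulmx1.
have rd (b : 'I_(tdim d n) -> R) : rdiag b = sp 1%:M b by rewrite spmxE adj1 mul1mx mulmx1.
rewrite /qn [rdiag (tprod s (n:=n))]rd (mxpow_sp _ _ u1) -rd.
by rewrite (mxtrace_conj _ _ uW).
Qed.

Lemma mxpow_add (A : 'M[C]_d) p q : posdef A -> mxpowR A p *m mxpowR A q = mxpowR A (p + q).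
Proof.
move=> [U [a [uU a0 ->]]]; rewrite !(mxpow_sp _ _ uU) (spM _ _ uU); apply: sp_eq => i.
by rewrite powRD // (gt_eqF (a0 i)) implybT.
Qed.

Lemma mxpow1 (A : 'M[C]_d) : posdef A -> mxpowR A 1 = A.
Proof.
move=> [U [a [uU a0 ->]]]; rewrite !(mxpow_sp _ _ uU); apply: sp_eq => i.
by rewrite powRr1 // ltW.
Qed.

Lemma psig : posdef sigma.
Proof. by rewrite esig; exact: posdef_sp. Qed.

Lemma high_link a : a != 0 ->
  trp a (mxpowR rho 2^-1 *m mxpowR sigma ((1 - a) / a) *m mxpowR rho 2^-1) = trp a (Ya s rho' a).
Proof.
move=> a0; pose k := (1 - a) / (2 * a).
have hk : k + k = (1 - a) / a by rewrite /k; field.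
have h2 : 2^-1 + 2^-1 = 1 :> R by field.
rewrite -hk (sandwich_swap a (posdef_herm (posdef_mxpow 2^-1 pr)) (posdef_herm (posdef_mxpow k psig))
  (etrans (mxpow_add _ _ pr) (etrans (congr1 (mxpowR rho) h2) (mxpow1 pr))) (mxpow_add k k psig)
  (posdef_mxpow _ psig) (posdef_unit (posdef_mxpow 2^-1 pr))).
rewrite -(conj_trp _ uE (Ya_posdef s0 pr' a)); congr trp.
by rewrite esig (mxpow_sp _ _ uE) spmxE /Ya -/k !mulmxA.
Qed.

Lemma low_link a :
  trp (1 - a) (mxpowR sigma 2^-1 *m mxpowR rho (a / (1 - a)) *m mxpowR sigma 2^-1) =
  trp (1 - a) (Wlow s rho' a).
Proof.
rewrite -(conj_trp _ uE (Wlow_posdef s0 pr' a)); congr trp.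
rewrite esig (mxpow_sp _ _ uE) spmxE /Wlow.
have -> : mxpowR rho (a / (1 - a)) = E^t* *m mxpowR rho' (a / (1 - a)) *m E.
  by rewrite -(conj_mxpow _ uE pr') unconj.
by rewrite 2!(conj_mul _ _ uE).
Qed.

Lemma seqL_link a : seqL a rho sigma = Dseq (psi s rho') a.
Proof.
have e n : (fun x : R => (x - 1)^-1 * ln (complex.Re (\tr (mxpowR
    (pinch (tpow sigma n) (tpow rho n)) x *m mxpowR (tpow sigma n) (1 - x))))) =
    (fun x : R => (x - 1)^-1 * psi s rho' n x).
  apply/funext => x; exact: (congr1 (fun q : R => (x - 1)^-1 * ln q) (qn_link n x)).
apply/funext => n.
exact: (congr1 (fun h : R -> R => n%:R^-1 * ext_by_limits h a) (e n)).
Qed.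

Lemma seqR_link a : seqR a sigma rho = Dseq (fun n x => psi s rho' n (1 - x)) a.
Proof.
have e n : (fun x : R => (x - 1)^-1 * ln (complex.Re (\tr (mxpowR (tpow sigma n) x *m
    mxpowR (pinch (tpow sigma n) (tpow rho n)) (1 - x))))) =
    (fun x : R => (x - 1)^-1 * psi s rho' n (1 - x)).
  apply/funext => x; have h := qn_link n (1 - x); rewrite mxtrace_mulC in h.
  have x1 : 1 - (1 - x) = x by ring.
  by rewrite x1 in h; exact: (congr1 (fun q : R => (x - 1)^-1 * ln q) h).
apply/funext => n.
exact: (congr1 (fun h : R -> R => n%:R^-1 * ext_by_limits h a) (e n)).
Qed.

End Pair.

Lemma full_rank_posdef (rho : 'M[C]_d) : full_rank_density rho -> posdef rho /\ \tr rho = 1.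
Proof.
move=> [/hermP hr pos tr1]; split=> //; apply: posdefP => // v v0.
have := pos v v0; rewrite map_trmx qfmxE; case: (_ 0 0) => x y.
by rewrite ltcE /= => /andP[].
Qed.

(* The value [(a - 1) * Dmin a rho sigma], without the extension to infinite orders. *)
Definition log_min (rho sigma : 'M[C]_d) (a : R) : R :=
  if 2^-1 <= a then
    ln (trp a (mxpowR rho 2^-1 *m mxpowR sigma ((1 - a) / a) *m mxpowR rho 2^-1))
  else ln (trp (1 - a) (mxpowR sigma 2^-1 *m mxpowR rho (a / (1 - a)) *m mxpowR sigma 2^-1)).

Lemma DminE a (rho sigma : 'M[C]_d) :
  Dmin a rho sigma = ext_by_limits (fun x => (x - 1)^-1 * log_min rho sigma x) a.
Proof.
rewrite /Dmin; congr ext_by_limits; apply/funext => x; rewrite /log_min.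
by case: ifP.
Qed.

Lemma log_min_high (rho sigma E : 'M[C]_d) s : E \is unitarymx -> (forall i, 0 < s i) ->
  sigma = sp E s -> posdef rho ->
  minimal_values s (E *m rho *m E^t*) (log_min rho sigma).
Proof.
have i2 : 0 < 2^-1 :> R by rewrite invr_gt0.
move=> uE s0 es pr; split=> [a a2|a a2|].
- rewrite /log_min (ltW a2).
  exact: (congr1 (@ln R) (high_link uE s0 es pr (lt0r_neq0 (lt_trans i2 a2)))).
- rewrite /log_min leNgt a2; exact: (congr1 (@ln R) (low_link uE s0 es pr a)).
- left; rewrite /log_min lexx; exact: (congr1 (@ln R) (high_link uE s0 es pr (lt0r_neq0 i2))).
Qed.

Lemma log_min_swap (rho sigma E : 'M[C]_d) s : E \is unitarymx -> (forall i, 0 < s i) ->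
  rho = sp E s -> posdef sigma ->
  minimal_values s (E *m sigma *m E^t*) (fun x => log_min rho sigma (1 - x)).
Proof.
move=> uE s0 es ps; have sub1 (a : R) : 1 - (1 - a) = a by ring.
have half1 : 1 - 2^-1 = 2^-1 :> R by field.
have i2 : 0 < 2^-1 :> R by rewrite invr_gt0.
split=> [a a2|a a2|].
- have h : (2^-1 <= 1 - a) = false by apply/negbTE; rewrite -ltNge; lra.
  rewrite /log_min h sub1.
  exact: (congr1 (@ln R) (high_link uE s0 es ps (lt0r_neq0 (lt_trans i2 a2)))).
- have h : 2^-1 <= 1 - a by lra.
  rewrite /log_min h sub1; exact: (congr1 (@ln R) (low_link uE s0 es ps a)).
- right; rewrite /log_min; have h : 2^-1 <= 1 - 2^-1 :> R by rewrite half1.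
  rewrite h sub1; exact: (congr1 (@ln R) (low_link uE s0 es ps 2^-1)).
Qed.

End Link.

(** * Assembly of the left and right versions *)

Theorem theorem11 (R : realType) (d : nat) (rho sigma : 'M[R[i]]_d) :
  full_rank_density rho -> full_rank_density sigma ->
  (* left version: Dhat^L *)
  ((forall a : \bar R, cvgn (seqL a rho sigma)) /\
   [/\ (forall a : \bar R, (0 <= a)%E -> 0 <= DhatL a rho sigma),
       (forall a : \bar R, (a <= 0)%E -> DhatL a rho sigma <= 0),
       (forall a : \bar R, (0 <= a)%E -> DhatL a rho sigma <= Dmin a rho sigma),
       (forall a : \bar R, (a <= 0)%E -> Dmin a rho sigma <= DhatL a rho sigma)
     & (forall a : R, derivable (fun x : R => DhatL x%:E rho sigma) a 1)]) /\
  (* right version: Dhat^R *)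
  ((forall a : \bar R, cvgn (seqR a rho sigma)) /\
   [/\ (forall a : \bar R, (0 <= a)%E -> 0 <= DhatR a rho sigma),
       (forall a : \bar R, (a <= 0)%E -> DhatR a rho sigma <= 0),
       (forall a : \bar R, (0 <= a)%E -> DhatR a rho sigma <= Dmin a rho sigma),
       (forall a : \bar R, (a <= 0)%E -> Dmin a rho sigma <= DhatR a rho sigma)
     & (forall a : R, derivable (fun x : R => DhatR x%:E rho sigma) a 1)]).
Proof.
move=> /full_rank_posdef[pr tr] /full_rank_posdef[ps ts].
have tr_conj (A E : 'M[R[i]]_d) : E \is unitarymx -> \tr A = 1 -> \tr (E *m A *m E^t*) = 1.
  by move=> uE tA; rewrite -mulmxA mxtrace_mulC -mulmxA (unitary_adjl uE) mulmx1.
have sum1 (A E : 'M[R[i]]_d) s : E \is unitarymx -> A = sp E s -> \tr A = 1 -> \sum_i s i = 1.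
  by move=> uE -> tA; apply: complexI; rewrite -(tr_sp _ uE) tA.
have [E [s [G [del [uE s0 es adp]]]]] := adapted_exists pr ps.
have [F [t [H [eps [uF t0 et adq]]]]] := adapted_exists ps pr.
have s1 := sum1 _ _ _ uE es ts; have t1 := sum1 _ _ _ uF et tr.
have prE := pr' uE pr; have trE := tr_conj _ _ uE tr.
have psF := pr' uF ps; have tsF := tr_conj _ _ uF ts.
pose M := log_min rho sigma.
have mL := log_min_high uE s0 es pr; have mR := log_min_swap uF t0 et ps.
have [cL1 _ _] := minimal_compare s0 s1 prE trE mL.
have [cR1 _ _] := minimal_compare t0 t1 psF tsF mR.
have [h1 _ _] := mL.
have M_1 : cvg ((fun x : R => (x - 1)^-1 * M x) @ (1 : R)^').
  have [c _ cv] := t2_cvg_quot (Psi_t2_1 s0 s1 prE) (Psi1 s prE trE).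
  apply/cvg_ex; exists c; apply: cvg_trans cv; apply: near_eq_cvg; near=> x.
  have x2 : 2^-1 < x.
    have : `|x - 1| <= 4^-1 by near: x; apply: near1_le; rewrite invr_gt0.
    by rewrite ler_norml => /andP[h _]; lra.
  have x0 : 0 < x by apply: lt_trans x2; rewrite invr_gt0.
  by rewrite (Psi_pos s0 s1 prE x0) /M (h1 x x2).
have M_pinfty : cvg ((fun x : R => (x - 1)^-1 * M x) @ +oo).
  have [g [K hg]] := Psi_asymptote s0 s1 prE trE.
  apply/cvg_ex; exists g; apply: (@cvg_pinfty_quot _ M g K) => x x1.
  by rewrite /M -(cL1 x (ltW x1)); exact: hg.
(* For x <= 0 the minimal divergence of the pair is governed by that of the swapped pair at 1 - x >=
   1, where it coincides with the limit function of that pair. *)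
have M_ninfty : cvg ((fun x : R => (x - 1)^-1 * M x) @ -oo).
  have [g [K hg]] := Psi_asymptote t0 t1 psF tsF.
  apply/cvg_ex; exists (- g); apply: (@cvg_ninfty_quot _ M (- g) (K + `|g|)) => x x0.
  have x1 : 1 < 1 - x by rewrite ltrDl oppr_gt0.
  have -> : M x = Psi t (F *m sigma *m F^t*) (1 - x).
    by rewrite (cR1 _ (ltW x1)) /M; congr log_min; ring.
  have -> : Psi t (F *m sigma *m F^t*) (1 - x) - (x - 1) * - g =
      (Psi t (F *m sigma *m F^t*) (1 - x) - (1 - x - 1) * g) - g by ring.
  by apply: le_trans (ler_normB _ _) _; rewrite lerD2r; exact: hg.
have eL a := seqL_link uE es pr a; have eR a := seqR_link uF et ps a.
have [L1 [L2 L3 L4 L5 L6]] := left_family s0 s1 prE trE adp M_1 M_pinfty M_ninfty mL.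
have [R1 [R2 R3 R4 R5 R6]] := right_family t0 t1 psF tsF adq M_1 M_pinfty M_ninfty mR.
have dL a : DhatL a rho sigma = limn (Dseq (psi s (E *m rho *m E^t*)) a) by rewrite /DhatL eL.
have dR a : DhatR a rho sigma =
    limn (Dseq (fun n x => psi t (F *m sigma *m F^t*) n (1 - x)) a) by rewrite /DhatR eR.
split; split.
- by move=> a; rewrite eL; exact: L1.
- split=> a.
  + by rewrite dL; exact: L2.
  + by rewrite dL; exact: L3.
  + by rewrite dL DminE; exact: L4.
  + by rewrite dL DminE; exact: L5.
  + have -> : (fun x : R => DhatL x%:E rho sigma) =
        (fun x : R => limn (Dseq (psi s (E *m rho *m E^t*)) x%:E)) by apply/funext => x; exact: dL.
    exact: L6.
- by move=> a; rewrite eR; exact: R1.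
- split=> a.
  + by rewrite dR; exact: R2.
  + by rewrite dR; exact: R3.
  + by rewrite dR DminE; exact: R4.
  + by rewrite dR DminE; exact: R5.
  + have -> : (fun x : R => DhatR x%:E rho sigma) =
        (fun x : R => limn (Dseq (fun n x => psi t (F *m sigma *m F^t*) n (1 - x)) x%:E)).
      by apply/funext => x; exact: dR.
    exact: R6.
Unshelve. all: by end_near.
Qed.
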